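(* Let $\mu,f,E$ be as in the context. (i) If $a=0$ and $\epsilon>0$ is sufficiently small, the global minimizer of $E$ can be written as $v(x)=(v_{\mathrm{rad}}(|x|),0)$ with $v_{\mathrm{rad}}\in C^\infty(\mathbb{R})$ positive, and it is unique up to replacing $v$ by $gv$ with $g\in SO(2)$. (ii) Given $\epsilon>0$, there exists $A>0$ such that for every $a>A$ the global minimizer $v_{\epsilon,a}$ of $E$ is unique and radial, i.e. $v(x)=v_{\mathrm{rad}}(|x|)\frac{x}{|x|}$.
   Context: $\mu\in C^\infty(\mathbb{R}^2,\mathbb{R})$ is radial, $\mu(x)=\mu_{\mathrm{rad}}(|x|)$ with $\mu_{\mathrm{rad}}\in C^\infty(\mathbb{R},\mathbb{R})$ having an even extension to $\mathbb{R}$; $\mu\in L^\infty$, $\mu_{\mathrm{rad}}'<0$ on $(0,\infty)$, and $\mu_{\mathrm{rad}}(\rho)=0$ for a unique $\rho>0$. $f\in C^\infty(\mathbb{R}^2,\mathbb{R}^2)$ is radial, $f(x)=f_{\mathrm{rad}}(|x|)\frac{x}{|x|}$ with $f_{\mathrm{rad}}$ smooth with an odd extension to $\mathbb{R}$, $f\in L^1\cap L^\infty$, $f_{\mathrm{rad}}>0$ on $(0,\infty)$. For $\epsilon>0$, $a\ge0$, $u\in H^1(\mathbb{R}^2,\mathbb{R}^2)$: $E(u)=\int_{\mathbb{R}^2}\frac12|\nabla u|^2-\frac{1}{2\epsilon^2}\mu|u|^2+\frac{1}{4\epsilon^2}|u|^4-\frac{a}{\epsilon}f\cdot u$; a global minimizer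 $v$ satisfies $E(v)=\min_{H^1}E$. *)

(* Defs.v *)
From HB Require Import structures.
From mathcomp Require Import all_boot all_order all_algebra.
From mathcomp Require Import all_classical all_reals all_analysis.
Set Implicit Arguments. Unset Strict Implicit. Unset Printing Implicit Defensive.
Import Order.TTheory GRing.Theory Num.Theory numFieldNormedType.Exports.
Local Open Scope classical_set_scope.
Local Open Scope ring_scope.

Section Defs.
Variable R : realType.

Definition eucl (x : R * R) : R := Num.sqrt (x.1 ^+ 2 + x.2 ^+ 2).

Definition leb2 := (@lebesgue_measure R \x @lebesgue_measure R)%E.

Fixpoint iterD {V W : normedModType R} (vs : seq V) (f : V -> W) : V -> W :=
  match vs with
  | [::] => f
  | v :: vs' => 'D_v (iterD vs' f)
  end.

Definition smooth {V W : normedModType R} (f : V -> W) : Prop :=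
  forall vs : seq V, continuous (iterD vs f) /\
    (forall (v x : V), derivable (iterD vs f) x v).

Definition test_fun (phi : R * R -> R) : Prop :=
  smooth phi /\ exists r : R, forall x, r < eucl x -> phi x = 0.

Definition comp (i : bool) (p : R * R) : R := if i then p.1 else p.2.
Definition dir (j : bool) : R * R := if j then (1, 0) else (0, 1).

Definition sqnorm2 (p : R * R) : R := p.1 ^+ 2 + p.2 ^+ 2.
Definition dot2 (p q : R * R) : R := p.1 * q.1 + p.2 * q.2.

(* u : R^2 -> R^2 belongs to H^1(R^2,R^2) with weak gradient G, where
   G i j = d_j u_i *)
Definition H1_with_grad (u : R * R -> R * R) (G : bool -> bool -> R * R -> R)
  : Prop :=
  (forall i, measurable_fun setT (fun x => comp i (u x)) /\
     leb2.-integrable setT (fun x => ((comp i (u x)) ^+ 2)%:E)) /\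
  (forall i j, measurable_fun setT (G i j) /\
     leb2.-integrable setT (fun x => ((G i j x) ^+ 2)%:E)) /\
  (forall i j phi, test_fun phi ->
     Rintegral leb2 setT (fun x => comp i (u x) * ('D_(dir j) phi) x) =
     - Rintegral leb2 setT (fun x => G i j x * phi x)).

Definition grad_sq (G : bool -> bool -> R * R -> R) (x : R * R) : R :=
  G true true x ^+ 2 + G true false x ^+ 2 +
  G false true x ^+ 2 + G false false x ^+ 2.

Definition energy (eps a : R) (mu : R * R -> R) (f : R * R -> R * R)
  (u : R * R -> R * R) (G : bool -> bool -> R * R -> R) : R :=
  Rintegral leb2 setT (fun x =>
    2^-1 * grad_sq G x
    - (2 * eps ^+ 2)^-1 * mu x * sqnorm2 (u x)
    + (4 * eps ^+ 2)^-1 * (sqnorm2 (u x)) ^+ 2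
    - a / eps * dot2 (f x) (u x)).

Definition global_minimizer eps a mu f (v : R * R -> R * R) : Prop :=
  exists G, H1_with_grad v G /\
    forall w Gw, H1_with_grad w Gw -> energy eps a mu f v G <= energy eps a mu f w Gw.

Definition SO2 (g : 'M[R]_2) : Prop := g *m g^T = 1%:M /\ \det g = 1.
Definition mxact (g : 'M[R]_2) (p : R * R) : R * R :=
  (g 0 0 * p.1 + g 0 1 * p.2, g 1 0 * p.1 + g 1 1 * p.2).

Definition mu_hyp (mu : R * R -> R) (mu_rad : R -> R) : Prop :=
  smooth mu /\ smooth mu_rad /\ (forall r, mu_rad (- r) = mu_rad r) /\
  (forall x, mu x = mu_rad (eucl x)) /\
  (exists M : R, forall x, `|mu x| <= M) /\
  (forall r, 0 < r -> derive1 mu_rad r < 0) /\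
  (exists rho, 0 < rho /\ mu_rad rho = 0 /\
     forall rho', 0 < rho' -> mu_rad rho' = 0 -> rho' = rho).

Definition f_hyp (f : R * R -> R * R) (f_rad : R -> R) : Prop :=
  smooth f /\ smooth f_rad /\ (forall r, f_rad (- r) = - f_rad r) /\
  (forall x, f x = (f_rad (eucl x) * (x.1 / eucl x), f_rad (eucl x) * (x.2 / eucl x))) /\
  (forall i, leb2.-integrable setT (fun x => (comp i (f x))%:E)) /\
  (exists M : R, forall x, eucl (f x) <= M) /\
  (forall r, 0 < r -> 0 < f_rad r).

End Defs.

(* Main.v *)
(* The minimizer is first constructed as a radial solution of the Euler-Lagrange equation
   [Lap v = V v - (a / eps) f], [V = (|v|^2 - mu) / eps^2], by shooting in the radial variable.
   It is then shown to minimize directly, without compactness or regularity theory. Weak derivatives of a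
   competitor [u] enter only through [int |u(x + s e_j) - u(x)|^2 <= s^2 int |d_j u|^2], and a discrete Picone
   identity with a positive function [z] gives [int |grad w|^2 >= int (- Lap z / z) w^2].
   (i) With [a = 0], [z = v] and [w = u] it yields [E(u) - E(v) >= (1 / 4 eps^2) int (|u|^2 - v^2)^2]; in the case
   of equality [u_i / v] is invariant under translations, hence constant.
   (ii) With [w = u - v] and an explicit [z = 1 + exp (- tau |x|^2)],
   [E(u) - E(v) >= 1/2 int (V - Lap z / z) |u - v|^2]. For large [a] the height [|v|] is large on any fixed annulus,
   which makes the weight positive: near [0] because [- Lap z] is large, on the annulus because of [V], and far
   away because [- mu] is bounded below there. *)
Require Import Defs.
From HB Require Import structures.
From mathcomp Require Import all_boot all_order all_algebra.
From mathcomp Require Import all_classical all_reals all_analysis.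
From mathcomp Require Import measurable_realfun ring lra.
Set Implicit Arguments. Unset Strict Implicit. Unset Printing Implicit Defensive.
Import Order.TTheory GRing.Theory Num.Theory numFieldNormedType.Exports.
Local Open Scope classical_set_scope.
Local Open Scope ring_scope.

(** * Integrable functions and translations of the plane *)

(** The energy is an [Rintegral], which takes the value 0 when the integral diverges. Instead of a
    Sobolev embedding that puts |u|^4 in L^1, the proof shows E(v) < 0: a competitor whose quartic
    term is not integrable has energy 0, so it neither beats v nor is a minimizer. The constructed v
    is only known to be bounded and positive. That v and grad v are in L^2 comes from a Caccioppoli
    estimate: plane cutoffs have bounded Dirichlet integral, and V is at least a positive constant
    outside a box, since mu is negative beyond rho. Radial functions are differentiated only along
    lines that miss the origin; in each coordinate direction these are almost all lines, so no
    regularity at the origin is required there. In (i) small eps makes small initial values die,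
    which keeps the shooting limit away from the zero solution. In (ii) writing v_i = x_i y(|x|)
    removes the singular term v/r^2 of the vector equation at the price of working in dimension
    four. *)

Lemma measurable_invr (R : realType) : measurable_fun setT (fun x : R => x^-1).
Proof.
(* Continuous approximations of [x^-1] that converge at every point, also at 0, where they vanish as
   [0^-1] does by convention. *)
pose g (n : nat) (x : R) := x * (x ^+ 2 + n.+1%:R^-1)^-1.
have p0 n (x : R) : 0 < x ^+ 2 + n.+1%:R^-1 by rewrite ltr_wpDl ?sqr_ge0 ?invr_gt0.
apply: (@measurable_fun_cvg _ _ _ _ g).
- move=> n; apply: continuous_measurable_fun => x.
  apply: cvgM; first exact: cvg_id.
  apply: cvgV; first by rewrite gt_eqF.
  by apply: cvgD; [exact: exprn_continuous|exact: cvg_cst].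
- move=> x _; have [->|x0] := eqVneq x 0.
    by rewrite invr0; apply: cvg_near_cst; apply: nearW => n; rewrite /g mul0r.
  rewrite (_ : x^-1 = x * (x ^+ 2 + 0)^-1); last by rewrite addr0 expr2 invfM mulrA mulfV// mul1r.
  apply: cvgM; first exact: cvg_cst.
  apply: cvgV; first by rewrite addr0 expf_neq0.
  by apply: cvgD; [exact: cvg_cst|exact: cvg_harmonic].
Qed.

Lemma measurable_funV d (T : measurableType d) (R : realType) (h : T -> R) :
  measurable_fun setT h -> measurable_fun setT (fun x => (h x)^-1).
Proof. by move=> mh; apply: (measurableT_comp (@measurable_invr R) mh). Qed.

Lemma measurable_fun_div d (T : measurableType d) (R : realType) (g h : T -> R) :
  measurable_fun setT g -> measurable_fun setT h -> measurable_fun setT (fun x => g x / h x).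
Proof. by move=> mg mh; apply: measurable_funM mg (measurable_funV mh). Qed.

Section L12.
Context d (T : measurableType d) (R : realType).
Variable mu : {measure set T -> \bar R}.
Implicit Types f g h : T -> R.

Definition L1 (f : T -> R) := mu.-integrable setT (fun x => (f x)%:E).
Definition L2 (f : T -> R) := measurable_fun setT f /\ L1 (fun x => f x ^+ 2).

Local Notation Int f := (Rintegral mu setT f).

Lemma L1_meas f : L1 f -> measurable_fun setT f.
Proof. by move=> /integrableP[/measurable_EFinP]. Qed.

Lemma L1_ext f g : (forall x, f x = g x) -> L1 f -> L1 g.
Proof. by move=> /funext ->. Qed.

Lemma L1_dom f g : measurable_fun setT f -> L1 g -> (forall x, `|f x| <= g x) -> L1 f.
Proof.
move=> mf ig fg; apply: le_integrable ig => //; first exact/measurable_EFinP.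
by move=> x _ /=; rewrite lee_fin (le_trans (fg x))// ler_norm.
Qed.

Lemma L1D f g : L1 f -> L1 g -> L1 (fun x => f x + g x).
Proof.
by move=> h1 h2; have := integrableD measurableT h1 h2; apply: eq_integrable.
Qed.

Lemma L1Z k f : L1 f -> L1 (fun x => k * f x).
Proof.
by move=> h1; have := integrableZl measurableT k h1; apply: eq_integrable.
Qed.

Lemma L1N f : L1 f -> L1 (fun x => - f x).
Proof. by move=> /(L1Z (-1)); apply: L1_ext => x; rewrite mulN1r. Qed.

Lemma L1B f g : L1 f -> L1 g -> L1 (fun x => f x - g x).
Proof. by move=> h1 /L1N h2; exact: L1D. Qed.

Lemma L1_0 : L1 (fun=> 0).
Proof. exact: integrable0. Qed.

Lemma L1_abs f : L1 f -> L1 (fun x => `|f x|).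
Proof.
move=> h; have /integrable_abse := h; apply: eq_integrable => //.
Qed.

Lemma IntD f g : L1 f -> L1 g -> Int (fun x => f x + g x) = Int f + Int g.
Proof. by move=> h1 h2; rewrite RintegralD. Qed.

Lemma IntB f g : L1 f -> L1 g -> Int (fun x => f x - g x) = Int f - Int g.
Proof. by move=> h1 h2; rewrite RintegralB. Qed.

Lemma IntZ k f : L1 f -> Int (fun x => k * f x) = k * Int f.
Proof. by move=> h1; rewrite RintegralZl. Qed.

Lemma IntN f : L1 f -> Int (fun x => - f x) = - Int f.
Proof.
move=> h1; rewrite -mulN1r -IntZ//; apply: eq_Rintegral => x _; rewrite mulN1r//.
Qed.

Lemma Int_ext f g : (forall x, f x = g x) -> Int f = Int g.
Proof. by move=> h; apply: eq_Rintegral. Qed.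

Lemma Int_ge0 f : (forall x, 0 <= f x) -> 0 <= Int f.
Proof. by move=> h; apply: Rintegral_ge0. Qed.

Lemma Int_le f g : L1 f -> L1 g -> (forall x, f x <= g x) -> Int f <= Int g.
Proof. by move=> h1 h2 h; apply: le_Rintegral. Qed.

Lemma Int_norm f : L1 f -> `|Int f| <= Int (fun x => `|f x|).
Proof. by move=> h; apply: le_normr_Rintegral. Qed.

Lemma Int_ae f g : measurable_fun setT f -> measurable_fun setT g ->
  {ae mu, forall x, f x = g x} -> Int f = Int g.
Proof.
move=> mf mg h; rewrite /Rintegral; congr fine; apply: ae_eq_integral => //.
- exact/measurable_EFinP.
- exact/measurable_EFinP.
- by apply: filterS h => x -> _.
Qed.

Lemma Int_eq0 f : L1 f -> (forall x, 0 <= f x) -> Int f = 0 -> {ae mu, forall x, f x = 0}.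
Proof.
move=> h1 h0 h; have mf : measurable_fun setT (fun x => (f x)%:E).
  by have /integrableP[] := h1.
have : ae_eq mu setT (fun x => (f x)%:E) (cst 0%E).
  apply/ae_eq_integral_abs => //.
  under eq_integral do rewrite /= ger0_norm//.
  apply/eqP; rewrite -fine_eq0; first exact/eqP.
  by have := integrable_fin_num measurableT h1.
by apply: filterS => x /(_ I) [].
Qed.

Lemma L2_meas f : L2 f -> measurable_fun setT f. Proof. by case. Qed.
Lemma L2_sq f : L2 f -> L1 (fun x => f x ^+ 2). Proof. by case. Qed.

Lemma L2_dom f g : measurable_fun setT f -> L2 g -> (forall x, `|f x| <= `|g x|) -> L2 f.
Proof.
move=> mf [mg ig] fg; split => //; apply: L1_dom ig _.
  exact: measurable_funX.
by move=> x; rewrite normrX -(real_normK (num_real (g x))) ler_pXn2r// ?nnegrE.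
Qed.

Lemma L2_mul f g : L2 f -> L2 g -> L1 (fun x => f x * g x).
Proof.
move=> [mf hf] [mg hg]; apply: (L1_dom (g := fun x => f x ^+ 2 + g x ^+ 2)).
- exact: measurable_funM.
- exact: L1D.
- move=> x; rewrite normrM -(real_normK (num_real (f x))) -(real_normK (num_real (g x))).
  move: (normr_ge0 (f x)) (normr_ge0 (g x)).
  by move: `|f x| `|g x| => a b; nra.
Qed.

Lemma L2D f g : L2 f -> L2 g -> L2 (fun x => f x + g x).
Proof.
move=> hf hg; split; first by apply: measurable_funD; exact: L2_meas.
apply: (@L1_ext (fun x => (f x ^+ 2 + g x ^+ 2) + 2 * (f x * g x))).
  by move=> x; ring.
apply: L1D; first by apply: L1D; exact: L2_sq.
by apply: L1Z; exact: L2_mul.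
Qed.

Lemma L2Z k f : L2 f -> L2 (fun x => k * f x).
Proof.
move=> hf; split; first by apply: measurable_funM => //; exact: L2_meas.
apply: (@L1_ext (fun x => k ^+ 2 * f x ^+ 2)); first by move=> x; ring.
by apply: L1Z; exact: L2_sq.
Qed.

Lemma L2_ext f g : (forall x, f x = g x) -> L2 f -> L2 g.
Proof. by move=> /funext ->. Qed.

Lemma L2N f : L2 f -> L2 (fun x => - f x).
Proof. by move=> /(L2Z (-1)); apply: L2_ext => x; rewrite mulN1r. Qed.

Lemma L2B f g : L2 f -> L2 g -> L2 (fun x => f x - g x).
Proof. by move=> h1 /L2N h2; exact: L2D. Qed.

Lemma L2_bdd f h (C : R) : L2 f -> measurable_fun setT h -> (forall x, `|h x| <= C) ->
  L2 (fun x => h x * f x).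
Proof.
move=> hf mh hC; apply: (@L2_dom _ (fun x => C * f x)).
- by apply: measurable_funM => //; exact: L2_meas.
- exact: L2Z.
- move=> x; rewrite !normrM ler_wpM2r//; apply: le_trans (ler_norm C); exact: hC.
Qed.

Lemma L1_bdd f h (C : R) : L1 f -> measurable_fun setT h -> (forall x, `|h x| <= C) ->
  L1 (fun x => h x * f x).
Proof.
move=> hf mh hC; apply: (@L1_dom _ (fun x => C * `|f x|)).
- by apply: measurable_funM => //; exact: L1_meas.
- by apply: L1Z; exact: L1_abs.
- by move=> x; rewrite normrM ler_wpM2r.
Qed.

Lemma DCT (f_ : nat -> T -> R) (f g : T -> R) :
  (forall n, measurable_fun setT (f_ n)) -> measurable_fun setT f -> L1 g ->
  {ae mu, forall x, f_ ^~ x @ \oo --> f x} ->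
  {ae mu, forall x n, `|f_ n x| <= g x} ->
  L1 f /\ (fun n => Int (f_ n)) @ \oo --> Int f.
Proof.
move=> mf_ mf ig cv dom.
have := @dominated_convergence _ _ _ mu setT measurableT
  (fun n x => (f_ n x)%:E) (fun x => (f x)%:E) (fun x => (g x)%:E).
case.
- by move=> n; exact/measurable_EFinP.
- exact/measurable_EFinP.
- apply: filterS cv => x h _; apply: cvg_EFin; last exact: h.
  by near=> n.
- exact: ig.
- by apply: filterS dom => x h n _; rewrite lee_fin; exact: h.
- move=> h1 _ h3; split; first exact: h1.
  have h2 := integrable_fin_num measurableT h1.
  rewrite /Rintegral; apply: fine_cvg.
  by rewrite fineK.
Unshelve. all: end_near. Qed.

Lemma Fatou (f_ : nat -> T -> R) (f : T -> R) (c_ : nat -> R) (c : R) :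
  (forall n, L1 (f_ n)) -> (forall n x, 0 <= f_ n x) -> measurable_fun setT f ->
  {ae mu, forall x, f_ ^~ x @ \oo --> f x} ->
  (forall n, Int (f_ n) <= c_ n) -> c_ @ \oo --> c ->
  (forall x, 0 <= f x) -> L1 f /\ Int f <= c.
Proof.
move=> i_ p_ mf cv le_ cc f0.
have F := @fatou _ _ _ mu setT measurableT (fun n x => (f_ n x)%:E) _ _.
have {}F : (\int[mu]_x (f x)%:E <= c%:E)%E.
  have := F (fun n => proj1 (integrableP _ _ _ (i_ n))) _.
  rewrite (_ : (\int[mu]_x (f x)%:E)%E =
     (\int[mu]_x limn_einf (fun n => (f_ n x)%:E))%E); last first.
    apply: ae_eq_integral => //; first exact/measurable_EFinP.
    - apply: measurableT_comp => //; apply: measurable_fun_limn_esup => n.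
      apply: measurableT_comp => //.
      exact: (proj1 (integrableP _ _ _ (i_ n))).
    - apply: filterS cv => x h _.
      have h' : (fun n => (f_ n x)%:E) @ \oo --> (f x)%:E.
        by apply: cvg_EFin; [near=> n|exact: h].
      by rewrite is_cvg_limn_einfE; [exact/esym/cvg_lim|apply/cvg_ex; exists (f x)%:E].
  move=> /(_ (fun n x _ => p_ n x)) F1; apply: le_trans F1 _.
  have h' : (fun n => (c_ n)%:E) @ \oo --> c%:E.
    by apply: cvg_EFin; [near=> n|exact: cc].
  have e : limn_einf (fun n => (c_ n)%:E) = c%:E.
    by rewrite is_cvg_limn_einfE; [exact/cvg_lim|apply/cvg_ex; exists c%:E].
  rewrite limn_einf_lim -e limn_einf_lim; apply: lee_lim; [exact: is_cvg_einfs|exact: is_cvg_einfs|].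
  apply: nearW => n; apply: le_ereal_inf_tmp => _ [k /= nk <-].
  apply: le_trans (ereal_inf_lbound _) _; first by exists k.
  rewrite -[leRHS](@fineK _ (c_ k)%:E)//.
  by rewrite -[leLHS]fineK ?lee_fin; [exact: le_|exact: integrable_fin_num (i_ k)].
have i : L1 f.
  apply/integrableP; split; first exact/measurable_EFinP.
  under eq_integral do rewrite /= ger0_norm//.
  by apply: le_lt_trans F _; exact: ltry.
split => //; rewrite -lee_fin /Rintegral fineK//.
exact: integrable_fin_num.
Unshelve. all: end_near. Qed.
End L12.

Notation plane R := (measurableTypeR R * measurableTypeR R)%type.
Notation Mes f := (@measurable_fun _ _ (plane _) _ setT f).

HB.instance Definition _ (R : realType) := Measure.on (@leb2 R).

(** Tonelli's theorem for [leb2] with itself, in [ae_translation_cst], asks for this. *)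
Lemma sigma_finite_leb2 (R : realType) : sigma_finite setT (@leb2 R).
Proof.
have /sigma_finiteP[F [TF ndF Foo]] := sigma_finiteT (@lebesgue_measure R).
exists (fun n => F n `*` F n).
  rewrite -setXTT TF predeqE => -[x y]; split.
    move=> [/= [n _ Fnx] [k _ Gky]]; exists (maxn n k) => //; split.
    - by move: x Fnx; exact/subsetPset/ndF/leq_maxl.
    - by move: y Gky; exact/subsetPset/ndF/leq_maxr.
  by move=> [n _ []/= ? ?]; split; exists n.
move=> k; have [? ?] := Foo k.
split; first exact: measurableX.
by rewrite /leb2 product_measure1E// lte_mul_pinfty// ge0_fin_numE.
Qed.

HB.instance Definition _ (R : realType) :=
  Measure_isSigmaFinite.Build _ _ _ (@leb2 R) (@sigma_finite_leb2 R).

Section Translation.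
Variable R : realType.
Local Notation leb := (@lebesgue_measure R).
Local Notation L := (@leb2 R).
Implicit Types (f : R * R -> R) (c : R * R).

(** The shifted measure agrees with Lebesgue measure on the intervals []a, b]], and these determine
    it. *)
Lemma leb_shift (c : R) (A : set (measurableTypeR R)) : measurable A ->
  leb ((fun x => x + c) @^-1` A) = leb A.
Proof.
move=> mA.
have mc : measurable_fun setT ((fun x => x + c) : measurableTypeR R -> measurableTypeR R).
  by apply: measurable_funD.
pose mc_ := isMeasurableFun.Build _ _ _ _ _ mc.
pose mcp : {mfun _ >-> _} := HB.pack (fun x : measurableTypeR R => x + c : measurableTypeR R) mc_.
apply/esym; apply: (@lebesgue_measure_unique R (pushforward leb mcp)) => // _ [[a b] /= ab <-].
rewrite /pushforward /=.
rewrite (_ : _ @^-1` _ = `]a - c, b - c]%classic); last first.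
  by apply/seteqP; split=> x /=; rewrite !in_itv/= ltrBlDr lerBrDr.
rewrite !lebesgue_measure_itv/= !lte_fin ltrD2r -!EFinB.
by have -> : b - c - (a - c) = b - a by ring.
Qed.

Definition tr (c : R * R) : plane R -> plane R := fun x : R * R => x + c.

Lemma measurable_tr (c : R * R) : measurable_fun setT (tr c).
Proof.
apply/measurable_fun_pairP; split.
- by apply: (measurable_funD (f := fun x : R * R => x.1) (g := cst c.1)); [exact: measurable_fst|exact: measurable_cst].
- by apply: (measurable_funD (f := fun x : R * R => x.2) (g := cst c.2)); [exact: measurable_snd|exact: measurable_cst].
Qed.

HB.instance Definition _ c := isMeasurableFun.Build _ _ _ _ (tr c) (measurable_tr c).

Lemma leb2_shift (c : R * R) (A : set (plane R)) : measurable A ->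
  pushforward L (tr c) A = L A.
Proof.
move=> mA.
apply/esym; apply: (@product_measure_unique _ _ _ _ _ leb leb (pushforward L (tr c))) => // B C mB mC.
change (L ((fun x : R * R => x + c) @^-1` (B `*` C)) = (leb B * leb C)%E).
rewrite (_ : _ @^-1` _ = ((fun x => x + c.1) @^-1` B) `*` ((fun x => x + c.2) @^-1` C))//.
have mBc (k : R) (D : set (measurableTypeR R)) : measurable D ->
    measurable ((fun x : measurableTypeR R => x + k) @^-1` D).
  move=> mD; rewrite -[X in measurable X]setTI.
  exact: (measurable_funD (f := fun x : measurableTypeR R => x) (g := cst k)).
rewrite /leb2 product_measure1E//; [|exact: mBc..].
by congr (_ * _)%E; exact: leb_shift.
Qed.

Lemma meas_shift (f : R * R -> R) c : Mes f ->
  Mes (fun x : R * R => f (x + c)).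
Proof. by move=> mf; apply: (measurableT_comp mf); exact: measurable_tr. Qed.

Lemma ge0_integral_shift (f : R * R -> \bar R) c : Mes f ->
  (forall x, 0 <= f x)%E -> integral L setT (fun x : R * R => f (x + c)) = integral L setT f.
Proof.
move=> mf f0.
have := @ge0_integral_pushforward _ _ _ _ R _ (measurable_tr c) L setT f measurableT mf (fun y _ => f0 y).
rewrite preimage_setT => <-.
by apply: (eq_measure_integral L) => A mA _; exact: leb2_shift.
Qed.

Lemma L1_shift f c : L1 L f -> L1 L (fun x : R * R => f (x + c)).
Proof.
move=> /integrableP[mf fi]; apply/integrableP; split.
  apply/measurable_EFinP; apply: meas_shift; exact/measurable_EFinP.
rewrite (@ge0_integral_shift (fun x => `|(f x)%:E|%E))//.
exact: measurableT_comp.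
Qed.

Lemma Int_shift f c : L1 L f -> Rintegral L setT (fun x : R * R => f (x + c)) = Rintegral L setT f.
Proof.
move=> h; rewrite /Rintegral; congr fine.
have mf := proj1 (integrableP _ _ _ h).
have := @integral_pushforward _ _ _ _ R _ (measurable_tr c) L setT _ mf.
rewrite preimage_setT => /(_ (L1_shift c h) measurableT) <-.
by apply: (eq_measure_integral L) => A mA _; exact: leb2_shift.
Qed.

Lemma L2_shift f c : L2 L f -> L2 L (fun x : R * R => f (x + c)).
Proof. by move=> [m1 m2]; split; [exact: meas_shift|exact: (L1_shift c m2)]. Qed.

(** The line through x in direction j misses the origin, the only point where |x| is not
    differentiable. The condition is invariant under shifts along j and fails only on a null set. *)
Definition off (j : bool) (x : R * R) := Defs.comp (~~ j) x != 0.

Lemma dirE (j : bool) s : s *: dir R j = if j then (s, 0) else (0, s).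
Proof.
by case: j; rewrite /dir; congr pair; rewrite /=; (exact: mulr1 || exact: mulr0).
Qed.

Lemma off_shift j x s : off j (x + s *: dir R j) = off j x.
Proof. by rewrite dirE /off; case: j => /=; rewrite addr0. Qed.

Lemma ae_off j : {ae L, forall x, off j x}.
Proof.
have m0 : measurable ([set 0] : set (measurableTypeR R)) by exact: measurable_set1.
have mT : measurable ([set: measurableTypeR R]) by [].
exists (if j then [set: R] `*` [set 0] else [set 0] `*` [set: R]); split.
- by case: j; apply: measurableX.
- case: j; rewrite /leb2 product_measure1E//.
    by rewrite -[X in (_ * X)%E]/(leb [set 0]) lebesgue_measure_set1 mule0.
  by rewrite -[X in (X * _)%E]/(leb [set 0]) lebesgue_measure_set1 mul0e.
- by case: j => -[x1 x2]/=; rewrite /off /= => /negP; rewrite negbK => /eqP.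
Qed.

Lemma ae_shift (P : R * R -> Prop) c : {ae L, forall x, P x} -> {ae L, forall x, P (x + c)}.
Proof.
move=> [A [mA A0 PA]]; exists ((fun x : R * R => x + c) @^-1` A); split.
- by rewrite -[X in measurable X]setTI; exact: (measurable_tr c).
- by rewrite -[LHS]/(pushforward L (tr c) A) leb2_shift.
- by move=> x /= nP; apply: PA.
Qed.

Lemma aeS (P Q : R * R -> Prop) : (forall x, P x -> Q x) ->
  {ae L, forall x, P x} -> {ae L, forall x, Q x}.
Proof.
move=> PQ [A [mA A0 PA]]; exists A; split => // x /= nQ.
by apply: PA => /= /PQ.
Qed.

Lemma aeI (P Q : R * R -> Prop) :
  {ae L, forall x, P x} -> {ae L, forall x, Q x} -> {ae L, forall x, P x /\ Q x}.
Proof.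
move=> [A [mA A0 PA]] [B [mB B0 QB]]; exists (A `|` B); split.
- exact: measurableU.
- by rewrite null_set_setU.
- by move=> x /= /not_andP [nP|nQ]; [left; apply: PA|right; apply: QB].
Qed.

Lemma aeT (P : R * R -> Prop) : (forall x, P x) -> {ae L, forall x, P x}.
Proof. by move=> h; apply: aeS (ae_off true). Qed.

(** By Tonelli g(x + c) = g(x) for almost every pair (x, c), so some fixed x0 satisfies g(x0 + c) =
    g(x0) for almost every c; shifting by - x0 gives the constant g(x0). *)
Lemma ae_translation_cst (g : R * R -> R) : Mes g ->
  (forall c, {ae L, forall x, g (x + c) = g x}) -> exists k, {ae L, forall x, g x = k}.
Proof.
move=> mg gc.
pose h (z : plane R * plane R) : R := `|g ((z.1 : R * R) + z.2) - g z.1|.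
have mh : measurable_fun setT h.
  apply: measurableT_comp => //; apply: measurable_funB; last first.
    by apply: (measurableT_comp mg); exact: measurable_fst.
  apply: (measurableT_comp mg); apply/measurable_fun_pairP; split.
  - apply: measurable_funD.
      by apply: measurableT_comp; exact: measurable_fst.
    by apply: measurableT_comp; [exact: measurable_fst|exact: measurable_snd].
  - apply: measurable_funD.
      by apply: measurableT_comp; [exact: measurable_snd|exact: measurable_fst].
    by apply: measurableT_comp; exact: measurable_snd.
pose H (z : plane R * plane R) : \bar R := (h z)%:E.
have mH : measurable_fun setT H by exact/measurable_EFinP.
have H0 z : (0 <= H z)%E by rewrite lee_fin normr_ge0.
have := @fubini_tonelli _ _ (plane R) (plane R) R L L H mH H0.
have mG := @measurable_fun_fubini_tonelli_F _ _ (plane R) (plane R) R L H mH H0.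
rewrite -/(fubini_F L H) -/(fubini_G L H).
have E2 : integral L setT (fubini_G L H) = 0%E.
  rewrite -(integral0 L setT); apply: eq_integral => c _; rewrite /fubini_G.
  rewrite -[RHS](integral0 L setT); apply: ae_eq_integral => //.
    by apply: measurableT_comp => //; exact: measurable_pair2.
  by apply: aeS (gc c) => x e _; rewrite /H /h /= e subrr normr0.
rewrite E2 => E1.
have F0 x : (0 <= fubini_F L H x)%E by apply: integral_ge0 => c _; exact: H0.
have A1 : {ae L, forall x, fubini_F L H x = 0%E}.
  have : ae_eq L setT (fubini_F L H) (cst 0%E).
    apply/ae_eq_integral_abs => //.
    rewrite -E1; apply: eq_integral => x _; exact: gee0_abs.
  by apply: aeS => x; apply.
(* A property that holds almost everywhere has a witness because the plane has positive measure. *)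
have [x0 /= Fx0] : exists x, fubini_F L H x = 0%E.
  apply: (@filter_ex _ _ (ae_properfilter_algebraOfSetsType _)) A1.
  have LT : L setT = (leb setT * leb setT)%E by rewrite -setXTT; exact: product_measure1E.
  have l1 : leb setT = +oo%E by rewrite -set_itvNyy lebesgue_measure_itv.
  by change (0%E < L setT)%E; rewrite LT l1 mulyy.
exists (g x0).
have A2 : {ae L, forall c, g ((x0 : R * R) + c) = g x0}.
  have : ae_eq L setT (fun c => H (x0, c)) (cst 0%E).
    apply/ae_eq_integral_abs => //.
      by apply: measurableT_comp => //; exact: measurable_pair1.
    rewrite -[RHS]Fx0; apply: eq_integral => x _; exact: gee0_abs.
  apply: aeS => c /(_ I) []/= /eqP; rewrite normr_eq0 subr_eq0 => /eqP //.
have := ae_shift (- (x0 : R * R)) A2.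
by apply: aeS => x <-; rewrite addrC subrK.
Qed.
End Translation.

(** * Smooth functions and bumps *)

Section SmoothLine.
Variable R : realType.
Implicit Types f g : R -> R.

(** Smoothness with explicit derivatives: closure under products and compositions is then an
    induction on n. [Cinf_smooth] and [smooth_Cinf] translate to and from [smooth]. *)
Fixpoint Cn (n : nat) f : Prop :=
  if n is k.+1 then exists2 f' : R -> R, (forall x : R, is_derive x 1 f (f' x)) & Cn k f'
  else continuous f.

Definition Cinf f := forall n, Cn n f.

Lemma is_derive_cont f (f' : R -> R) : (forall x : R, is_derive x 1 f (f' x)) -> continuous f.
Proof.
move=> h x; apply: differentiable_continuous.
by apply/derivable1_diffP; have [] := h x.
Qed.

Lemma CnS n f : Cn n.+1 f -> Cn n f.
Proof.
elim: n f => [|n IH] f /= [f' df cf].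
  exact: is_derive_cont df.
by exists f' => //; exact: IH.
Qed.

Lemma Cn_cont n f : Cn n f -> continuous f.
Proof. by elim: n => // n IH /CnS. Qed.

Lemma Cn_ext n f g : f =1 g -> Cn n f -> Cn n g.
Proof. by move=> /funext ->. Qed.

Lemma Cinf_cst k : Cinf (fun=> k).
Proof.
move=> n; elim: n k => [|n IH] k; first by move=> x; exact: cvg_cst.
by exists (fun=> 0) => //= x; exact: is_derive_cst.
Qed.

Lemma Cinf_id : Cinf id.
Proof.
case=> [|n]; first by move=> x; exact: cvg_id.
by exists (fun=> 1); [move=> x; exact: is_derive_id|exact: Cinf_cst].
Qed.

Lemma CnD n f g : Cn n f -> Cn n g -> Cn n (fun x => f x + g x).
Proof.
elim: n f g => [|n IH] f g /=; first by move=> cf cg x; exact: cvgD (cf x) (cg x).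
move=> [f' df cf] [g' dg cg]; exists (fun x => f' x + g' x); last exact: IH.
by move=> x; exact: is_deriveD.
Qed.

Lemma CnM n f g : Cn n f -> Cn n g -> Cn n (fun x => f x * g x).
Proof.
elim: n f g => [|n IH] f g /=; first by move=> cf cg x; exact: cvgM (cf x) (cg x).
move=> cf1 cg1; have [f' df cf] := cf1; have [g' dg cg] := cg1.
exists (fun x => f x * g' x + g x * f' x).
  by move=> x; exact: is_deriveM.
by apply: CnD; apply: IH => //; exact: CnS.
Qed.

Lemma is_derive_comp f g (x df dg : R) : is_derive (g x) 1 f df -> is_derive x 1 g dg ->
  is_derive x 1 (fun x => f (g x)) (df * dg).
Proof. by move=> h1 h2; exact: is_derive1_comp. Qed.

Lemma Cn_comp n f g : Cn n f -> Cn n g -> Cn n (fun x => f (g x)).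
Proof.
elim: n f g => [|n IH] f g /=; first by move=> cf cg x; exact: continuous_comp (cg x) (cf _).
move=> [f' df cf] cg1; have [g' dg cg] := cg1.
exists (fun x => f' (g x) * g' x).
  by move=> x; exact: is_derive_comp.
by apply: CnM => //; apply: IH => //; exact: CnS.
Qed.

Lemma CinfD f g : Cinf f -> Cinf g -> Cinf (fun x => f x + g x).
Proof. by move=> cf cg n; exact: CnD. Qed.
Lemma CinfM f g : Cinf f -> Cinf g -> Cinf (fun x => f x * g x).
Proof. by move=> cf cg n; exact: CnM. Qed.
Lemma Cinf_comp f g : Cinf f -> Cinf g -> Cinf (fun x => f (g x)).
Proof. by move=> cf cg n; exact: Cn_comp. Qed.

Lemma Cinf_derive f : Cinf f -> exists2 f', (forall x : R, is_derive x 1 f (f' x)) & Cinf f'.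
Proof.
move=> cf; have [f' df _] := cf 1; exists f' => // n.
have [g dg cg] := cf n.+1.
suff -> : f' = g by [].
apply/funext => x; have [_ <-] := df x; by have [_ <-] := dg x.
Qed.

Lemma Cinf_cont f : Cinf f -> continuous f.
Proof. by move=> /(_ 0%N). Qed.

Lemma is_derive_dir f (x v df : R) : is_derive x 1 f df -> is_derive x v f (v * df).
Proof.
move=> [d1 e1]; have df1 : differentiable f x by apply/derivable1_diffP.
apply: DeriveDef; first exact: diff_derivable.
rewrite deriveE// (_ : v = v *: 1) ?linearZ/=; last by rewrite /GRing.scale/= mulr1.
by rewrite -deriveE// e1 /GRing.scale /= mulr1.
Qed.

Lemma Cinf_iterD vs f : Cinf f -> Cinf (Defs.iterD vs f).
Proof.
elim: vs => // v vs IH cf /=.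
have [g' dg cg] := Cinf_derive (IH cf).
rewrite (_ : 'D_v _ = fun x => v * g' x); first by apply: CinfM cg; exact: Cinf_cst.
by apply/funext => x; have [_ ->] := is_derive_dir v (dg x).
Qed.

Lemma Cinf_smooth f : Cinf f -> smooth f.
Proof.
move=> cf vs; have c := Cinf_iterD vs cf.
split; first exact: (Cinf_cont c).
move=> v x; have [g' dg cg] := Cinf_derive c.
by have [] := is_derive_dir v (dg x).
Qed.

Lemma smooth_Cinf f : smooth f -> Cinf f.
Proof.
move=> sf n; elim: n f sf => [|n IH] f sf; first by have [] := sf [::].
exists ('D_1 f).
  by move=> x; apply: derivableP; have [_ ] := sf [::]; apply.
apply: IH => vs; have := sf (vs ++ [:: 1]).
rewrite (_ : Defs.iterD (vs ++ [:: 1]) f = Defs.iterD vs ('D_1 f))//.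
by elim: vs => //= v vs ->.
Qed.

End SmoothLine.

(** * Flat functions and bumps on the line *)

Section Bump.
Variable R : realType.

(** A quadratic remainder is the form in which derivatives are found at the flat point of [thetap]
    and under the integral sign in [tens_trans_derive]. *)
Lemma is_derive_quad (f : R -> R) (x d C del : R) : 0 < del ->
  (forall h, `|h| < del -> `|f (h + x) - f x - h * d| <= C * h ^+ 2) -> is_derive x 1 f d.
Proof.
move=> del0 H.
have C0 : 0 <= C.
  have := H (del / 2); rewrite gtr0_norm ?divr_gt0// ltr_pdivrMr// ltr_pMr// ltr1n.
  move=> /(_ isT) /(le_trans (normr_ge0 _)).
  by rewrite pmulr_lge0// exprn_gt0// divr_gt0.
have L : (fun h : R => h^-1 *: (f (h *: (1 : R) + x) - f x)) @ (0 : R)^' --> d.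
  apply/cvgrPdist_le => e e0.
  have C1 : 0 < C + 1 by rewrite ltr_wpDl.
  near=> h.
  have h0 : h != 0 by near: h; exact: nbhs_dnbhs_neq.
  have hd : `|h| < del.
    near: h; apply: dnbhs0_lt => //.
  have he : `|h| < e / (C + 1).
    by near: h; apply: dnbhs0_lt; rewrite divr_gt0.
  have -> : h *: (1 : R) = h by exact: mulr1.
  rewrite -[d]mul1r -(mulVf h0) -mulrA -[X in _ - X]/(h^-1 * _) -mulrBr.
  rewrite normrM distrC normfV mulrC ler_pdivrMr ?normr_gt0//.
  apply: le_trans (H h hd) _.
  rewrite -[h ^+ 2]real_normK ?num_real// expr2 mulrA ler_wpM2r//.
  apply: (@le_trans _ _ ((C + 1) * `|h|)); first by rewrite ler_wpM2r// lerDl.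
  by rewrite mulrC -ler_pdivlMr// ltW.
split; first by apply/cvg_ex; exists d.
exact: cvg_lim L.
Unshelve. all: end_near. Qed.

Lemma expR_pow_bound (k : nat) (y : R) : 0 <= y -> y ^+ k * expR (- y) <= k`!%:R.
Proof.
case: k => [|k] y0; first by rewrite !expr0 mul1r -expR0 ler_expR oppr_le0.
rewrite expRN ler_pdivrMr ?expR_gt0// mulrC -ler_pdivrMr ?ltr0n ?fact_gt0//.
by apply: le_trans (expR_ge1Dxn k y0); rewrite lerDr.
Qed.

Lemma poly_expR_bound (p : {poly R}) :
  exists C, forall y, 0 <= y -> `|p.[y]| * expR (- y) <= C.
Proof.
exists (\sum_(i < size p) `|p`_i| * i`!%:R) => y y0.
rewrite horner_coef.
apply: (@le_trans _ _ ((\sum_(i < size p) `|p`_i * y ^+ i|) * expR (- y))).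
  by rewrite ler_wpM2r ?expR_ge0// ler_norm_sum.
rewrite mulr_suml; apply: ler_sum => i _.
rewrite normrM normrX (ger0_norm y0) -mulrA ler_wpM2l//.
exact: expR_pow_bound.
Qed.

(** The functions p(1/x) exp(-1/x), extended by zero, form a family stable under differentiation, so
    one induction over all p proves that exp(-1/x) is smooth. *)
Definition thetap (p : {poly R}) (x : R) : R :=
  if x <= 0 then 0 else p.[x^-1] * expR (- x^-1).

Lemma thetap_derive (p : {poly R}) (x : R) :
  is_derive x 1 (thetap p) (thetap ((p - p^`()) * 'X^2) x).
Proof.
have [x0|x0|->] := ltgtP x 0.
- rewrite {2}/thetap ltW//.
  apply: (near_eq_is_derive (f := cst 0)) => //.
  near=> y; rewrite /thetap ifT//; apply: ltW; near: y.
  exact: lt_nbhsl.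
- rewrite {2}/thetap leNgt x0/=.
  apply: (near_eq_is_derive (f := fun y : R => p.[y^-1] * expR (- y^-1))) => //.
    near=> y; rewrite /thetap ifF//; apply/negbTE; rewrite -ltNge; near: y.
    exact: lt_nbhsr.
  have xn0 : x != 0 by rewrite gt_eqF.
  have di : is_derive x 1 (fun y : R => y^-1) (- x ^- 2).
    apply: is_derive_eq; first exact: is_deriveV.
    by rewrite /GRing.scale/= mulr1.
  have dp := is_derive_comp (is_derive_poly p x^-1) di.
  have de := is_derive_comp (g := fun y : R => - y^-1) (is_derive_expR (- x^-1)) (is_deriveN di).
  refine (is_derive_eq (is_deriveM dp de) _).
  rewrite hornerM hornerD hornerN hornerXn /GRing.scale/= exprVn; ring.
(* At 0 the quotient of the function by h^2 is (p X^2)(1/h) exp(-1/h), which is bounded; the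
   remainder is therefore quadratic and the derivative is 0. *)
- have [C hC] := poly_expR_bound (p * 'X^2).
  rewrite {2}/thetap lexx.
  apply: (@is_derive_quad _ _ _ C 1) => // h _.
  have C0 : 0 <= C by apply: le_trans (hC 0 (lexx _)); rewrite mulr_ge0// expR_ge0.
  rewrite /thetap lexx addr0 mulr0 !subr0; case: ifPn => [h0|].
    by rewrite normr0 mulr_ge0// sqr_ge0.
  rewrite -ltNge => h0.
  have := hC h^-1; rewrite invr_ge0 ltW// => /(_ isT).
  rewrite hornerM hornerXn normrM => H.
  rewrite -ler_pdivrMr ?exprn_gt0//; apply: le_trans H.
  by rewrite normrM (ger0_norm (expR_ge0 _)) normrX normfV (gtr0_norm h0) exprVn mulrAC.
Unshelve. all: end_near. Qed.

Definition theta := thetap 1.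

Lemma Cinf_thetap p : Cinf (thetap p).
Proof.
move=> n; elim: n p => [|n IH] p.
  exact: is_derive_cont (thetap_derive p).
by exists (thetap ((p - p^`()) * 'X^2)) => //; exact: thetap_derive.
Qed.

Lemma Cinf_theta : Cinf theta. Proof. exact: Cinf_thetap. Qed.

Lemma theta_le0 x : x <= 0 -> theta x = 0.
Proof. by rewrite /theta /thetap => ->. Qed.

Lemma theta_gt0E x : 0 < x -> theta x = expR (- x^-1).
Proof. by rewrite /theta /thetap leNgt => -> /=; rewrite hornerC mul1r. Qed.

Lemma theta_ge0 x : 0 <= theta x.
Proof.
have [/theta_le0 ->//|/theta_gt0E ->] := leP x 0; exact: expR_ge0.
Qed.

Lemma theta_gt0 x : 0 < x -> 0 < theta x.
Proof. by move=> /theta_gt0E ->; exact: expR_gt0. Qed.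

Lemma theta_le1 x : theta x <= 1.
Proof.
have [/theta_le0 ->//|x0] := leP x 0.
by rewrite theta_gt0E// -expR0 ler_expR oppr_le0 invr_ge0 ltW.
Qed.

Lemma theta_cvg (c : R) : (fun n : nat => theta (n%:R * c)) @ \oo --> ((0 < c)%R%:R : R).
Proof.
have [c0|c0] := ltP 0 c; last first.
  apply: cvg_near_cst; apply: nearW => n.
  by rewrite theta_le0// mulr_ge0_le0.
rewrite -(cvg_shiftS (fun n : nat => theta (n%:R * c))).
rewrite (_ : [sequence _]_n = (fun n => expR (- (n.+1%:R^-1 * c^-1)))); last first.
  by apply/funext => n /=; rewrite theta_gt0E ?invfM// mulr_gt0.
have C : (fun n : nat => - (n.+1%:R^-1 * c^-1)) @ \oo --> (- (0 * c^-1) : R).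
  by apply: cvgN; apply: cvgMl; exact: cvg_harmonic.
rewrite mul0r oppr0 in C.
have -> : (true%:R : R) = expR 0 by rewrite expR0.
have C2 := continuous_cvg _ (@continuous_expR R 0) C.
exact: C2.
Qed.

(** The inner product is positive exactly on ]a, b[, and multiplying it by n before applying [theta]
    drives the values to 1 there: the bumps tend to the indicator of ]a, b[ and stay between 0 and
    1. *)
Definition bump (a b : R) (n : nat) (t : R) : R := theta (n%:R * (theta (t - a) * theta (b - t))).

Lemma Cinf_bump a b n : Cinf (bump a b n).
Proof.
rewrite /bump; apply: (Cinf_comp Cinf_theta (g := fun t => n%:R * (theta (t - a) * theta (b - t)))).
apply: CinfM; first exact: Cinf_cst.
apply: CinfM.
- apply: (Cinf_comp Cinf_theta (g := fun t => t - a)); apply: CinfD; [exact: Cinf_id|exact: Cinf_cst].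
- apply: (Cinf_comp Cinf_theta (g := fun t => b - t)); apply: CinfD; first exact: Cinf_cst.
  have := CinfM (Cinf_cst (-1)) (@Cinf_id R).
  by move=> h n0; apply: Cn_ext (h n0) => x; rewrite mulN1r.
Qed.

Lemma bump_supp a b n t : ~~ (a < t < b) -> bump a b n t = 0.
Proof.
rewrite negb_and -!leNgt /bump => /orP[h|h].
  by rewrite (theta_le0 (x := t - a)) ?subr_le0// mul0r mulr0 theta_le0.
by rewrite (theta_le0 (x := b - t)) ?subr_le0// !mulr0 theta_le0.
Qed.

Lemma bump_ge0 a b n t : 0 <= bump a b n t. Proof. exact: theta_ge0. Qed.
Lemma bump_le1 a b n t : bump a b n t <= 1. Proof. exact: theta_le1. Qed.

Lemma bump_cvg a b t : (fun n => bump a b n t) @ \oo --> ((a < t < b)%R%:R : R).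
Proof.
have -> : (a < t < b) = (0 < theta (t - a) * theta (b - t)).
  have [h|] := boolP (a < t < b).
    by move: h => /andP[h1 h2]; rewrite mulr_gt0// theta_gt0// subr_gt0.
  rewrite negb_and -!leNgt => /orP[h|h].
    by rewrite (theta_le0 (x := t - a)) ?subr_le0// mul0r ltxx.
  by rewrite (theta_le0 (x := b - t)) ?subr_le0// mulr0 ltxx.
exact: theta_cvg.
Qed.
End Bump.

(** * Tensor products on the plane *)

Section PlaneSmooth.
Variable R : realType.
Local Notation L := (@leb2 R).
Local Notation Int f := (Rintegral L setT f).

Lemma line_derive (V : normedModType R) (f : V -> R) (x v : V) (t df : R) :
  is_derive t 1 (fun h : R => f (x + h *: v)) df <-> is_derive (x + t *: v) v f df.
Proof.
have E : (fun h : R => h^-1 *: (f (x + (h *: (1 : R) + t) *: v) - f (x + t *: v))) =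
         (fun h : R => h^-1 *: (f (h *: v + (x + t *: v)) - f (x + t *: v))).
  apply/funext => h; congr (_ *: (f _ - _)).
  have -> : h *: (1 : R) = h by exact: mulr1.
  by rewrite scalerDl addrCA.
split=> -[h1 h2]; split.
- by move: h1; rewrite /derivable E.
- by move: h2; rewrite /derive E.
- by move: h1; rewrite /derivable E.
- by move: h2; rewrite /derive E.
Qed.

(** A class closed under directional derivatives, so that [smooth], which speaks of all iterated
    derivatives, follows for its members by induction. *)
Inductive TS : (R * R -> R) -> Prop :=
| TS1 a b : Cinf a -> Cinf b -> TS (fun x => a x.1 * b x.2)
| TSD f g : TS f -> TS g -> TS (fun x => f x + g x).

Lemma is_derive_affine (a : R -> R) (x v da : R) (t : R) : is_derive (x + t * v) 1 a da ->
  is_derive t 1 (fun h : R => a (x + h * v)) (v * da).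
Proof.
move=> h; rewrite mulrC.
have dv : is_derive t 1 (fun h : R => x + h * v) v.
  have d1 : is_derive t 1 (fun h : R => h * v) v.
    refine (is_derive_eq (is_deriveM (is_derive_id t (1 : R)) (is_derive_cst v t 1)) _).
    by rewrite /GRing.scale/= mulr0 add0r mulr1.
  refine (is_derive_eq (is_deriveD (is_derive_cst x t 1) d1) _).
  by rewrite add0r.
exact: (is_derive_comp (g := fun h : R => x + h * v) h dv).
Qed.

Lemma fst_cont : continuous (fst : R * R -> R).
Proof. by move=> z; exact: cvg_fst. Qed.
Lemma snd_cont : continuous (snd : R * R -> R).
Proof. by move=> z; exact: cvg_snd. Qed.

Lemma TS_continuous f : TS f -> continuous f.
Proof.
elim=> {f} [a b ca cb|f g _ cf _ cg] x.
- apply: cvgM.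
  + by apply: (@continuous_comp _ _ _ fst a); [exact: fst_cont|exact: Cinf_cont].
  + by apply: (@continuous_comp _ _ _ snd b); [exact: snd_cont|exact: Cinf_cont].
- exact: cvgD (cf x) (cg x).
Qed.

Lemma TS_derive f v : TS f ->
  exists2 f', (forall x : R * R, is_derive x v f (f' x)) & TS f'.
Proof.
elim=> {f} [a b ca cb|f g _ [f' df sf] _ [g' dg sg]].
- have [a' da ca'] := Cinf_derive ca; have [b' db cb'] := Cinf_derive cb.
  exists (fun x => (v.1 * a' x.1) * b x.2 + a x.1 * (v.2 * b' x.2)).
    move=> x; have := (@line_derive _ (fun x => a x.1 * b x.2) x v 0
      ((v.1 * a' x.1) * b x.2 + a x.1 * (v.2 * b' x.2))).1.
    rewrite scale0r addr0; apply.
    have d1 : is_derive (0 : R) 1 (fun h : R => a (x.1 + h * v.1)) (v.1 * a' x.1).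
      by apply: is_derive_affine; rewrite mul0r addr0.
    have d2 : is_derive (0 : R) 1 (fun h : R => b (x.2 + h * v.2)) (v.2 * b' x.2).
      by apply: is_derive_affine; rewrite mul0r addr0.
    refine (is_derive_eq (is_deriveM d1 d2) _).
    by rewrite !mul0r !addr0 /GRing.scale/= addrC mulrC.
  apply: TSD.
  + by apply: (TS1 (a := fun s => v.1 * a' s)) => //; apply: CinfM => //; exact: Cinf_cst.
  + by apply: (TS1 (b := fun s => v.2 * b' s)) => //; apply: CinfM => //; exact: Cinf_cst.
- exists (fun x => f' x + g' x); last exact: TSD.
  by move=> x; exact: is_deriveD.
Qed.

Lemma TS_smooth f : TS f -> smooth f.
Proof.
move=> sf vs; suff s : TS (Defs.iterD vs f).
  split; first exact: TS_continuous.
  by move=> v x; have [g dg _] := TS_derive v s; have [] := dg x.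
elim: vs => //= v vs IH; have [g dg sg] := TS_derive v IH.
suff -> : 'D_v (Defs.iterD vs f) = g by [].
by apply/funext => x; have [_ ->] := dg x.
Qed.

Definition tens (j : bool) (a b : R -> R) (x : R * R) : R :=
  a (Defs.comp j x) * b (Defs.comp (~~ j) x).

Lemma TS_tens j a b : Cinf a -> Cinf b -> TS (tens j a b).
Proof.
move=> ca cb; case: j; first exact: TS1.
rewrite (_ : tens _ _ _ = fun x => b x.1 * a x.2); first exact: TS1.
by apply/funext => x; rewrite /tens /= mulrC.
Qed.

Lemma tens_derive j a b a' (x : R * R) : is_derive (Defs.comp j x) 1 a (a' (Defs.comp j x)) ->
  is_derive x (dir R j) (tens j a b) (tens j a' b x).
Proof.
move=> d; have := (@line_derive _ (tens j a b) x (dir R j) 0 (tens j a' b x)).1.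
rewrite scale0r addr0; apply.
have -> : (fun h : R => tens j a b (x + h *: dir R j)) =
  (fun h : R => a (Defs.comp j x + h * 1) * b (Defs.comp (~~ j) x)).
  by apply/funext => h; rewrite dirE /tens; case: j {d} => /=; rewrite mulr1 addr0.
have d1 : is_derive (0 : R) 1 (fun h : R => a (Defs.comp j x + h * 1)) (1 * a' (Defs.comp j x)).
  by apply: is_derive_affine; rewrite mul0r addr0.
refine (is_derive_eq (is_deriveM d1 (is_derive_cst (b (Defs.comp (~~ j) x)) (0 : R) 1)) _).
by rewrite /tens /GRing.scale/= mulr0 add0r mul1r mulrC.
Qed.

Lemma eucl_comp (j : bool) (x : R * R) : `|Defs.comp j x| <= eucl x.
Proof.
rewrite /eucl -sqrtr_sqr ler_sqrt ?addr_ge0 ?sqr_ge0//.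
by case: j => /=; rewrite ?lerDl ?lerDr sqr_ge0.
Qed.

Lemma eucl_le (x : R * R) : eucl x <= `|x.1| + `|x.2|.
Proof.
rewrite -[leRHS]ger0_norm ?addr_ge0// -sqrtr_sqr ler_sqrt ?sqr_ge0//.
rewrite -(real_normK (num_real x.1)) -(real_normK (num_real x.2)).
have := mulr_ge0 (normr_ge0 x.1) (normr_ge0 x.2); nra.
Qed.

Lemma test_tens j a b (r : R) : Cinf a -> Cinf b -> (forall t, r < `|t| -> a t = 0) ->
  (forall t, r < `|t| -> b t = 0) -> test_fun (tens j a b).
Proof.
move=> ca cb sa sb; split; first exact/TS_smooth/TS_tens.
exists (r + r) => x hx.
have [h|h] := ltP r `|Defs.comp j x|; first by rewrite /tens sa// mul0r.
have [h'|h'] := ltP r `|Defs.comp (~~ j) x|; first by rewrite /tens sb// mulr0.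
have := lt_le_trans hx (eucl_le x).
by rewrite ltNge; case: j h h' => /= h h'; rewrite ?lerD// addrC lerD.
Qed.
End PlaneSmooth.

(** * Density of test functions *)

Section PlaneInduction.
Variable R : realType.

(** A generating pi-system. The whole line is included so that the complement of one factor of a
    rectangle is a proper difference of two rectangles. *)
Definition ray (A : set (measurableTypeR R)) := A = setT \/ exists x, A = `]x, +oo[%classic.

Lemma ray_measurable (A : set (measurableTypeR R)) : ray A -> measurable A.
Proof. by case=> [->|[x ->]] //; exact: measurable_itv. Qed.

Lemma rayI : setI_closed ray.
Proof.
move=> A B [->|[x ->]] [->|[y ->]]; rewrite ?setTI ?setIT; first by left.
- by right; exists y.
- by right; exists x.
- right; exists (Order.max x y); apply/seteqP; split=> z /=; rewrite !in_itv/= !andbT gt_max.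
    by move=> [-> ->].
  by move=> /andP[].
Qed.

Lemma measurable_ray : @measurable _ (measurableTypeR R) = <<s ray >>.
Proof.
apply/seteqP; split.
  have -> : @measurable _ (measurableTypeR R) = <<s (@RGenOInfty.G R) >>.
    exact: RGenOInfty.measurableE.
  by apply: sub_sigma_algebra2 => A [x ->]; right; exists x.
apply: smallest_sub; first exact: sigma_algebra_measurable.
exact: ray_measurable.
Qed.

(** Dynkin's theorem is applied in the first variable, in the second, and finally to the pi-system
    of measurable rectangles. Complements are replaced by proper differences, which suit properties
    of the indicator of S. *)
Lemma plane_dynkin (P : set (plane R) -> Prop) :
  (forall A B, ray A -> ray B -> P (A `*` B)) ->
  (forall S S', measurable S -> measurable S' -> S `<=` S' -> P S -> P S' -> P (S' `\` S)) ->
  (forall F : (set (plane R))^nat, (forall n, measurable (F n)) -> trivIset setT F ->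
     (forall n, P (F n)) -> P (\bigcup_k F k)) ->
  forall S, measurable S -> P S.
Proof.
move=> P0 PD PU.
have step1 A B : measurable A -> ray B -> P (A `*` B).
  move=> + rB; rewrite measurable_ray.
  have mB := ray_measurable rB.
  apply: (dynkin_induction (P := fun A => P (A `*` B)) measurable_ray rayI).
  - by apply: P0 => //; left.
  - by move=> A' rA'; exact: P0.
  - move=> A' mA' PA'.
    have -> : ~` A' `*` B = (setT `*` B) `\` (A' `*` B).
      apply/seteqP; split=> -[x y] /= [h1 h2]; first by split=> // -[].
      by split; [move=> h; apply: h2; split=> //; case: h1|case: h1].
    apply: PD => //; [exact: measurableX|exact: measurableX| |].
      by move=> [x y] /= [_ ?].
    by apply: P0 => //; left.
  - move=> F mF tF PF.
    rewrite (_ : _ `*` B = \bigcup_k (F k `*` B)); last first.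
      apply/seteqP; split=> -[x y] /=; first by move=> [[k _ h] h2]; exists k.
      by move=> [k _ /= [h h2]]; split=> //; exists k.
    apply: PU => //.
      by move=> k; exact: measurableX.
    apply/trivIsetP => i j _ _ ij; move/trivIsetP : tF => /(_ i j I I ij) e.
    apply/seteqP; split=> // -[x y] /= [[h1 _] [h2 _]].
    by have : (F i `&` F j) x by []; rewrite e.
have step2 A B : measurable A -> measurable B -> P (A `*` B).
  move=> mA; rewrite measurable_ray.
  apply: (dynkin_induction (P := fun B => P (A `*` B)) measurable_ray rayI).
  - by apply: step1 => //; left.
  - by move=> A' rA'; exact: step1.
  - move=> B' mB' PB'.
    have -> : A `*` ~` B' = (A `*` setT) `\` (A `*` B').
      apply/seteqP; split=> -[x y] /= [h1 h2]; first by split=> // -[].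
      by split; [case: h1|move=> h; apply: h2; split=> //; case: h1].
    apply: PD => //; [exact: measurableX|exact: measurableX| |].
      by move=> [x y] /= [? _].
    by apply: step1 => //; left.
  - move=> F mF tF PF.
    rewrite (_ : A `*` _ = \bigcup_k (A `*` F k)); last first.
      apply/seteqP; split=> -[x y] /=; first by move=> [h2 [k _ h]]; exists k.
      by move=> [k _ /= [h h2]]; split=> //; exists k.
    apply: PU => //.
      by move=> k; exact: measurableX.
    apply/trivIsetP => i j _ _ ij; move/trivIsetP : tF => /(_ i j I I ij) e.
    apply/seteqP; split=> // -[x y] /= [[_ h1] [_ h2]].
    by have : (F i `&` F j) y by []; rewrite e.
pose G2 := [set A `*` B | A in (@measurable _ (measurableTypeR R)) & B in (@measurable _ (measurableTypeR R))].
have mE : @measurable _ (plane R) = <<s G2 >> by exact: measurable_prod_measurableType.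
move=> S; rewrite mE.
apply: (dynkin_induction (P := P) mE).
- move=> _ _ [A mA [B mB <-]] [A' mA' [B' mB' <-]].
  exists (A `&` A'); first exact: measurableI.
  by exists (B `&` B'); [exact: measurableI|rewrite setXI].
- by rewrite -setXTT; apply: step2.
- by move=> _ [A mA [B mB <-]]; exact: step2.
- move=> S' mS' PS'; rewrite -setTD; apply: PD => //.
  by rewrite -setXTT; apply: step2.
- exact: PU.
Qed.

End PlaneInduction.

Section Density.
Variable R : realType.
Local Notation leb := (@lebesgue_measure R).
Local Notation L := (@leb2 R).
Local Notation Int f := (Rintegral L setT f).

Definition box (N : R) : set (plane R) := `]-N, N[%classic `*` `]-N, N[%classic.

Lemma boxP N (x : R * R) : box N x <-> `|x.1| < N /\ `|x.2| < N.
Proof. by rewrite /box /= !in_itv/= !ltr_norml; split. Qed.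

Lemma measurable_box N : measurable (box N).
Proof. by apply: measurableX; exact: measurable_itv. Qed.

Lemma Mes_indic (A : set (plane R)) : measurable A -> Mes (\1_A : R * R -> R).
Proof. by move=> mA; apply: measurable_indic. Qed.

Lemma L1_indic_box N : L1 L (\1_(box N) : R * R -> R).
Proof.
apply/integrableP; split; first by apply/measurable_EFinP; apply: Mes_indic; exact: measurable_box.
under eq_integral do rewrite /= ger0_norm//.
rewrite integral_indic//; last exact: measurable_box.
rewrite setIT.
pose J : set (measurableTypeR R) := `]-N, N[%classic.
have LE : L (box N) = (leb J * leb J)%E.
  by apply: product_measure1E; exact: measurable_itv.
change (L (box N) < +oo)%E; rewrite LE /J.
rewrite lebesgue_measure_itv/=; case: ifP => _; last by rewrite mul0e ltry.
by rewrite -EFinB -EFinM ltry.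
Qed.

Lemma L1_box (f : R * R -> R) C N : Mes f -> (forall x, `|f x| <= C) ->
  (forall x, ~ box N x -> f x = 0) -> L1 L f.
Proof.
move=> mf fC fN; apply: (L1_dom (g := fun x => C * \1_(box N) x)) => //.
  by apply: L1Z; exact: L1_indic_box.
move=> x; rewrite indicE; have [h|/negP h] := boolP (x \in box N).
  by rewrite mulr1; exact: fC.
by rewrite fN ?normr0 ?mulr0//; move=> b; apply: h; rewrite inE.
Qed.

Lemma L2_box (f : R * R -> R) C N : Mes f -> (forall x, `|f x| <= C) ->
  (forall x, ~ box N x -> f x = 0) -> L2 L f.
Proof.
move=> mf fC fN; split => //; apply: (@L1_box _ (C ^+ 2) N).
- exact: measurable_funX.
- move=> x; rewrite normrX lerXn2r ?nnegrE//; first exact: le_trans (fC x).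
- by move=> x /fN ->; rewrite expr0n.
Qed.

Definition Cc (a : R -> R) := Cinf a /\ exists r, forall t, r < `|t| -> a t = 0.

Lemma Cc_bounded a : Cc a -> exists C, forall t, `|a t| <= C.
Proof.
move=> [ca [r hr]]; pose r1 := `|r|.
have r0 : - r1 <= r1 by rewrite /r1 ge0_cp.
have cont : {within `[- r1, r1], continuous (fun t => `|a t|)}.
  apply: continuous_subspaceT => t; apply: continuous_comp; first exact: Cinf_cont.
  exact: norm_continuous.
have [c _ hc] := EVT_max r0 cont.
exists `|a c| => t; have [h|h] := leP `|t| r1.
  by apply: hc; rewrite in_itv/= -ler_norml.
by rewrite hr ?normr0// (le_lt_trans _ h)// ler_norm.
Qed.

Lemma Cinf_Mes1 a : Cinf a -> Mes (fun x : R * R => a x.1).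
Proof.
move=> ca; apply: (measurableT_comp (f := a)); last exact: measurable_fst.
by apply: continuous_measurable_fun; exact: Cinf_cont.
Qed.

Lemma Cinf_Mes2 a : Cinf a -> Mes (fun x : R * R => a x.2).
Proof.
move=> ca; apply: (measurableT_comp (f := a)); last exact: measurable_snd.
by apply: continuous_measurable_fun; exact: Cinf_cont.
Qed.

Inductive T0 : (R * R -> R) -> Prop :=
| T01 a b : Cc a -> Cc b -> T0 (fun x => a x.1 * b x.2)
| T0D f g : T0 f -> T0 g -> T0 (fun x => f x + g x).

Lemma T0Z k f : T0 f -> T0 (fun x => k * f x).
Proof.
elim=> {f} [a b [ca [r hr]] cb|f g _ IHf _ IHg].
- rewrite (_ : (fun x => _) = fun x => (k * a x.1) * b x.2); last first.
    by apply/funext => x; rewrite mulrA.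
  apply: (T01 (a := fun t => k * a t)) => //; split.
    by apply: CinfM => //; exact: Cinf_cst.
  by exists r => t /hr ->; rewrite mulr0.
- rewrite (_ : (fun x => _) = fun x => (k * f x) + (k * g x)); last first.
    by apply/funext => x; rewrite mulrDr.
  exact: T0D.
Qed.

Lemma T0_L2 f : T0 f -> L2 L f.
Proof.
elim=> {f} [a b ca cb|f g _ IHf _ IHg]; last exact: L2D.
have [A hA] := Cc_bounded ca; have [B hB] := Cc_bounded cb.
have [ca' [r hr]] := ca; have [cb' [s hs]] := cb.
apply: (@L2_box _ (A * B) (`|r| + `|s| + 1)).
- by apply: measurable_funM; [exact: Cinf_Mes1|exact: Cinf_Mes2].
- by move=> x; rewrite normrM ler_pM.
- move=> x /boxP/not_andP[] /negP; rewrite -leNgt => h.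
    rewrite hr ?mul0r//; apply: lt_le_trans h; have := ler_norm r; have := normr_ge0 s; lra.
  rewrite hs ?mulr0//; apply: lt_le_trans h; have := ler_norm s; have := normr_ge0 r; lra.
Qed.

Lemma Int_sq_tri f g h : L2 L f -> L2 L g -> L2 L h ->
  Int (fun x => (f x - h x) ^+ 2) <=
  2 * Int (fun x => (f x - g x) ^+ 2) + 2 * Int (fun x => (g x - h x) ^+ 2).
Proof.
move=> lf lg lh.
have i1 := L2_sq (L2B lf lg); have i2 := L2_sq (L2B lg lh); have i3 := L2_sq (L2B lf lh).
rewrite -!IntZ// -IntD; [|exact: L1Z..].
apply: Int_le => //; first by apply: L1D; exact: L1Z.
move=> x; rewrite -subr_ge0 [leRHS](_ : _ = (f x - g x - (g x - h x)) ^+ 2); last by ring.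
exact: sqr_ge0.
Qed.

Definition apx f := L2 L f /\ forall e, 0 < e -> exists2 p, T0 p & Int (fun x => (f x - p x) ^+ 2) < e.

Lemma apx_lim f : L2 L f -> (forall e, 0 < e -> exists2 g, apx g & Int (fun x => (f x - g x) ^+ 2) < e) -> apx f.
Proof.
move=> lf H; split => // e e0.
have [g [lg ag] hg] := H (e / 4) ltac:(lra).
have [p tp hp] := ag (e / 4) ltac:(lra).
exists p => //; apply: le_lt_trans (Int_sq_tri lf lg (T0_L2 tp)) _; lra.
Qed.

Lemma apxD f g : apx f -> apx g -> apx (fun x => f x + g x).
Proof.
move=> [lf af] [lg ag]; split; first exact: L2D.
move=> e e0.
have [p tp hp] := af (e / 4) ltac:(lra).
have [q tq hq] := ag (e / 4) ltac:(lra).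
exists (fun x => p x + q x); first exact: T0D.
have lp := T0_L2 tp; have lq := T0_L2 tq.
have i1 := L2_sq (L2B lf lp); have i2 := L2_sq (L2B lg lq).
have i3 := L2_sq (L2B (L2D lf lg) (L2D lp lq)).
apply: (@le_lt_trans _ _ (2 * Int (fun x => (f x - p x) ^+ 2) + 2 * Int (fun x => (g x - q x) ^+ 2))); last by lra.
rewrite -!IntZ// -IntD; [|exact: L1Z..].
apply: Int_le => //; first by apply: L1D; exact: L1Z.
move=> x; rewrite -subr_ge0 [leRHS](_ : _ = (f x - p x - (g x - q x)) ^+ 2); last by ring.
exact: sqr_ge0.
Qed.

Lemma apxZ k f : apx f -> apx (fun x => k * f x).
Proof.
move=> [lf af]; split; first exact: L2Z.
move=> e e0; have k0 : 0 < k ^+ 2 + 1 by have := sqr_ge0 k; lra.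
have [p tp hp] := af (e / (k ^+ 2 + 1)) (divr_gt0 e0 k0).
exists (fun x => k * p x); first exact: T0Z.
have i1 := L2_sq (L2B lf (T0_L2 tp)).
rewrite (@Int_ext _ _ _ L _ (fun x => k ^+ 2 * (f x - p x) ^+ 2)); last by move=> x; ring.
rewrite IntZ//; move: hp; rewrite ltr_pdivlMr// => hp.
apply: le_lt_trans hp; rewrite mulrC ler_wpM2l//; last by rewrite lerDl.
by apply: Int_ge0 => x; exact: sqr_ge0.
Qed.

Lemma apx_ext f g : (forall x, f x = g x) -> apx f -> apx g.
Proof. by move=> /funext ->. Qed.

Lemma apx_dct (f_ : nat -> R * R -> R) (f g : R * R -> R) : (forall n, apx (f_ n)) -> Mes f -> L2 L g ->
  {ae L, forall x, f_ ^~ x @ \oo --> f x} ->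
  (forall x n, `|f_ n x| <= g x) -> (forall x, `|f x| <= g x) -> apx f.
Proof.
move=> af mf lg cv dom domf.
have lf : L2 L f.
  by apply: L2_dom mf lg _ => x; exact: le_trans (domf x) (ler_norm _).
apply: apx_lim => // e e0.
have [_ C] : L1 L (fun=> 0) /\ (fun n => Int (fun x => (f x - f_ n x) ^+ 2)) @ \oo --> Int (fun=> 0).
  apply: (@DCT _ _ _ L (fun n x => (f x - f_ n x) ^+ 2) (fun=> 0) (fun x => 4 * g x ^+ 2)).
  - by move=> n; exact: L1_meas (L2_sq (L2B lf (proj1 (af n)))).
  - exact: measurable_cst.
  - by apply: L1Z; exact: L2_sq.
  - apply: aeS cv => x cx.
    rewrite (_ : 0 = (f x - f x) * (f x - f x)); last by rewrite subrr mul0r.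
    by apply: cvgM; apply: cvgB => //; exact: cvg_cst.
  - apply: aeT => x n; rewrite ger0_norm ?sqr_ge0//.
    have := dom x n; have := domf x; rewrite !ler_norml => /andP[a1 a2] /andP[b1 b2].
    nra.
have e1 : Int (fun=> 0) = 0 by rewrite Rintegral_cst//= ?mul0r.
rewrite e1 in C; move/cvgrPdist_lt : C => /(_ e e0) [N _ /(_ N (leqnn _))] /=.
rewrite sub0r normrN => h; exists (f_ N) => //; apply: le_lt_trans h; exact: ler_norm.
Qed.

Lemma apx_rect (a b c d : R) : apx (fun x : R * R => ((a < x.1 < b) && (c < x.2 < d))%R%:R).
Proof.
pose N := `|a| + `|b| + `|c| + `|d| + 1.
(* The indicator of [box N] dominates all the bump products, so that [apx_dct] applies. *)
have supp x : ~ box N x -> ~~ ((a < x.1 < b) && (c < x.2 < d)).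
  move=> h; apply/negP => /andP[/andP[h1 h2] /andP[h3 h4]]; apply: h; apply/boxP.
  have := ler_norm b; have := ler_norm d; have := ler_norm (- a); have := ler_norm (- c).
  rewrite !normrN !ltr_norml /N.
  have := normr_ge0 a; have := normr_ge0 b; have := normr_ge0 c; have := normr_ge0 d.
  by split; lra.
apply: (@apx_dct (fun n x => bump a b n x.1 * bump c d n x.2) _ (\1_(box N))).
- move=> n; have t : T0 (fun x => bump a b n x.1 * bump c d n x.2).
    apply: T01; (split; first exact: Cinf_bump).
    + exists (`|a| + `|b|) => t ht; apply: bump_supp; apply/negP => /andP[h1 h2].
      move: ht; rewrite ltNge ler_norml => /negP; apply.
      have := ler_norm b; have := ler_norm (- a); have := normr_ge0 a; have := normr_ge0 b.
      rewrite !normrN; lra.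
    + exists (`|c| + `|d|) => t ht; apply: bump_supp; apply/negP => /andP[h1 h2].
      move: ht; rewrite ltNge ler_norml => /negP; apply.
      have := ler_norm d; have := ler_norm (- c); have := normr_ge0 c; have := normr_ge0 d.
      rewrite !normrN; lra.
  split; first exact: T0_L2.
  move=> e e0; exists (fun x => bump a b n x.1 * bump c d n x.2) => //.
  under eq_Rintegral do rewrite subrr expr0n/=.
  by rewrite Rintegral_cst//= mul0r.
- rewrite (_ : (fun x => _) = \1_(`]a, b[%classic `*` `]c, d[%classic)).
    by apply: Mes_indic; apply: measurableX; exact: measurable_itv.
  apply/funext => x; rewrite indicE; congr (_ %:R); congr nat_of_bool.
  by apply/idP/idP; rewrite inE /= !in_itv/= => /andP.
- split; first by apply: Mes_indic; exact: measurable_box.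
  apply: L1_ext (L1_indic_box N) => x.
  by rewrite indicE; case: (_ \in _); rewrite ?expr1n ?expr0n.
- apply: aeT => x; rewrite -mulnb natrM; apply: cvgM; exact: bump_cvg.
- move=> x n; rewrite indicE; have [h|/negP h] := boolP (x \in box N).
    rewrite ger0_norm; first by rewrite mulr_ile1// ?bump_ge0 ?bump_le1.
    by rewrite mulr_ge0// bump_ge0.
  have /supp : ~ box N x by move=> b'; apply: h; rewrite inE.
  rewrite negb_and => /orP[/bump_supp ->|/bump_supp ->]; by rewrite ?mul0r ?mulr0 normr0.
- move=> x; rewrite indicE; have [h|/negP h] := boolP (x \in box N).
    by rewrite ger0_norm// lern1; case: (_ && _).
  have /supp : ~ box N x by move=> b'; apply: h; rewrite inE.
  by move=> /negbTE ->; rewrite normr0.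
Qed.

End Density.

Section Density2.
Variable R : realType.
Local Notation L := (@leb2 R).
Local Notation Int f := (Rintegral L setT f).

Lemma L2_indic_box N : L2 L (\1_(box N) : R * R -> R).
Proof.
split; first by apply: Mes_indic; exact: measurable_box.
apply: L1_ext (L1_indic_box N) => x.
by rewrite indicE; case: (_ \in _); rewrite ?expr1n ?expr0n.
Qed.

Lemma indic01 (A : set (plane R)) x : 0 <= (\1_A x : R) <= 1.
Proof. by rewrite indicE; case: (_ \in _) => /=; rewrite ?ler01 ?lexx. Qed.

Lemma indic_le (A B : set (plane R)) x : A `<=` B -> (\1_A x : R) <= \1_B x.
Proof.
move=> AB; rewrite !indicE; have [/set_mem/AB/mem_set ->//|_] := boolP (x \in A).
by case: (_ \in _).
Qed.

Lemma apx_zero : apx (fun _ : R * R => 0 : R).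
Proof.
have := apxZ 0 (apx_rect (0 : R) 0 0 0).
by apply: apx_ext => x; rewrite mul0r.
Qed.

(** The sets with this property form a Dynkin class containing the rectangles: differences and
    finite unions by linearity, countable disjoint unions by dominated convergence. The box supplies
    the square integrable majorant. *)
Lemma apx_indic N (S : set (plane R)) : measurable S -> apx (\1_(S `&` box N) : R * R -> R).
Proof.
have mb := @measurable_box R N.
move: S; apply: plane_dynkin.
- move=> A B rA rB.
  have E (A' : set (measurableTypeR R)) : ray A' -> exists a, forall t, (A' t /\ - N < t < N) <-> a < t < N.
    case=> [->|[a ->]]; first by exists (- N) => t; split=> [[]|].
    exists (Order.max a (- N)) => t /=; rewrite in_itv/= andbT gt_max.
    split; first by move=> [-> /andP[-> ->]].
    by move=> /andP[/andP[-> ->] ->].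
  have [a ha] := E _ rA; have [b hb] := E _ rB.
  apply: apx_ext (apx_rect a N b N) => x; rewrite indicE; congr (_ %:R); congr nat_of_bool.
  apply/idP/idP.
    move=> /andP[/ha[h1 h2] /hb[h3 h4]]; rewrite inE; split; first by [].
    by split=> /=; rewrite in_itv.
  rewrite inE => -[[/= h1 h2] [/=]]; rewrite !in_itv/= => h3 h4.
  by apply/andP; split; [apply/ha|apply/hb].
- move=> S S' mS mS' SS' aS aS'.
  apply: apx_ext (apxD aS' (apxZ (-1) aS)) => x.
  have E : (x \in (S' `\` S) `&` box N) = (x \in S') && (x \notin S) && (x \in box N).
    by rewrite in_setI in_setD.
  rewrite !indicE E !in_setI; have [h|h] := boolP (x \in S).
    have -> : x \in S' by apply: mem_set; apply: SS'; exact: set_mem.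
    by case: (x \in box N) => /=; ring.
  by rewrite /= mulr0 addr0 andbT.
- move=> F mF tF aF.
  have sumE x n : \sum_(k < n) (\1_(F k `&` box N) x : R) =
      \1_((\bigcup_(k in `I_n) F k) `&` box N) x.
    rewrite indicE; have [|h] := boolP (_ \in _).
      rewrite inE => -[[k /= kn Fk] bx].
      rewrite (bigD1 (Ordinal kn))//= big1 ?addr0.
        by rewrite indicE mem_set.
      move=> i ik; rewrite indicE; case: (boolP (_ \in _)) => //.
      rewrite inE => -[Fi _]; move/trivIsetP : tF => /(_ i k I I) e.
      have : (F i `&` F k) x by [].
      rewrite e// => // /eqP ee; move/negP: ik; apply; apply/eqP/val_inj; exact: ee.
    apply: big1 => i _; rewrite indicE; case: (boolP (_ \in _)) => //.
    rewrite inE => -[Fi bx]; move/negP : h; case; rewrite inE; split => //.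
    by exists (val i) => //=.
  have mU n : measurable (\bigcup_(k in `I_n) F k) by apply: bigcup_measurable => k _.
  apply: (@apx_dct _ (fun n x => \sum_(k < n) (\1_(F k `&` box N) x : R)) _ (\1_(box N))).
  + elim=> [|n IH]; first by apply: apx_ext apx_zero => x; rewrite big_ord0.
    by apply: apx_ext (apxD IH (aF n)) => x; rewrite big_ord_recr.
  + by apply: Mes_indic; apply: measurableI => //; exact: bigcup_measurable.
  + exact: L2_indic_box.
  + apply: aeT => x.
    have [[k _ Fk]|h] := pselect ((\bigcup_k F k) x).
      apply: cvg_near_cst; near=> n; rewrite sumE !indicE !in_setI; congr ((_ && _) %:R).
      rewrite !mem_set//; first by exists k.
      exists k => //=; near: n; exact: nbhs_infty_gt.
    apply: cvg_near_cst; apply: nearW => n; rewrite sumE !indicE !in_setI; congr ((_ && _) %:R).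
    rewrite !memNset// => -[k _ Fk]; apply: h; by exists k.
  + move=> x n; rewrite sumE ger0_norm; first by apply: indic_le => ? [].
    by have /andP[] := indic01 ((\bigcup_(k in `I_n) F k) `&` box N) x.
  + move=> x; rewrite ger0_norm; first by apply: indic_le => ? [].
    by have /andP[] := indic01 ((\bigcup_k F k) `&` box N) x.
Unshelve. all: end_near. Qed.

Lemma apx_unit N (f : R * R -> R) : Mes f -> (forall x, 0 <= f x < 1) ->
  (forall x, ~ box N x -> f x = 0) -> apx f.
Proof.
move=> mf f01 fN.
(* Greedy binary expansion: the digit 2^-(i+1) is added wherever the remainder is at least that
   large, so the remainder stays in [0, 2^-i] and each [g i] is a finite combination of
   indicators. *)
pose g := fix g (i : nat) : R * R -> R := if i is k.+1 then
  fun x => g k x + 2^-1 ^+ k.+1 * \1_([set x : plane R | 2^-1 ^+ k.+1 <= f x - g k x] `&` box N) x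
  else fun=> 0.
have mS (h : R * R -> R) c : Mes h -> measurable [set x : plane R | c <= f x - h x].
  move=> mh; rewrite -[X in measurable X]setTI.
  rewrite (_ : [set x | _] = (fun x => f x - h x) @^-1` `[c, +oo[%classic).
    exact: (measurable_funB mf mh).
  by apply/seteqP; split=> x /=; rewrite in_itv/= andbT.
have ag i : apx (g i).
  elim: i => [|i IH]; first exact: apx_zero.
  apply: apxD => //; apply: apxZ; apply: apx_indic; apply: mS.
  by have [[]] := IH.
have g0 x i : 0 <= g i x.
  elim: i => [|i IH]; first by [].
  have /andP[q _] := indic01 ([set x : plane R | 2^-1 ^+ i.+1 <= f x - g i x] `&` box N) x.
  by apply: addr_ge0 => //; apply: mulr_ge0 => //; apply: exprn_ge0; rewrite invr_ge0.
have inv i x : 0 <= f x - g i x <= 2^-1 ^+ i.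
  elim: i => [|i /andP[h1 h2]]; first by rewrite subr0 expr0; have /andP[-> /ltW] := f01 x.
  rewrite /= indicE; have e0 : 0 < 2^-1 ^+ i :> R by rewrite exprn_gt0.
  rewrite exprS; have [h|h] := boolP (_ \in _).
    move: h; rewrite inE => -[/= h _]; rewrite mulr1; move: h; lra.
  rewrite mulr0 addr0 h1/=.
  have [bx|nb] := pselect (box N x); last first.
    have := fN x nb; have := g0 x i; move: h1; lra.
  rewrite leNgt; apply/negP => h'; move/negP : h; apply; rewrite inE; split => //=.
  by rewrite ltW.
apply: (@apx_dct _ g f (\1_(box N))) => //; first exact: L2_indic_box.
- apply: aeT => x; apply/cvgrPdist_le => e e0.
  have C : (fun n : nat => (2^-1 : R) ^+ n) @ \oo --> (0 : R).
    by apply: cvg_expr; rewrite ger0_norm// invf_lt1// ltr1n.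
  move/cvgrPdist_le : C => /(_ e e0); apply: filterS => n.
  rewrite sub0r normrN; have /andP[h1 h2] := inv n x.
  by rewrite (ger0_norm h1) => h; apply: le_trans h2 (le_trans (ler_norm _) h).
- move=> x n; rewrite ger0_norm//; have /andP[h _] := inv n x.
  rewrite subr_ge0 in h; apply: le_trans h _; rewrite indicE.
  have [_|/negP nb] := boolP (_ \in _); first by have /andP[_ /ltW] := f01 x.
  by rewrite fN// => bx; apply: nb; rewrite inE.
- move=> x; have /andP[h0 h1] := f01 x; rewrite ger0_norm// indicE.
  have [_|/negP nb] := boolP (_ \in _); first exact: ltW.
  by rewrite fN// => bx; apply: nb; rewrite inE.
Qed.

Lemma apx_bounded N C (f : R * R -> R) : Mes f -> (forall x, `|f x| <= C) ->
  (forall x, ~ box N x -> f x = 0) -> apx f.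
Proof.
move=> mf fC fN.
have C0 : 0 <= C by apply: le_trans (fC (0, 0)).
have k0 : 0 < 2 * C + 1 by lra.
have ab : apx (\1_(box N) : R * R -> R).
  by have := @apx_indic N setT measurableT; rewrite setTI.
pose h x := (2 * C + 1)^-1 * (f x + C * \1_(box N) x).
have ah : apx h.
  apply: (@apx_unit N).
  - apply: measurable_funM => //; apply: measurable_funD => //.
    by apply: measurable_funM => //; apply: Mes_indic; exact: measurable_box.
  - move=> x; rewrite /h mulrC ler_pdivlMr// ltr_pdivrMr// mul0r mul1r.
    rewrite indicE; have [_|/negP nb] := boolP (_ \in _).
      have := fC x; rewrite ler_norml mulr1; lra.
    rewrite mulr0 fN; first by lra.
    by move=> bx; apply: nb; rewrite inE.
  - by move=> x nb; rewrite /h fN// indicE memNset// mulr0 addr0 mulr0.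
apply: apx_ext (apxD (apxZ (2 * C + 1) ah) (apxZ (- C) ab)) => x.
by rewrite /h mulrA mulfV ?gt_eqF// mul1r mulNr addrK.
Qed.

Lemma apx_L2 (f : R * R -> R) : L2 L f -> apx f.
Proof.
move=> lf; have mf := L2_meas lf.
pose T (n : nat) : set (plane R) := [set x : plane R | `|f x| <= n%:R] `&` box n%:R.
have mT n : measurable (T n).
  apply: measurableI; last exact: measurable_box.
  rewrite -[X in measurable X]setTI.
  rewrite (_ : [set x | _] = (fun x => `|f x|) @^-1` `]-oo, n%:R]%classic).
    have : Mes (fun x : R * R => `|f x|) by exact: measurableT_comp.
    by apply.
  by apply/seteqP; split=> x /=; rewrite in_itv.
apply: (@apx_dct _ (fun n x => \1_(T n) x * f x) f (fun x => `|f x|)) => //.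
- move=> n; apply: (@apx_bounded n%:R n%:R).
  + by apply: measurable_funM => //; exact: Mes_indic.
  + move=> x; rewrite indicE; have [|_] := boolP (_ \in _); last by rewrite mul0r normr0.
    by rewrite inE mul1r => -[].
  + by move=> x nb; rewrite indicE memNset ?mul0r// => -[].
- refine (@L2_dom _ _ _ L (fun x => `|f x|) f _ lf _); first exact: measurableT_comp.
  by move=> x; rewrite normr_id.
- apply: aeT => x; apply: cvg_near_cst; near=> n.
  rewrite indicE mem_set ?mul1r//; split => /=.
    by near: n; exact: nbhs_infty_ger.
  apply/boxP; split; near: n; exact: nbhs_infty_gtr.
- move=> x n; rewrite normrM ler_piMl//.
  by have /andP[h1 h2] := indic01 (T n) x; rewrite ger0_norm.
Unshelve. all: end_near. Qed.

End Density2.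

Section MeanValue.
Variable R : realType.

Lemma MVT_all (f f' : R -> R) (a b : R) : (forall x : R, is_derive x 1 f (f' x)) ->
  exists2 c, `|c - a| <= `|b - a| & f b - f a = f' c * (b - a).
Proof.
move=> df; have cf : continuous f by exact: is_derive_cont df.
have [ab|ba|->] := ltgtP a b.
- have [c /[!in_itv]/= /andP[ac cb] e] := @MVT R f f' a b ab (fun x _ => df x) (continuous_subspaceT cf).
  by exists c => //; rewrite !ger0_norm ?subr_ge0 ?lerD2r// ltW.
- have [c /[!in_itv]/= /andP[ac cb] e] := @MVT R f f' b a ba (fun x _ => df x) (continuous_subspaceT cf).
  exists c; first by rewrite !ler0_norm ?subr_le0 ?lerN2 ?lerD2r// ltW.
  by rewrite -opprB e -mulrN opprB.
- by exists b; rewrite ?subrr ?normr0// mulr0.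
Qed.

Lemma taylor1 (f f' f'' : R -> R) C (x h : R) : (forall x : R, is_derive x 1 f (f' x)) ->
  (forall x : R, is_derive x 1 f' (f'' x)) -> (forall x, `|f'' x| <= C) ->
  `|f (x + h) - f x - h * f' x| <= C * h ^+ 2.
Proof.
move=> df df' fC; have C0 : 0 <= C by apply: le_trans (fC 0).
have [c] := MVT_all x (x + h) df; rewrite addrAC subrr add0r => hc ->.
have [d hd e] := MVT_all x c df'.
have -> : f' c * h - h * f' x = h * (f' c - f' x) by ring.
rewrite e !normrM -(real_normK (num_real h)) expr2 mulrCA.
by rewrite ler_pM// ?mulr_ge0// ler_wpM2l.
Qed.
End MeanValue.

(** * Weak derivatives and translations *)

Section TranslationBound.
Variable R : realType.
Local Notation L := (@leb2 R).
Local Notation Int f := (Rintegral L setT f).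
Local Notation comp := Defs.comp.

Definition weak (j : bool) (w G : R * R -> R) := forall phi, test_fun phi ->
  Int (fun x => w x * ('D_(dir R j) phi) x) = - Int (fun x => G x * phi x).

Lemma Cc_derive (a : R -> R) : Cc a -> exists2 a', (forall x : R, is_derive x 1 a (a' x)) & Cc a'.
Proof.
move=> [ca [r hr]]; have [a' da ca'] := Cinf_derive ca.
exists a' => //; split => //; exists r => t rt.
have [_ <-] := da t.
rewrite (near_eq_derive (g := cst 0)); first exact: derive_cst.
near=> s; rewrite hr//; near: s.
have : (fun s : R => `|s|) @ t --> `|t| by exact: norm_continuous.
move/cvgr_gt; exact.
Unshelve. all: end_near. Qed.

Lemma Cc_shift (a : R -> R) (t : R) : Cc a -> Cc (fun x => a (x - t)).
Proof.
move=> [ca [r hr]]; split.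
  apply: (Cinf_comp ca (g := fun x => x - t)); apply: CinfD; [exact: Cinf_id|exact: Cinf_cst].
exists (r + `|t|) => x h; apply: hr.
have := ler_normD (x - t) t; rewrite subrK; lra.
Qed.

Lemma Cc_test j (a b : R -> R) : Cc a -> Cc b -> test_fun (tens j a b).
Proof.
move=> [ca [r hr]] [cb [s hs]]; apply: (@test_tens _ _ _ _ (`|r| + `|s|)) => // t ht.
  by apply: hr; apply: le_lt_trans ht; have := ler_norm r; have := normr_ge0 s; lra.
by apply: hs; apply: le_lt_trans ht; have := ler_norm s; have := normr_ge0 r; lra.
Qed.

Lemma comp_meas j : Mes (fun x : R * R => comp j x).
Proof. by case: j; [exact: measurable_fst|exact: measurable_snd]. Qed.

Lemma tens_meas j (a b : R -> R) : continuous a -> continuous b -> Mes (tens j a b).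
Proof.
move=> ca cb; apply: measurable_funM.
- apply: (measurableT_comp (f := a)); last exact: comp_meas.
  exact: continuous_measurable_fun.
- apply: (measurableT_comp (f := b)); last exact: comp_meas.
  exact: continuous_measurable_fun.
Qed.

Lemma boxP' N j (x : R * R) : box N x <-> `|comp j x| < N /\ `|comp (~~ j) x| < N.
Proof. by rewrite boxP; case: j => /=; split=> -[]. Qed.

Lemma tens_L2 j (a b : R -> R) : Cc a -> Cc b -> L2 L (tens j a b).
Proof.
move=> ca cb; case: j; first by apply: T0_L2; exact: T01.
apply: (@L2_ext _ _ _ L (fun x => b x.1 * a x.2)); first by move=> x; rewrite mulrC.
by apply: T0_L2; exact: T01.
Qed.

(** Moving the test function by t differentiates it along - e_j under the integral, and the
    definition of the weak derivative moves that derivative onto w. The remainder is quadratic in h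
    because [a] has a bounded second derivative. *)
Lemma tens_trans_derive j (w G : R * R -> R) (a b : R -> R) (t : R) : L2 L w -> L2 L G -> weak j w G ->
  Cc a -> Cc b ->
  is_derive t 1 (fun t : R => Int (fun x => w x * tens j a b (x + (- t) *: dir R j)))
    (Int (fun x => G x * tens j a b (x + (- t) *: dir R j))).
Proof.
move=> lw lG wG ca cb.
have [a' da ca'] := Cc_derive ca; have [a'' da' ca''] := Cc_derive ca'.
have [C hC] := Cc_bounded ca''; have [B hB] := Cc_bounded cb.
have E (c : R -> R) s x : tens j c b (x + (- s) *: dir R j) = tens j (fun u => c (u - s)) b x.
  by rewrite dirE /tens; case: j {wG} => /=; rewrite addr0.
have wk : Int (fun x => w x * tens j (fun u => a' (u - t)) b x) = - Int (fun x => G x * tens j (fun u => a (u - t)) b x).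
  rewrite -(wG _ (Cc_test j (Cc_shift t ca) cb)); apply: Int_ext => x; congr (_ * _).
  have da2 : is_derive (comp j x) 1 (fun u => a (u - t)) (a' (comp j x - t)).
    have := is_derive_comp (g := fun u : R => u - t) (da (comp j x - t)) (is_deriveB (is_derive_id (comp j x) (1 : R)) (is_derive_cst t _ _)).
    by move/is_derive_eq; apply; rewrite subr0 mulr1.
  by have [_ ->] := @tens_derive _ j _ b (fun u => a' (u - t)) x da2.
have [_ [r hr]] := ca; have [_ [r' hr']] := ca'; have [_ [s hs]] := cb.
(* For |h| < 1 this box contains the supports of the functions shifted by t and by h + t. *)
pose N := `|r| + `|r'| + `|s| + `|t| + 2.
pose K := Int (fun x => `|w x| * \1_(box N) x).
have lwa : L2 L (fun x => `|w x|).
  by refine (@L2_dom _ _ _ L (fun x => `|w x|) w _ lw _); [by apply: measurableT_comp => //; exact: (L2_meas lw)|by move=> x; rewrite normr_id].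
have iK := L2_mul lwa (L2_indic_box N).
apply: (@is_derive_quad _ _ _ _ (C * B * K) 1) => // h h1.
set f := fun x => w x * (tens j (fun u => a (u - (h + t)) - a (u - t) + h * a' (u - t)) b x).
have lt1 := L2_mul lw (tens_L2 j (Cc_shift (h + t) ca) cb).
have lt2 := L2_mul lw (tens_L2 j (Cc_shift t ca) cb).
have lt3 := L2_mul lw (tens_L2 j (Cc_shift t ca') cb).
have lf : L1 L f.
  apply: (L1_ext _ (L1D (L1B lt1 lt2) (L1Z h lt3))) => x.
  by rewrite /f /tens; ring.
have -> : Int (fun x => w x * tens j a b (x + - (h + t) *: dir R j)) -
   Int (fun x => w x * tens j a b (x + - t *: dir R j)) -
   h * Int (fun x => G x * tens j a b (x + - t *: dir R j)) = Int f.
  rewrite (@Int_ext _ _ _ L f (fun x => (w x * tens j (fun u => a (u - (h + t))) b x - w x * tens j (fun u => a (u - t)) b x)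
     + h * (w x * tens j (fun u => a' (u - t)) b x))); last by move=> x; rewrite /f /tens; ring.
  rewrite IntD ?IntB ?IntZ//; [|exact: L1B|exact: L1Z].
  rewrite wk mulrN; congr (_ - _ - _ * _); by apply: Int_ext => x; rewrite E.
apply: le_trans (Int_norm lf) _.
rewrite mulrAC /K -IntZ//.
apply: Int_le; [exact: L1_abs|exact: L1Z|].
move=> x; rewrite /f normrM mulrCA ler_wpM2l//.
rewrite indicE; have [xb|nb] := boolP (_ \in _).
  rewrite mulr1 /tens normrM mulrAC ler_pM//.
  have := taylor1 (comp j x - t) (- h) da da' hC.
  have -> : comp j x - (h + t) = comp j x - t - h by ring.
  by rewrite sqrrN mulNr opprK.
have {}nb : ~ box N x by move=> bx; move/negP : nb; apply; rewrite inE.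
have C0 : 0 <= C by apply: le_trans (hC 0).
have B0 : 0 <= B by apply: le_trans (hB 0).
rewrite mulr0; move/(boxP' N j)/not_andP : nb => [] /negP; rewrite -leNgt /N => nb.
  rewrite /tens !hr ?hr' ?subrr ?mulr0 ?add0r ?mul0r ?normr0//.
  - have := ler_normD (comp j x - t) t; rewrite subrK; have := ler_norm r'; have := normr_ge0 r; have := normr_ge0 s; lra.
  - have := ler_normD (comp j x - t) t; rewrite subrK; have := ler_norm r; have := normr_ge0 r'; have := normr_ge0 s; lra.
  - have := ler_normD (comp j x - (h + t)) (h + t); rewrite subrK; have := ler_normD h t; have := ler_norm r; have := normr_ge0 r'; have := normr_ge0 s; lra.
rewrite /tens (hs (comp (~~ j) x)) ?mulr0 ?normr0//.
have := ler_norm s; have := normr_ge0 r; have := normr_ge0 r'; have := normr_ge0 t; lra.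
Qed.

Lemma T0_trans_derive j (w G f : R * R -> R) (t : R) : L2 L w -> L2 L G -> weak j w G -> T0 f ->
  is_derive t 1 (fun t : R => Int (fun x => w x * f (x + (- t) *: dir R j)))
    (Int (fun x => G x * f (x + (- t) *: dir R j))).
Proof.
move=> lw lG wG; elim=> {f} [a b ca cb|f g tf IHf tg IHg].
  case: j wG => wG; first exact: (tens_trans_derive t lw lG wG ca cb).
  have := (tens_trans_derive t lw lG wG cb ca).
  have E : tens false b a = fun x => a x.1 * b x.2 by apply/funext => x; rewrite /tens /= mulrC.
  by rewrite E.
have split (v : R * R -> R) s : L2 L v -> Int (fun x => v x * (f (x + (- s) *: dir R j) + g (x + (- s) *: dir R j))) =
   Int (fun x => v x * f (x + (- s) *: dir R j)) + Int (fun x => v x * g (x + (- s) *: dir R j)).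
  move=> lv; rewrite -IntD; first by apply: Int_ext => x; rewrite mulrDr.
    by apply: L2_mul => //; apply: L2_shift; exact: T0_L2.
  by apply: L2_mul => //; apply: L2_shift; exact: T0_L2.
rewrite split//.
rewrite (_ : (fun t0 : R => _) = (fun t : R => Int (fun x => w x * f (x + (- t) *: dir R j)) + Int (fun x => w x * g (x + (- t) *: dir R j)))).
  exact: is_deriveD.
by apply/funext => s; rewrite split.
Qed.

(** Duality: for a test function f, the mean value theorem in the shift gives int F f = s int G f(.
    - c e_j) for some c, hence 2 int F f <= s^2 int G^2 + int f^2. Letting f approach F in L^2
    leaves the bound with its sharp constant. *)
Lemma weak_translation j (w G : R * R -> R) (s : R) : L2 L w -> L2 L G -> weak j w G -> 0 < s ->
  Int (fun x => (w (x + s *: dir R j) - w x) ^+ 2) <= s ^+ 2 * Int (fun x => G x ^+ 2).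
Proof.
move=> lw lG wG s0.
pose F x := w (x + s *: dir R j) - w x.
have lF : L2 L F by apply: L2B => //; exact: L2_shift.
have key f : T0 f -> 2 * Int (fun x => F x * f x) <= s ^+ 2 * Int (fun x => G x ^+ 2) + Int (fun x => f x ^+ 2).
  move=> tf; have lf := T0_L2 tf.
  have [c _] := MVT_all 0 s (fun t => T0_trans_derive t lw lG wG tf).
  rewrite oppr0 scale0r addr0.
  have -> : Int (fun x => w x * f (x + - s *: dir R j)) - Int (fun x => w x * f (x + 0)) = Int (fun x => F x * f x).
    rewrite -(@Int_shift _ (fun x => w x * f (x + - s *: dir R j)) (s *: dir R j)); last first.
      by apply: L2_mul => //; exact: L2_shift.
    rewrite -IntB.
    - by apply: Int_ext => x; rewrite -addrA scaleNr subrr !addr0 /F mulrBl.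
    - apply: (L1_ext _ (L2_mul (L2_shift (s *: dir R j) lw) lf)) => x.
      by rewrite -addrA scaleNr subrr addr0.
    - by apply: (L1_ext _ (L2_mul lw lf)) => x; rewrite addr0.
  move=> ->.
  have lfc : L2 L (fun x => f (x + - c *: dir R j)) by exact: L2_shift.
  rewrite -(Int_shift (- c *: dir R j) (L2_sq lf)).
  rewrite [X in 2 * X](_ : _ = Int (fun x => s * (G x * f (x + - c *: dir R j)))); last first.
    by rewrite IntZ; [rewrite mulrC|exact: L2_mul].
  have i1 := L1Z s (L2_mul lG lfc); have i2 := L1Z (s ^+ 2) (L2_sq lG).
  have i3 := L2_sq lfc.
  rewrite -(IntZ 2 i1) -(IntZ (s ^+ 2) (L2_sq lG)) -(IntD i2 i3).
  apply: Int_le; [exact: L1Z|exact: L1D|].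
  by move=> x; have := sqr_ge0 (s * G x - f (x + - c *: dir R j)); nra.
have [_ ap] := apx_L2 lF.
rewrite -/(F _); apply/ler_addgt0Pr => e e0.
have [p tp hp] := ap e e0; have lp := T0_L2 tp.
have := key p tp.
have E : Int (fun x => (F x - p x) ^+ 2) = Int (fun x => F x ^+ 2) - 2 * Int (fun x => F x * p x) + Int (fun x => p x ^+ 2).
  have i1 := L2_sq lF; have i2 := L2_sq lp; have i3 := L2_mul lF lp.
  rewrite -IntZ// -IntB//; last exact: L1Z.
  rewrite -IntD//; first by apply: Int_ext => x; ring.
  by apply: L1B => //; exact: L1Z.
move: hp; rewrite E /F; lra.
Qed.
End TranslationBound.

(** * Picone's identity *)

Section SecondDifference.
Variable R : realType.
Local Notation L := (@leb2 R).
Local Notation Int f := (Rintegral L setT f).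

Definition dif2 (j : bool) (p : R * R -> R) (s : R) (x : R * R) : R :=
  p (x + s *: dir R j) + p (x + (- s) *: dir R j) - 2 * p x.

(** All the regularity that Picone's identity asks of z, stated off a null set. The steps are S / (n
    + 1) so that n + 1 of them add up to the displacement S in [picone_rigid]. *)
Definition SDiff (j : bool) (p Z : R * R -> R) (C : R) :=
  [/\ Mes p, Mes Z,
   forall (s : R) (x : R * R), 0 < s <= 1 -> off j x -> `|dif2 j p s x| <= C * s ^+ 2 &
   forall (S : R) (x : R * R), 0 < S <= 1 -> off j x ->
     (fun n : nat => dif2 j p (S / n.+1%:R) x / (S / n.+1%:R) ^+ 2) @ \oo --> Z x].

Lemma dif2_mean (f f' : R -> R) (l s : R) : 0 < s -> (forall x : R, is_derive x 1 f (f' x)) ->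
  exists2 c, 0 < c < s & (f s + f (- s) - 2 * f 0) / s ^+ 2 = (f' c - f' (- c)) / (2 * c).
Proof.
move=> s0 df.
pose k := f s + f (- s) - 2 * f 0.
(* Rolle's theorem applies because psi takes the value 2 f(0) s^2 both at 0 and at s. *)
pose psi (t : R) := (f t + f (- t)) * s ^+ 2 - k * t ^+ 2.
have dpsi (t : R) : is_derive t 1 psi ((f' t - f' (- t)) * s ^+ 2 - k * (2 * t)).
  have dN : is_derive t 1 (fun t : R => - t) (- 1) by exact: is_deriveN.
  have d1 : is_derive t 1 (fun t : R => f (- t)) (f' (- t) * - 1).
    exact: (is_derive_comp (g := fun t : R => - t) (df (- t)) dN).
  have d2 := is_deriveM (is_deriveD (df t) d1) (is_derive_cst (s ^+ 2) t (1 : R)).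
  have d3 := is_deriveM (is_derive_cst k t (1 : R)) (is_deriveM (is_derive_id t (1 : R)) (is_derive_id t (1 : R))).
  refine (is_derive_eq (is_deriveB d2 d3) _).
  by rewrite /GRing.scale/=; ring.
have cpsi : continuous psi by exact: is_derive_cont dpsi.
have [c cs d] := @Rolle R psi 0 s s0 (fun x _ => ex_derive (is_derive := dpsi x)) (continuous_subspaceT cpsi) ltac:(by rewrite /psi /k oppr0; ring).
have {}d := @derive_val _ _ _ _ _ _ _ d.
move: cs; rewrite in_itv/= => /andP[c0 cs]; exists c; first by rewrite c0.
have := dpsi c => -[_]; rewrite d -/k => /esym/eqP; rewrite subr_eq0 => /eqP e.
have s2 : s ^+ 2 != 0 by rewrite expf_neq0// gt_eqF.
have c2 : 2 * c != 0 by rewrite mulf_neq0// gt_eqF.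
by apply/eqP; rewrite eqr_div//; apply/eqP/esym.
Qed.

Lemma dif2_cvg (f f' : R -> R) (l S : R) : 0 < S -> (forall x : R, is_derive x 1 f (f' x)) ->
  is_derive (0 : R) 1 f' l ->
  (fun n : nat => (f (S / n.+1%:R) + f (- (S / n.+1%:R)) - 2 * f 0) / (S / n.+1%:R) ^+ 2) @ \oo --> l.
Proof.
move=> S0 df [dl el]; apply/cvgrPdist_le => e e0.
have L1 : (fun h : R => h^-1 *: (f' (h *: (1 : R) + 0) - f' 0)) @ (0 : R)^' --> l.
  by rewrite -el; exact: dl.
move/cvgrPdist_le : L1 => /(_ e e0) [d /= d0 hd].
have sn0 n : 0 < S / n.+1%:R by rewrite divr_gt0.
have C : (fun n : nat => S / n.+1%:R) @ \oo --> (0 : R).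
  by rewrite -(mulr0 S); apply: cvgMr; exact: cvg_harmonic.
move/cvgrPdist_lt : C => /(_ d d0); apply: filterS => n /=.
rewrite sub0r normrN gtr0_norm// => nd.
have [c /andP[c0 cs] ->] := dif2_mean 0 (sn0 n) df.
have q (h : R) : h != 0 -> `|h| < d -> `|l - h^-1 * (f' h - f' 0)| <= e.
  move=> h0 hd'; have := hd h; rewrite /= sub0r normrN => /(_ hd' h0).
  rewrite (_ : h *: (1 : R) + 0 = h)//.
  by rewrite addr0; exact: mulr1.
have q1 := q c (negbT (gt_eqF c0)) ltac:(by rewrite gtr0_norm// (lt_trans cs)).
have q2 := q (- c) ltac:(by rewrite oppr_eq0 gt_eqF) ltac:(by rewrite normrN gtr0_norm// (lt_trans cs)).
have -> : l - (f' c - f' (- c)) / (2 * c) = 2^-1 * ((l - c^-1 * (f' c - f' 0)) + (l - (- c)^-1 * (f' (- c) - f' 0))).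
  by rewrite invrN; field; rewrite gt_eqF.
rewrite normrM ger0_norm//; have := ler_normD (l - c^-1 * (f' c - f' 0)) (l - (- c)^-1 * (f' (- c) - f' 0)); lra.
Qed.

Lemma SDiff_derive j (p p1 p2 : R * R -> R) C : Mes p -> Mes p2 ->
  (forall x, off j x -> is_derive x (dir R j) p (p1 x)) ->
  (forall x, off j x -> is_derive x (dir R j) p1 (p2 x)) ->
  (forall x, off j x -> `|p2 x| <= C) -> SDiff j p p2 (2 * C).
Proof.
move=> mp mp2 d1 d2 pC.
have l1 x : off j x -> forall t : R, is_derive t 1 (fun h : R => p (x + h *: dir R j)) (p1 (x + t *: dir R j)).
  by move=> ox t; apply/line_derive; apply: d1; rewrite off_shift.
have l2 x : off j x -> forall t : R, is_derive t 1 (fun h : R => p1 (x + h *: dir R j)) (p2 (x + t *: dir R j)).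
  by move=> ox t; apply/line_derive; apply: d2; rewrite off_shift.
split => //.
- move=> s x /andP[s0 s1] ox.
  have b t : `|p2 (x + t *: dir R j)| <= C by apply: pC; rewrite off_shift.
  have := taylor1 0 s (l1 x ox) (l2 x ox) b; have := taylor1 0 (- s) (l1 x ox) (l2 x ox) b.
  rewrite !add0r scale0r addr0 sqrrN /dif2 => h1 h2.
  set A := p (x + s *: _) in h2 *; set B := p (x + (- s) *: _) in h1 *.
  rewrite (_ : A + B - 2 * p x = (A - p x - s * p1 x) + (B - p x - - s * p1 x)); last by ring.
  by apply: le_trans (ler_normD _ _) _; lra.
- move=> S x /andP[S0 S1] ox.
  have := @dif2_cvg _ _ (p2 x) S S0 (l1 x ox).
  rewrite /= scale0r addr0; apply.
  by have := l2 x ox 0; rewrite scale0r addr0.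
Qed.

End SecondDifference.

Section Picone.
Variable R : realType.
Local Notation L := (@leb2 R).
Local Notation Int f := (Rintegral L setT f).
Variable j : bool.
Variables (z Z w : R * R -> R) (C eta M : R).
Hypotheses (sd : SDiff j z Z C) (eta0 : 0 < eta) (zeta : forall x, eta <= z x)
  (zM : forall x, z x <= M) (lw : L2 L w).
Local Notation E s := (s *: dir R j).

Let mz : Mes z. Proof. by case: sd. Qed.
Let z0 x : 0 < z x. Proof. exact: lt_le_trans (zeta x). Qed.
Let zn x : z x != 0. Proof. by rewrite gt_eqF. Qed.

Definition picrest (s : R) (x : R * R) := z x * z (x + E s) * (w (x + E s) / z (x + E s) - w x / z x) ^+ 2.

Let i1 : L1 L (fun x => w x ^+ 2). Proof. exact: L2_sq. Qed.

Let Mes_ratio (s : R) : Mes (fun x => z (x + E s) / z x).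
Proof.
apply: measurable_funM; first exact: meas_shift.
exact: measurable_funV.
Qed.

Let ratio_bd (s : R) (x : R * R) : `|z (x + E s) / z x| <= M / eta.
Proof.
rewrite ger0_norm; last by rewrite divr_ge0// ltW.
apply: (@le_trans _ _ (M / z x)); first by rewrite ler_wpM2r// invr_ge0 ltW.
by rewrite ler_wpM2l ?lef_pV2 ?posrE// (le_trans (ltW (z0 x))).
Qed.

Let i2 (s : R) : L1 L (fun x => z (x + E s) / z x * w x ^+ 2).
Proof. exact: L1_bdd i1 (Mes_ratio s) (ratio_bd s). Qed.

Let i6E (s : R) : (fun x => - dif2 j z s x / z x * w x ^+ 2) =
  (fun x => 2 * w x ^+ 2 - (z (x + E s) / z x * w x ^+ 2 + z (x + E (- s)) / z x * w x ^+ 2)).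
Proof. by apply/funext => x; rewrite /dif2; field. Qed.

Let i6 (s : R) : L1 L (fun x => - dif2 j z s x / z x * w x ^+ 2).
Proof. by rewrite i6E; apply: L1B; [exact: L1Z|exact: L1D]. Qed.

(* Discrete form of [|grad w|^2 = grad (w^2 / z) . grad z + z^2 |grad (w / z)|^2]; the integration by parts is
   the translation invariance of the measure, so [w] needs no regularity. *)
Lemma picone_identity (s : R) :
  L1 L (picrest s) /\
  Int (fun x => (w (x + E s) - w x) ^+ 2) =
  Int (fun x => - (dif2 j z s x) / z x * w x ^+ 2) + Int (picrest s).
Proof.
have li := L2_shift (E s) lw.
have i3 : L1 L (fun x => z x / z (x + E s) * w (x + E s) ^+ 2).
  apply: (L1_ext _ (L1_shift (E s) (i2 (- s)))) => x.
  by rewrite -addrA scaleNr addrN addr0.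
have e3 : Int (fun x => z x / z (x + E s) * w (x + E s) ^+ 2) = Int (fun x => z (x + E (- s)) / z x * w x ^+ 2).
  rewrite -(Int_shift (E s) (i2 (- s))); apply: Int_ext => x.
  by rewrite -addrA scaleNr addrN addr0.
have i4 := L2_mul lw li; have i5 := L2_sq li.
have e5 : Int (fun x => w (x + E s) ^+ 2) = Int (fun x => w x ^+ 2) := Int_shift (E s) i1.
have pe x : picrest s x = (z x / z (x + E s) * w (x + E s) ^+ 2 + z (x + E s) / z x * w x ^+ 2) - 2 * (w x * w (x + E s)).
  by rewrite /picrest; field; rewrite !zn.
have ip : L1 L (picrest s).
  have -> : picrest s = fun x => (z x / z (x + E s) * w (x + E s) ^+ 2 + z (x + E s) / z x * w x ^+ 2) - 2 * (w x * w (x + E s)).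
    by apply/funext.
  exact: (L1B (L1D i3 (i2 s)) (L1Z 2 i4)).
split=> //.
rewrite (@Int_ext _ _ _ L _ _ pe) (IntB (L1D i3 (i2 s)) (L1Z 2 i4)) (IntD i3 (i2 s)).
rewrite e3.
rewrite (@Int_ext _ _ _ L (fun x => (w (x + E s) - w x) ^+ 2) (fun x => (w (x + E s) ^+ 2 + w x ^+ 2) - 2 * (w x * w (x + E s)))); last by move=> x; ring.
rewrite (IntB (L1D i5 i1) (L1Z 2 i4)) (IntD i5 i1) e5.
rewrite i6E.
rewrite (IntB (L1Z 2 i1) (L1D (i2 s) (i2 (- s)))) (IntD (i2 s) (i2 (- s))) (IntZ 2 i1).
by ring.
Qed.

Lemma picrest_ge0 s x : 0 <= picrest s x.
Proof. by apply: mulr_ge0; [apply: mulr_ge0; exact: ltW|exact: sqr_ge0]. Qed.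

Let mV (h : R * R -> R) : Mes h -> Mes (fun x => h x / z x).
Proof.
move=> mh; apply: measurable_funM => //.
exact: measurable_funV.
Qed.

Lemma picone_limit (S : R) : 0 < S <= 1 ->
  L1 L (fun x => - Z x / z x * w x ^+ 2) /\
  (fun n : nat => (S / n.+1%:R) ^- 2 * Int (fun x => - (dif2 j z (S / n.+1%:R) x) / z x * w x ^+ 2)) @ \oo -->
    Int (fun x => - Z x / z x * w x ^+ 2).
Proof.
move=> S01; have [_ mZ bd cv] := sd.
have C0 : 0 <= C.
  have o : off j ((1, 1) : R * R) by rewrite /off; case: j => /=; exact: oner_neq0.
  have := bd 1 (1, 1); rewrite ltr01 lexx expr1n mulr1 => /(_ isT o); exact: le_trans.
have s01 n : 0 < S / n.+1%:R <= 1.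
  have /andP[h0 h1] := S01; rewrite divr_gt0//= ler_pdivrMr// mul1r (le_trans h1)//.
  by rewrite ler1n.
have mdif s : Mes (dif2 j z s).
  apply: measurable_funB; last by apply: measurable_funM.
  by apply: measurable_funD; exact: meas_shift.
have := @DCT _ _ _ L (fun n x => - (dif2 j z (S / n.+1%:R) x / (S / n.+1%:R) ^+ 2) / z x * w x ^+ 2)
   (fun x => - Z x / z x * w x ^+ 2) (fun x => (C / eta) * w x ^+ 2).
have mw2 : Mes (fun x : R * R => w x ^+ 2) by exact: (L1_meas i1).
case.
- move=> n; apply: measurable_funM => //; apply: mV; apply: measurableT_comp => //.
  by apply: measurable_funM.
- by apply: measurable_funM => //; apply: mV; exact: measurableT_comp.
- exact: L1Z.
- apply: aeS (@ae_off R j) => x ox; apply: cvgM; last exact: cvg_cst.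
  by apply: cvgM; [apply: cvgN; exact: cv|exact: cvg_cst].
- apply: aeS (@ae_off R j) => x ox n.
  have /andP[h0 h1] := s01 n.
  rewrite normrM (ger0_norm (sqr_ge0 (w x))) ler_wpM2r ?sqr_ge0//.
  rewrite normrM normrN normfV (gtr0_norm (z0 x)) normrM normfV (ger0_norm (sqr_ge0 (S / n.+1%:R))).
  apply: ler_pM; rewrite ?divr_ge0 ?sqr_ge0 ?invr_ge0// ?(ltW (z0 x))//.
    by rewrite ler_pdivrMr ?exprn_gt0//; exact: bd.
  by rewrite lef_pV2 ?posrE.
move=> iZ cZ; split => //.
apply: cvg_trans cZ; apply: near_eq_cvg; apply: nearW => n.
rewrite -(IntZ _ (i6 (S / n.+1%:R))).
by apply: Int_ext => x; ring.
Qed.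

Variable K : R.
Hypothesis hK : forall s : R, 0 < s <= 1 -> Int (fun x => (w (x + E s) - w x) ^+ 2) <= s ^+ 2 * K.

Let sub01 (S : R) n : 0 < S <= 1 -> 0 < S / n.+1%:R <= 1.
Proof.
move=> /andP[h0 h1]; rewrite divr_gt0//= ler_pdivrMr// mul1r (le_trans h1)//.
by rewrite ler1n.
Qed.

Lemma picone : Int (fun x => - Z x / z x * w x ^+ 2) <= K.
Proof.
have S01 : 0 < (1 : R) <= 1 by rewrite ltr01 lexx.
have [_ cv] := picone_limit S01.
apply: cvgr_to_le cv _; apply: nearW => n.
have s01 := sub01 n S01; have /andP[s0 _] := s01.
have [ip e] := picone_identity (1 / n.+1%:R).
rewrite [leLHS]mulrC ler_pdivrMr ?exprn_gt0// [leRHS]mulrC; apply: le_trans (hK s01).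
by rewrite e lerDl; apply: Int_ge0 => x; exact: picrest_ge0.
Qed.

Let sum_sq (d : nat -> R) n : (\sum_(k < n) d k) ^+ 2 <= n%:R * \sum_(k < n) d k ^+ 2.
Proof.
elim: n => [|n IH]; first by rewrite !big_ord0 expr0n mulr0.
rewrite !big_ord_recr/=; move: IH; set s := \sum_(_ < n) _; set Q := \sum_(_ < n) _ => IH.
have Q0 : 0 <= Q by apply: sumr_ge0 => i _; exact: sqr_ge0.
rewrite -natr1; case: n @s @Q IH Q0 => [|n] s Q IH Q0.
  by rewrite /s /Q !big_ord0; rewrite !add0r mul1r.
have n0 : 0 < n.+1%:R :> R by [].
move: (n.+1%:R) n0 IH => N N0 IH; rewrite -(ler_pM2l N0).
have := sqr_ge0 (s - N * d n.+1); nra.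
Qed.

(** The displacement S is split into n + 1 steps s. The squared increment of w / z is at most n + 1
    times the sum of the squared small increments, each bounded by [picrest] / m^2, and Picone's
    identity bounds int [picrest] by s^2 K minus the weighted term. The factors combine to S^2 /
    m^2, and n tends to infinity. *)
Lemma picone_rigid (S m : R) (A : set (plane R)) : 0 < S <= 1 -> measurable A -> 0 < m ->
  (forall x : R * R, A x -> forall t, 0 <= t <= S -> m <= z (x + E t)) ->
  L1 L (fun x : R * R => \1_A x * (w (x + E S) / z (x + E S) - w x / z x) ^+ 2) /\
  Int (fun x : R * R => \1_A x * (w (x + E S) / z (x + E S) - w x / z x) ^+ 2) <=
    S ^+ 2 / m ^+ 2 * (K - Int (fun x => - Z x / z x * w x ^+ 2)).
Proof.
move=> S01 mA m0 mz'.
pose g x := w x / z x.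
set f := fun x : R * R => _.
have mg : Mes g by apply: mV; exact: (L2_meas lw).
have mf : Mes f.
  apply: measurable_funM; first exact: Mes_indic.
  apply: measurable_funX; apply: measurable_funB => //.
  exact: (meas_shift (f := g)).
have f0 x : 0 <= f x.
  by rewrite /f mulr_ge0 ?sqr_ge0//; have /andP[] := indic01 A x.
have step n : L1 L f /\ Int f <= S ^+ 2 / m ^+ 2 *
   (K - (S / n.+1%:R) ^- 2 * Int (fun x => - (dif2 j z (S / n.+1%:R) x) / z x * w x ^+ 2)).
  have s01 := sub01 n S01; have /andP[s0 s1] := s01.
  set s := S / n.+1%:R in s01 s0 s1 *.
  have nS : n.+1%:R * s = S by rewrite /s mulrC divfK.
  have [ip e] := picone_identity s.
  pose B (x : R * R) := n.+1%:R / m ^+ 2 * \sum_(k < n.+1) picrest s (x + E (k%:R * s)).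
  have is_ (k : nat) := L1_shift (E (k%:R * s)) ip.
  have IS (k : nat) := Int_shift (E (k%:R * s)) ip.
  have [iB eB] : L1 L B /\ Int B = n.+1%:R / m ^+ 2 * (n.+1%:R * Int (picrest s)).
    have : forall N : nat, L1 L (fun x : R * R => \sum_(k < N) picrest s (x + E (k%:R * s))) /\
       Int (fun x : R * R => \sum_(k < N) picrest s (x + E (k%:R * s))) = N%:R * Int (picrest s).
      elim=> [|N [IH1 IH2]].
        have -> : (fun x : R * R => \sum_(k < 0) picrest s (x + E (k%:R * s))) = (fun=> 0).
          by apply/funext => x; rewrite big_ord0.
        split; first exact: L1_0.
        by rewrite Rintegral_cst//= !mul0r.
      have -> : (fun x : R * R => \sum_(k < N.+1) picrest s (x + E (k%:R * s))) =
          (fun x => (\sum_(k < N) picrest s (x + E (k%:R * s))) + picrest s (x + E (N%:R * s))).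
        by apply/funext => x; rewrite big_ord_recr.
      split; first exact: (L1D IH1 (is_ N)).
      by rewrite (IntD IH1 (is_ N)) IH2 IS -natr1 mulrDl mul1r.
    move=> /(_ n.+1) [h1 h2]; split; first exact: L1Z.
    by rewrite /B (IntZ _ h1) h2.
  have fB x : f x <= B x.
    rewrite /f indicE; have [xA|nA] := boolP (_ \in A); last first.
      rewrite mul0r /B mulr_ge0 ?divr_ge0 ?sqr_ge0//.
      by apply: sumr_ge0 => k _; exact: picrest_ge0.
    rewrite mul1r; move/set_mem : xA => xA.
    have -> : w (x + E S) / z (x + E S) - w x / z x =
        \sum_(k < n.+1) (g (x + E (k.+1%:R * s)) - g (x + E (k%:R * s))).
      rewrite -(big_mkord xpredT (fun k => g (x + E (k.+1%:R * s)) - g (x + E (k%:R * s)))).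
      rewrite telescope_sumr// nS mul0r scale0r addr0//.
    apply: le_trans (sum_sq (fun k => g (x + E (k.+1%:R * s)) - g (x + E (k%:R * s))) n.+1) _.
    rewrite /B -mulrA ler_wpM2l// mulrC ler_pdivlMr ?exprn_gt0//.
    rewrite mulr_suml; apply: ler_sum => k _.
    have e1 : x + E (k%:R * s) + E s = x + E (k.+1%:R * s).
      by rewrite -addrA -scalerDl -natr1 mulrDl mul1r.
    rewrite /picrest e1 -/(g _) -/(g _) mulrC ler_wpM2r ?sqr_ge0//.
    have kS (i : nat) : (i <= n.+1)%N -> 0 <= i%:R * s <= S.
      by move=> hi; rewrite mulr_ge0 ?(ltW s0)//= -nS ler_wpM2r ?(ltW s0)// ler_nat.
    have h1 := mz' _ xA _ (kS k (ltnW (ltn_ord k))).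
    have h2 := mz' _ xA _ (kS k.+1 (ltn_ord k)).
    by rewrite expr2 ler_pM// ltW.
  have jf : L1 L f by apply: L1_dom mf iB _ => x; rewrite ger0_norm.
  split => //; apply: (le_trans (Int_le jf iB fB)).
  have Kp : Int (picrest s) <= s ^+ 2 * K - Int (fun x => - (dif2 j z s x) / z x * w x ^+ 2).
    by have := hK s01; rewrite e; lra.
  rewrite eB -nS; move: Kp; set P := Int (picrest s); set Q := Rintegral _ _ _ => Kp.
  have sn : s != 0 by rewrite gt_eqF.
  have mn : m != 0 by rewrite gt_eqF.
  have -> : (n.+1%:R * s) ^+ 2 / m ^+ 2 * (K - s ^- 2 * Q) = n.+1%:R / m ^+ 2 * (n.+1%:R * (s ^+ 2 * K - Q)).
    by field; rewrite mn sn.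
  by rewrite ler_wpM2l ?divr_ge0 ?sqr_ge0// ler_wpM2l.
have [jf _] := step 0%N; split => //.
have [_ cv] := picone_limit S01.
have cv2 : (fun n : nat => S ^+ 2 / m ^+ 2 *
   (K - (S / n.+1%:R) ^- 2 * Int (fun x => - (dif2 j z (S / n.+1%:R) x) / z x * w x ^+ 2))) @ \oo -->
   S ^+ 2 / m ^+ 2 * (K - Int (fun x => - Z x / z x * w x ^+ 2)).
  by apply: cvgMr; apply: cvgB => //; exact: cvg_cst.
apply: cvgr_to_ge cv2 _; apply: nearW => n; exact: (step n).2.
Qed.
End Picone.

(** * The radial initial value problem *)

Section Antiderivative.
Variable R : realType.
Implicit Types f g F : R -> R.
Local Notation leb := (@lebesgue_measure R).

Lemma is_derive_within f (f' : R -> R) (A : set R) : (forall x : R, is_derive x 1 f (f' x)) -> {within A, continuous f}.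
Proof. by move=> d; apply: continuous_subspaceT; exact: is_derive_cont d. Qed.

Lemma rolle_all f (f' : R -> R) (r : R) : r != 0 -> (forall x : R, is_derive x 1 f (f' x)) ->
  f 0 = f r -> exists c, [/\ c != 0, `|c| < `|r|, 0 < c * r & f' c = 0].
Proof.
move=> r0 df e; have dv (x : R) : derivable f x 1 by have [] := df x.
have fin (c : R) : is_derive c 1 f 0 -> f' c = 0.
  by move=> [_ <-]; have [_ <-] := df c.
have [rn|rp|re] := ltgtP r 0; last by rewrite re eqxx in r0.
- have [c] := Rolle rn (fun x _ => dv x) (is_derive_within df) (esym e).
  rewrite in_itv/= => /andP[h1 h2] /fin h3; exists c; split => //; first by rewrite lt_eqF.
    by rewrite !ltr0_norm ?ltrN2.
  by rewrite -mulrNN mulr_gt0 ?oppr_gt0.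
- have [c] := Rolle rp (fun x _ => dv x) (is_derive_within df) e.
  rewrite in_itv/= => /andP[h1 h2] /fin h3; exists c; split => //; first by rewrite gt_eqF.
    by rewrite !gtr0_norm.
  by rewrite mulr_gt0.
Qed.

Lemma cauchy_mvt f g (f' g' : R -> R) (r : R) : r != 0 ->
  (forall x : R, is_derive x 1 f (f' x)) -> (forall x : R, is_derive x 1 g (g' x)) ->
  exists c, [/\ c != 0, `|c| < `|r|, 0 < c * r & f' c * (g r - g 0) = g' c * (f r - f 0)].
Proof.
move=> r0 df dg.
pose k t := f t * (g r - g 0) - g t * (f r - f 0).
have dk (x : R) : is_derive x 1 k (f' x * (g r - g 0) - g' x * (f r - f 0)).
  have := is_deriveB (is_deriveM (df x) (is_derive_cst (g r - g 0) x (1 : R)))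
    (is_deriveM (dg x) (is_derive_cst (f r - f 0) x (1 : R))).
  move=> h; refine (is_derive_eq h _).
  by rewrite /GRing.scale/=; ring.
have [c [c0 cr ccr /eqP]] := rolle_all r0 dk ltac:(by rewrite /k; ring).
by rewrite subr_eq0 => /eqP h; exists c.
Qed.

Lemma derive_eq_fun f g (h : R -> R) : (forall x : R, is_derive x 1 f (h x)) ->
  (forall x : R, is_derive x 1 g (h x)) -> f 0 = g 0 -> f =1 g.
Proof.
move=> df dg e x; have [->//|x0] := eqVneq x 0.
have dfg (u : R) : is_derive u 1 (fun t => f t - g t) 0.
  by refine (is_derive_eq (is_deriveB (df u) (dg u)) _); rewrite subrr.
have did (u : R) : is_derive u 1 (fun t : R => t) 1 by exact: is_derive_id.
have [c [_ _ _]] := cauchy_mvt x0 dfg did.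
by rewrite mul0r mul1r e subrr subr0 => /esym/eqP; rewrite subr_eq0 => /eqP.
Qed.

Lemma antiderivative f : continuous f ->
  exists Phi : R -> R, Phi 0 = 0 /\ forall x : R, is_derive x 1 Phi (f x).
Proof.
move=> cf.
have intf (a b : R) : leb.-integrable `[a, b] (EFin \o f).
  apply: continuous_compact_integrable; first exact: segment_compact.
  exact: continuous_subspaceT.
pose I (a x : R) := Rintegral leb `[a, x] f.
have Iab (a b x : R) : a <= b -> b <= x -> I a x - I a b = Rintegral leb `]b, x] f.
  move=> ab bx; rewrite /I Rintegral_itvB//.
have Icons a a' x : a <= x -> a' <= x -> a <= 0 -> a' <= 0 -> I a x - I a 0 = I a' x - I a' 0.
  move=> ax a'x a0 a'0; have [x0|x0] := leP 0 x; first by rewrite !Iab.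
  by rewrite -[LHS]opprB -[RHS]opprB !Iab// ltW.
(* The base point lies to the left of both x and 0; by [Icons] the value does not depend on it, so
   near a given x it can be frozen. *)
pose Phi x := I (- `|x| - 1) x - I (- `|x| - 1) 0.
exists Phi; split; first by rewrite /Phi subrr.
move=> x; pose a := - `|x| - 2.
have ax : a < x by rewrite /a; have := ler_norm (- x); rewrite normrN; lra.
have [d1 d2] := @continuous_FTC1_closed R f a x (x + 1) ltac:(by rewrite ltrDl) (intf _ _) ax (cf x).
have dI : is_derive x 1 (I a) (f x) by split; [exact: d1|rewrite -d2 derive1E].
apply: (near_eq_is_derive (f := fun t : R => I a t - I a 0)); last first.
  by refine (is_derive_eq (is_deriveB dI (is_derive_cst (I a 0) x (1 : R))) _); rewrite subr0.
near=> t; apply: Icons.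
- apply: ltW; near: t; exact: lt_nbhsr.
- have := ler_norm (- t); rewrite normrN; lra.
- by rewrite /a; have := normr_ge0 x; lra.
- by have := normr_ge0 t; lra.
Unshelve. all: end_near. Qed.

Definition prim f : R -> R :=
  xget (fun=> 0) [set Phi : R -> R | Phi 0 = 0 /\ forall x : R, is_derive x 1 Phi (f x)].

Lemma prim_spec f : continuous f -> prim f 0 = 0 /\ forall x : R, is_derive x 1 (prim f) (f x).
Proof.
move=> /antiderivative [Phi hPhi].
rewrite /prim; case: xgetP => [P _ //|/(_ Phi)]; last by case.
Qed.

Lemma prim0 f : continuous f -> prim f 0 = 0. Proof. by move=> /prim_spec[]. Qed.
Lemma prim_derive f (x : R) : continuous f -> is_derive x 1 (prim f) (f x).
Proof. by move=> /prim_spec[]. Qed.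
Lemma prim_uniq f g : continuous f -> g 0 = 0 -> (forall x : R, is_derive x 1 g (f x)) -> prim f =1 g.
Proof. by move=> cf g0 dg; have [p0 pd] := prim_spec cf; apply: derive_eq_fun pd dg _; rewrite p0 g0. Qed.

(* [avg n F r] is [int_0^1 s^n F(r s) ds]. *)
Definition avg (n : nat) F (r : R) : R :=
  if r == 0 then F 0 / n.+1%:R else prim (fun t : R => t ^+ n * F t) r / r ^+ n.+1.

Lemma powM_cont n F : continuous F -> continuous (fun t : R => t ^+ n * F t).
Proof. by move=> cF t; apply: cvgM; [exact: exprn_continuous|exact: cF]. Qed.

Lemma is_derive_pow n (x : R) : is_derive x 1 (fun t : R => t ^+ n.+1) (n.+1%:R * x ^+ n).
Proof.
split; first exact: exprn_derivable.
rewrite exp_derive; rewrite /GRing.scale/= mulr1.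
by [].
Qed.

Lemma avgE n F (r : R) : continuous F -> r ^+ n.+1 * avg n F r = prim (fun t : R => t ^+ n * F t) r.
Proof.
move=> cF; rewrite /avg; case: eqP => [->|/eqP r0].
  by rewrite expr0n mul0r prim0//; exact: powM_cont.
by rewrite mulrC divfK// expf_neq0.
Qed.

Lemma avg_mean_sgn n F (r : R) : continuous F ->
  exists c, [/\ `|c| <= `|r|, 0 <= c * r & avg n F r = F c / n.+1%:R].
Proof.
move=> cF; have [->|r0] := eqVneq r 0; first by exists 0; rewrite // /avg eqxx mulr0.
have cp := @powM_cont n F cF.
have [c [c0 cr cc]] := cauchy_mvt r0 (fun x => prim_derive x cp) (is_derive_pow n).
rewrite prim0// expr0n !subr0 => e; exists c; split; [exact: ltW|exact: ltW|].
rewrite /avg (negbTE r0); apply/eqP; rewrite eqr_div ?expf_neq0//.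
have cn : c ^+ n != 0 by rewrite expf_neq0.
apply/eqP/(mulfI cn); rewrite [RHS]mulrA e; ring.
Qed.

Lemma avg_mean n F (r : R) : continuous F -> exists2 c, `|c| <= `|r| & avg n F r = F c / n.+1%:R.
Proof. by move=> cF; have [c [h1 _ h2]] := avg_mean_sgn n r cF; exists c. Qed.

Lemma avg_mean_pos n F (r : R) : continuous F -> 0 <= r ->
  exists2 c, 0 <= c <= r & avg n F r = F c / n.+1%:R.
Proof.
move=> cF r0; have [c [h1 h2 h3]] := avg_mean_sgn n r cF; exists c => //.
move: h1; rewrite (ger0_norm r0) => h1; rewrite (le_trans (ler_norm c) h1) andbT.
move: r0; rewrite le_eqVlt => /orP[/eqP e|r0]; last by rewrite -(pmulr_lge0 _ r0).
by move: h1; rewrite -e normr_le0 => /eqP ->.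
Qed.

Lemma avg_derive n F (r : R) : continuous F -> r != 0 ->
  is_derive r 1 (avg n F) ((F r - n.+1%:R * avg n F r) / r).
Proof.
move=> cF r0; have cp := @powM_cont n F cF.
have rn : r ^+ n.+1 != 0 by rewrite expf_neq0.
apply: (near_eq_is_derive (f := fun t : R => prim (fun t : R => t ^+ n * F t) t * (t ^+ n.+1)^-1)).
  near=> t; rewrite /avg ifF//; apply/negbTE; near: t.
  by have := @open_neq R^o 0; rewrite openE => /(_ r r0).
have dv := @is_deriveV R _ r _ 1 rn (is_derive_pow n r).
refine (is_derive_eq (is_deriveM (prim_derive r cp) dv) _).
rewrite /= -avgE// /GRing.scale/= exprS.
by field; rewrite r0 expf_neq0.
Unshelve. all: end_near. Qed.

Lemma avg_cont n F : continuous F -> continuous (avg n F).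
Proof.
move=> cF r; have [->|r0] := eqVneq r 0; last first.
  apply: differentiable_continuous; apply/derivable1_diffP.
  by have [] := avg_derive n cF r0.
apply/cvgrPdist_le => e e0; have := cF 0; move/cvgrPdist_le => /(_ e e0) [d /= d0 hd].
exists d => //= t; rewrite /= sub0r normrN => td.
have [c ct ->] := avg_mean n t cF.
rewrite /avg eqxx -mulrBl normrM normfV normr_nat ler_pdivrMr//.
apply: le_trans (hd c _) _; first by apply: le_lt_trans td; rewrite ?sub0r ?normrN.
by rewrite ler_pMr// ler1n.
Qed.

(** The mean value theorem transfers the limit of the derivative to the difference quotient; this
    settles the center of radial functions. *)
Lemma is_derive_at0 f (g : R -> R) : continuous f -> {for 0, continuous g} ->
  (forall r : R, r != 0 -> is_derive r 1 f (g r)) -> is_derive (0 : R) 1 f (g 0).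
Proof.
move=> cf cg df.
have L : (fun h : R => h^-1 *: (f (h *: (1 : R) + 0) - f 0)) @ (0 : R)^' --> g 0.
  apply/cvgrPdist_le => e e0; move/cvgrPdist_le : cg => /(_ e e0) [d /= d0 hd].
  exists d => //= h hh h0; rewrite /= sub0r normrN in hh.
  have -> : h *: (1 : R) + 0 = h by rewrite addr0; exact: mulr1.
  have [c [c0 ch e1]] : exists c, [/\ c != 0, `|c| < `|h| & f h - f 0 = g c * h].
    have [hn|hp|he] := ltgtP h 0; last by rewrite he eqxx in h0.
    - have d' (x : R) : x \in `]h, 0[ -> is_derive x 1 f (g x).
        by rewrite in_itv/= => /andP[_ /lt_eqF x0]; apply: df; rewrite x0.
      have [c] := @MVT R f g h 0 hn d' (continuous_subspaceT cf).
      rewrite in_itv/= => /andP[c1 c2] e1; exists c; split; first by rewrite lt_eqF.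
        by rewrite !ltr0_norm ?ltrN2.
      by rewrite -opprB e1 sub0r mulrN opprK.
    - have d' (x : R) : x \in `]0, h[ -> is_derive x 1 f (g x).
        by rewrite in_itv/= => /andP[/gt_eqF x0 _]; apply: df; rewrite x0.
      have [c] := @MVT R f g 0 h hp d' (continuous_subspaceT cf).
      rewrite in_itv/= => /andP[c1 c2] e1; exists c; split; first by rewrite gt_eqF.
        by rewrite !gtr0_norm.
      by rewrite e1 subr0.
  rewrite e1 (_ : h^-1 *: (g c * h) = g c); last by rewrite /GRing.scale/= mulrC mulfK.
  by apply: hd; apply: lt_trans hh; rewrite sub0r normrN.
by split; [apply/cvg_ex; exists (g 0)|exact: cvg_lim L].
Qed.

(** Differentiation of int_0^1 s^n F(r s) ds under the integral sign: off zero it is an integration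
    by parts, at zero the derivative extends continuously. Hence [avg] preserves C^k through the
    center. *)
Lemma avg_derive_C1 n F (F' : R -> R) (r : R) : (forall x : R, is_derive x 1 F (F' x)) -> continuous F' ->
  is_derive r 1 (avg n F) (avg n.+1 F' r).
Proof.
move=> dF cF'; have cF := is_derive_cont dF.
have E (t : R) : t != 0 -> is_derive t 1 (avg n F) (avg n.+1 F' t).
  move=> t0; refine (is_derive_eq (avg_derive n cF t0) _).
  apply: (mulfI (_ : t ^+ n.+2 != 0)); first by rewrite expf_neq0.
  rewrite avgE//.
  have q : prim (fun t : R => t ^+ n.+1 * F' t) =1 (fun t => t ^+ n.+1 * F t - n.+1%:R * prim (fun t : R => t ^+ n * F t) t).
    apply: prim_uniq; first exact: powM_cont.
      by rewrite expr0n mul0r prim0 ?mulr0 ?subrr//; exact: powM_cont.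
    move=> x; have d1 := is_deriveM (is_derive_pow n x) (dF x).
    have d2 := is_deriveM (is_derive_cst (n.+1%:R : R) x (1 : R)) (prim_derive x (@powM_cont n F cF)).
    refine (is_derive_eq (is_deriveB d1 d2) _).
    by rewrite /GRing.scale/=; ring.
  rewrite q -avgE// !exprS; field; exact: t0.
have [->|r0] := eqVneq r 0; last exact: E.
apply: is_derive_at0 => //; first exact: avg_cont.
exact: avg_cont.
Qed.

Lemma avg_Cn n k F : Cn k F -> Cn k (avg n F).
Proof.
elim: k n F => [|k IH] n F /=; first exact: avg_cont.
move=> [F' dF cF']; exists (avg n.+1 F'); last exact: IH.
by move=> x; apply: avg_derive_C1 => //; exact: Cn_cont cF'.
Qed.

End Antiderivative.

Section Limits.
Variable R : realType.

(** The intervals u k - 2 C 2^-k, u k + 2 C 2^-k are nested; the supremum of their lower ends is the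
    limit. *)
Lemma geometric_limit (u : nat -> R) (C : R) : (forall k, `|u k.+1 - u k| <= C * 2^-1 ^+ k) ->
  exists l, forall k, `|l - u k| <= 2 * C * 2^-1 ^+ k.
Proof.
move=> H; pose h k : R := 2^-1 ^+ k.
have hS k : h k.+1 = h k / 2 by rewrite /h exprSr.
have h0 k : 0 < h k by rewrite exprn_gt0.
have C0 : 0 <= C by have := le_trans (normr_ge0 _) (H 0%N); rewrite expr0 mulr1.
pose a k := u k + 2 * C * h k; pose b k := u k - 2 * C * h k.
have bS k : b k <= b k.+1.
  have := H k; rewrite ler_norml => /andP[h1 h2]; rewrite /b hS -/(h k) in h1 h2 *; lra.
have aS k : a k.+1 <= a k.
  have := H k; rewrite ler_norml => /andP[h1 h2]; rewrite /a hS -/(h k) in h1 h2 *; lra.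
have bm k i : b k <= b (k + i)%N.
  by elim: i => [|i IH]; rewrite ?addn0// addnS (le_trans IH).
have am k i : a (k + i)%N <= a k.
  by elim: i => [|i IH]; rewrite ?addn0// addnS (le_trans _ IH).
have ba k i : b k <= a i.
  apply: (@le_trans _ _ (b (k + i)%N)) => //.
  apply: (@le_trans _ _ (a (k + i)%N)); last by rewrite addnC.
  by rewrite /a /b; have := mulr_ge0 C0 (ltW (h0 (k + i)%N)); lra.
have sb : has_sup (range b).
  split; first by exists (b 0%N), 0%N.
  by exists (a 0%N) => _ [k _ <-].
exists (sup (range b)) => k; rewrite ler_norml -/(h k); apply/andP; split.
  have : b k <= sup (range b) by apply: sup_upper_bound => //; exists k.
  rewrite /b; lra.
have : sup (range b) <= a k by apply: ge_sup; [exists (b 0%N), 0%N|move=> _ [i _ <-]].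
rewrite /a; lra.
Qed.

Lemma half_small (C e : R) : 0 < e -> exists k, C * 2^-1 ^+ k < e.
Proof.
move=> e0; have c : (fun k : nat => C * 2^-1 ^+ k) @ \oo --> (0 : R).
  rewrite -(mulr0 C); apply: cvgMr; apply: cvg_expr.
  by rewrite ger0_norm// invf_lt1// ltr1n.
move/cvgrPdist_lt : c => /(_ e e0) [N _ /(_ N (leqnn _))] /=.
by rewrite sub0r normrN => h; exists N; apply: le_lt_trans h; exact: ler_norm.
Qed.

Lemma half_zero (x C : R) : (forall k, `|x| <= C * 2^-1 ^+ k) -> x = 0.
Proof.
move=> H; apply/eqP; rewrite -normr_eq0 eq_le normr_ge0 andbT leNgt; apply/negP => x0.
have [k hk] := half_small C x0; have := H k; lra.
Qed.
End Limits.

(** * Picard iteration for the radial equation *)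

Section IVP.
Variable R : realType.
Variables (n : nat) (Phi : R -> R -> R) (Lc K0 : R).
Hypotheses (Lc0 : 0 < Lc)
  (cPhi : forall y : R -> R, continuous y -> continuous (fun t => Phi t (y t)))
  (lPhi : forall t u v, `|Phi t u - Phi t v| <= Lc * `|u - v|)
  (bPhi : forall t, `|Phi t 0| <= K0).

(** Bielecki weight. As W' = 2 Lc r W, the operator [volterra] gains a factor 1 / (2 Lc), so the
    Picard map contracts by 1/2 on the whole line at once and no continuation argument is needed. *)
Let W (r : R) := expR (Lc * r ^+ 2).
Let W1 r : 1 <= W r.
Proof. by rewrite -expR0 ler_expR mulr_ge0 ?sqr_ge0// ltW. Qed.
Let W0 r : 0 < W r. Proof. exact: expR_gt0. Qed.
Let Wmono (r s : R) : `|r| <= `|s| -> W r <= W s.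
Proof.
by move=> h; rewrite ler_expR ler_pM2l// -(real_normK (num_real r)) -(real_normK (num_real s)) lerXn2r.
Qed.
Let dW (r : R) : is_derive r 1 W (2 * Lc * r * W r).
Proof.
have d1 : is_derive r 1 (fun t : R => Lc * t ^+ 2) (Lc * (2 * r ^+ 1)).
  refine (is_derive_eq (is_deriveM (is_derive_cst Lc r (1 : R)) (is_derive_pow 1 r)) _).
  by rewrite /GRing.scale/=; ring.
refine (is_derive_eq (is_derive_comp (g := fun t : R => Lc * t ^+ 2) (is_derive_expR _) d1) _).
by rewrite /W expr1; ring.
Qed.

(** Inverse of the radial Laplacian in dimension n + 1: the function Y with Y(0) = 0 and (t^n Y')' =
    t^n g that is regular at the center. *)
Definition volterra (g : R -> R) := prim (fun t : R => t * avg n g t).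

Lemma volterra_cont g : continuous g -> continuous (fun t : R => t * avg n g t).
Proof. by move=> cg t; apply: cvgM; [exact: cvg_id|exact: avg_cont]. Qed.

Let dvol g (r : R) : continuous g -> is_derive r 1 (volterra g) (r * avg n g r).
Proof. by move=> cg; apply: prim_derive (volterra_cont cg). Qed.

Lemma avgB (f g : R -> R) (r : R) : continuous f -> continuous g ->
  avg n f r - avg n g r = avg n (fun t => f t - g t) r.
Proof.
move=> cf cg; have cfg : continuous (fun t => f t - g t) by move=> t; exact: cvgB (cf t) (cg t).
rewrite /avg; case: eqP => _; first by rewrite mulrBl.
rewrite -mulrBl; congr (_ / _); symmetry.
apply: (prim_uniq (powM_cont cfg) (g := fun t => prim (fun t : R => t ^+ n * f t) t - prim (fun t : R => t ^+ n * g t) t)).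
  by rewrite !prim0 ?subrr//; exact: powM_cont.
move=> x.
have h := is_deriveB (prim_derive x (@powM_cont _ n _ cf)) (prim_derive x (@powM_cont _ n _ cg)).
by refine (is_derive_eq h _); ring.
Qed.

(** Cauchy's mean value theorem against W: the derivatives of the difference and of W share the
    factor r, which cancels. *)
Lemma volterra_bound f g K (r : R) : continuous f -> continuous g ->
  (forall t, `|f t - g t| <= K * W t) -> `|volterra f r - volterra g r| <= K / (2 * Lc) * W r.
Proof.
move=> cf cg H; have K0' : 0 <= K.
  by have := le_trans (normr_ge0 _) (H 0); rewrite pmulr_lge0.
have L2 : 0 < 2 * Lc by rewrite mulr_gt0.
have vf := @volterra_cont f cf; have vg := @volterra_cont g cg.
have [->|r0] := eqVneq r 0.
  rewrite /volterra (prim0 vf) (prim0 vg) subrr normr0; apply: mulr_ge0; last exact: ltW.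
  by rewrite divr_ge0// ltW.
have cfg : continuous (fun t => f t - g t) by move=> t; exact: cvgB (cf t) (cg t).
have dB (x : R) : is_derive x 1 (fun t => volterra f t - volterra g t) (x * avg n (fun t => f t - g t) x).
  refine (is_derive_eq (is_deriveB (dvol x cf) (dvol x cg)) _).
  by rewrite -avgB// mulrBr.
have [c [c0 cr _]] := cauchy_mvt r0 dB dW.
have V0 : volterra f 0 - volterra g 0 = 0 by rewrite /volterra (prim0 vf) (prim0 vg) subrr.
rewrite V0 subr0.
have [d dc ->] := avg_mean n c cfg.
set D := volterra f r - _; have -> : W 0 = 1 by rewrite /W expr0n mulr0 expR0.
move=> e; have wc := W0 c.
have {e} : ((f d - g d) / n.+1%:R) * (W r - 1) = 2 * Lc * W c * D.
  by apply: (mulfI c0); rewrite mulrA e; ring.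
move=> e; have {e} -> : D = (f d - g d) * ((W r - 1) / (n.+1%:R * (2 * Lc) * W c)).
  apply: (@mulfI _ (2 * Lc * W c)); first by rewrite !mulf_neq0 ?gt_eqF//.
  by rewrite -e; field; rewrite !gt_eqF//= ltr0n.
have r1 : 0 <= W r - 1 by rewrite subr_ge0.
rewrite normrM (ger0_norm (_ : 0 <= (W r - 1) / _)); last first.
  by rewrite divr_ge0// !mulr_ge0// ltW.
apply: (@le_trans _ _ ((K * W c) * ((W r - 1) / (n.+1%:R * (2 * Lc) * W c)))).
  apply: ler_wpM2r; first by rewrite divr_ge0// !mulr_ge0// ltW.
  by apply: le_trans (H d) _; rewrite ler_wpM2l// Wmono.
have -> : K * W c * ((W r - 1) / (n.+1%:R * (2 * Lc) * W c)) = K / (2 * Lc) * ((W r - 1) / n.+1%:R).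
  by field; rewrite !gt_eqF//= ltr0n.
rewrite ler_wpM2l ?divr_ge0 ?(ltW L2)//.
rewrite ler_pdivrMr//; apply: (@le_trans _ _ (W r)); first by rewrite gerBl.
by rewrite ler_peMr ?ler1n// ltW.
Qed.

Section fixed_kappa.
Variable k : R.

Fixpoint pic (i : nat) : R -> R :=
  if i is i'.+1 then fun r => k + volterra (fun t => Phi t (pic i' t)) r else fun=> k.

Lemma volt_cont g : continuous g -> continuous (volterra g).
Proof. by move=> cg; apply: is_derive_cont => x; exact: dvol. Qed.

Lemma pic_cont i : continuous (pic i).
Proof.
elim: i => [|i IH] /= x; first exact: cvg_cst.
by apply: cvgD; [exact: cvg_cst|apply: volt_cont; exact: cPhi].
Qed.

Let D := (K0 + Lc * `|k|) / (2 * Lc).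

Let lip_bound (u v : R -> R) K (r : R) : continuous u -> continuous v ->
  (forall t, `|u t - v t| <= K * W t) ->
  `|volterra (fun t => Phi t (u t)) r - volterra (fun t => Phi t (v t)) r| <= K / 2 * W r.
Proof.
move=> cu cv H.
have -> : K / 2 = (Lc * K) / (2 * Lc) by field; rewrite gt_eqF.
apply: volterra_bound; [exact: cPhi|exact: cPhi|move=> t].
apply: le_trans (lPhi t _ _) _; by rewrite -mulrA ler_pM2l.
Qed.

Lemma pic_step i (r : R) : `|pic i.+1 r - pic i r| <= D * W r * 2^-1 ^+ i.
Proof.
elim: i r => [|i IH] r.
  rewrite expr0 mulr1 /= addrAC subrr add0r.
  have c0 : continuous (fun _ : R => 0 : R) by move=> t; exact: cvg_cst.
  have vz : volterra (fun=> 0) r = 0.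
    have z : avg n (fun=> 0 : R) =1 (fun=> 0).
      move=> t; have [c _ ->] := avg_mean n t c0; by rewrite mul0r.
    apply: (prim_uniq (volterra_cont c0) (g := fun=> 0)) => // x.
    by refine (is_derive_eq (is_derive_cst (0 : R) x (1 : R)) _); rewrite z mulr0.
  have := @volterra_bound (fun t => Phi t k) (fun=> 0) (K0 + Lc * `|k|) r.
  rewrite vz subr0; apply => //; first by apply: cPhi => t; exact: cvg_cst.
  move=> t; rewrite subr0; apply: (@le_trans _ _ (K0 + Lc * `|k|)).
    have := lPhi t k 0; rewrite subr0 => h1; have := ler_normD (Phi t k - Phi t 0) (Phi t 0).
    rewrite subrK; have := bPhi t; lra.
  by rewrite ler_peMr// addr_ge0 ?mulr_ge0 ?(ltW Lc0)//; apply: le_trans (bPhi 0).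
have cp j : continuous (pic j) by exact: pic_cont.
have -> : pic i.+2 r - pic i.+1 r = volterra (fun t => Phi t (pic i.+1 t)) r - volterra (fun t => Phi t (pic i t)) r.
  by rewrite [LHS](_ : _ = (k + volterra (fun t => Phi t (pic i.+1 t)) r) - (k + volterra (fun t => Phi t (pic i t)) r))//; ring.
have -> : D * W r * 2^-1 ^+ i.+1 = (D * 2^-1 ^+ i) / 2 * W r by rewrite exprS; field.
apply: lip_bound; [exact: cp|exact: cp|move=> t].
by apply: le_trans (IH t) _; rewrite mulrAC.
Qed.

Lemma ivp_exists : exists y : R -> R, [/\ continuous y,
   (forall r, y r = k + volterra (fun t => Phi t (y t)) r) &
   exists M, forall r, `|y r - k| <= M * W r].
Proof.
have /choice[y hy] : forall r, exists l, forall i, `|l - pic i r| <= 2 * (D * W r) * 2^-1 ^+ i.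
  by move=> r; apply: geometric_limit => i; exact: pic_step.
have cy : continuous y.
  move=> r; apply/cvgrPdist_le => e e0.
  have D0 : 0 <= D.
    rewrite divr_ge0 ?mulr_ge0 ?(ltW Lc0)// addr_ge0 ?mulr_ge0 ?(ltW Lc0)//.
    exact: le_trans (bPhi 0).
  have [i hi] := half_small (2 * (D * W (`|r| + 1))) (divr_gt0 e0 (ltr0n R 4)).
  have := @pic_cont i r; move/cvgrPdist_lt => /(_ (e / 4) (divr_gt0 e0 (ltr0n R 4))).
  have near1 : \forall s \near r, `|s| <= `|r| + 1.
    have : (fun s : R => `|s|) @ r --> `|r| by exact: norm_continuous.
    by move/cvgr_lt => /(_ (`|r| + 1)); rewrite ltrDl ltr01 => /(_ isT); apply: filterS => s /ltW.
  move=> near2; apply: filterS2 near1 near2 => s hs1 h3.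
  have b (u : R) : `|u| <= `|r| + 1 -> `|y u - pic i u| <= e / 4.
    move=> hu; apply: le_trans (hy u i) _; apply: le_trans _ (ltW hi).
    have hu' : `|u| <= `|(`|r| + 1)| by rewrite [leRHS]ger0_norm// addr_ge0.
    by rewrite ler_wpM2r ?exprn_ge0// ler_wpM2l// ler_wpM2l// Wmono.
  have h1 := b r ltac:(by rewrite lerDl).
  have h2 := b s hs1.
  rewrite (_ : y r - y s = (y r - pic i r) + (pic i r - pic i s) - (y s - pic i s)); last by ring.
  have := ler_normB ((y r - pic i r) + (pic i r - pic i s)) (y s - pic i s).
  have := ler_normD (y r - pic i r) (pic i r - pic i s); lra.
exists y; split => //.
- move=> r; apply/eqP; rewrite -subr_eq0; apply/eqP.
  apply: (@half_zero _ _ (4 * (D * W r))) => i.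
  have h1 := hy r i.+1.
  have h2 : `|volterra (fun t => Phi t (y t)) r - volterra (fun t => Phi t (pic i t)) r| <=
     (2 * D * 2^-1 ^+ i) / 2 * W r.
    apply: lip_bound => //; first exact: pic_cont.
    by move=> t; apply: le_trans (hy t i) _; rewrite le_eqVlt; apply/orP; left; apply/eqP; ring.
  move: h1; rewrite /= => h1.
  set A := volterra _ r in h2 *; set B := volterra _ r in h1 h2.
  rewrite (_ : y r - (k + A) = (y r - (k + B)) - (A - B)); last by ring.
  have := ler_normB (y r - (k + B)) (A - B).
  have h0 : 0 <= (2^-1 ^+ i : R) by rewrite exprn_ge0.
  move: h1 h2; rewrite exprS.
  have DW : 0 <= D * W r.
    have := le_trans (normr_ge0 _) (pic_step 0 r); by rewrite expr0 mulr1.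
  move: (mulr_ge0 DW h0); lra.
- exists (2 * D) => r; have := hy r 0%N; rewrite /= expr0 mulr1; by rewrite mulrA.
Qed.

End fixed_kappa.

(** The growth bounds make the difference O(W); feeding a bound into the integral equation halves
    its excess over 2 |k1 - k2|, and iteration removes the excess. With k1 = k2 this is
    uniqueness. *)
Lemma ivp_lipschitz (k1 k2 : R) (y1 y2 : R -> R) : continuous y1 -> continuous y2 ->
  (forall r, y1 r = k1 + volterra (fun t => Phi t (y1 t)) r) ->
  (forall r, y2 r = k2 + volterra (fun t => Phi t (y2 t)) r) ->
  (exists M, forall r, `|y1 r - k1| <= M * W r) -> (exists M, forall r, `|y2 r - k2| <= M * W r) ->
  forall r, `|y1 r - y2 r| <= 2 * `|k1 - k2| * W r.
Proof.
move=> c1 c2 e1 e2 [M1 h1] [M2 h2].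
pose M := M1 + M2 + `|k1 - k2|.
have M0 r : `|y1 r - y2 r| <= M * W r.
  rewrite (_ : y1 r - y2 r = (y1 r - k1) - (y2 r - k2) + (k1 - k2)); last by ring.
  apply: le_trans (ler_normD _ _) _; have := ler_normB (y1 r - k1) (y2 r - k2).
  have := h1 r; have := h2 r; have := W1 r; have := normr_ge0 (k1 - k2); rewrite /M; nra.
have key i : forall r, `|y1 r - y2 r| <= (2 * `|k1 - k2| + M * 2^-1 ^+ i) * W r.
  elim: i => [|i IH] r.
    rewrite expr0 mulr1; apply: le_trans (M0 r) _; rewrite ler_wpM2r ?(ltW (W0 r))//.
    by rewrite lerDr mulr_ge0.
  rewrite e1 e2.
  rewrite (_ : k1 + _ - _ = (k1 - k2) + (volterra (fun t => Phi t (y1 t)) r - volterra (fun t => Phi t (y2 t)) r)); last by ring.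
  apply: le_trans (ler_normD _ _) _.
  have : `|volterra (fun t => Phi t (y1 t)) r - volterra (fun t => Phi t (y2 t)) r| <= (2 * `|k1 - k2| + M * 2^-1 ^+ i) / 2 * W r.
    have -> : (2 * `|k1 - k2| + M * 2^-1 ^+ i) / 2 = (Lc * (2 * `|k1 - k2| + M * 2^-1 ^+ i)) / (2 * Lc).
      by field; rewrite gt_eqF.
    apply: volterra_bound; [exact: cPhi|exact: cPhi|move=> t].
    by apply: le_trans (lPhi t _ _) _; rewrite -mulrA ler_pM2l.
  have : `|k1 - k2| <= `|k1 - k2| * W r by rewrite ler_peMr.
  by rewrite exprS; lra.
move=> r; rewrite -subr_ge0; apply/ler_addgt0Pl => e e0; rewrite -lerBlDl.
have [i hi] := half_small (M * W r) e0.
have := key i r; rewrite mulrDl; move: hi; rewrite mulrAC; lra.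
Qed.

End IVP.

(** * Shooting *)

Section Tests.
Variable R : realType.

Lemma first_hit (f : R -> R) (c s : R) : continuous f -> 0 <= s -> f 0 < c -> c <= f s ->
  exists t, [/\ 0 < t <= s, f t = c & forall u, 0 <= u < t -> f u < c].
Proof.
move=> cf s0 f0 fs.
pose A := [set t : R | 0 <= t <= s /\ c <= f t].
have hA : has_inf A.
  split; first by exists s; split=> //; rewrite s0 lexx.
  by exists 0 => t [/andP[]].
pose t := inf A.
have t0 : 0 <= t by apply: lb_le_inf; [case: hA|move=> u [/andP[]]].
have ts : t <= s by apply: ge_inf; [case: hA|split=> //; rewrite s0 lexx].
have below u : 0 <= u < t -> f u < c.
  move=> /andP[u0 ut]; rewrite ltNge; apply/negP => h.
  have : t <= u by apply: ge_inf; [case: hA|split=> //; rewrite u0 (le_trans (ltW ut))].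
  by rewrite leNgt ut.
have ft : c <= f t.
  rewrite leNgt; apply/negP => h.
  have /cvgr_lt /(_ _ h) [d /= d0 hd] := cf t.
  have [u [/andP[u0 us] fu] ud] := inf_adherent d0 hA.
  have tu : t <= u by apply: ge_inf; [case: hA|split=> //; rewrite u0].
  have := hd u; rewrite /= ler0_norm ?subr_le0// opprB ltrBlDl => /(_ ud).
  by rewrite ltNge fu.
have tp : 0 < t by rewrite lt_neqAle t0 andbT; apply/eqP => e; move: ft; rewrite -e leNgt f0.
exists t; split => //; first by rewrite tp.
apply/eqP; rewrite eq_le ft andbT leNgt; apply/negP => h.
have /cvgr_gt /(_ _ h) [d /= d0 hd] := cf t.
pose u := Num.max 0 (t - d / 2).
have ut : u < t by rewrite /u gt_max tp/=; lra.
have u0 : 0 <= u by rewrite /u le_max lexx.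
have ud : `|t - u| < d.
  rewrite ger0_norm ?subr_ge0 ?(ltW ut)//; have : t - d / 2 <= u by rewrite /u le_max lexx orbT.
  lra.
have := hd u ud; have := below u; rewrite u0 ut => /(_ isT) h1 h2; have := lt_trans h1 h2.
by rewrite ltxx.
Qed.

(** Only the derivative of f' at c is used, because along a radial solution the second derivative of
    the height is known off the center only. *)
Lemma second_test (f f' : R -> R) (c d e : R) : (forall x : R, is_derive x 1 f (f' x)) ->
  f' c = 0 -> is_derive c 1 f' d -> 0 < d -> 0 < e -> exists t, c < t < c + e /\ f c < f t.
Proof.
move=> df f0 [dd dE] d0 e0.
have L1 : (fun h : R => h^-1 *: (f' (h *: (1 : R) + c) - f' c)) @ (0 : R)^' --> d by rewrite -dE; exact: dd.
move/cvgr_gt : L1 => /(_ 0 d0) [r /= r0 hr].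
pose s := Num.min r e / 2.
have s0 : 0 < s by rewrite divr_gt0// lt_min r0.
have mr : Num.min r e <= r by rewrite ge_min lexx.
have sr : s < r by rewrite /s; lra.
have me : Num.min r e <= e by rewrite ge_min lexx orbT.
have se : s < e by rewrite /s; lra.
exists (c + s); split; first by lra.
have [x] := @MVT R f f' c (c + s) ltac:(lra) (fun x _ => df x) (is_derive_within df).
rewrite in_itv/= => /andP[cx xs] E; rewrite -subr_gt0 E addrAC subrr add0r mulr_gt0//.
have xc : x - c != 0 by rewrite gt_eqF// subr_gt0.
have := hr (x - c); rewrite /= sub0r normrN gtr0_norm ?subr_gt0// => /(_ ltac:(lra) xc).
have -> : (x - c) *: (1 : R) + c = x by rewrite (_ : _ *: _ = x - c) ?subrK//; exact: mulr1.
by rewrite f0 subr0 /GRing.scale/= pmulr_rgt0// invr_gt0 subr_gt0.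
Qed.

Lemma interior_max_derive (f : R -> R) (f' : R -> R) (a b c : R) : (forall x : R, is_derive x 1 f (f' x)) ->
  a < c < b -> (forall t, a <= t <= b -> f t <= f c) -> f' c = 0.
Proof.
move=> df acb h; have ab : a <= b by lra.
have := @derive1_at_max R f a b c ab.
case.
- by move=> x _; have [] := df x.
- by rewrite in_itv/=.
- by move=> x; rewrite in_itv/= => /andP[h1 h2]; apply: h; lra.
- by move=> _ <-; have [_ ->] := df c.
Qed.

Lemma interior_max_second (f f' : R -> R) (a b c d : R) : (forall x : R, is_derive x 1 f (f' x)) ->
  a < c < b -> (forall t, a <= t <= b -> f t <= f c) -> is_derive c 1 f' d -> d <= 0.
Proof.
move=> df acb h dd; rewrite leNgt; apply/negP => d0.
have f0 := interior_max_derive df acb h.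
have bc : 0 < b - c by rewrite subr_gt0; case/andP: acb.
have [t [/andP[ct tb] ht2]] := second_test df f0 dd d0 bc.
have at' : a <= t <= b by case/andP: acb => h1 h2; apply/andP; split; lra.
by have := h t at'; rewrite leNgt ht2.
Qed.
End Tests.

Section Shooting.
Variable R : realType.
Variables (m : bool) (mu g : R -> R) (e2 M K0 H : R).
Hypotheses (e20 : 0 < e2) (H0 : 0 < H) (cmu : continuous mu) (cg : continuous g)
  (muM : forall t, `|mu t| <= M) (gK : forall t, `|g t| <= K0)
  (mu_even : forall t, mu (- t) = mu t) (g_even : forall t, g (- t) = g t) (g0 : forall t : R, 0 <= t -> 0 <= g t).

(* [m = false] is the equation for [y(|x|)] in the plane, [m = true] the one for [v_i = x_i y(|x|)], which is
   radial in dimension four; [hgt] is the height [|v|]. The cutoff [min] makes the right-hand side Lipschitz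
   and is inactive on the solution that is kept. *)
Definition hgt (t u : R) : R := if m then t * u else u.
(** One less than the dimension: the power of r in the radial volume element. *)
Definition ndim : nat := (if m then 3 else 1)%N.
Definition pot (t u : R) : R := (Num.min (hgt t u ^+ 2) (H ^+ 2) - mu t) / e2.
Definition rhs (t u : R) : R := pot t u * u - g t.
(** The truncated cubic has Lipschitz constant 3 H^2 by [cub], and [mu] contributes M. *)
Let Lc := (3 * H ^+ 2 + M + 1) / e2.

(** The constant height H is a strict supersolution: at height at least H the right-hand side is
    positive, which excludes a maximum of the height there. *)
Hypothesis topH : forall t : R, 0 <= t -> hgt t (g t) < (H ^+ 2 - mu t) / e2 * H.

Let M0 : 0 <= M. Proof. exact: le_trans (muM 0). Qed.

Let Lc0 : 0 < Lc.
Proof. by rewrite divr_gt0// ltr_wpDl// addr_ge0// mulr_ge0 ?sqr_ge0. Qed.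

Lemma hgt_cont (y : R -> R) : continuous y -> continuous (fun t => hgt t (y t)).
Proof.
by move=> cy t; rewrite /hgt; case: m; [apply: cvgM; [exact: cvg_id|exact: cy]|exact: cy].
Qed.

Let crhs (y : R -> R) : continuous y -> continuous (fun t => rhs t (y t)).
Proof.
move=> cy t; rewrite /rhs; apply: cvgB; last exact: cg.
apply: cvgM; last exact: cy.
rewrite /pot; apply: cvgM; last exact: cvg_cst.
apply: cvgB; last exact: cmu.
pose w (t : R) := hgt t (y t) ^+ 2.
have cw : continuous w.
  move=> u; apply: (@continuous_comp _ _ _ (fun t => hgt t (y t)) (fun x : R => x ^+ 2)); first exact: hgt_cont.
  exact: exprn_continuous.
rewrite (_ : (fun _ => _) = (fun t => (w t + H ^+ 2 - `|w t - H ^+ 2|) / 2)); last first.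
  by apply/funext => u; rewrite minr_absE.
rewrite minr_absE -/(w t); apply: cvgM; last exact: cvg_cst.
apply: cvgB; first by apply: cvgD; [exact: cw|exact: cvg_cst].
by apply: cvg_norm; apply: cvgB; [exact: cw|exact: cvg_cst].
Qed.

(** The factor s is t or 1 according to [m], and the constant must not depend on it. In the mixed
    case, with only one value truncated, the inequality is multiplied by |s| so that it involves s u
    and s v alone. *)
Let cub (s u v : R) : `|Num.min ((s * u) ^+ 2) (H ^+ 2) * u - Num.min ((s * v) ^+ 2) (H ^+ 2) * v| <= 3 * H ^+ 2 * `|u - v|.
Proof.
wlog uv : u v / (s * u) ^+ 2 <= (s * v) ^+ 2.
  move=> Hw; have [h|h] := leP ((s * u) ^+ 2) ((s * v) ^+ 2); first exact: Hw.
  by rewrite distrC (distrC u) Hw// ltW.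
have HH := ltW H0.
have ab (x : R) : x ^+ 2 <= H ^+ 2 -> `|x| <= H by move=> h; rewrite -ler_sqr ?nnegrE// real_normK// num_real.
have [h1|h1] := leP ((s * v) ^+ 2) (H ^+ 2).
  have h2 := le_trans uv h1.
  rewrite (min_idPl h2).
  have -> : (s * u) ^+ 2 * u - (s * v) ^+ 2 * v = ((s * u) ^+ 2 + (s * u) * (s * v) + (s * v) ^+ 2) * (u - v) by ring.
  rewrite normrM ler_wpM2r//.
  have n1 := ab _ h1; have n2 := ab _ h2.
  apply: le_trans (ler_normD _ _) _; rewrite (ger0_norm (sqr_ge0 (s * v))).
  have : `|(s * u) ^+ 2 + s * u * (s * v)| <= H ^+ 2 + H ^+ 2.
    apply: le_trans (ler_normD _ _) _; rewrite (ger0_norm (sqr_ge0 _)) lerD// normrM expr2.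
    exact: ler_pM.
  lra.
have [h2|h2] := leP ((s * u) ^+ 2) (H ^+ 2); last first.
  by rewrite -mulrBr normrM ger0_norm ?sqr_ge0// ler_wpM2r//; have := sqr_ge0 H; lra.
have n2 := ab _ h2.
have -> : (s * u) ^+ 2 * u - H ^+ 2 * v = H ^+ 2 * (u - v) - (H ^+ 2 - (s * u) ^+ 2) * u by ring.
have n1 : H < `|s * v|.
  by rewrite -ltr_sqr ?nnegrE// real_normK// num_real.
have k : `|s * u| * (H - `|s * u|) <= H * (`|s| * `|u - v|).
  apply: ler_pM => //; first by rewrite subr_ge0.
  rewrite -normrM mulrBr.
  have := ler_normB (s * u) (s * u - s * v); rewrite opprB addrCA subrr addr0; lra.
apply: le_trans (ler_normB _ _) _.
rewrite normrM ger0_norm ?sqr_ge0//.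
suff : `|(H ^+ 2 - (s * u) ^+ 2) * u| <= 2 * H ^+ 2 * `|u - v| by lra.
rewrite normrM ger0_norm ?subr_ge0//.
have s0 : 0 < `|s|.
  by rewrite normr_gt0; apply/eqP => e; move: n1; rewrite e mul0r normr0 ltNge HH.
rewrite -(ler_pM2l s0).
have -> : `|s| * ((H ^+ 2 - (s * u) ^+ 2) * `|u|) = (`|s * u| * (H - `|s * u|)) * (H + `|s * u|).
  by rewrite -[(s * u) ^+ 2](real_normK (num_real (s * u))) normrM; ring.
apply: (@le_trans _ _ ((H * (`|s| * `|u - v|)) * (2 * H))); last by rewrite le_eqVlt; apply/orP; left; apply/eqP; ring.
by apply: ler_pM => //; [rewrite mulr_ge0// subr_ge0|rewrite addr_ge0|lra].
Qed.

Let lrhs (t u v : R) : `|rhs t u - rhs t v| <= Lc * `|u - v|.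
Proof.
rewrite /rhs /pot.
set s := if m then t else 1.
have hs w : hgt t w = s * w by rewrite /hgt /s; case: m; rewrite ?mul1r.
rewrite !hs.
have -> : (Num.min ((s * u) ^+ 2) (H ^+ 2) - mu t) / e2 * u - g t - ((Num.min ((s * v) ^+ 2) (H ^+ 2) - mu t) / e2 * v - g t)
  = ((Num.min ((s * u) ^+ 2) (H ^+ 2) * u - Num.min ((s * v) ^+ 2) (H ^+ 2) * v) - mu t * (u - v)) / e2.
  by field; rewrite gt_eqF.
rewrite normrM (gtr0_norm (_ : 0 < e2^-1)) ?invr_gt0// /Lc mulrAC ler_wpM2r ?invr_ge0 ?(ltW e20)//.
apply: le_trans (ler_normB _ _) _.
have := cub s u v; rewrite normrM; have := muM t; have := normr_ge0 (u - v); nra.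
Qed.

Let brhs (t : R) : `|rhs t 0| <= K0.
Proof. by rewrite /rhs mulr0 sub0r normrN. Qed.

(** The growth bound is the uniqueness class of the contraction; it is what lets [sol_lipschitz]
    compare any two solutions. *)
Definition sol_spec (k : R) (y : R -> R) := [/\ continuous y,
   (forall r, y r = k + volterra ndim (fun t => rhs t (y t)) r) &
   exists M, forall r, `|y r - k| <= M * expR (Lc * r ^+ 2)].

Lemma sol_exists k : exists y, sol_spec k y.
Proof. exact: (ivp_exists ndim Lc0 crhs lrhs brhs). Qed.

Lemma sol_lipschitz k1 k2 y1 y2 : sol_spec k1 y1 -> sol_spec k2 y2 ->
  forall r, `|y1 r - y2 r| <= 2 * `|k1 - k2| * expR (Lc * r ^+ 2).
Proof. by move=> [c1 e1 b1] [c2 e2' b2]; exact: (ivp_lipschitz Lc0 crhs lrhs c1 c2 e1 e2' b1 b2). Qed.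

Section one.
Variables (k : R) (y : R -> R).
Hypothesis sy : sol_spec k y.
Let F t := rhs t (y t).
Let b := avg ndim F.

Lemma sol_cont : continuous y. Proof. by case: sy. Qed.
Lemma sol_Fcont : continuous F. Proof. by apply: crhs; exact: sol_cont. Qed.

Lemma sol0 : y 0 = k.
Proof.
case: sy => _ -> _; rewrite /volterra prim0 ?addr0//; exact: volterra_cont sol_Fcont.
Qed.

Lemma sol_derive (r : R) : is_derive r 1 y (r * b r).
Proof.
have d := prim_derive r (volterra_cont (n := ndim) sol_Fcont).
have -> : y = (fun r => k + volterra ndim F r) by apply/funext => t; case: sy.
by refine (is_derive_eq (is_deriveD (is_derive_cst k r (1 : R)) d) _); rewrite add0r.
Qed.

Lemma sol_b_derive (r : R) : r != 0 -> is_derive r 1 b ((F r - ndim.+1%:R * b r) / r).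
Proof. by move=> r0; apply: avg_derive => //; exact: sol_Fcont. Qed.

(* Mean value form of [y(r) = k + int_0^r t b(t) dt]. *)
Lemma sol_mean (r : R) : 0 <= r -> exists2 d, 0 <= d <= r & y r = k + r ^+ 2 / 2 * (F d / ndim.+1%:R).
Proof.
move=> r0; have [->|rn] := eqVneq r 0.
  by exists 0; rewrite ?lexx// sol0 expr0n !mul0r addr0.
have [c [c0 cr cc]] := cauchy_mvt rn sol_derive (is_derive_pow 1).
rewrite sol0 !expr1 expr0n subr0 => e.
have rp : 0 < r by rewrite lt_neqAle eq_sym rn.
have cp : 0 <= c by rewrite -(pmulr_lge0 _ rp) ltW.
have [d /andP[d0 dc] E] := avg_mean_pos ndim sol_Fcont cp.
exists d; first by rewrite d0 (le_trans dc)//; move: cr; rewrite (ger0_norm cp) (ger0_norm r0) => /ltW.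
have : b c * r ^+ 2 = 2 * (y r - k) by apply: (mulfI c0); rewrite mulrA e; ring.
rewrite /b E => e'; rewrite -[LHS](subrK k) addrC; congr (_ + _).
have nn : (ndim.+1%:R : R) != 0 by rewrite pnatr_eq0.
have two : (2 : R) != 0 by rewrite pnatr_eq0.
by apply: (mulfI two); rewrite -e'; move: (ndim.+1%:R : R) nn => N nn; field.
Qed.

Lemma hgt_derive (t : R) : is_derive t 1 (fun t => hgt t (y t)) (if m then y t + t * (t * b t) else t * b t).
Proof.
rewrite /hgt; case em : m; last exact: sol_derive.
refine (is_derive_eq (is_deriveM (is_derive_id t (1 : R)) (sol_derive t)) _).
by rewrite /GRing.scale/=; ring.
Qed.

Lemma hgt_derive2 (t : R) : 0 < t -> is_derive t 1 (fun t => if m then y t + t * (t * b t) else t * b t)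
  (if m then t * F t - t * b t else F t - b t).
Proof.
move=> t0; have tn : t != 0 by rewrite gt_eqF.
have d1 := is_deriveM (is_derive_id t (1 : R)) (sol_b_derive tn).
case em : m.
  refine (is_derive_eq (is_deriveD (sol_derive t) (is_deriveM (is_derive_id t (1 : R)) d1)) _).
  by rewrite /ndim em /GRing.scale/= -[(id * b) t]/(t * b t); field.
refine (is_derive_eq d1 _).
by rewrite /ndim em /GRing.scale/=; field.
Qed.

(** At the maximum c of the height on [0, r], a height of at least H would give it a positive second
    derivative: by [topH] when [m] is false, and with the further positive term y(c) / c when [m] is
    true. As y(r) < 0, the maximum is not at r. *)
Lemma sol_top (r : R) : 0 <= r -> y r < 0 -> forall t, 0 <= t <= r -> hgt t (y t) < H.
Proof.
move=> r0 yr t /andP[t0 tr]; rewrite ltNge; apply/negP => ht.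
have hr : hgt r (y r) <= 0.
  by rewrite /hgt; case: m; [apply: mulr_ge0_le0 => //; exact: ltW|exact: ltW].
have cw : {within `[0, r], continuous (fun t => hgt t (y t))} := is_derive_within hgt_derive.
have [c] := EVT_max r0 cw; rewrite in_itv/= => /andP[c0 cr] hc.
have hcH : H <= hgt c (y c) by apply: le_trans ht _; apply: hc; rewrite in_itv/= t0.
have cr' : c < r by rewrite lt_neqAle cr andbT; apply/eqP => e; move: hcH; rewrite e leNgt (le_lt_trans hr).
have FH : 0 < hgt c (F c).
  have := topH c0; rewrite /F /rhs /pot.
  have -> : Num.min (hgt c (y c) ^+ 2) (H ^+ 2) = H ^+ 2.
    by apply/min_idPr; rewrite lerXn2r ?nnegrE// ?(ltW H0)// (le_trans (ltW H0)).
  have V0 : 0 <= (H ^+ 2 - mu c) / e2.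
    have h1 : 0 <= hgt c (g c) by rewrite /hgt; case: m; [exact: mulr_ge0 (g0 c0)|exact: g0].
    by have := le_lt_trans h1 (topH c0); rewrite pmulr_lgt0// => /ltW.
  rewrite /hgt; case em : m.
    have hcH' : H <= c * y c by move: hcH; rewrite /hgt em.
    move: (ler_wpM2l V0 hcH'); lra.
  have hcH' : H <= y c by move: hcH; rewrite /hgt em.
  move: (ler_wpM2l V0 hcH'); lra.
have hc' t' : 0 <= t' <= r -> hgt t' (y t') <= hgt c (y c) by move=> h; apply: hc; rewrite in_itv.
have [c00|cn] := eqVneq c 0.
  move: hcH hc' FH; rewrite /hgt c00; case em : m; first by rewrite mul0r leNgt H0.
  move=> _ hc' F0.
  have /cvgr_gt /(_ _ F0) [d /= d0 hd] := @sol_Fcont 0.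
  pose s := Num.min d r / 2.
  have r0' : 0 < r by rewrite -c00.
  have s0 : 0 < s by rewrite divr_gt0// lt_min d0.
  have md : Num.min d r <= d by rewrite ge_min lexx.
  have mr : Num.min d r <= r by rewrite ge_min lexx orbT.
  have sd : s < d by rewrite /s; lra.
  have sr : s <= r by rewrite /s; lra.
  have [e /andP[e0 es] ys] := sol_mean (ltW s0).
  have Fe : 0 < F e by apply: hd; rewrite /= sub0r normrN ger0_norm// (le_lt_trans es).
  have := hc' s; rewrite sol0 ys (ltW s0) sr => /(_ isT).
  rewrite gerDl leNgt => /negP; apply.
  by apply: mulr_gt0; apply: divr_gt0; rewrite ?ltr0n ?exprn_gt0.
have cp : 0 < c by rewrite lt_neqAle eq_sym cn.
have c0r : 0 < c < r by rewrite cp.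
have e1 := interior_max_derive hgt_derive c0r hc'.
have := interior_max_second hgt_derive c0r hc' (hgt_derive2 cp).
rewrite leNgt => /negP; apply.
move: hcH FH e1; rewrite /hgt; case em : m => hcH FH e1.
  have yc : 0 < y c by rewrite -(pmulr_rgt0 _ cp) (lt_le_trans H0).
  have : c * (c * b c) = - y c by lra.
  move=> e3; have : c * b c = - (y c / c) by apply: (mulfI cn); rewrite e3 mulrN mulrCA mulfV// mulr1.
  by move=> ->; rewrite opprK addr_gt0// divr_gt0.
move/eqP : e1; rewrite mulf_eq0 (negbTE cn)/= => /eqP ->; by rewrite subr0.
Qed.

End one.

Definition dies (k : R) := exists y r, [/\ sol_spec k y, 0 <= r & y r < 0].

(* The initial value is the supremum of those whose solution becomes negative. *)
Lemma shoot k0 k1 : dies k0 -> (forall k, dies k -> k <= k1) ->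
  (forall k y, k0 <= k -> sol_spec k y -> (forall r : R, 0 <= r -> 0 <= y r) -> forall r : R, 0 <= r -> 0 < y r) ->
  exists k y, [/\ k0 <= k, sol_spec k y, forall r : R, 0 <= r -> 0 < y r & forall r : R, 0 <= r -> hgt r (y r) <= H].
Proof.
move=> A0 Ab pos.
have sA : has_sup [set k | dies k] by split; [exists k0|exists k1 => k /Ab].
pose k := sup [set k | dies k].
have [y sy] := sol_exists k.
have kk : k0 <= k by apply: sup_upper_bound.
have W0 r : 0 < expR (Lc * r ^+ 2) by exact: expR_gt0.
(* If y were negative at r, the solution starting at k + d would still be negative there, against
   the choice of k as a supremum. *)
have nonneg (r : R) : 0 <= r -> 0 <= y r.
  move=> r0; rewrite leNgt; apply/negP => yr.
  pose d := - y r / (4 * expR (Lc * r ^+ 2)).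
  have d0 : 0 < d by rewrite divr_gt0 ?oppr_gt0// mulr_gt0.
  have [y' sy'] := sol_exists (k + d).
  have := sol_lipschitz sy' sy r; rewrite addrAC subrr add0r (gtr0_norm d0).
  have -> : 2 * d * expR (Lc * r ^+ 2) = - y r / 2 by rewrite /d; field; rewrite gt_eqF.
  rewrite ler_norml => /andP[_ h].
  have : k + d <= k by apply: sup_upper_bound => //; exists y', r; split => //; lra.
  lra.
have py := pos k y kk sy nonneg.
exists k, y; split => // r r0; rewrite leNgt; apply/negP => hr.
have cw : {within `[0, r], continuous y} := continuous_subspaceT (sol_cont sy).
have [c] := EVT_min r0 cw; rewrite in_itv/= => /andP[c0 cr] hc.
have yc := py c c0.
pose B := expR (Lc * r ^+ 2).
(* A dying k' within d of k has a solution y' so close to y on [0, r] that it stays positive there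
   and its height at r still exceeds H; the factor r + 1 covers both forms of the height. *)
pose d := Num.min (y c / (4 * B)) ((hgt r (y r) - H) / (4 * B * (r + 1))).
have r1 : 0 < r + 1 by rewrite ltr_wpDl.
have d0 : 0 < d.
  have B0 : 0 < B by exact: W0.
  by rewrite lt_min; apply/andP; split; apply: divr_gt0; rewrite ?mulr_gt0// subr_gt0.
have [k' Ak' kk'] := sup_adherent d0 sA.
have [y' [r' [sy' r'0 y'r']]] := Ak'.
have k'k : k' <= k by apply: sup_upper_bound.
have lip t : 0 <= t <= r -> `|y' t - y t| <= 2 * d * B.
  move=> /andP[t0 tr]; apply: le_trans (sol_lipschitz sy' sy t) _.
  apply: ler_pM; rewrite ?mulr_ge0 ?expR_ge0//.
    by rewrite ler_wpM2l// ler0_norm; rewrite -/k in kk'; lra.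
  by rewrite ler_expR ler_pM2l// lerXn2r// nnegrE.
have B0 : 0 < B by exact: W0.
have dc : 2 * d * B <= y c / 2.
  have : d <= y c / (4 * B) by rewrite ge_min lexx.
  rewrite ler_pdivlMr; last by rewrite mulr_gt0.
  lra.
have dh : (r + 1) * (2 * d * B) <= (hgt r (y r) - H) / 2.
  have : d <= (hgt r (y r) - H) / (4 * B * (r + 1)) by rewrite ge_min lexx orbT.
  rewrite ler_pdivlMr; last by rewrite !mulr_gt0.
  lra.
(* If y' dies after r, its height at r contradicts [sol_top]; if it dies before r, it contradicts
   the positive minimum of y on [0, r]. *)
have [rr'|r'r] := leP r r'.
  have := sol_top sy' r'0 y'r' (t := r); rewrite r0 rr' => /(_ isT).
  have := lip r; rewrite r0 lexx => /(_ isT) hl.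
  have : `|hgt r (y' r) - hgt r (y r)| <= (r + 1) * (2 * d * B).
    rewrite /hgt; case: m.
      rewrite -mulrBr normrM (ger0_norm r0) ler_pM//; lra.
    by apply: le_trans hl _; rewrite ler_peMl ?lerDr// !mulr_ge0// ltW.
  rewrite ler_norml => /andP[h1 _] h2; lra.
have := lip r'; rewrite r'0 (ltW r'r) => /(_ isT); rewrite ler_norml => /andP[h1 _].
have := hc r'; rewrite in_itv/= r'0 (ltW r'r) => /(_ isT); lra.
Qed.

(** The reflection of y solves the same problem with the same initial value, because [ndim] is odd
    and [mu] and [g] are even; uniqueness identifies the two. *)
Lemma sol_even k y : sol_spec k y -> forall r, y (- r) = y r.
Proof.
move=> sy; have [cy ey [B hB]] := sy.
have sy' : sol_spec k (fun r => y (- r)).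
  have cN : continuous (fun r => y (- r)).
    by move=> r; apply: (@continuous_comp _ _ _ (fun r : R => - r) y); [exact: opp_continuous|exact: cy].
  split => //; last by exists B => r; have := hB (- r); rewrite sqrrN.
  move=> r; rewrite ey; congr (_ + _).
  have cF := sol_Fcont sy; have cF' := crhs cN.
  have nn : odd ndim by rewrite /ndim; case: m.
  have E t : avg ndim (fun t => rhs t (y t)) (- t) = avg ndim (fun t => rhs t (y (- t))) t.
    rewrite /avg oppr_eq0 oppr0; case: eqP => // _.
    have -> : (- t) ^+ ndim.+1 = t ^+ ndim.+1 by rewrite exprNn -signr_odd /= nn expr0 mul1r.
    congr (_ / _); symmetry.
    have c1 := @powM_cont _ ndim _ cF.
    apply: (prim_uniq (@powM_cont _ ndim _ cF') (g := fun t => prim (fun t : R => t ^+ ndim * rhs t (y t)) (- t))).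
      by rewrite oppr0 prim0.
    move=> x; have dN : is_derive x 1 (fun t : R => - t) (- 1) by exact: is_deriveN.
    refine (is_derive_eq (is_derive_comp (g := fun t : R => - t) (prim_derive (- x) c1) dN) _).
    have -> : rhs (- x) (y (- x)) = rhs x (y (- x)).
      by rewrite /rhs /pot mu_even g_even /hgt; case: m => //; rewrite mulNr sqrrN.
    by rewrite exprNn -signr_odd nn expr1; ring.
  symmetry; apply: (prim_uniq (volterra_cont cF') (g := fun t => volterra ndim (fun t => rhs t (y t)) (- t))).
    by rewrite oppr0 /volterra prim0//; exact: volterra_cont.
  move=> x; have dN : is_derive x 1 (fun t : R => - t) (- 1) by exact: is_deriveN.
  refine (is_derive_eq (is_derive_comp (g := fun t : R => - t) (prim_derive (- x) (volterra_cont cF)) dN) _).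
  by rewrite E; ring.
move=> r; have := sol_lipschitz sy' sy r; rewrite subrr normr0 mulr0 mul0r normr_le0 subr_eq0 => /eqP //.
Qed.

End Shooting.

(** * The radial profile without forcing *)

Section CaseI.
Variable R : realType.
Implicit Types y mu : R -> R.

Lemma mvt_open (f f' : R -> R) (a b : R) : (forall x : R, is_derive x 1 f (f' x)) -> a < b ->
  exists2 c : R, a < c < b & f b - f a = f' c * (b - a).
Proof.
move=> df ab; have [c] := @MVT R f f' a b ab (fun x _ => df x) (is_derive_within df).
by rewrite in_itv/= => h1 h2; exists c.
Qed.

Lemma global_min_derive (f f' : R -> R) (c : R) : (forall x : R, is_derive x 1 f (f' x)) ->
  (forall t : R, f c <= f t) -> f' c = 0.
Proof.
move=> df hc; have dN (x : R) : is_derive x 1 (fun t => - f t) (- f' x) by exact: is_deriveN.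
have := @interior_max_derive R (fun t => - f t) (fun t => - f' t) (c - 1) (c + 1) c dN.
by move=> /(_ ltac:(lra) (fun t _ => ltac:(by rewrite lerN2))) /eqP; rewrite oppr_eq0 => /eqP.
Qed.

Variables (mu : R -> R) (M rho : R).
Hypotheses (cmu : Cinf mu) (mu_even : forall t, mu (- t) = mu t) (muM : forall t, `|mu t| <= M)
  (mu_dec : forall s t : R, 0 <= s -> s < t -> mu t < mu s) (rho0 : 0 < rho) (mu_rho : mu rho = 0).

Let cm : continuous mu := Cinf_cont cmu.
Let g : R -> R := fun=> 0.
Let cg : continuous g. Proof. by move=> x; exact: cvg_cst. Qed.
Let gK (t : R) : `|g t| <= 0. Proof. by rewrite normr0. Qed.
Let g0 (t : R) : 0 <= t -> 0 <= g t. Proof. by []. Qed.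
Let g_even (t : R) : g (- t) = g t. Proof. by []. Qed.
Let M0 : 0 <= M. Proof. exact: le_trans (muM 0). Qed.
Variable H : R.
Hypothesis HM : M + 1 <= H.
Let H0 : 0 < H. Proof. by rewrite (lt_le_trans _ HM)// ltr_wpDl. Qed.
Let H2 t : 1 <= H ^+ 2 - mu t.
Proof. by have := muM t; rewrite ler_norml => /andP[_ h]; have := M0; have := HM; nra. Qed.

Section e2.
Variable e2 : R.
Hypothesis e20 : 0 < e2.

Let topH (t : R) : 0 <= t -> hgt false t (g t) < (H ^+ 2 - mu t) / e2 * H.
Proof. by move=> _; rewrite /hgt/g !mulr_gt0 ?invr_gt0//; have := H2 t; lra. Qed.

Let spec := sol_spec false mu g e2 M H.
Let F y t := rhs false mu g e2 H t (y t).
Let rhsE y t : F y t = (Num.min (y t ^+ 2) (H ^+ 2) - mu t) / e2 * y t.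
Proof. by rewrite /F /rhs /pot /hgt /g subr0. Qed.

Let b y := avg 1 (F y).

Let normF y t : `|F y t| <= (H ^+ 2 + M) / e2 * `|y t|.
Proof.
rewrite rhsE normrM normrM (gtr0_norm (_ : 0 < e2^-1)) ?invr_gt0// ler_wpM2r//.
rewrite ler_wpM2r ?invr_ge0 ?(ltW e20)//.
apply: le_trans (ler_normB _ _) (lerD _ (muM t)).
by rewrite ger0_norm ?ge_min ?lexx ?orbT// le_min !sqr_ge0.
Qed.

Let deriveE k y : spec k y -> forall t : R, is_derive t 1 y (t * b y t).
Proof. by move=> sy t; exact: (sol_derive cm cg sy). Qed.

Let deriveyy k y : spec k y -> forall t : R, t != 0 -> is_derive t 1 (fun t => t * b y t) (F y t - b y t).
Proof.
move=> sy t t0; refine (is_derive_eq (is_deriveM (is_derive_id t (1 : R)) (sol_b_derive cm cg sy t0)) _).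
rewrite /GRing.scale/= /b /F /ndim; field; exact: t0.
Qed.

(** At a first zero t0 also y' vanishes, as y is nonnegative everywhere by evenness. Backward
    Gronwall: (y^2 + y'^2) exp(K t) is nondecreasing on [t0 / 2, t0] and zero at t0, although y(t0 /
    2) > 0. *)
Lemma positivity_i k y : 0 < k -> spec k y -> (forall r : R, 0 <= r -> 0 <= y r) ->
  forall r : R, 0 <= r -> 0 < y r.
Proof.
move=> k0 sy y0 s s0; rewrite lt_neqAle y0// andbT; apply/eqP => ys.
have cN : continuous (fun t => - y t).
  by move=> t; apply: cvgN; exact: (sol_cont sy).
have [t0 [/andP[t00 t0s] yt0 below]] := @first_hit R (fun t => - y t) 0 s cN s0
  ltac:(by rewrite /= (sol0 cm cg sy) oppr_lt0) ltac:(by rewrite /= -ys oppr0).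
have yt : y t0 = 0 by apply/eqP; rewrite -oppr_eq0 yt0.
have ev := sol_even e20 H0 cm cg muM mu_even g_even sy.
have ymin t : y t0 <= y t.
  by rewrite yt; have [/y0//|t0'] := leP 0 t; rewrite -ev y0// oppr_ge0 ltW.
have y't : t0 * b y t0 = 0 := global_min_derive (deriveE sy) ymin.
(* In the derivative, 1 absorbs 2 y y', L absorbs 2 y' F, and 4 / t0 absorbs the friction 2 y'^2 / t
   for t >= t0 / 2. *)
pose L := (H ^+ 2 + M) / e2; pose K := 1 + L + 4 / t0.
have L0 : 0 <= L by rewrite divr_ge0 ?(ltW e20)// addr_ge0// sqr_ge0.
pose e t := (y t ^+ 2 + (t * b y t) ^+ 2) * expR (K * t).
pose e' t := (2 * y t * (t * b y t) + 2 * (t * b y t) * (F y t - b y t)) * expR (K * t)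
  + (y t ^+ 2 + (t * b y t) ^+ 2) * (expR (K * t) * K).
have de (t : R) : t != 0 -> is_derive t 1 e (e' t).
  move=> tn.
  have dK : is_derive t 1 (fun t : R => K * t) K.
    by refine (is_derive_eq (is_deriveM (is_derive_cst K t (1 : R)) (is_derive_id t (1 : R))) _); rewrite /GRing.scale/=; ring.
  have dE := is_derive_comp (g := fun t : R => K * t) (is_derive_expR (K * t)) dK.
  have d1 := is_deriveM (deriveE sy t) (deriveE sy t).
  have d2 := is_deriveM (deriveyy sy tn) (deriveyy sy tn).
  have := is_deriveM (is_deriveD d1 d2) dE.
  have -> : ((y * y + (fun t : R => t * b y t) * (fun t : R => t * b y t)) * (fun x : R => expR (K * x)))%R = e.
    by apply/funext => u.
  move=> h; refine (is_derive_eq h _).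
  rewrite /e' /GRing.scale/=.
  by rewrite -[(_ + _) t]/(y t * y t + (t * b y t) * (t * b y t)); ring.
have e'0 (t : R) : t0 / 2 <= t -> 0 <= e' t.
  move=> ht; have tp : 0 < t by apply: lt_le_trans ht; rewrite divr_gt0.
  have -> : e' t = ((2 * y t * (t * b y t) + 2 * (t * b y t) * (F y t - b y t)) + (y t ^+ 2 + (t * b y t) ^+ 2) * K) * expR (K * t).
    by rewrite /e'; ring.
  rewrite mulr_ge0 ?expR_ge0//.
  set p := t * b y t.
  have bE : b y t = p / t by rewrite /p mulrC mulKf// gt_eqF.
  rewrite bE.
  have tb : t^-1 <= 2 / t0.
    by rewrite -[t^-1]mul1r ler_pdivrMr// mulrAC ler_pdivlMr//; lra.
  have ti : 0 < t^-1 by rewrite invr_gt0.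
  have nF := normF y t; rewrite -/L in nF.
  have pF : - (L * (`|p| * `|y t|)) <= p * F y t.
    have : `|p * F y t| <= L * (`|p| * `|y t|) by rewrite normrM mulrCA ler_wpM2l.
    by rewrite ler_norml => /andP[].
  have q1 : 2 * (`|p| * `|y t|) <= p ^+ 2 + y t ^+ 2.
    by rewrite -[p ^+ 2]real_normK ?num_real// -[y t ^+ 2]real_normK ?num_real//; have := sqr_ge0 (`|p| - `|y t|); lra.
  have q2 : 0 <= (p + y t) ^+ 2 by exact: sqr_ge0.
  have q3 : p ^+ 2 * t^-1 <= p ^+ 2 * (2 / t0) by rewrite ler_wpM2l// sqr_ge0.
  have q4 : L * (2 * (`|p| * `|y t|)) <= L * (p ^+ 2 + y t ^+ 2) by rewrite ler_wpM2l.
  have q5 : 0 <= y t ^+ 2 * t0^-1 by rewrite mulr_ge0 ?sqr_ge0// invr_ge0 ltW.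
  rewrite /K; lra.
have t2 : 0 < t0 / 2 by rewrite divr_gt0.
have [x] := @MVT R e e' (t0 / 2) t0 ltac:(lra)
   ltac:(by move=> x; rewrite in_itv/= => /andP[h _]; apply: de; rewrite gt_eqF// (lt_trans t2))
   ltac:(by apply: derivable_within_continuous => x; rewrite in_itv/= => /andP[h _]; have [] := de x ltac:(by rewrite gt_eqF// (lt_le_trans t2))).
rewrite in_itv/= => /andP[x1 _].
rewrite {1}/e yt y't !expr0n addr0 mul0r sub0r => E.
have : 0 <= - e (t0 / 2) by rewrite E mulr_ge0 ?e'0 ?ltW//; lra.
rewrite oppr_ge0 leNgt => /negP; apply.
rewrite mulr_gt0 ?expR_gt0// ltr_wpDr ?sqr_ge0//.
have := below (t0 / 2); rewrite (ltW t2) ltr_pdivrMr// ltr_pMr// ltr1n => /(_ isT).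
by rewrite oppr_lt0 => h; rewrite exprn_gt0.
Qed.

(* While [y >= 0] is small, [t^2 b(t)] decreases, hence [y' <= - c / t] with [c] large compared with [y]. *)
Lemma small_dies : e2 < mu (rho / 2) * rho ^+ 2 / 128 -> exists2 k, 0 < k & dies false mu g e2 M H k.
Proof.
have rp := rho0; move=> e2s; set r0 := rho / 4; set m1 := mu (rho / 2).
have m10 : 0 < m1 by have := @mu_dec (rho / 2) rho ltac:(lra) ltac:(lra); rewrite mu_rho.
have r00 : 0 < r0 by rewrite divr_gt0.
(* This gives c^2 <= m1 / 2, so on [0, rho / 2], where mu >= m1, every value y <= c makes (y^2 - mu)
   / e2 at most - m1 / (2 e2). *)
pose c := Num.min 1 (m1 / 2).
have c0 : 0 < c by rewrite lt_min ltr01 divr_gt0.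
have c1 : c <= 1 by rewrite ge_min lexx.
have c2 : c <= m1 / 2 by rewrite ge_min lexx orbT.
have c2' : c ^+ 2 <= m1 / 2 by apply: le_trans c2; rewrite expr2 ler_piMr// ltW.
pose k := c / 2; have k0 : 0 < k by rewrite divr_gt0.
have kc : k < c by rewrite /k; lra.
exists k => //.
have [y sy] := sol_exists false e20 H0 cm cg muM gK k.
apply: contrapT => nd.
have y0 (r : R) : 0 <= r -> 0 <= y r.
  by move=> r0'; rewrite leNgt; apply/negP => h; apply: nd; exists y, r.
have yp := positivity_i k0 sy y0.
pose lam := m1 / (4 * e2).
have lam0 : 0 < lam by rewrite divr_gt0// mulr_gt0.
have Fneg (t : R) : 0 <= t <= rho / 2 -> y t <= c -> F y t <= - (2 * lam * y t).
  move=> /andP[t0 tr] yc; rewrite rhsE.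
  have mt : m1 <= mu t.
    move: tr; rewrite le_eqVlt => /orP[/eqP ->//|h]; exact: ltW (mu_dec t0 h).
  have yt := y0 t t0.
  have -> : - (2 * lam * y t) = (- (m1 / 2)) / e2 * y t by rewrite /lam; field; rewrite gt_eqF.
  rewrite ler_wpM2r// ler_wpM2r ?invr_ge0 ?(ltW e20)//.
  have : y t ^+ 2 <= c ^+ 2 by rewrite lerXn2r// nnegrE// ltW.
  have : Num.min (y t ^+ 2) (H ^+ 2) <= y t ^+ 2 by rewrite ge_min lexx.
  lra.
have y00 : y 0 < c by rewrite (sol0 cm cg sy).
(* Before the level c is first reached F is at most 0, so by [sol_mean] y stays at most k = c / 2;
   hence c is never reached. *)
have below (t : R) : 0 <= t <= rho / 2 -> y t < c.
  move=> /andP[t0 tr]; rewrite ltNge; apply/negP => h.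
  have [s [/andP[s0 st] ys below]] := first_hit (sol_cont sy) t0 y00 h.
  have [d /andP[d0 ds] ys'] := sol_mean cm cg sy (ltW s0).
  have yd : y d <= c.
    by move: ds; rewrite le_eqVlt => /orP[/eqP ->|h']; [rewrite ys|rewrite ltW// below// d0].
  have Fd : F y d <= 0.
    apply: le_trans (Fneg d _ yd) _; first by rewrite d0 (le_trans ds (le_trans st tr)).
    by rewrite oppr_le0; apply: mulr_ge0; [apply: mulr_ge0 => //; exact: ltW|exact: y0].
  have : y s <= k.
    rewrite ys' gerDl; apply: mulr_ge0_le0; first by rewrite divr_ge0// sqr_ge0.
    by rewrite mulr_le0_ge0.
  by rewrite ys leNgt kc.
have Fn (t : R) : 0 <= t <= rho / 2 -> F y t <= - (2 * lam * y t) by move=> h; apply: Fneg => //; exact: ltW (below t h).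
have F0 (t : R) : 0 <= t <= rho / 2 -> F y t <= 0.
  move=> h; apply: le_trans (Fn t h) _; rewrite oppr_le0; apply: mulr_ge0; [apply: mulr_ge0 => //; exact: ltW|by apply: y0; case/andP: h].
have cF := sol_Fcont cm cg sy.
have b0 (t : R) : 0 <= t <= rho / 2 -> b y t <= 0.
  move=> /andP[t0 tr]; have [d /andP[d0 dt] E] := avg_mean_pos 1 cF t0.
  by rewrite [b y t]E mulr_le0_ge0// F0// d0 (le_trans dt).
have ydec (s t : R) : 0 <= s -> s <= t -> t <= rho / 2 -> y t <= y s.
  move=> s0; rewrite le_eqVlt => /orP[/eqP ->//|st] tr.
  have [x /andP[x1 x2] E] := mvt_open (deriveE sy) st.
  rewrite -subr_le0 E; apply: mulr_le0_ge0; last by rewrite subr_ge0 ltW.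
  by apply: mulr_ge0_le0; [lra|apply: b0; lra].
have r02 : r0 <= rho / 2 by rewrite /r0; lra.
have br0 : b y r0 <= - (lam * y r0).
  have [d /andP[d0 dt] E] := avg_mean_pos 1 cF (ltW r00).
  rewrite [b y r0]E.
  have := Fn d ltac:(by rewrite d0 (le_trans dt)); rewrite /F.
  have := ler_wpM2l (ltW lam0) (ydec _ _ d0 dt r02); lra.
have [x /andP[x1 x2]] := mvt_open (deriveE sy) (ltac:(rewrite /r0; lra) : r0 < rho / 2).
have x0 := lt_trans r00 x1.
have bx : x ^+ 2 * b y x <= r0 ^+ 2 * b y r0.
  rewrite [x ^+ 2 * _](avgE 1 x cF) [r0 ^+ 2 * _](avgE 1 r0 cF).
  have [z /andP[z1 z2] E] := mvt_open (fun t => prim_derive t (@powM_cont _ 1 _ cF)) x1.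
  rewrite -subr_le0 E; apply: mulr_le0_ge0; last by rewrite subr_ge0 ltW.
  by apply: mulr_ge0_le0; [rewrite expr1; lra|apply: F0; lra].
have xb : x * b y x <= - (lam * r0 / 2 * y r0).
  rewrite -(ler_pM2l x0) mulrA -expr2; apply: le_trans bx _.
  apply: (@le_trans _ _ (r0 ^+ 2 * - (lam * y r0))); first by rewrite ler_wpM2l// sqr_ge0.
  have ly : 0 <= lam * y r0 by apply: mulr_ge0; [exact: ltW|apply: y0; exact: ltW].
  have xr : 0 <= 2 * r0 - x by rewrite /r0; lra.
  have := mulr_ge0 (mulr_ge0 (ltW r00) xr) ly; lra.
have e1 : rho / 2 - r0 = r0 by rewrite /r0; field.
rewrite e1 => E.
(* This is the origin of 128. Over [rho / 4, rho / 2], of length r0, y drops by at least lam r0^2 /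
   2 times y(r0), where lam r0^2 = m1 rho^2 / (64 e2); a factor above 1 makes y negative. *)
have lr : 2 < lam * r0 ^+ 2.
  have -> : lam * r0 ^+ 2 = (m1 * rho ^+ 2 / 64) / e2 by rewrite /lam /r0; field; rewrite gt_eqF.
  by rewrite ltr_pdivlMr//; rewrite -/m1 in e2s; lra.
have := ler_wpM2r (ltW r00) xb; rewrite -E.
have := yp r0 (ltW r00); have := y0 (rho / 2) ltac:(lra).
nra.
Qed.

(** The data handed to the plane: [bb] is y' / r, continuous through 0, and [F0] is the Laplacian of
    y(|x|), with the truncation already removed. *)
Lemma ode_i : e2 < mu (rho / 2) * rho ^+ 2 / 128 -> exists y bb F0 : R -> R,
  [/\ Cinf y, continuous bb /\ continuous F0, (forall r, 0 < y r /\ y r <= H) /\ (forall r, y (- r) = y r),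
      (forall r : R, is_derive r 1 y (r * bb r)) /\
      (forall r : R, r != 0 -> is_derive r 1 bb ((F0 r - 2 * bb r) / r)) &
      (forall r, F0 r = (y r ^+ 2 - mu r) / e2 * y r) /\ (exists C, forall r, `|bb r| <= C /\ `|F0 r| <= C)].
Proof.
move=> e2s; have [k0 k00 dk0] := small_dies e2s.
(* Here the height at 0 is k itself, so [sol_top] bounds the initial values that die. *)
have kH k : dies false mu g e2 M H k -> k <= H.
  move=> [y [r [sy r0 yr]]]; have := sol_top H0 cm cg g0 topH sy r0 yr (t := 0).
  by rewrite lexx r0 /hgt (sol0 cm cg sy) => /(_ isT) /ltW.
have pos k y : k0 <= k -> spec k y -> (forall r : R, 0 <= r -> 0 <= y r) -> forall r : R, 0 <= r -> 0 < y r.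
  by move=> kk; apply: positivity_i; exact: lt_le_trans kk.
have [k [y [kk sy yp yH]]] := shoot e20 H0 cm cg muM gK g0 topH dk0 kH pos.
have ev := sol_even e20 H0 cm cg muM mu_even g_even sy.
have yp' r : 0 < y r by have [/yp//|r0] := leP 0 r; rewrite -ev yp// oppr_ge0 ltW.
have yH' r : y r <= H by have [/yH//|r0] := leP 0 r; rewrite -ev; apply: yH; rewrite oppr_ge0 ltW.
have FE r : F y r = (y r ^+ 2 - mu r) / e2 * y r.
  rewrite rhsE (min_idPl _)//; have := yp' r; have := yH' r; have := H0; nra.
have cF : continuous (F y) := sol_Fcont cm cg sy.
have Fe : F y = fun r => ((y r * y r) + (-1) * mu r) * (e2^-1 * y r).
  by apply/funext => r; rewrite FE; ring.
exists y, (b y), (F y); split => //.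
(* Bootstrap: F is a polynomial in y and mu, so y in C^n puts F and its average [b] in C^n, and y' =
   r b puts y in C^(n+1). *)
- elim=> [|n IH]; first exact: (sol_cont sy).
  exists (fun r => r * b y r); first exact: deriveE sy.
  apply: CnM; first exact: Cinf_id.
  apply: avg_Cn; rewrite Fe; apply: CnM; last by apply: CnM IH; exact: Cinf_cst.
  by apply: CnD; [exact: CnM|apply: CnM; [exact: Cinf_cst|exact: cmu]].
- by split => //; exact: avg_cont.
- split; [exact: deriveE sy|exact: (sol_b_derive cm cg sy)].
- split=> //; pose C := (H ^+ 2 + M) / e2 * H; exists C.
  have bF r : `|F y r| <= C.
    apply: le_trans (normF y r) _; rewrite ler_wpM2l ?divr_ge0 ?(ltW e20)//; first by rewrite addr_ge0// sqr_ge0.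
    by rewrite gtr0_norm.
  move=> r; split=> //; have [c _ e] := avg_mean 1 r cF; rewrite [b y r]e.
  rewrite normrM; apply: le_trans (bF c); rewrite ler_piMr// normfV normr_nat invf_le1//.
  by rewrite ler1n.
Qed.

End e2.
End CaseI.

(** * The radial profile with forcing *)

Section CaseII.
Variable R : realType.
Variables (mu q : R -> R) (M K0 e2 H : R).
Hypotheses (cm : continuous mu) (cq : continuous q) (mu_even : forall t, mu (- t) = mu t)
  (q_even : forall t, q (- t) = q t) (muM : forall t, `|mu t| <= M) (qK : forall t, `|q t| <= K0)
  (q0 : forall t : R, 0 <= t -> 0 <= q t) (qp : forall t : R, 0 < t -> 0 < q t) (e20 : 0 < e2) (H0 : 0 < H)
  (topH : forall t : R, 0 <= t -> hgt true t (q t) < (H ^+ 2 - mu t) / e2 * H).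

Let spec := sol_spec true mu q e2 M H.
Let F y t := rhs true mu q e2 H t (y t).
Let b y := avg 3 (F y).
Let B := (H ^+ 2 + M) / e2.

Let M0 : 0 <= M. Proof. exact: le_trans (muM 0). Qed.
Let K00 : 0 <= K0. Proof. exact: le_trans (qK 0). Qed.
Let B0 : 0 <= B.
Proof. by rewrite divr_ge0 ?(ltW e20)// addr_ge0// sqr_ge0. Qed.

Let normP t u : `|pot true mu e2 H t u| <= B.
Proof.
rewrite /pot normrM (gtr0_norm (_ : 0 < e2^-1)) ?invr_gt0//.
rewrite ler_wpM2r ?invr_ge0 ?(ltW e20)//.
apply: le_trans (ler_normB _ _) (lerD _ (muM t)).
by rewrite ger0_norm ?ge_min ?lexx ?orbT// le_min !sqr_ge0.
Qed.

Let deriveE k y : spec k y -> forall t : R, is_derive t 1 y (t * b y t).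
Proof. by move=> sy t; exact: (sol_derive cm cq sy). Qed.

Let deriveyy k y : spec k y -> forall t : R, t != 0 -> is_derive t 1 (fun t => t * b y t) (F y t - 3 * b y t).
Proof.
move=> sy t t0; refine (is_derive_eq (is_deriveM (is_derive_id t (1 : R)) (sol_b_derive cm cq sy t0)) _).
rewrite /GRing.scale/= /b /F /ndim; field; exact: t0.
Qed.

(** At a zero t > 0 of the nonnegative y one has y' = 0 and y'' = - q(t) < 0, so y becomes negative
    nearby. At the center, k = 0 is excluded by the integral equation: as q >= 0, the maximum of y
    on a short interval would be at most an eighth of itself. *)
Lemma positivity_ii k y : spec k y -> (forall r : R, 0 <= r -> 0 <= y r) ->
  forall r : R, 0 <= r -> 0 < y r.
Proof.
move=> sy y0.
have ev := sol_even e20 H0 cm cq muM mu_even q_even sy.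
have y0' t : 0 <= y t by have [/y0//|t0'] := leP 0 t; rewrite -ev y0// oppr_ge0 ltW.
have pos (t : R) : 0 < t -> 0 < y t.
  move=> t0; rewrite lt_neqAle y0' andbT; apply/eqP => yt; have {}yt := esym yt.
  have y't := global_min_derive (deriveE sy) (c := t) (fun s => ltac:(by rewrite yt y0')).
  have dN (x : R) : is_derive x 1 (fun t => - y t) (- (x * b y x)).
    by apply: is_deriveN; exact: deriveE sy x.
  have b0 : b y t = 0 by apply: (mulfI (lt0r_neq0 t0)); rewrite y't mulr0.
  have dN2 : is_derive t 1 (fun t => - (t * b y t)) (q t).
    refine (is_derive_eq (is_deriveN (deriveyy sy (lt0r_neq0 t0))) _).
    by rewrite b0 /F /rhs yt; ring.
  have nt : - (t * b y t) = 0 by rewrite y't oppr0.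
  have [s [_]] := second_test dN nt dN2 (qp t0) (ltr01 : 0 < 1 :> R).
  by rewrite yt oppr0 ltNge oppr_le0 y0'.
move=> r; rewrite le_eqVlt => /orP[/eqP <-|]; last exact: pos.
rewrite lt_neqAle y0' andbT; apply/eqP => e.
have k0 : k = 0 by rewrite -(sol0 cm cq sy) -e.
(* Short enough that s^2 B <= s B <= 1, where B bounds the potential. *)
pose s := Num.min 1 (B + 1)^-1.
have B1 : 0 < B + 1 by rewrite ltr_wpDl.
have s0 : 0 < s by rewrite lt_min ltr01 invr_gt0.
have s1 : s <= 1 by rewrite ge_min lexx.
have sB : s * B <= 1.
  have : s <= (B + 1)^-1 by rewrite ge_min lexx orbT.
  by rewrite -[X in _ <= X]mul1r ler_pdivlMr//; lra.
have cw : {within `[0, s], continuous y} := continuous_subspaceT (sol_cont sy).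
have [c] := EVT_max (ltW s0) cw; rewrite in_itv/= => /andP[c0 cs] hc.
have [d /andP[d0 dc] E] := sol_mean cm cq sy c0.
have yd : y d <= y c by apply: hc; rewrite in_itv/= d0 (le_trans dc).
have Fd : rhs true mu q e2 H d (y d) <= B * y c.
  have := normP d (y d); rewrite ler_norml => /andP[_ h].
  have h1 := ler_wpM2r (y0' d) h; have h2 := ler_wpM2l B0 yd; have h3 := q0 d0.
  rewrite /rhs; lra.
have ys := pos s s0.
have ysc : y s <= y c by apply: hc; rewrite in_itv/= (ltW s0) lexx.
have yc : 0 < y c by lra.
move: E; rewrite k0 add0r /ndim => E.
have c2 : c ^+ 2 <= s.
  by apply: le_trans (_ : s ^+ 2 <= s); [rewrite lerXn2r// nnegrE// ltW|rewrite expr2 ler_piMr// ltW].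
have h1 : y c * 8 = c ^+ 2 * rhs true mu q e2 H d (y d) by rewrite E; field.
have h2 := ler_wpM2l (sqr_ge0 c) Fd.
have h3 := ler_wpM2r (mulr_ge0 B0 (ltW yc)) c2.
have h4 := ler_wpM2r (ltW yc) sB.
lra.
Qed.

(** The height is now t y and vanishes at the center, so [sol_top] does not bound k there. Instead,
    for large k the solution stays above H / s on [0, s]; it has not died by then, and its height at
    s exceeds H. *)
Lemma dies_bounded : exists k1, forall k, dies true mu q e2 M H k -> k <= k1.
Proof.
have bb := B0; have kk := K00; have HH := H0.
pose s := Num.min 1 (B + 1)^-1.
have B1 : 0 < B + 1 by rewrite ltr_wpDl.
have s0 : 0 < s by rewrite lt_min ltr01 invr_gt0.
have s1 : s <= 1 by rewrite ge_min lexx.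
have sB : s * B <= 1.
  have : s <= (B + 1)^-1 by rewrite ge_min lexx orbT.
  by rewrite -[X in _ <= X]mul1r ler_pdivlMr//; lra.
exists (2 * (K0 + H / s)) => k [y [r [sy r0 yr]]]; rewrite leNgt; apply/negP => kbig.
have Hs : 0 < H / s by rewrite divr_gt0.
have k0 : 0 < k by lra.
have cw : {within `[0, s], continuous (fun t => `|y t|)}.
  by apply: continuous_subspaceT => t; apply: cvg_norm; exact: (sol_cont sy).
have [c] := EVT_max (ltW s0) cw; rewrite in_itv/= => /andP[c0 cs] hc.
have key (t : R) : 0 <= t <= s -> `|y t - k| <= (`|y c| + K0) / 8.
  move=> /andP[t0 ts]; have [d /andP[d0 dt] E] := sol_mean cm cq sy t0.
  rewrite E addrAC subrr add0r normrM ger0_norm ?divr_ge0 ?sqr_ge0//.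
  rewrite normrM /ndim (gtr0_norm (_ : 0 < 4^-1))//.
  have t2 : t ^+ 2 <= s.
    by apply: le_trans (_ : s ^+ 2 <= s); [rewrite lerXn2r// nnegrE// ltW|rewrite expr2 ler_piMr// ltW].
  have yd : `|y d| <= `|y c| by apply: hc; rewrite in_itv/= d0 (le_trans dt).
  have Fd : `|rhs true mu q e2 H d (y d)| <= B * `|y c| + K0.
    apply: le_trans (ler_normB _ _) (lerD _ (qK d)).
    by rewrite normrM ler_pM.
  have h1 := ler_wpM2l (sqr_ge0 t) Fd.
  have h2 := ler_wpM2r (addr_ge0 (mulr_ge0 B0 (normr_ge0 (y c))) K00) t2.
  have h3 := ler_wpM2r (normr_ge0 (y c)) sB.
  have h4 := ler_wpM2r K00 s1.
  lra.
have mc : `|y c| <= k + (`|y c| + K0) / 8.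
  have := key c; rewrite c0 cs => /(_ isT) h; rewrite -[X in `|X| <= _](subrK k) addrC.
  by apply: le_trans (ler_normD _ _) _; rewrite gtr0_norm// lerD.
have low (t : R) : 0 <= t <= s -> H / s < y t.
  by move=> /key; rewrite ler_norml => /andP[h _]; lra.
have rs : s <= r.
  by rewrite leNgt; apply/negP => h; have := low r ltac:(by rewrite r0 ltW); lra.
have := sol_top H0 cm cq q0 topH sy r0 yr (t := s); rewrite (ltW s0) rs => /(_ isT).
rewrite /hgt; have := low s; rewrite (ltW s0) lexx => /(_ isT).
by rewrite ltr_pdivrMr// mulrC => h1 h2; have := lt_trans h1 h2; rewrite ltxx.
Qed.

Lemma ode_ii : exists y bb F0 : R -> R,
  [/\ continuous bb /\ continuous F0, (forall r, 0 < y r) /\ (forall r, y (- r) = y r),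
      (forall r : R, 0 <= r -> r * y r <= H),
      (forall r : R, is_derive r 1 y (r * bb r)) /\
      (forall r : R, r != 0 -> is_derive r 1 bb ((F0 r - 4 * bb r) / r)) &
      forall r, F0 r = ((r * y r) ^+ 2 - mu r) / e2 * y r - q r].
Proof.
have [k1 hk1] := dies_bounded.
have d1 : dies true mu q e2 M H (-1).
  have [y sy] := sol_exists true e20 H0 cm cq muM qK (-1).
  by exists y, 0; split=> //; rewrite (sol0 cm cq sy) oppr_lt0.
have pos k y : -1 <= k -> spec k y -> (forall r : R, 0 <= r -> 0 <= y r) -> forall r : R, 0 <= r -> 0 < y r.
  by move=> _; exact: positivity_ii.
have [k [y [kk sy yp yH]]] := shoot e20 H0 cm cq muM qK q0 topH d1 hk1 pos.
have ev := sol_even e20 H0 cm cq muM mu_even q_even sy.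
have yp' r : 0 < y r by have [/yp//|r0] := leP 0 r; rewrite -ev yp// oppr_ge0 ltW.
have cF : continuous (F y) := sol_Fcont cm cq sy.
exists y, (b y), (F y); split => //.
- by split => //; exact: avg_cont.
- split; [exact: deriveE sy|exact: (sol_b_derive cm cq sy)].
- move=> r; rewrite /F /rhs /pot /hgt (min_idPl _)//.
  have h : `|r * y r| <= H.
    rewrite normrM (gtr0_norm (yp' r)); have [r0|r0] := leP 0 r.
      by rewrite ger0_norm//; exact: (yH r).
    by rewrite -ev ltr0_norm//; apply: (yH (- r)); rewrite oppr_ge0 ltW.
  by rewrite -real_normK ?num_real// lerXn2r// nnegrE ltW.
Qed.

End CaseII.

(** * Lower bound for the height on an annulus *)

Section lower.
Variable R : realType.
Variables (mu q y bb F0 : R -> R) (M e2 k d R1 fm : R).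
Hypotheses (e20 : 0 < e2) (muM : forall t, `|mu t| <= M) (yp : forall r, 0 < y r) (k0 : 0 < k) (d0 : 0 < d)
  (dy : forall r : R, is_derive r 1 y (r * bb r))
  (db : forall r : R, r != 0 -> is_derive r 1 bb ((F0 r - 4 * bb r) / r))
  (FE : forall r, F0 r = ((r * y r) ^+ 2 - mu r) / e2 * y r - q r)
  (qm : forall r : R, d / 2 <= r <= R1 + d -> fm <= r * q r)
  (fmE : (4 * k ^+ 2 + M) / e2 * (2 * k) + 64 * k / d ^+ 2 < fm).

(* Comparison with the concave parabola [2k(1 - 4(r - rs)^2/d^2)]. *)
Lemma height_lower (r : R) : d <= r <= R1 -> k <= r * y r.
Proof.
have dp := d0; have kp := k0.
move=> /andP[dr rR]; rewrite leNgt; apply/negP => hr.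
(* With this curvature the parabola is 2k at r and 0 at r - d/2 and r + d/2. If the height at r is
   below k, then psi(r) > k while psi is negative at both ends, so its maximum c is interior. *)
pose c4 := 8 * k / d ^+ 2.
pose psi (t : R) := 2 * k - c4 * (t - r) ^+ 2 - t * y t.
pose psi1 (t : R) := - (2 * c4 * (t - r)) - (y t + t * (t * bb t)).
have dpsi (t : R) : is_derive t 1 psi (psi1 t).
  have h1 : is_derive t 1 (fun t : R => t - r) 1.
    by refine (is_derive_eq (is_deriveB (is_derive_id t (1 : R)) (is_derive_cst r t (1 : R))) _); rewrite subr0.
  have h2 := is_deriveB (is_derive_cst (2 * k) t (1 : R)) (is_deriveM (is_derive_cst c4 t (1 : R)) (is_deriveM h1 h1)).
  refine (is_derive_eq (is_deriveB h2 (is_deriveM (is_derive_id t (1 : R)) (dy t))) _).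
  by rewrite /psi1 /GRing.scale/=; ring.
have cw : {within `[r - d / 2, r + d / 2], continuous psi} := is_derive_within dpsi.
have [c] := EVT_max (ltac:(lra) : r - d / 2 <= r + d / 2) cw; rewrite in_itv/= => /andP[c1 c2] hc.
have dn : d != 0 by rewrite gt_eqF.
have pr : k < psi r by rewrite /psi subrr expr0n mulr0 subr0; lra.
have prc : psi r <= psi c by apply: hc; rewrite in_itv/=; lra.
have cp : 0 < c by lra.
have end1 t : (t - r) ^+ 2 = (d / 2) ^+ 2 -> 0 < t -> psi t < 0.
  move=> e t0; rewrite /psi e.
  have -> : c4 * (d / 2) ^+ 2 = 2 * k by rewrite /c4; field.
  by rewrite subrr sub0r oppr_lt0 mulr_gt0.
have c1' : r - d / 2 < c.
  rewrite lt_neqAle c1 andbT; apply/eqP => e; have := end1 c; rewrite -e => h.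
  have : psi (r - d / 2) < 0 by apply: h; [ring|lra].
  by rewrite e; lra.
have c2' : c < r + d / 2.
  rewrite lt_neqAle c2 andbT; apply/eqP => e; have := end1 c; rewrite e => h.
  have : psi (r + d / 2) < 0 by apply: h; [ring|lra].
  by rewrite -e; lra.
have cc : r - d / 2 < c < r + d / 2 by rewrite c1'.
have hc' t : r - d / 2 <= t <= r + d / 2 -> psi t <= psi c by move=> h; apply: hc; rewrite in_itv.
have e1 := interior_max_derive dpsi cc hc'.
have cn : c != 0 by rewrite gt_eqF.
have d2 : is_derive c 1 psi1 (- (2 * c4) - c * F0 c + c * bb c).
  have h1 : is_derive c 1 (fun t : R => t - r) 1.
    by refine (is_derive_eq (is_deriveB (is_derive_id c (1 : R)) (is_derive_cst r c (1 : R))) _); rewrite subr0.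
  have h2 := is_deriveM (is_derive_id c (1 : R)) (is_deriveM (is_derive_id c (1 : R)) (db cn)).
  have h3 := is_deriveD (dy c) h2.
  refine (is_derive_eq (is_deriveB (is_deriveN (is_deriveM (is_derive_cst (2 * c4) c (1 : R)) h1)) h3) _).
  by rewrite /GRing.scale/= -[(id * bb) c]/(c * bb c); field.
(* At c the height is at most 2k, so V times the height costs at most (4 k^2 + M) / e2 * 2k. The
   parabola and the first order term [c * bb c] cost at most 5 c4. By [fmE] the forcing exceeds the
   sum, 64 k / d^2 being 8 c4, so psi'' would be positive at a maximum. *)
have := interior_max_second dpsi cc hc' d2.
rewrite leNgt => /negP; apply.
have c40 : 0 <= c4 by rewrite /c4 divr_ge0 ?sqr_ge0// mulr_ge0// ltW.
have hk : c * y c <= 2 * k.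
  have := mulr_ge0 c40 (sqr_ge0 (c - r)); rewrite /psi in pr prc *; lra.
have h0 : 0 < c * y c by rewrite mulr_gt0.
have e2' : c * bb c = - (2 * c4 * (c - r) + y c) / c.
  have -> : 2 * c4 * (c - r) + y c = - (c * (c * bb c)) by move: e1; rewrite /psi1; lra.
  by rewrite opprK; field.
have lo : - (2 * c4) <= c * bb c + y c / c.
  have -> : c * bb c + y c / c = - (2 * c4 * (c - r)) / c by rewrite e2'; field.
  rewrite ler_pdivlMr//.
  have r0 : 0 <= r by lra.
  have := mulr_ge0 c40 r0; lra.
have yc : y c / c <= 8 * k / d ^+ 2.
  rewrite ler_pdivrMr// mulrAC ler_pdivlMr ?exprn_gt0//.
  have h5 : d ^+ 2 <= 4 * c ^+ 2.
    have -> : 4 * c ^+ 2 = (2 * c) ^+ 2 by ring.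
    by rewrite lerXn2r ?nnegrE//; lra.
  have h6 := ler_wpM2l (ltW (yp c)) h5.
  have h7 := ler_wpM2l (ltW cp) hk.
  lra.
have V : c * F0 c <= (4 * k ^+ 2 + M) / e2 * (2 * k) - fm.
  rewrite FE mulrBr lerB//; last by apply: qm; lra.
  have hy2 : (c * y c) ^+ 2 <= 4 * k ^+ 2 by have := h0; nra.
  have h8 := muM c; rewrite ler_norml in h8; case/andP: h8 => h8 _.
  have M0 : 0 <= M := le_trans (normr_ge0 _) (muM 0).
  have -> : c * (((c * y c) ^+ 2 - mu c) / e2 * y c) = ((c * y c) ^+ 2 - mu c) / e2 * (c * y c) by ring.
  have h9 : ((c * y c) ^+ 2 - mu c) / e2 <= (4 * k ^+ 2 + M) / e2.
    by rewrite ler_wpM2r ?invr_ge0 ?(ltW e20)//; lra.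
  apply: le_trans (ler_wpM2r (ltW h0) h9) _.
  apply: ler_wpM2l => //; rewrite divr_ge0 ?(ltW e20)//; have := sqr_ge0 k; lra.
have := fmE; rewrite -/c4 in yc; have : 64 * k / d ^+ 2 = 8 * c4 by rewrite /c4; ring.
lra.
Qed.
End lower.

(** * Calculus off the axes *)

Section PlaneCalculus.
Variable R : realType.
Local Notation L := (@leb2 R).
Local Notation Int f := (Rintegral L setT f).

(** Measurability on the plane refers to the product sigma-algebra, not to open sets. Rounding the
    first coordinate down to a grid makes every preimage a countable union of rectangles; the mesh
    then tends to 0. *)
Lemma continuous_Mes (f : R * R -> R) : continuous f -> Mes f.
Proof.
move=> cf.
pose fl (n : nat) (t : R) : R := (Num.floor (n.+1%:R * t))%:~R / n.+1%:R.
have fl_itv n t : fl n t <= t < fl n t + n.+1%:R^-1.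
  have := floor_itv (n.+1%:R * t); rewrite intrD => /andP[h1 h2].
  have n0 : 0 < n.+1%:R :> R by rewrite ltr0n.
  apply/andP; split; first by rewrite ler_pdivrMr// [leRHS]mulrC.
  by rewrite -[X in _ + X]mul1r -mulrDl ltr_pdivlMr// [ltLHS]mulrC.
have key (t u : R) : (fun n => f (fl n t, u)) @ \oo --> f (t, u).
  have h : (fun n => fl n t) @ \oo --> t.
    apply/cvgrPdist_lt => e e0; near=> n.
    have /andP[h1 h2] := fl_itv n t; rewrite ger0_norm ?subr_ge0//=.
    rewrite ltrBlDl; apply: lt_trans h2 _; rewrite ltrD2l.
    by near: n; exact: near_infty_natSinv_lt (PosNum e0).
  have h2 : (fun n => (fl n t, u) : R * R) @ \oo --> ((t, u) : R * R).
    exact: (cvg_pair h (cvg_cst u)).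
  exact: (cvg_comp _ _ h2 (cf (t, u))).
apply: (measurable_fun_cvg (h := fun n (x : plane R) => f (fl n x.1, x.2))).
- move=> n _ Y mY; rewrite setTI.
  pose S (k : int) : set (plane R) :=
    [set t | fl n t = k%:~R / n.+1%:R] `*` [set u | Y (f (k%:~R / n.+1%:R, u))].
  have -> : (fun x : plane R => f (fl n x.1, x.2)) @^-1` Y = \bigcup_k S k.
    apply/seteqP; split => [[t u] /= h|[t u] [k _ [/= e h]]]; last by rewrite e.
    by exists (Num.floor (n.+1%:R * t)).
  apply: countable_bigcupT_measurable => // k; apply: measurableX.
  + have -> : [set t : R | fl n t = k%:~R / n.+1%:R] = `[k%:~R / n.+1%:R, (k + 1)%:~R / n.+1%:R[%classic.
      have n0 : 0 < n.+1%:R :> R by rewrite ltr0n.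
      apply/seteqP; split => t /=; rewrite in_itv/=.
        by move=> e; have := fl_itv n t; rewrite e intrD mulrDl mul1r.
      rewrite ler_pdivrMr// ltr_pdivlMr// [t * _]mulrC => h.
      by rewrite /fl (floor_def h).
    exact: measurable_itv.
  + have c2 : continuous (fun u : R => f (k%:~R / n.+1%:R, u)).
      move=> u; apply: (@continuous_comp _ _ _ (fun u : R => (k%:~R / n.+1%:R, u) : R * R) f); last exact: cf.
      exact: (cvg_pair (cvg_cst _) cvg_id).
    have := continuous_measurable_fun c2 measurableT mY; by rewrite setTI.
- by move=> [t u] _; exact: key.
Unshelve. all: by end_near.
Qed.

Lemma cont_box_bounded (f : R * R -> R) N : continuous f -> exists C, forall x, box N x -> `|f x| <= C.
Proof.
move=> cf.
have cK : compact (`[- N, N] `*` `[- N, N] : set (R * R)) by apply: compact_setX; exact: segment_compact.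
have /compact_bounded [M [_ hM]] := continuous_compact (continuous_subspaceT cf) cK.
exists (M + 1) => x /boxP[x1 x2]; apply: (hM (M + 1)); first by rewrite ltrDl.
exists x => //; split => /=; rewrite in_itv/=; move: x1 x2; rewrite !ltr_norml => /andP[h1 h2] /andP[h3 h4].
  by rewrite !ltW.
by rewrite !ltW.
Qed.

Lemma off_line (j : bool) (w D : R * R -> R) : (forall x, off j x -> is_derive x (dir R j) w (D x)) ->
  forall x, off j x -> forall t : R, is_derive t 1 (fun h : R => w (x + h *: dir R j)) (D (x + t *: dir R j)).
Proof. by move=> d x ox t; apply/line_derive; apply: d; rewrite off_shift. Qed.

Lemma comp_shift (j : bool) (x : R * R) (s : R) : Defs.comp j (x + s *: dir R j) = Defs.comp j x + s.
Proof.
by case: j => /=; rewrite /GRing.scale/= ?mulr1.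
Qed.

Lemma comp_shiftN (j : bool) (x : R * R) (s : R) : Defs.comp (~~ j) (x + s *: dir R j) = Defs.comp (~~ j) x.
Proof. by case: j => /=; rewrite /GRing.scale/= mulr0 addr0. Qed.

Lemma box_shift j N (x : R * R) (s : R) : `|s| <= 1 -> box N (x + s *: dir R j) -> box (N + 1) x.
Proof.
move=> s1 /(boxP' _ j); rewrite comp_shift comp_shiftN => -[h1 h2]; apply/(boxP' _ j); split; last by lra.
have := ler_normB (Defs.comp j x + s) s; rewrite addrK; lra.
Qed.

(* The difference quotients of [w] have integral zero by translation invariance. *)
Lemma int_derive0 (j : bool) (w D : R * R -> R) (C C0 N : R) : Mes w -> Mes D ->
  (forall x, ~ box N x -> w x = 0) -> (forall x, `|w x| <= C0) ->
  (forall x, off j x -> is_derive x (dir R j) w (D x)) -> (forall x, off j x -> `|D x| <= C) ->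
  Int D = 0.
Proof.
move=> mw mD wN wC dw DC.
have lw : L1 L w := L1_box mw wC wN.
pose s (n : nat) : R := n.+1%:R^-1.
have s0 n : 0 < s n by rewrite invr_gt0 ltr0n.
have s1 n : s n <= 1 by rewrite invf_le1 ?ltr0n// ler1n.
pose q n x := (s n)^-1 * (w (x + s n *: dir R j) - w x).
have lq n : L1 L (q n) by apply: L1Z; apply: L1B => //; exact: L1_shift.
have Iq n : Int (q n) = 0.
  rewrite /q IntZ; last by apply: L1B => //; exact: L1_shift.
  by rewrite (IntB (L1_shift _ lw) lw) (Int_shift _ lw) subrr mulr0.
have C_ge0 : 0 <= C.
  have o : off j ((1, 1) : R * R) by rewrite /off; case: j {dw DC lq Iq q} => /=; exact: oner_neq0.
  exact: le_trans (normr_ge0 _) (DC _ o).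
have qb n x : off j x -> `|q n x| <= C * \1_(box (N + 1)) x.
  move=> ox; have [bx|bx] := pselect (box (N + 1) x).
    rewrite indicE mem_set// mulr1.
    have [c _] := MVT_all 0 (s n) (off_line dw ox).
    rewrite scale0r addr0 subr0 => e; rewrite /q e mulrC mulfK ?gt_eqF//.
    by apply: DC; rewrite off_shift.
  rewrite indicE memNset// mulr0 /q !wN ?subrr ?mulr0 ?normr0//.
    by move=> h; apply: bx; move/boxP : h => -[h1 h2]; apply/boxP; split; lra.
  by move=> h; apply: bx; apply: box_shift h; rewrite ger0_norm// ltW.
have := @DCT _ _ _ L q D (fun x => C * \1_(box (N + 1)) x) (fun n => L1_meas (lq n)) mD
  (L1Z C (L1_indic_box (N + 1))).
have a1 : {ae L, forall x, (fun n => q n x) @ \oo --> D x}.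
  apply: aeS (ae_off R j) => x ox.
  have := off_line dw ox 0; rewrite scale0r addr0 => -[dd <-].
  have /cvgr_dnbhsP /(_ s) := dd.
  have sc : (forall n, s n != 0) /\ (s @ \oo --> (0 : R)).
    by split; [move=> n; rewrite gt_eqF|exact: cvg_harmonic].
  move=> /(_ sc); apply: cvg_trans; apply: near_eq_cvg; apply: nearW => n /=; rewrite /q.
  by rewrite scale0r addr0 addr0 -[_ *: (1 : R)]/(_ * 1) mulr1.
have a2 : {ae L, forall x, forall n, `|q n x| <= C * \1_(box (N + 1)) x}.
  by apply: aeS (ae_off R j) => x ox n; exact: qb.
move=> /(_ a1 a2)[_ cv]; have e : (fun n => Int (q n)) = fun=> 0 by apply/funext.
rewrite e in cv; apply/esym; apply: (cvg_unique _ _ cv) => //; exact: cvg_cst.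
Qed.

End PlaneCalculus.

(** * Cutoff functions *)

Section Cutoff.
Variable R : realType.
Local Notation L := (@leb2 R).
Local Notation Int f := (Rintegral L setT f).
Implicit Types (f g h w : R * R -> R).

(** [Lb] functions are the multipliers of [Ct]: a product with one compactly supported bounded
    factor is integrable, which spares all growth conditions on v and its derivatives. *)
Definition Lb g := Mes g /\ forall N, exists C, forall x, box N x -> `|g x| <= C.
Definition Ct (N : R) h := [/\ Mes h, (exists C, forall x, `|h x| <= C) & forall x, ~ box N x -> h x = 0].

Lemma LbM g h : Lb g -> Lb h -> Lb (fun x => g x * h x).
Proof.
move=> [mg bg] [mh bh]; split; first exact: measurable_funM.
move=> N; have [C hC] := bg N; have [C' hC'] := bh N.
by exists (C * C') => x bx; rewrite normrM ler_pM ?hC ?hC'.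
Qed.

Lemma LbD g h : Lb g -> Lb h -> Lb (fun x => g x + h x).
Proof.
move=> [mg bg] [mh bh]; split; first exact: measurable_funD.
move=> N; have [C hC] := bg N; have [C' hC'] := bh N.
by exists (C + C') => x bx; apply: le_trans (ler_normD _ _) _; rewrite lerD ?hC ?hC'.
Qed.

Lemma Lb_bdd g (C : R) : Mes g -> (forall x, `|g x| <= C) -> Lb g.
Proof. by move=> mg hC; split => // N; exists C. Qed.

Lemma Lb_cont g : continuous g -> Lb g.
Proof. by move=> cg; split; [exact: continuous_Mes|move=> N; exact: cont_box_bounded]. Qed.

Lemma Ct_Lb N h : Ct N h -> Lb h.
Proof. by move=> [mh [C hC] _]; exact: Lb_bdd hC. Qed.

Lemma CtM N h g : Ct N h -> Lb g -> Ct N (fun x => h x * g x).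
Proof.
move=> [mh [C hC] hN] [mg bg]; split; first exact: measurable_funM.
- have [C' hC'] := bg N; have C0 : 0 <= C := le_trans (normr_ge0 _) (hC (0, 0)).
  exists (C * `|C'|) => x; have [bx|bx] := pselect (box N x).
    by rewrite normrM ler_pM// (le_trans (hC' x bx))// ler_norm.
  by rewrite hN// mul0r normr0 mulr_ge0.
- by move=> x bx; rewrite hN// mul0r.
Qed.

Lemma CtD N h g : Ct N h -> Ct N g -> Ct N (fun x => h x + g x).
Proof.
move=> [mh [C hC] hN] [mg [C' hC'] gN]; split; first exact: measurable_funD.
- by exists (C + C') => x; apply: le_trans (ler_normD _ _) _; rewrite lerD.
- by move=> x bx; rewrite hN// gN// addr0.
Qed.

Lemma CtZ N h (k : R) : Ct N h -> Ct N (fun x => k * h x).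
Proof.
move=> [mh [C hC] hN]; split; first exact: measurable_funM.
- by exists (`|k| * C) => x; rewrite normrM ler_wpM2l.
- by move=> x bx; rewrite hN// mulr0.
Qed.

Lemma Ct_L1 N h : Ct N h -> L1 L h.
Proof. by move=> [mh [C hC] hN]; exact: (L1_box mh hC hN). Qed.

Lemma Ct_L2 N h : Ct N h -> L2 L h.
Proof. by move=> [mh [C hC] hN]; exact: (L2_box mh hC hN). Qed.

Lemma Ct_int0 j N N' w D : Ct N w -> Ct N' D -> (forall x, off j x -> is_derive x (dir R j) w (D x)) -> Int D = 0.
Proof.
move=> [mw [C hC] wN] [mD [C' hC'] DN] d.
exact: (int_derive0 mw mD wN hC d (fun x _ => hC' x)).
Qed.

Lemma Int_indic_box (N : R) : 0 < N -> Int (\1_(box N) : R * R -> R) = (2 * N) ^+ 2.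
Proof.
move=> N0; rewrite /Rintegral.
have -> : (\int[L]_x (\1_(box N) x)%:E)%E = L (box N).
  by rewrite integral_indic//; [rewrite setIT|exact: measurable_box].
pose J : set (measurableTypeR R) := `]-N, N[%classic.
have -> : L (box N) = (lebesgue_measure J * lebesgue_measure J)%E.
  by apply: product_measure1E; exact: measurable_itv.
rewrite /J lebesgue_measure_itv/= lte_fin ifT; last by lra.
by rewrite -EFinB -EFinM/=; ring.
Qed.

(** The n-th function lives at scale n + 1. Only pure second derivatives are kept, as only the
    Laplacian enters; they are of order 1 / (n + 1)^2, and the weaker bound recorded here is enough
    to make them vanish in the limit. *)
Record cutoff (chi : nat -> R * R -> R) (d dd : bool -> nat -> R * R -> R) (K : R) : Prop := Cutoff {
  cutoff_ge0 : 0 <= K;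
  cutoff_Ct : forall n, Ct n.+1%:R (chi n);
  cutoff_dCt : forall j n, Ct n.+1%:R (d j n);
  cutoff_ddCt : forall j n, Ct n.+1%:R (dd j n);
  cutoff_derive : forall j n x, is_derive x (dir R j) (chi n) (d j n x);
  cutoff_derive2 : forall j n x, is_derive x (dir R j) (d j n) (dd j n x);
  cutoff_le : forall n x, `|chi n x| <= K;
  cutoff_dle : forall j n x, `|d j n x| <= K / n.+1%:R;
  cutoff_ddle : forall j n x, `|dd j n x| <= K / n.+1%:R;
  cutoff_cvg : forall x, (fun n => chi n x) @ \oo --> (1 : R) }.

(** Normalized at 0, without a plateau: the limits only need that the rescaled functions tend to 1
    pointwise and stay bounded. *)
Let kap (t : R) : R := bump (- 1) 1 1 t / bump (- 1) 1 1 0.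

Let kap00 : 0 < bump (- 1) 1 1 (0 : R).
Proof. by rewrite /bump sub0r opprK subr0 mul1r; apply: theta_gt0; rewrite mulr_gt0// theta_gt0. Qed.

Let kap0 : kap 0 = 1.
Proof. by rewrite /kap divff// gt_eqF. Qed.

Let kap_supp t : ~~ (`|t| < 1) -> kap t = 0.
Proof. by move=> h; rewrite /kap bump_supp ?mul0r// -ltr_norml. Qed.

Let Cc_kap : Cc kap.
Proof.
split; first by apply: CinfM; [exact: Cinf_bump|exact: Cinf_cst].
by exists 1 => t h; apply: kap_supp; rewrite -leNgt ltW.
Qed.

Let derive_supp (a a' : R -> R) : (forall x : R, is_derive x 1 a (a' x)) ->
  (forall t, ~~ (`|t| < 1) -> a t = 0) -> continuous a' -> forall t, ~~ (`|t| < 1) -> a' t = 0.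
Proof.
move=> da sa ca' t; rewrite -leNgt => t1.
have out (u : R) : 1 < `|u| -> a' u = 0.
  move=> u1; have d0 : is_derive u 1 a 0.
    have z : is_derive u 1 (cst (0 : R)) 0 by exact: is_derive_cst.
    apply: near_eq_is_derive z.
    have : {for u, continuous (fun v : R => `|v|)} by exact: norm_continuous.
    move/cvgr_gt => /(_ _ u1); apply: filterS => v v1; apply/esym/sa; by rewrite -leNgt ltW.
  by have [_ <-] := da u; have [_ ->] := d0.
move: t1; rewrite le_eqVlt => /orP[/eqP e|]; last exact: out.
(* At |t| = 1 the derivative vanishes by continuity from outside, so that all derivatives share the
   open support box. *)
have c1 : (fun n : nat => a' (t * (1 + n.+1%:R^-1))) @ \oo --> a' (t * (1 + 0)).
  apply: (cvg_comp (fun n : nat => t * (1 + n.+1%:R^-1)) a'); last exact: ca'.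
  by apply: cvgM; [exact: cvg_cst|apply: cvgD; [exact: cvg_cst|exact: cvg_harmonic]].
rewrite addr0 mulr1 in c1.
have e0 : (fun n : nat => a' (t * (1 + n.+1%:R^-1))) = fun=> 0.
  apply/funext => n; apply: out; rewrite normrM -e mul1r.
  have h : 0 < n.+1%:R^-1 :> R by rewrite invr_gt0 ltr0n.
  by move: (n.+1%:R^-1) h => v v0; rewrite gtr0_norm; lra.
by rewrite e0 in c1; apply/esym; apply: (cvg_unique _ (cvg_cst _) c1).
Qed.

Lemma cutoff_exists : exists chi d dd K, cutoff chi d dd K.
Proof.
have [k1 dk Ck1] := Cc_derive Cc_kap; have [k2 dk1 Ck2] := Cc_derive Ck1.
have [A hA] := Cc_bounded Cc_kap; have [A1 hA1] := Cc_bounded Ck1; have [A2 hA2] := Cc_bounded Ck2.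
have ck (a : R -> R) : Cc a -> continuous a by move=> [ca _]; exact: Cinf_cont.
have s1 := derive_supp dk kap_supp (ck _ Ck1).
have s2 := derive_supp dk1 s1 (ck _ Ck2).
pose sc0 (N : R) (k : nat) (a : R -> R) (t : R) : R := N ^- k * a (t / N).
pose sc (n k : nat) (a : R -> R) (t : R) : R := sc0 n.+1%:R k a t.
have n0 n : 0 < n.+1%:R :> R by rewrite ltr0n.
have dsc0 (N : R) k (a a' : R -> R) (x : R) : (forall x : R, is_derive x 1 a (a' x)) -> is_derive x 1 (sc0 N k a) (sc0 N k.+1 a' x).
  move=> da.
  have d1 : is_derive x 1 (fun t : R => t / N) (N^-1).
    by refine (is_derive_eq (is_deriveM (is_derive_id x (1 : R)) (is_derive_cst (N^-1) x (1 : R))) _); rewrite /GRing.scale/= mulr0 add0r mulr1.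
  have d2 : is_derive x 1 (fun t : R => a (t / N)) (a' (x / N) * N^-1).
    exact: (is_derive_comp (f := a) (g := fun t : R => t / N) (da (x / N)) d1).
  refine (is_derive_eq (is_deriveM (is_derive_cst (N ^- k) x (1 : R)) d2) _).
  by rewrite /GRing.scale/= mulr0 addr0 /sc0 exprSr invfM mulrCA [RHS]mulrC.
have dsc n k (a a' : R -> R) (x : R) : (forall x : R, is_derive x 1 a (a' x)) -> is_derive x 1 (sc n k a) (sc n k.+1 a' x).
  by move=> da; exact: dsc0.
have csc n k a : Cc a -> continuous (sc n k a).
  move=> /ck ca x; apply: cvgM; first exact: cvg_cst.
  by apply: (cvg_comp (fun t : R => t / n.+1%:R) a); [apply: cvgM; [exact: cvg_id|exact: cvg_cst]|exact: ca].
have supp n k (a : R -> R) t : (forall t, ~~ (`|t| < 1) -> a t = 0) -> ~~ (`|t| < n.+1%:R) -> sc n k a t = 0.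
  move=> sa h; rewrite /sc /sc0 sa ?mulr0//; apply: contra h.
  by rewrite normrM normfV (gtr0_norm (n0 n)) ltr_pdivrMr// mul1r.
pose K := (`|A| + `|A1| + `|A2|) ^+ 2.
have bsc n k (a : R -> R) B t : (forall t, `|a t| <= B) -> `|sc n k a t| <= n.+1%:R ^- k * `|B|.
  move=> hB; rewrite /sc /sc0 normrM ger0_norm ?invr_ge0 ?exprn_ge0//.
  by rewrite ler_wpM2l ?invr_ge0 ?exprn_ge0// (le_trans (hB _))// ler_norm.
have p0 n k : 0 <= n.+1%:R ^- k :> R by rewrite invr_ge0 exprn_ge0.
have tb n k j (a b : R -> R) A' B' x : (forall t, `|a t| <= A') -> (forall t, `|b t| <= B') ->
    `|tens j (sc n k a) (sc n 0%N b) x| <= n.+1%:R ^- k * (`|A'| * `|B'|).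
  move=> ha hb; rewrite /tens normrM mulrA.
  have := bsc n 0%N b B' (Defs.comp (~~ j) x) hb; rewrite expr0 invr1 mul1r => h.
  by apply: ler_pM => //; exact: bsc.
have Ctt n k j (a b : R -> R) : Cc a -> Cc b -> (forall t, ~~ (`|t| < 1) -> a t = 0) -> (forall t, ~~ (`|t| < 1) -> b t = 0) ->
    Ct n.+1%:R (tens j (sc n k a) (sc n 0%N b)).
  move=> Ca Cb sa sb; split.
  - by apply: tens_meas; exact: csc.
  - have [A' hA'] := Cc_bounded Ca; have [B' hB'] := Cc_bounded Cb.
    by exists (n.+1%:R ^- k * (`|A'| * `|B'|)) => x; exact: tb.
  - move=> x nb; rewrite /tens.
    have [h1|h1] := boolP (`|Defs.comp j x| < n.+1%:R); last by rewrite (supp _ _ _ _ sa h1) mul0r.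
    have [h2|h2] := boolP (`|Defs.comp (~~ j) x| < n.+1%:R); last by rewrite (supp _ _ _ _ sb h2) mulr0.
    by case: nb; apply/(boxP' _ j).
have aa : `|A| * `|A| <= K.
  have h1 := normr_ge0 A; have h2 := normr_ge0 A1; have h3 := normr_ge0 A2; rewrite /K.
  have := mulr_ge0 h1 h2; have := mulr_ge0 h1 h3; have := mulr_ge0 h2 h3; have := sqr_ge0 `|A1|; have := sqr_ge0 `|A2|; lra.
have aa1 : `|A1| * `|A| <= K.
  have h1 := normr_ge0 A; have h2 := normr_ge0 A1; have h3 := normr_ge0 A2; rewrite /K.
  have := mulr_ge0 h1 h2; have := mulr_ge0 h1 h3; have := mulr_ge0 h2 h3; have := sqr_ge0 `|A1|; have := sqr_ge0 `|A2|; have := sqr_ge0 `|A|; lra.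
have aa2 : `|A2| * `|A| <= K.
  have h1 := normr_ge0 A; have h2 := normr_ge0 A1; have h3 := normr_ge0 A2; rewrite /K.
  have := mulr_ge0 h1 h2; have := mulr_ge0 h1 h3; have := mulr_ge0 h2 h3; have := sqr_ge0 `|A1|; have := sqr_ge0 `|A2|; have := sqr_ge0 `|A|; lra.
have chiE n : tens true (sc n 0%N kap) (sc n 0%N kap) = tens false (sc n 0%N kap) (sc n 0%N kap) :> (R * R -> R).
  by apply/funext => x; exact: mulrC.
exists (fun n => tens true (sc n 0%N kap) (sc n 0%N kap)), (fun j n => tens j (sc n 1%N k1) (sc n 0%N kap)),
  (fun j n => tens j (sc n 2%N k2) (sc n 0%N kap)), K; split.
- exact: sqr_ge0.
- by move=> n; exact: Ctt.
- by move=> j n; exact: Ctt.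
- by move=> j n; exact: Ctt.
- move=> j n x; have -> : tens true (sc n 0%N kap) (sc n 0%N kap) = tens j (sc n 0%N kap) (sc n 0%N kap) :> (R * R -> R).
    by case: j; rewrite ?chiE.
  by apply: tens_derive; exact: dsc.
- by move=> j n x; apply: tens_derive; exact: dsc.
- move=> n x; apply: le_trans (tb n 0%N _ _ _ _ _ x hA hA) _; by rewrite expr0 invr1 mul1r.
- move=> j n x; apply: le_trans (tb n 1%N _ _ _ _ _ x hA1 hA) _; by rewrite expr1 mulrC ler_wpM2r// invr_ge0.
- move=> j n x; apply: le_trans (tb n 2%N _ _ _ _ _ x hA2 hA) _; rewrite mulrC; apply: ler_pM => //.
  rewrite lef_pV2 ?posrE ?exprn_gt0// expr2 ler_peMr// ler1n//.
- move=> x; rewrite /tens.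
  have h t : (fun n => sc n 0%N kap t) @ \oo --> (1 : R).
    have -> : (fun n => sc n 0%N kap t) = (fun n => kap (t * n.+1%:R^-1)).
      by apply/funext => n; rewrite /sc /sc0 expr0 invr1 mul1r.
    have c0 : (fun n : nat => t * n.+1%:R^-1) @ \oo --> (0 : R).
      by rewrite -[X in _ --> X](mulr0 t); apply: cvgM; [exact: cvg_cst|exact: cvg_harmonic].
    have ck0 : kap x @[x --> (0 : R)] --> (1 : R) by have := ck _ Cc_kap 0; rewrite /continuous_at kap0.
    exact: (cvg_comp (fun n : nat => t * n.+1%:R^-1) kap c0 ck0).
  by rewrite -[X in _ --> X](mulr1 1); apply: cvgM; exact: h.
Qed.

End Cutoff.

(** * Critical points *)

Section Scalar.
Variable R : realType.
Local Notation L := (@leb2 R).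
Local Notation Int f := (Rintegral L setT f).
Variables (v f V : R * R -> R) (D DD : bool -> R * R -> R) (H c0 Vb R0 : R).
Variables (chi : nat -> R * R -> R) (d dd : bool -> nat -> R * R -> R) (K : R).
Hypotheses (cut : cutoff chi d dd K).
Hypotheses (mv : Mes v) (vH : forall x, `|v x| <= H) (LbDj : forall j, Lb (D j)) (LbDD : forall j, Lb (DD j))
  (mV : Mes V) (VVb : forall x, `|V x| <= Vb) (c00 : 0 < c0) (R00 : 0 < R0) (Vc0 : forall x, ~ box R0 x -> c0 <= V x)
  (lf : L1 L f) (dv : forall j x, off j x -> is_derive x (dir R j) v (D j x))
  (dD : forall j x, off j x -> is_derive x (dir R j) (D j) (DD j x))
  (eqn : forall x, DD true x + DD false x = V x * v x - f x).

Let Lbv : Lb v := Lb_bdd mv vH.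
Let LbV : Lb V := Lb_bdd mV VVb.
Let K0 : 0 <= K := cutoff_ge0 cut.
Let H0 : 0 <= H := le_trans (normr_ge0 _) (vH (0, 0)).
Let Cchi n := cutoff_Ct cut n.
Let Cd j n := cutoff_dCt cut j n.
Let Lchi n := Ct_Lb (Cchi n).
Let Ld j n := Ct_Lb (Cd j n).

Let Cgrad j n : Ct n.+1%:R (fun x => chi n x * (chi n x * (D j x * D j x))).
Proof. by apply: CtM => //; apply: LbM => //; exact: LbM. Qed.
Let CvDD j n : Ct n.+1%:R (fun x => chi n x * (chi n x * (v x * DD j x))).
Proof. by apply: CtM => //; apply: LbM => //; exact: LbM. Qed.
Let Ccross j n : Ct n.+1%:R (fun x => chi n x * (d j n x * (v x * D j x))).
Proof. by apply: CtM => //; apply: LbM => //; exact: LbM. Qed.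
Let Cdv j n : Ct n.+1%:R (fun x => d j n x * (d j n x * (v x * v x))).
Proof. by apply: CtM => //; apply: LbM => //; exact: LbM. Qed.

(** The j-th derivative of chi_n^2 v D_j has integral zero. *)
Lemma cutoff_parts j n : Int (fun x => chi n x * (chi n x * (D j x * D j x))) +
  Int (fun x => chi n x * (chi n x * (v x * DD j x))) = - (2 * Int (fun x => chi n x * (d j n x * (v x * D j x)))).
Proof.
pose w x := chi n x * (chi n x * (v x * D j x)).
have Cw : Ct n.+1%:R w by apply: CtM => //; apply: LbM => //; exact: LbM.
have dw x : off j x -> is_derive x (dir R j) w
   ((chi n x * (chi n x * (D j x * D j x)) + chi n x * (chi n x * (v x * DD j x))) + 2 * (chi n x * (d j n x * (v x * D j x)))).
  move=> ox; have e1 := cutoff_derive cut j n x.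
  refine (is_derive_eq (is_deriveM e1 (is_deriveM e1 (is_deriveM (dv ox) (dD ox)))) _).
  by rewrite /GRing.scale/= -[(v * D j) x]/(v x * D j x) -[(chi n * (v * D j)) x]/(chi n x * (v x * D j x)); ring.
have := Ct_int0 Cw (CtD (CtD (Cgrad j n) (CvDD j n)) (CtZ 2 (Ccross j n))) dw.
rewrite (IntD (L1D (Ct_L1 (Cgrad j n)) (Ct_L1 (CvDD j n))) (L1Z 2 (Ct_L1 (Ccross j n)))).
rewrite (IntD (Ct_L1 (Cgrad j n)) (Ct_L1 (CvDD j n))) (IntZ 2 (Ct_L1 (Ccross j n))).
by move=> h; rewrite -[LHS]subr0 -h; ring.
Qed.

Let young (a b c e : R) : - (2 * (a * (b * (c * e)))) <= 2^-1 * (a * (a * (e * e))) + 2 * (b * (b * (c * c))).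
Proof. by have := sqr_ge0 (a * e + 2 * (b * c)); lra. Qed.

(** The squared slope (K / N)^2 times the area (2N)^2 of the box: independent of n because the
    dimension is two. *)
Let dvbound j n : Int (fun x => d j n x * (d j n x * (v x * v x))) <= 4 * (K ^+ 2 * H ^+ 2).
Proof.
have N0 : 0 < n.+1%:R :> R by rewrite ltr0n.
have h x : d j n x * (d j n x * (v x * v x)) <= (K / n.+1%:R) ^+ 2 * H ^+ 2 * \1_(box n.+1%:R) x.
  have [bx|bx] := pselect (box n.+1%:R x).
    rewrite indicE mem_set// mulr1.
    have -> : d j n x * (d j n x * (v x * v x)) = `|d j n x| ^+ 2 * `|v x| ^+ 2.
      by rewrite !real_normK ?num_real//; ring.
    by apply: ler_pM; rewrite ?exprn_ge0// lerXn2r ?nnegrE// ?divr_ge0// ?(cutoff_dle cut)// ltW.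
  rewrite indicE memNset// mulr0; have [_ _ ->//] := Cd j n; by rewrite mul0r.
have := Int_le (Ct_L1 (Cdv j n)) (L1Z ((K / n.+1%:R) ^+ 2 * H ^+ 2) (L1_indic_box n.+1%:R)) h.
rewrite (IntZ _ (L1_indic_box n.+1%:R)) (Int_indic_box N0) => /le_trans; apply.
move: (n.+1%:R : R) N0 => N N0; rewrite le_eqVlt; apply/orP; left; apply/eqP.
by field; rewrite gt_eqF.
Qed.

Let lap n : Int (fun x => chi n x * (chi n x * (v x * DD true x))) + Int (fun x => chi n x * (chi n x * (v x * DD false x)))
  = Int (fun x => chi n x * (chi n x * (v x * (V x * v x - f x)))).
Proof.
rewrite -(IntD (Ct_L1 (CvDD true n)) (Ct_L1 (CvDD false n))); apply: Int_ext => x.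
by rewrite -eqn; ring.
Qed.

Let lchi2 n (h : R * R -> R) : L1 L h -> L1 L (fun x => chi n x * (chi n x * h x)).
Proof.
move=> lh; have [m1 _] := Lchi n.
by apply: (L1_bdd _ m1 (cutoff_le cut n)); apply: (L1_bdd lh m1 (cutoff_le cut n)).
Qed.

Let lvf : L1 L (fun x => v x * f x) := L1_bdd lf mv vH.

(** The equation is tested with chi_n^2 v. The cross term is absorbed by [young], up to the cutoff
    term, which [dvbound] controls using only that v is bounded; f is paired with the bounded v. The
    estimate is uniform in n, and Fatou's lemma gives integrability. *)
Lemma caccioppoli : L1 L (fun x => 2^-1 * (D true x ^+ 2 + D false x ^+ 2) + c0 * v x ^+ 2).
Proof.
pose cB := (c0 + Vb) * (K ^+ 2 * H ^+ 2).
pose F n x := chi n x ^+ 2 * (2^-1 * (D true x ^+ 2 + D false x ^+ 2) + c0 * v x ^+ 2).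
pose Const := Int (fun x => K ^+ 2 * `|v x * f x|) + 4 * (4 * (K ^+ 2 * H ^+ 2)) + Int (fun x => cB * \1_(box R0) x).
have Vb0 : 0 <= Vb := le_trans (normr_ge0 _) (VVb (0, 0)).
have lF n : L1 L (F n).
  have -> : F n = (fun x => (2^-1 * (chi n x * (chi n x * (D true x * D true x))) + 2^-1 * (chi n x * (chi n x * (D false x * D false x))))
       + c0 * (chi n x * (chi n x * (v x * v x)))).
    by apply/funext => x; rewrite /F; ring.
  apply: L1D; first by apply: L1D; apply: L1Z; exact: Ct_L1 (Cgrad _ n).
  by apply: L1Z; apply: (@Ct_L1 _ n.+1%:R); apply: CtM => //; apply: LbM => //; exact: LbM.
have bound n : Int (F n) <= Const.
  pose G x := (2^-1 * (chi n x * (chi n x * (D true x * D true x))) + 2^-1 * (chi n x * (chi n x * (D false x * D false x))))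
      + chi n x * (chi n x * (v x * (V x * v x - f x))).
  have lVf : L1 L (fun x => chi n x * (chi n x * (v x * (V x * v x - f x)))).
    have -> : (fun x => chi n x * (chi n x * (v x * (V x * v x - f x)))) =
      (fun x => chi n x * (chi n x * (v x * DD true x)) + chi n x * (chi n x * (v x * DD false x))).
      by apply/funext => x; rewrite -eqn; ring.
    exact: L1D (Ct_L1 (CvDD true n)) (Ct_L1 (CvDD false n)).
  have lG : L1 L G.
    by apply: L1D lVf; apply: L1D; apply: L1Z; exact: Ct_L1 (Cgrad _ n).
  have IG : Int G <= 4 * (4 * (K ^+ 2 * H ^+ 2)).
    have p1 := cutoff_parts true n; have p2 := cutoff_parts false n.
    rewrite (IntD (L1D (L1Z 2^-1 (Ct_L1 (Cgrad true n))) (L1Z 2^-1 (Ct_L1 (Cgrad false n)))) lVf).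
    rewrite (IntD (L1Z 2^-1 (Ct_L1 (Cgrad true n))) (L1Z 2^-1 (Ct_L1 (Cgrad false n)))).
    rewrite !(IntZ 2^-1 (Ct_L1 (Cgrad _ n))) -lap.
    have yj j : - (2 * Int (fun x => chi n x * (d j n x * (v x * D j x)))) <=
       2^-1 * Int (fun x => chi n x * (chi n x * (D j x * D j x))) + 2 * (4 * (K ^+ 2 * H ^+ 2)).
      have := Int_le (L1N (L1Z 2 (Ct_L1 (Ccross j n)))) (L1D (L1Z 2^-1 (Ct_L1 (Cgrad j n))) (L1Z 2 (Ct_L1 (Cdv j n))))
        (fun x => young (chi n x) (d j n x) (v x) (D j x)).
      rewrite (IntN (L1Z 2 (Ct_L1 (Ccross j n)))) (IntZ 2 (Ct_L1 (Ccross j n))).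
      rewrite (IntD (L1Z 2^-1 (Ct_L1 (Cgrad j n))) (L1Z 2 (Ct_L1 (Cdv j n)))) (IntZ 2^-1 (Ct_L1 (Cgrad j n))) (IntZ 2 (Ct_L1 (Cdv j n))).
      have := dvbound j n; lra.
    have := yj true; have := yj false; lra.
  have FG x : F n x <= G x + (K ^+ 2 * `|v x * f x| + cB * \1_(box R0) x).
    have ck : chi n x ^+ 2 <= K ^+ 2.
      by rewrite -[leLHS]real_normK ?num_real// lerXn2r ?nnegrE// (cutoff_le cut).
    have c20 := sqr_ge0 (chi n x).
    have h1 : chi n x ^+ 2 * (v x * f x) <= K ^+ 2 * `|v x * f x|.
      by apply: le_trans (ler_wpM2l c20 (ler_norm _)) _; rewrite ler_wpM2r.
    (* Inside the box [R0] the potential may be below c0; the deficit is bounded there and is paid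
       by the integrable [cB] term. *)
    have h2 : chi n x ^+ 2 * (c0 * v x ^+ 2) <= chi n x ^+ 2 * (V x * v x ^+ 2) + cB * \1_(box R0) x.
      have [bx|bx] := pselect (box R0 x).
        rewrite indicE mem_set// mulr1 /cB.
        have v2 : v x ^+ 2 <= H ^+ 2 by rewrite -[leLHS]real_normK ?num_real// lerXn2r ?nnegrE.
        have e1 : chi n x ^+ 2 * v x ^+ 2 <= K ^+ 2 * H ^+ 2 by rewrite ler_pM ?sqr_ge0.
        have e2 : c0 - V x <= c0 + Vb by have := VVb x; rewrite ler_norml => /andP[]; lra.
        have c0Vb : 0 <= c0 + Vb by rewrite addr_ge0// ltW.
        have e3 : (c0 - V x) * (chi n x ^+ 2 * v x ^+ 2) <= (c0 + Vb) * (chi n x ^+ 2 * v x ^+ 2).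
          by rewrite ler_wpM2r// mulr_ge0 ?sqr_ge0.
        have e4 := ler_wpM2l c0Vb e1; lra.
      by rewrite indicE memNset// mulr0 addr0 ler_wpM2l// ler_wpM2r ?sqr_ge0// Vc0.
    rewrite /F /G; lra.
  have l2 : L1 L (fun x => K ^+ 2 * `|v x * f x|) by apply: L1Z; exact: L1_abs.
  have l3 : L1 L (fun x => cB * \1_(box R0) x) by apply: L1Z; exact: L1_indic_box.
  have := Int_le (lF n) (L1D lG (L1D l2 l3)) FG; rewrite (IntD lG (L1D l2 l3)) (IntD l2 l3) => /le_trans; apply.
  by rewrite /Const [leRHS]addrAC [leRHS]addrC lerD2r.
have mD j : Mes (D j) by case: (LbDj j).
have m2 (h : R * R -> R) : Mes h -> Mes (fun x => h x ^+ 2) by move=> mh; exact: measurable_funX.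
have := @Fatou _ _ _ L F (fun x => 2^-1 * (D true x ^+ 2 + D false x ^+ 2) + c0 * v x ^+ 2) (fun=> Const) Const lF.
case=> //.
- move=> n x; rewrite /F mulr_ge0 ?sqr_ge0// addr_ge0// mulr_ge0 ?sqr_ge0 ?(ltW c00)//.
  by rewrite addr_ge0// sqr_ge0.
- apply: measurable_funD; first by apply: measurable_funM => //; apply: measurable_funD; exact: m2.
  by apply: measurable_funM => //; exact: m2.
- apply: aeT => x; rewrite /F -[X in _ --> X]mul1r; apply: cvgM; last exact: cvg_cst.
  rewrite -(expr1n R 2); have := cutoff_cvg cut x.
  by move=> h; rewrite expr2; apply: (cvgM h h).
- exact: cvg_cst.
- move=> x; rewrite addr_ge0// mulr_ge0 ?sqr_ge0 ?(ltW c00)//.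
  by rewrite addr_ge0// sqr_ge0.
Qed.

Lemma sol_L2 : L2 L v.
Proof.
split=> //; apply: (@L1_dom _ _ _ L _ (fun x => c0^-1 * (2^-1 * (D true x ^+ 2 + D false x ^+ 2) + c0 * v x ^+ 2))).
- exact: measurable_funX.
- by apply: L1Z; exact: caccioppoli.
- move=> x; rewrite ger0_norm ?sqr_ge0// mulrC ler_pdivlMr// mulrC lerDr mulr_ge0// addr_ge0 ?sqr_ge0//.
Qed.

Lemma sol_grad_L2 j : L2 L (D j).
Proof.
have [mD _] := LbDj j.
split=> //; apply: (@L1_dom _ _ _ L _ (fun x => 2 * (2^-1 * (D true x ^+ 2 + D false x ^+ 2) + c0 * v x ^+ 2))).
- exact: measurable_funX.
- by apply: L1Z; exact: caccioppoli.
- move=> x; rewrite ger0_norm ?sqr_ge0//.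
  have := mulr_ge0 (ltW c00) (sqr_ge0 (v x)); have := sqr_ge0 (D true x); have := sqr_ge0 (D false x).
  case: j {mD}; lra.
Qed.

Lemma sol_weak j : weak j v (D j).
Proof.
move=> phi [sphi [r hr]].
have cphi : continuous phi by have [] := sphi [::].
have cdphi : continuous ('D_(dir R j) phi) by have [] := sphi [:: dir R j].
have out x : ~ box (`|r| + 1) x -> r < eucl x.
  move=> nb; apply: contrapT => /negP; rewrite -leNgt => h; apply: nb.
  by apply/(boxP' _ true); split; apply: le_lt_trans (eucl_comp _ _) _; have := ler_norm r; lra.
have Cphi : Ct (`|r| + 1) phi.
  have [C hC] := cont_box_bounded (`|r| + 1) cphi.
  have z x : ~ box (`|r| + 1) x -> phi x = 0 by move=> /out/hr.
  split=> //; first exact: continuous_Mes.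
  exists `|C| => x; have [/hC h|/z ->] := pselect (box (`|r| + 1) x); last by rewrite normr0.
  exact: le_trans h (ler_norm _).
have oute : continuous (fun x : R * R => eucl x).
  move=> x; apply: (@continuous_comp _ _ _ (fun x : R * R => x.1 ^+ 2 + x.2 ^+ 2) Num.sqrt); last exact: sqrt_continuous.
  apply: cvgD; apply: cvgM; first [exact: fst_cont|exact: snd_cont].
have Cdphi : Ct (`|r| + 1) ('D_(dir R j) phi).
  have [C hC] := cont_box_bounded (`|r| + 1) cdphi.
  have z x : ~ box (`|r| + 1) x -> ('D_(dir R j) phi) x = 0.
    move=> /out h; have dz : is_derive x (dir R j) (cst (0 : R)) 0 by exact: is_derive_cst.
    have : is_derive x (dir R j) phi 0.
      apply: near_eq_is_derive dz; have /cvgr_gt /(_ _ h) := oute x.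
      by apply: filterS => y /hr ->.
    by case.
  split=> //; first exact: continuous_Mes.
  exists `|C| => x; have [/hC h|/z ->] := pselect (box (`|r| + 1) x); last by rewrite normr0.
  exact: le_trans h (ler_norm _).
have C1 : Ct (`|r| + 1) (fun x => phi x * v x) := CtM Cphi Lbv.
have C2 := CtM Cdphi Lbv; have C3 := CtM Cphi (LbDj j).
have := Ct_int0 (j := j) C1 (CtD C2 C3).
rewrite (IntD (Ct_L1 C2) (Ct_L1 C3)).
have -> : Int (fun x => v x * ('D_(dir R j) phi) x) = Int (fun x => ('D_(dir R j) phi) x * v x).
  by apply: Int_ext => x; rewrite mulrC.
have -> : Int (fun x => D j x * phi x) = Int (fun x => phi x * D j x).
  by apply: Int_ext => x; rewrite mulrC.
move=> h; apply/eqP; rewrite -addr_eq0; apply/eqP; apply: h => x ox.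
have dphi : is_derive x (dir R j) phi (('D_(dir R j) phi) x).
  by apply: derivableP; have [_] := sphi [::]; apply.
refine (is_derive_eq (is_deriveM dphi (dv ox)) _).
by rewrite /GRing.scale/= addrC mulrC.
Qed.

(** The equation tested with v itself: in the version tested with chi_n^2 v the cross term is
    O(1/n), because v D_j is now known to be integrable. *)
Lemma sol_energy : L1 L (fun x => v x * (V x * v x - f x)) /\
  Int (fun x => D true x ^+ 2) + Int (fun x => D false x ^+ 2) + Int (fun x => v x * (V x * v x - f x)) = 0.
Proof.
have lv := sol_L2; have lD := sol_grad_L2.
have lVv : L1 L (fun x => v x * (V x * v x - f x)).
  have -> : (fun x => v x * (V x * v x - f x)) = (fun x => V x * (v x * v x) - v x * f x).
    by apply/funext => x; ring.
  by apply: L1B lvf; apply: (L1_bdd _ mV VVb); exact: L2_mul.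
split=> //.
have c2 x (k : R) : (fun n => chi n x * (chi n x * k)) @ \oo --> k.
  have h := cutoff_cvg cut x; have h3 := cvgM h (cvgM h (cvg_cst k)).
  by rewrite !mul1r in h3; exact: h3.
have bd n x (k : R) : `|chi n x * (chi n x * k)| <= K * (K * `|k|).
  by rewrite !normrM; do 2! (apply: ler_pM => //; rewrite ?mulr_ge0//; try exact: (cutoff_le cut)).
have lim (h : R * R -> R) : L1 L h -> (fun n => Int (fun x => chi n x * (chi n x * h x))) @ \oo --> Int h.
  move=> lh.
  have l2 : L1 L (fun x => K * (K * `|h x|)) by apply: L1Z; apply: L1Z; exact: L1_abs.
  have [_ cv] := @DCT _ _ _ L (fun n x => chi n x * (chi n x * h x)) h (fun x => K * (K * `|h x|))
    (fun n => L1_meas (lchi2 n lh)) (L1_meas lh) l2 (aeT (fun x => c2 x (h x))) (aeT (fun x n => bd n x (h x))).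
  exact: cv.
have lDD j : L1 L (fun x => D j x * D j x) by apply: L2_mul.
have lvD j : L1 L (fun x => `|v x * D j x|) by apply: L1_abs; apply: L2_mul.
have cross j : (fun n => Int (fun x => chi n x * (d j n x * (v x * D j x)))) @ \oo --> (0 : R).
  pose C := K * K * Int (fun x => `|v x * D j x|).
  have b n : `|Int (fun x => chi n x * (d j n x * (v x * D j x)))| <= C * n.+1%:R^-1.
    apply: le_trans (Int_norm (Ct_L1 (Ccross j n))) _.
    have -> : C * n.+1%:R^-1 = Int (fun x => (K * K / n.+1%:R) * `|v x * D j x|).
      by rewrite (IntZ _ (lvD j)) /C; ring.
    apply: Int_le; [exact: L1_abs (Ct_L1 (Ccross j n))|exact: L1Z|] => x.
    rewrite normrM [`|d j n x * _|]normrM.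
    have := cutoff_le cut n x; have := cutoff_dle cut j n x => h1 h2.
    have h3 : `|d j n x| * `|v x * D j x| <= K / n.+1%:R * `|v x * D j x| by rewrite ler_wpM2r.
    have h4 := ler_pM (normr_ge0 _) (mulr_ge0 (normr_ge0 _) (normr_ge0 _)) h2 h3.
    by apply: le_trans h4 _; rewrite !mulrA.
  apply/norm_cvg0P; apply: (squeeze_cvgr (f := fun=> 0) (h := fun n => C * n.+1%:R^-1)).
  - by apply: nearW => n; rewrite normr_ge0 b.
  - exact: cvg_cst.
  - by rewrite -[X in _ --> X](mulr0 C); apply: cvgM; [exact: cvg_cst|exact: cvg_harmonic].
have e n : Int (fun x => chi n x * (chi n x * (D true x * D true x))) + Int (fun x => chi n x * (chi n x * (D false x * D false x)))
   + Int (fun x => chi n x * (chi n x * (v x * (V x * v x - f x))))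
   = - (2 * Int (fun x => chi n x * (d true n x * (v x * D true x)))) + - (2 * Int (fun x => chi n x * (d false n x * (v x * D false x)))).
  by rewrite -lap -!cutoff_parts; ring.
have c1 := cvgD (cvgD (lim _ (lDD true)) (lim _ (lDD false))) (lim _ lVv).
have c3 := cvgD (cvgN (cvgM (cvg_cst (2 : R)) (cross true))) (cvgN (cvgM (cvg_cst (2 : R)) (cross false))).
have E j : Int (fun x => D j x ^+ 2) = Int (fun x => D j x * D j x) by apply: Int_ext => x; rewrite expr2.
rewrite !E.
have c1' : (fun n => Int (fun x => chi n x * (chi n x * (D true x * D true x))) + Int (fun x => chi n x * (chi n x * (D false x * D false x)))
   + Int (fun x => chi n x * (chi n x * (v x * (V x * v x - f x))))) @ \oo --> (0 : R).
  have -> : (fun n => Int (fun x => chi n x * (chi n x * (D true x * D true x))) + Int (fun x => chi n x * (chi n x * (D false x * D false x)))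
   + Int (fun x => chi n x * (chi n x * (v x * (V x * v x - f x))))) = (fun n =>
    - (2 * Int (fun x => chi n x * (d true n x * (v x * D true x)))) + - (2 * Int (fun x => chi n x * (d false n x * (v x * D false x))))).
    by apply/funext.
  by rewrite -[X in _ --> X](_ : - (2 * 0) + - (2 * 0) = 0); [exact: c3|ring].
by apply: (cvg_unique _ _ c1') => //; exact: c1.
Qed.

End Scalar.

(** * Lower bound for the Dirichlet integral relative to a critical point *)

Section Comparison.
Variable R : realType.
Local Notation L := (@leb2 R).
Local Notation Int f := (Rintegral L setT f).

Lemma cvg_sqr (a : nat -> R) (l : R) : a @ \oo --> l -> (fun n => a n ^+ 2) @ \oo --> l ^+ 2.
Proof.
move=> h; have -> : (fun n => a n ^+ 2) = (fun n => a n * a n) by apply/funext.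
by rewrite expr2; exact: (cvgM h h).
Qed.

Lemma parts_dif2 j (p q : R * R -> R) (s : R) : L2 L p -> L2 L q ->
  L1 L (fun x => (q (x + s *: dir R j) - q x) * (p (x + s *: dir R j) - p x)) /\
  Int (fun x => (q (x + s *: dir R j) - q x) * (p (x + s *: dir R j) - p x)) = - Int (fun x => p x * dif2 j q s x).
Proof.
move=> lp lq; pose e := s *: dir R j; pose e' := (- s) *: dir R j.
have ee (x : R * R) : x + e + e' = x by rewrite /e /e' scaleNr addrK.
have ee' (x : R * R) : x + e' + e = x by rewrite /e /e' scaleNr subrK.
have lpe := L2_shift e lp; have lqe := L2_shift e lq; have lqe' := L2_shift e' lq.
have a1 := L2_mul lqe lpe; have a2 := L2_mul lq lp; have a3 := L2_mul lqe lp; have a4 := L2_mul lq lpe.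
have a5 := L2_mul lqe' lp.
have b1 : Int (fun x => q (x + e) * p (x + e)) = Int (fun x => q x * p x) := Int_shift e a2.
have b2 : Int (fun x => q x * p (x + e)) = Int (fun x => q (x + e') * p x).
  rewrite -(Int_shift e' a4); apply: Int_ext => x; by rewrite ee'.
have E1 : (fun x => (q (x + e) - q x) * (p (x + e) - p x)) =
  (fun x => (q (x + e) * p (x + e) + q x * p x) - (q (x + e) * p x + q x * p (x + e))).
  by apply/funext => x; ring.
have E2 : (fun x => p x * dif2 j q s x) = (fun x => (q (x + e) * p x + q (x + e') * p x) - 2 * (q x * p x)).
  by apply/funext => x; rewrite /dif2 -/e -/e'; ring.
rewrite -/e E1 E2; split; first exact: L1B (L1D a1 a2) (L1D a3 a4).
rewrite (IntB (L1D a1 a2) (L1D a3 a4)) (IntD a1 a2) (IntD a3 a4) (IntB (L1D a3 a5) (L1Z 2 a2)) (IntD a3 a5) (IntZ 2 a2) b1 b2.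
ring.
Qed.

Lemma dif2_Int_cvg j (p q Z : R * R -> R) C N : L2 L p -> L2 L q -> SDiff j q Z C ->
  (forall x, ~ box N x -> q x = 0) ->
  (fun n : nat => (1 / n.+1%:R) ^- 2 * Int (fun x => p x * dif2 j q (1 / n.+1%:R) x)) @ \oo --> Int (fun x => p x * Z x).
Proof.
move=> lp lq [mq mZ bd cv] qN.
pose s (n : nat) : R := 1 / n.+1%:R.
have s0 n : 0 < s n by rewrite divr_gt0.
have s1 n : s n <= 1 by rewrite /s div1r invf_le1 ?ltr0n// ler1n.
have mdif n : Mes (fun x => dif2 j q (s n) x).
  apply: measurable_funB; first by apply: measurable_funD; exact: meas_shift.
  by apply: measurable_funM.
have mp := L2_meas lp.
have ldif n : L1 L (fun x => p x * dif2 j q (s n) x).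
  have -> : (fun x => p x * dif2 j q (s n) x) = (fun x => (p x * q (x + s n *: dir R j) + p x * q (x + (- s n) *: dir R j)) - 2 * (p x * q x)).
    by apply/funext => x; rewrite /dif2; ring.
  by apply: L1B; [apply: L1D; apply: L2_mul => //; exact: L2_shift|apply: L1Z; exact: L2_mul].
pose g n x := (s n) ^- 2 * (p x * dif2 j q (s n) x).
have -> : (fun n : nat => (1 / n.+1%:R) ^- 2 * Int (fun x => p x * dif2 j q (1 / n.+1%:R) x)) = (fun n => Int (g n)).
  by apply/funext => n; rewrite /g IntZ.
have lg n : L1 L (g n) by apply: L1Z.
have C0 : 0 <= C.
  have o : off j ((1, 1) : R * R) by rewrite /off; case: j {bd cv mdif ldif g lg} => /=; exact: oner_neq0.
  have := bd 1 (1, 1); rewrite ltr01 lexx expr1n mulr1 => /(_ isT o); exact: le_trans.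
have ld : L1 L (fun x => C * `|p x * \1_(box (N + 1)) x|).
  by apply: L1Z; apply: L1_abs; apply: L2_mul => //; exact: L2_indic_box.
have a1 : {ae L, forall x, (fun n => g n x) @ \oo --> p x * Z x}.
  apply: aeS (ae_off R j) => x ox.
  have S01 : 0 < (1 : R) <= 1 by rewrite ltr01 lexx.
  have c1 := cv 1 x S01 ox.
  have c2 := cvgM (cvg_cst (p x)) c1.
  have -> : (fun n => g n x) = (fun n => p x * (dif2 j q (1 / n.+1%:R) x / (1 / n.+1%:R) ^+ 2)).
    by apply/funext => n; rewrite /g /s; ring.
  exact: c2.
have a2 : {ae L, forall x, forall n, `|g n x| <= C * `|p x * \1_(box (N + 1)) x|}.
  apply: aeS (ae_off R j) => x ox n.
  rewrite /g normrM gtr0_norm ?invr_gt0 ?exprn_gt0// mulrC ler_pdivrMr ?exprn_gt0//.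
  have [bx|bx] := pselect (box (N + 1) x).
    rewrite indicE mem_set// mulr1 normrM.
    have h := bd (s n) x (ltac:(by rewrite s0 s1)) ox.
    have := ler_wpM2l (normr_ge0 (p x)) h; lra.
  rewrite indicE memNset// mulr0 normr0 mulr0 mul0r /dif2 !qN ?mulr0 ?addr0 ?subr0 ?mulr0 ?normr0//.
  - by move=> h; apply: bx; move/boxP : h => -[h1 h2]; apply/boxP; split; lra.
  - by move=> h; apply: bx; apply: box_shift h; rewrite normrN ger0_norm// ltW.
  - by move=> h; apply: bx; apply: box_shift h; rewrite ger0_norm// ltW.
have mpZ : Mes (fun x => p x * Z x) by exact: measurable_funM.
by have [_ ] := @DCT _ _ _ L g (fun x => p x * Z x) _ (fun n => L1_meas (lg n)) mpZ ld a1 a2.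
Qed.

Variables (v g u z : R * R -> R) (D DD Z : bool -> R * R -> R) (Ku : bool -> R) (Cz C' M : R).
Variables (chi : nat -> R * R -> R) (d dd : bool -> nat -> R * R -> R) (K : R).
Hypotheses (cut : cutoff chi d dd K).
Hypotheses (lv : L2 L v) (Lbv : Lb v) (LbDj : forall j, Lb (D j)) (LbDD : forall j, Lb (DD j))
  (lD : forall j, L2 L (D j)) (lg : L2 L g)
  (dv : forall j x, off j x -> is_derive x (dir R j) v (D j x))
  (dD : forall j x, off j x -> is_derive x (dir R j) (D j) (DD j x))
  (eqn : forall x, DD true x + DD false x = g x)
  (sz : forall j, SDiff j z (Z j) Cz) (ZC : forall j x, `|Z j x| <= C') (z1 : forall x, 1 <= z x) (zM : forall x, z x <= M)
  (lu : L2 L u)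
  (hK : forall j (s : R), 0 < s <= 1 -> Int (fun x => (u (x + s *: dir R j) - u x) ^+ 2) <= s ^+ 2 * Ku j).

Let K0 : 0 <= K := cutoff_ge0 cut.
Let Cchi n := cutoff_Ct cut n.
Let Cd j n := cutoff_dCt cut j n.
Let Cdd j n := cutoff_ddCt cut j n.

Let vN n x := chi n x * v x.
Let ZN j n x := (dd j n x * v x + 2 * (d j n x * D j x)) + chi n x * DD j x.

Let CvN n : Ct n.+1%:R (vN n). Proof. exact: CtM. Qed.
Let CZN j n : Ct n.+1%:R (ZN j n).
Proof. by apply: CtD; [apply: CtD; [exact: CtM|apply: CtZ; exact: CtM]|exact: CtM]. Qed.

Let SvN j n : exists C, SDiff j (vN n) (ZN j n) C.
Proof.
have [mZ [C hC] _] := CZN j n; have [mvN _ _] := CvN n.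
exists (2 * C); apply: (@SDiff_derive _ j (vN n) (fun x => d j n x * v x + chi n x * D j x)) => //.
- move=> x ox; refine (is_derive_eq (is_deriveM (cutoff_derive cut j n x) (dv ox)) _).
  by rewrite /GRing.scale/=; ring.
- move=> x ox; have e1 := cutoff_derive cut j n x; have e2 := cutoff_derive2 cut j n x.
  refine (is_derive_eq (is_deriveD (is_deriveM e2 (dv ox)) (is_deriveM e1 (dD ox))) _).
  by rewrite /GRing.scale/= /ZN; ring.
Qed.

Let lvN n : L2 L (vN n). Proof. exact: Ct_L2 (CvN n). Qed.

(* [u - chi_n v] is estimated by Picone's identity, and the cross terms of the difference quotients of [u] and
   [chi_n v] are summed by parts onto the second differences of the regular factor [chi_n v]. *)
Lemma comparison_cut j n :
  Int (fun x => - Z j x / z x * (u x - vN n x) ^+ 2) - Int (fun x => (2 * u x - vN n x) * ZN j n x) <= Ku j.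
Proof.
have [C sv] := SvN j n; have [_ _ vN0] := CvN n.
pose p x := 2 * u x - vN n x; pose w x := u x - vN n x.
have lp : L2 L p by apply: L2B (L2Z 2 lu) (lvN n).
have lw : L2 L w by apply: L2B.
have c1 := dif2_Int_cvg lp (lvN n) sv vN0.
have S01 : 0 < (1 : R) <= 1 by rewrite ltr01 lexx.
have [_ c2] := picone_limit (sz j) ltr01 z1 zM lw S01.
apply: (cvgr_to_le (cvgB c2 c1)); apply: nearW => m /=.
have m0 : 0 < 1 / m.+1%:R :> R by rewrite divr_gt0.
have m1 : 1 / m.+1%:R <= 1 :> R by rewrite div1r invf_le1 ?ltr0n// ler1n.
set s : R := 1 / m.+1%:R in m0 m1 *.
have [li e1] := picone_identity (sz j) ltr01 z1 zM lw s.
have [lp1 e2] := parts_dif2 j s lp (lvN n).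
have h := hK j (ltac:(by rewrite m0 m1) : 0 < s <= 1).
rewrite -[_ - _]/(_ - _) -mulrBr mulrC ler_pdivrMr ?exprn_gt0// mulrC.
apply: le_trans h.
have lws : L1 L (fun x => (w (x + s *: dir R j) - w x) ^+ 2).
  by apply: L2_sq; apply: L2B => //; exact: L2_shift.
have -> : (fun x => (u (x + s *: dir R j) - u x) ^+ 2) = (fun x => (w (x + s *: dir R j) - w x) ^+ 2
   + (vN n (x + s *: dir R j) - vN n x) * (p (x + s *: dir R j) - p x)).
  by apply/funext => x; rewrite /w /p; ring.
rewrite (IntD lws lp1) e1 e2 lerD2r lerDl.
apply: Int_ge0 => x; rewrite /picrest mulr_ge0 ?sqr_ge0// mulr_ge0// (le_trans ler01)//.
Qed.

Let small (h : nat -> R) : (forall n, `|h n| <= K / n.+1%:R) -> h @ \oo --> (0 : R).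
Proof.
move=> hh; apply/norm_cvg0P; apply: (squeeze_cvgr (f := fun=> 0) (h := fun n => K * n.+1%:R^-1)).
- by apply: nearW => n; rewrite normr_ge0 hh.
- exact: cvg_cst.
- by rewrite -[X in _ --> X](mulr0 K); apply: cvgM; [exact: cvg_cst|exact: cvg_harmonic].
Qed.

(** Formally |grad u|^2 = |grad (u - v)|^2 + grad v . grad (2u - v); Picone's identity bounds the
    first term and parts turns the second into - (2u - v) Lap v. In the limit of [comparison_cut],
    Lap (chi_n v) is chi_n g plus terms of order 1/n in v and grad v. *)
Lemma comparison :
  [/\ L1 L (fun x => - (Z true x + Z false x) / z x * (u x - v x) ^+ 2), L1 L (fun x => (2 * u x - v x) * g x) &
  Int (fun x => - (Z true x + Z false x) / z x * (u x - v x) ^+ 2) - Int (fun x => (2 * u x - v x) * g x)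
  <= Ku true + Ku false].
Proof.
have mv := L2_meas lv; have mu := L2_meas lu; have mg := L2_meas lg.
have mz : Mes z by have [] := sz true.
have mZ j : Mes (Z j) by have [] := sz j.
have C0 : 0 <= C' := le_trans (normr_ge0 _) (ZC true (0, 0)).
have z0 x : 0 < z x := lt_le_trans ltr01 (z1 x).
have mchi n : Mes (chi n) by have [] := Cchi n.
have mvN n : Mes (vN n) by have [] := CvN n.
have mZN j n : Mes (ZN j n) by have [] := CZN j n.
pose A n x := - (Z true x + Z false x) / z x * (u x - vN n x) ^+ 2.
pose A0 x := - (Z true x + Z false x) / z x * (u x - v x) ^+ 2.
pose P n x := (2 * u x - vN n x) * (ZN true n x + ZN false n x).
pose P0 x := (2 * u x - v x) * g x.
have mcoef : Mes (fun x => - (Z true x + Z false x) / z x).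
  apply: (@measurable_fun_div _ (plane R) _ _ _ _ mz).
  by apply: measurableT_comp => //; exact: (measurable_funD (mZ true) (mZ false)).
have coefb x : `|- (Z true x + Z false x) / z x| <= 2 * C'.
  rewrite normrM normrN (gtr0_norm (_ : 0 < (z x)^-1)) ?invr_gt0//.
  have h1 : `|Z true x + Z false x| <= 2 * C'.
    by apply: le_trans (ler_normD _ _) _; have := ZC true x; have := ZC false x; lra.
  rewrite -[leRHS]mulr1; apply: ler_pM => //; first by rewrite invr_ge0 ltW.
  by rewrite invf_le1.
have vNc x : (fun n => vN n x) @ \oo --> v x.
  have h := cvgM (cutoff_cvg cut x) (cvg_cst (v x)); rewrite mul1r in h; exact: h.
have vNb n x : `|vN n x| <= K * `|v x| by rewrite normrM ler_wpM2r// (cutoff_le cut).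
have lA : L1 L A0 /\ (fun n => Int (A n)) @ \oo --> Int A0.
  apply: (@DCT _ _ _ L A A0 (fun x => (2 * C') * (2 * u x ^+ 2 + (2 * K ^+ 2) * v x ^+ 2))).
  - by move=> n; apply: measurable_funM => //; apply: measurable_funX; exact: measurable_funB.
  - by apply: measurable_funM => //; apply: measurable_funX; exact: measurable_funB.
  - by apply: L1Z; apply: L1D; apply: L1Z; exact: L2_sq.
  - apply: aeT => x; apply: cvgM; first exact: cvg_cst.
    have h : (fun n => u x - vN n x) @ \oo --> u x - v x := cvgB (cvg_cst (u x)) (vNc x).
    have h2 : (fun n => (u x - vN n x) ^+ 2) @ \oo --> (u x - v x) ^+ 2 by apply: cvg_sqr; exact: h.
    exact: h2.
  - apply: aeT => x n; rewrite normrM; apply: ler_pM => //.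
    rewrite ger0_norm ?sqr_ge0//.
    have h : vN n x ^+ 2 <= K ^+ 2 * v x ^+ 2.
      rewrite -[leLHS]real_normK ?num_real// -[v x ^+ 2]real_normK ?num_real// -exprMn.
      by rewrite lerXn2r ?nnegrE// mulr_ge0.
    have := sqr_ge0 (u x + vN n x); lra.
have lP : L1 L P0 /\ (fun n => Int (P n)) @ \oo --> Int P0.
  pose Q x := 2 * `|u x| + K * `|v x|.
  pose S x := (K * `|g x| + (2 * K) * `|v x|) + ((2 * K) * `|D true x| + (2 * K) * `|D false x|).
  have ab (h : R * R -> R) : L2 L h -> L2 L (fun x => `|h x|).
    by move=> lh; apply: (L2_dom _ lh) => [|x]; [exact: measurableT_comp (L2_meas lh)|rewrite normr_id].
  have lQ : L2 L Q by apply: L2D; apply: L2Z; exact: ab.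
  have lS : L2 L S by apply: L2D; apply: L2D; apply: L2Z; exact: ab.
  have E n x : ZN true n x + ZN false n x = (chi n x * g x + (dd true n x + dd false n x) * v x) +
     (2 * d true n x * D true x + 2 * d false n x * D false x).
    by rewrite -eqn /ZN; ring.
  have n1 n : K / n.+1%:R <= K by rewrite ler_pdivrMr ?ltr0n// ler_peMr// ler1n.
  apply: (@DCT _ _ _ L P P0 (fun x => Q x * S x)).
  - by move=> n; apply: measurable_funM; [apply: measurable_funB => //; exact: measurable_funM|exact: measurable_funD].
  - by apply: measurable_funM => //; apply: measurable_funB => //; exact: measurable_funM.
  - exact: L2_mul.
  - apply: aeT => x; apply: cvgM; first by apply: cvgB; [exact: cvg_cst|exact: vNc].
    have -> : (fun n => ZN true n x + ZN false n x) = (fun n => (chi n x * g x + (dd true n x + dd false n x) * v x) +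
     (2 * d true n x * D true x + 2 * d false n x * D false x)).
      by apply/funext => n; exact: E.
    have t1 j := small (fun n => cutoff_ddle cut j n x).
    have t2 j := small (fun n => cutoff_dle cut j n x).
    have h := cvgD (cvgD (cvgM (cutoff_cvg cut x) (cvg_cst (g x))) (cvgM (cvgD (t1 true) (t1 false)) (cvg_cst (v x))))
      (cvgD (cvgM (cvgM (cvg_cst (2 : R)) (t2 true)) (cvg_cst (D true x))) (cvgM (cvgM (cvg_cst (2 : R)) (t2 false)) (cvg_cst (D false x)))).
    rewrite mul1r !mulr0 !addr0 !mul0r !addr0 in h; exact: h.
  - apply: aeT => x n; rewrite /P normrM; apply: ler_pM => //.
      apply: le_trans (ler_normB _ _) _; rewrite normrM (ger0_norm (_ : 0 <= 2 :> R))//.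
      by rewrite lerD2l; exact: vNb.
    rewrite E; apply: le_trans (ler_normD _ _) _; apply: lerD; apply: le_trans (ler_normD _ _) _; apply: lerD.
    + by rewrite normrM ler_wpM2r// (cutoff_le cut).
    + rewrite normrM ler_wpM2r//; apply: le_trans (ler_normD _ _) _.
      have h1 := le_trans (cutoff_ddle cut true n x) (n1 n).
      have h2 := le_trans (cutoff_ddle cut false n x) (n1 n).
      have -> : 2 * K = K + K by ring.
      exact: lerD.
    + rewrite normrM ler_wpM2r// normrM (ger0_norm (_ : 0 <= 2 :> R))// ler_wpM2l//.
      exact: le_trans (cutoff_dle cut true n x) (n1 n).
    + rewrite normrM ler_wpM2r// normrM (ger0_norm (_ : 0 <= 2 :> R))// ler_wpM2l//.
      exact: le_trans (cutoff_dle cut false n x) (n1 n).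
have [lA0 cA] := lA; have [lP0 cP] := lP; split => //.
apply: (cvgr_to_le (cvgB cA cP)); apply: nearW => n.
change (Int (A n) - Int (P n) <= Ku true + Ku false).
have lw : L2 L (fun x => u x - vN n x) by apply: L2B.
have S01 : 0 < (1 : R) <= 1 by rewrite ltr01 lexx.
have l1 j : L1 L (fun x => - Z j x / z x * (u x - vN n x) ^+ 2).
  by have [] := picone_limit (sz j) ltr01 z1 zM lw S01.
have l2 j : L1 L (fun x => (2 * u x - vN n x) * ZN j n x).
  by apply: L2_mul; [apply: L2B => //; exact: L2Z|exact: Ct_L2 (CZN j n)].
have -> : A n = (fun x => - Z true x / z x * (u x - vN n x) ^+ 2 + - Z false x / z x * (u x - vN n x) ^+ 2).
  by apply/funext => x; rewrite /A; ring.
have -> : P n = (fun x => (2 * u x - vN n x) * ZN true n x + (2 * u x - vN n x) * ZN false n x).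
  by apply/funext => x; rewrite /P; ring.
rewrite (IntD (l1 true) (l1 false)) (IntD (l2 true) (l2 false)).
have := comparison_cut true n; have := comparison_cut false n; lra.
Qed.

End Comparison.

(** * Radial functions *)

Section RadialFun.
Variable R : realType.
Implicit Types x : R * R.

Lemma eucl_ge0 x : 0 <= eucl x. Proof. exact: sqrtr_ge0. Qed.

Lemma eucl_sqr x : eucl x ^+ 2 = x.1 ^+ 2 + x.2 ^+ 2.
Proof. by rewrite sqr_sqrtr// addr_ge0// sqr_ge0. Qed.

Lemma eucl_gt0 j x : off j x -> 0 < eucl x.
Proof.
rewrite /off -normr_gt0 => h; exact: lt_le_trans h (eucl_comp _ _).
Qed.

Lemma eucl_cont : continuous (@eucl R).
Proof.
move=> x; apply: (@continuous_comp _ _ _ (fun x : R * R => x.1 ^+ 2 + x.2 ^+ 2) Num.sqrt); last exact: sqrt_continuous.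
apply: cvgD; apply: cvgM; first [exact: fst_cont|exact: snd_cont].
Qed.

Lemma radial_cont (a : R -> R) : continuous a -> continuous (fun x : R * R => a (eucl x)).
Proof. by move=> ca x; apply: (@continuous_comp _ _ _ (@eucl R) a); [exact: eucl_cont|exact: ca]. Qed.

Lemma comp_cont i : continuous (fun x : R * R => Defs.comp i x).
Proof. by case: i; [exact: fst_cont|exact: snd_cont]. Qed.

Lemma comp_derive (i j : bool) x : is_derive x (dir R j) (fun x : R * R => Defs.comp i x) (i == j)%:R.
Proof.
have := (@line_derive _ _ (fun x : R * R => Defs.comp i x) x (dir R j) 0 (i == j)%:R).1.
rewrite scale0r addr0; apply.
have did : is_derive (0 : R) 1 (fun h : R => h) 1 by exact: is_derive_id.
have [->|ij] := eqVneq i j.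
  have -> : (fun h : R => Defs.comp j (x + h *: dir R j)) = (fun h => Defs.comp j x + h).
    by apply/funext => h; rewrite comp_shift.
  by refine (is_derive_eq (is_deriveD (is_derive_cst (Defs.comp j x) (0 : R) (1 : R)) did) _); rewrite add0r.
have -> : (fun h : R => Defs.comp i (x + h *: dir R j)) = (fun h => Defs.comp i x).
  apply/funext => h; have -> : i = ~~ j by case: i j ij => -[].
  by rewrite comp_shiftN.
exact: is_derive_cst.
Qed.

Lemma radial_derive j (a : R -> R) (a' : R) x : off j x -> is_derive (eucl x) 1 a a' ->
  is_derive x (dir R j) (fun x : R * R => a (eucl x)) (Defs.comp j x / eucl x * a').
Proof.
move=> ox da; have e0 := eucl_gt0 ox.
have := (@line_derive _ _ (fun x : R * R => a (eucl x)) x (dir R j) 0 (Defs.comp j x / eucl x * a')).1.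
rewrite scale0r addr0; apply.
pose q (h : R) := (Defs.comp j x + h) ^+ 2 + Defs.comp (~~ j) x ^+ 2.
have eq h : eucl (x + h *: dir R j) = Num.sqrt (q h).
  rewrite /eucl /q -(comp_shift j x h) -(comp_shiftN j x h); congr Num.sqrt.
  by case: j {ox q} => //=; rewrite addrC.
have q0 : Num.sqrt (q 0) = eucl x by rewrite -eq scale0r addr0.
have qp : 0 < q 0 by rewrite -sqrtr_gt0 q0.
have -> : (fun h : R => a (eucl (x + h *: dir R j))) = (fun h => a (Num.sqrt (q h))).
  by apply/funext => h; rewrite eq.
have did : is_derive (0 : R) 1 (fun h : R => Defs.comp j x + h) 1.
  by refine (is_derive_eq (is_deriveD (is_derive_cst (Defs.comp j x) (0 : R) (1 : R)) (is_derive_id (0 : R) (1 : R))) _); rewrite add0r.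
have dq : is_derive (0 : R) 1 q (2 * Defs.comp j x).
  refine (is_derive_eq (is_deriveD (is_deriveM did did) (is_derive_cst (Defs.comp (~~ j) x ^+ 2) (0 : R) (1 : R))) _).
  by rewrite /GRing.scale/=; ring.
have ds := is_derive_comp (f := Num.sqrt) (g := q) (is_derive1_sqrt qp) dq.
rewrite q0 in ds; rewrite -q0 in da.
refine (is_derive_eq (is_derive_comp (f := a) (g := fun h => Num.sqrt (q h)) da ds) _).
by field; rewrite gt_eqF.
Qed.

(* [ang j x] is [x_j ^ 2 / |x| ^ 2]; the value at the origin keeps the sum over [j] equal to one. *)
Definition ang (j : bool) x : R := Defs.comp j x ^+ 2 / eucl x ^+ 2 + 2^-1 * \1_[set (0 : R)] (eucl x).

Lemma ang_off j i x : off j x -> ang i x = Defs.comp i x ^+ 2 / eucl x ^+ 2.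
Proof.
move=> /eucl_gt0 e0; rewrite /ang indicE memNset ?mulr0 ?addr0//= => e.
by rewrite e ltxx in e0.
Qed.

Lemma ang_sum x : ang true x + ang false x = 1.
Proof.
rewrite /ang indicE; have [e|e] := eqVneq (eucl x) 0.
  by rewrite mem_set//= e expr0n invr0 !mulr0 !add0r; field.
rewrite memNset; last by move/eqP : e.
by rewrite !mulr0 !addr0 -mulrDl/= -eucl_sqr divff// expf_neq0.
Qed.

Lemma ang_ge0 j x : 0 <= ang j x.
Proof. by rewrite addr_ge0// ?divr_ge0 ?sqr_ge0// mulr_ge0// indicE ler0n. Qed.

Lemma ang_le1 j x : `|ang j x| <= 1.
Proof.
rewrite ger0_norm ?ang_ge0//; have := ang_sum x; have := ang_ge0 true x; have := ang_ge0 false x.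
by case: j; lra.
Qed.

Lemma Lb_comp i : Lb (fun x : R * R => Defs.comp i x).
Proof. by apply: Lb_cont; exact: comp_cont. Qed.

Lemma Mes_radial (a : R -> R) : measurable_fun setT (a : measurableTypeR R -> R) -> Mes (fun x : R * R => a (eucl x)).
Proof.
by move=> ma; apply: (measurableT_comp (f := a)) => //; apply: continuous_Mes; exact: eucl_cont.
Qed.

Lemma Lb_ang j : Lb (ang j).
Proof.
apply: (@Lb_bdd _ _ 1); last exact: ang_le1.
apply: measurable_funD.
  apply: measurable_funM; first by apply: measurable_funX; exact: comp_meas.
  by apply: measurable_funV; apply: measurable_funX; apply: continuous_Mes; exact: eucl_cont.
apply: measurable_funM => //; apply: (Mes_radial (a := \1_[set (0 : R)])).
by apply: measurable_indic; exact: measurable_set1.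
Qed.

End RadialFun.

Section RadialSol.
Variable R : realType.
(** [N] is the dimension whose radial Laplacian of y is [F0]: it is 2 for y(|x|) and 4 for x_i
    y(|x|). *)
Variables (y bb F0 : R -> R) (N : R).
Hypotheses (cb : continuous bb) (cF : continuous F0)
  (dy : forall r : R, is_derive r 1 y (r * bb r))
  (db : forall r : R, r != 0 -> is_derive r 1 bb ((F0 r - N * bb r) / r)).
Implicit Types x : R * R.
Let Y x := y (eucl x).
Let B x := bb (eucl x).
Let W x := F0 (eucl x).
Let LbY : Lb Y.
Proof. by apply: Lb_cont; apply: radial_cont; apply: is_derive_cont => r; exact: dy. Qed.
Let LbB : Lb B. Proof. by apply: Lb_cont; exact: radial_cont. Qed.
Let LbW : Lb W. Proof. by apply: Lb_cont; exact: radial_cont. Qed.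
Let Lbc (k : R) : Lb (fun _ : R * R => k).
Proof. by apply: (@Lb_bdd _ _ `|k|) => // x; rewrite lexx. Qed.

Let dY j x : off j x -> is_derive x (dir R j) Y (Defs.comp j x * B x).
Proof.
move=> ox; refine (is_derive_eq (radial_derive ox (dy _)) _).
by rewrite mulrA divfK// gt_eqF// (eucl_gt0 ox).
Qed.

Let dB j x : off j x -> is_derive x (dir R j) B (Defs.comp j x / eucl x ^+ 2 * (W x - N * B x)).
Proof.
move=> ox; have e0 : eucl x != 0 by rewrite gt_eqF// (eucl_gt0 ox).
refine (is_derive_eq (radial_derive ox (db e0)) _).
by rewrite /W /B; field.
Qed.

(* Partial derivatives of [y(|x|)], then of [x_i y(|x|)]. *)
Definition sgrad (j : bool) x := Defs.comp j x * B x.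
Definition shess (j : bool) x := B x + ang j x * (W x - N * B x).

Lemma Lb_sgrad j : Lb (sgrad j). Proof. by apply: LbM LbB; exact: Lb_comp. Qed.
Lemma Lb_shess j : Lb (shess j).
Proof.
apply: LbD => //; apply: LbM; first exact: Lb_ang.
have -> : (fun x => W x - N * B x) = (fun x => W x + (- N) * B x) by apply/funext => x; ring.
by apply: LbD => //; apply: LbM.
Qed.

Lemma sgrad_derive j x : off j x -> is_derive x (dir R j) Y (sgrad j x).
Proof. exact: dY. Qed.

Lemma shess_derive j x : off j x -> is_derive x (dir R j) (sgrad j) (shess j x).
Proof.
move=> ox; refine (is_derive_eq (is_deriveM (comp_derive j j x) (dB ox)) _).
by rewrite /GRing.scale/= eqxx /shess (ang_off _ ox) -[true%:R]/(1 : R); ring.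
Qed.

Lemma shess_sum x : N = 2 -> shess true x + shess false x = W x.
Proof.
move=> N2; have -> : shess true x + shess false x = 2 * B x + (ang true x + ang false x) * (W x - N * B x).
  by rewrite /shess; ring.
by rewrite ang_sum N2; ring.
Qed.

Definition vsol (i : bool) x := Defs.comp i x * Y x.
Definition vgrad (i j : bool) x := (i == j)%:R * Y x + Defs.comp i x * (Defs.comp j x * B x).
Definition vhess (i j : bool) x :=
  2 * (i == j)%:R * (Defs.comp j x * B x) + Defs.comp i x * B x + Defs.comp i x * (ang j x * (W x - N * B x)).

Lemma Lb_vsol i : Lb (vsol i). Proof. by apply: LbM LbY; exact: Lb_comp. Qed.
Lemma Lb_vgrad i j : Lb (vgrad i j).
Proof.
by apply: LbD; apply: LbM => //; [exact: Lb_comp|apply: LbM => //; exact: Lb_comp].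
Qed.
Lemma Lb_vhess i j : Lb (vhess i j).
Proof.
apply: LbD; first apply: LbD.
- by apply: LbM => //; apply: LbM => //; exact: Lb_comp.
- by apply: LbM => //; exact: Lb_comp.
- apply: LbM; first exact: Lb_comp.
  apply: LbM; first exact: Lb_ang.
  have -> : (fun x => W x - N * B x) = (fun x => W x + (- N) * B x) by apply/funext => x; ring.
  by apply: LbD => //; apply: LbM.
Qed.

Lemma vgrad_derive i j x : off j x -> is_derive x (dir R j) (vsol i) (vgrad i j x).
Proof.
move=> ox; refine (is_derive_eq (is_deriveM (comp_derive i j x) (dY ox)) _).
by rewrite /GRing.scale/= /vgrad; ring.
Qed.

Lemma vhess_derive i j x : off j x -> is_derive x (dir R j) (vgrad i j) (vhess i j x).
Proof.
move=> ox.
have d1 := is_deriveM (is_derive_cst ((i == j)%:R : R) x (dir R j)) (dY ox).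
have d2 := is_deriveM (comp_derive i j x) (is_deriveM (comp_derive j j x) (dB ox)).
refine (is_derive_eq (is_deriveD d1 d2) _).
rewrite /GRing.scale/= eqxx /vhess (ang_off _ ox) -[true%:R]/(1 : R).
rewrite -[((Defs.comp j : R * R -> R) * B) x]/(Defs.comp j x * B x).
by case: i {d1 d2}; case: j ox => //= ox; ring.
Qed.

Lemma vhess_sum i x : N = 4 -> vhess i true x + vhess i false x = Defs.comp i x * W x.
Proof.
move=> N2; have -> : vhess i true x + vhess i false x = 4 * (Defs.comp i x * B x) +
    Defs.comp i x * ((ang true x + ang false x) * (W x - N * B x)).
  by rewrite /vhess; case: i => /=; ring.
by rewrite ang_sum N2; ring.
Qed.

End RadialSol.

(** * The energy *)

Section Energy.
Variable R : realType.
Local Notation L := (@leb2 R).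
Local Notation Int f := (Rintegral L setT f).
Implicit Types (u v : R * R -> R * R) (G : bool -> bool -> R * R -> R).

(* The integral is [+oo], which [Rintegral] maps to [0]. *)
Lemma Int_undefined (l k : R * R -> R) : L1 L l -> Mes k -> (forall x, 0 <= k x) -> ~ L1 L k ->
  Int (fun x => l x + k x) = 0.
Proof.
move=> ll mk k0 nk; have ml := L1_meas ll.
set h := fun x => l x + k x.
have mh : Mes h by exact: measurable_funD.
have mhE : measurable_fun setT (EFin \o h : plane R -> \bar R) by exact/measurable_EFinP.
have neg : (\int[L]_x ((EFin \o h)^\- x) < +oo)%E.
  have /integrableP[_ ] := ll; apply: le_lt_trans; apply: ge0_le_integral => //.
  - exact: measurable_funeneg.
  - by apply: measurableT_comp => //; exact/measurable_EFinP.
  - move=> x _; rewrite funenegE -[(EFin \o h) x]/((h x)%:E) -EFinN -EFin_max lee_fin ge_max normr_ge0 andbT /h.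
    have := ler_norm (- l x); rewrite normrN; have := k0 x; lra.
have pos : (\int[L]_x ((EFin \o h)^\+ x) = +oo)%E.
  apply/eqP; rewrite -leye_eq leNgt; apply/negP => pf; apply: nk.
  have lh : L1 L h.
    apply/integrableP; split => //.
    rewrite -[fun x => `|(h x)%:E|%E]/(abse \o (EFin \o h)) fune_abse.
    rewrite ge0_integralD//; [exact: lte_add_pinfty|exact: measurable_funepos|exact: measurable_funeneg].
  apply: (@L1_ext _ _ _ L (fun x => h x - l x)); first by move=> x; rewrite /h addrAC subrr add0r.
  exact: L1B.
rewrite /Rintegral integralE pos.
have : (0 <= \int[L]_x ((EFin \o h)^\- x))%E.
  by apply: integral_ge0 => x _; rewrite funenegE le_max lexx orbT.
by move: neg; case: (\int[L]_x ((EFin \o h)^\- x))%E.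
Qed.

(** Otherwise the indicator of [box 1] would vanish almost everywhere, while its integral is 4. *)
Lemma no_ae_false (P : R * R -> Prop) : {ae L, forall x, P x} -> exists x, P x.
Proof.
move=> h; apply: contrapT => nP.
have I1 : Int (\1_(box 1) : R * R -> R) = 0.
  have <- : Int (fun _ : R * R => (0 : R)) = 0 by rewrite /Rintegral integral0.
  apply: Int_ae => //; first exact: L1_meas (L1_indic_box 1).
  by apply: aeS h => x Px; case: nP; exists x.
have := Int_indic_box (ltr01 : 0 < 1 :> R); rewrite I1 => /eqP; rewrite eq_sym expf_eq0/= mulr1.
by rewrite pnatr_eq0.
Qed.

Variables (eps a M : R) (mu : R * R -> R) (f : R * R -> R * R).
Hypotheses (eps0 : 0 < eps) (mmu : Mes mu) (muM : forall x, `|mu x| <= M)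
  (lf : forall i, L2 L (fun x => Defs.comp i (f x))).

Definition pot_density (u : R * R -> R * R) (x : R * R) : R :=
  (4 * eps ^+ 2)^-1 * sqnorm2 (u x) ^+ 2 - (2 * eps ^+ 2)^-1 * mu x * sqnorm2 (u x) - a / eps * dot2 (f x) (u x).
Definition dirichlet G : R :=
  (Int (fun x => G true true x ^+ 2) + Int (fun x => G true false x ^+ 2)) +
  (Int (fun x => G false true x ^+ 2) + Int (fun x => G false false x ^+ 2)).
Definition cL2 u := forall i, L2 L (fun x => Defs.comp i (u x)).
Definition gL2 G := forall i j, L2 L (G i j).

Lemma L1_sqnorm u : cL2 u -> L1 L (fun x => sqnorm2 (u x)).
Proof. by move=> lu; apply: L1D; [exact: L2_sq (lu true)|exact: L2_sq (lu false)]. Qed.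

Let lower_L1 u : cL2 u -> L1 L (fun x => - ((2 * eps ^+ 2)^-1 * mu x * sqnorm2 (u x)) - a / eps * dot2 (f x) (u x)).
Proof.
move=> lu; apply: L1B.
  have -> : (fun x => - ((2 * eps ^+ 2)^-1 * mu x * sqnorm2 (u x))) = (fun x => (- (2 * eps ^+ 2)^-1) * (mu x * sqnorm2 (u x))).
    by apply/funext => x; ring.
  by apply: L1Z; apply: (L1_bdd _ mmu muM); exact: L1_sqnorm.
by apply: L1Z; apply: L1D; [exact: L2_mul (lf true) (lu true)|exact: L2_mul (lf false) (lu false)].
Qed.

Lemma pot_L1 u : cL2 u -> L1 L (fun x => sqnorm2 (u x) ^+ 2) -> L1 L (pot_density u).
Proof.
move=> lu l4; have -> : pot_density u = (fun x => (4 * eps ^+ 2)^-1 * sqnorm2 (u x) ^+ 2 +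
   (- ((2 * eps ^+ 2)^-1 * mu x * sqnorm2 (u x)) - a / eps * dot2 (f x) (u x))).
  by apply/funext => x; rewrite /pot_density addrA.
by apply: L1D; [exact: L1Z|exact: lower_L1].
Qed.

Lemma grad_L1 G : gL2 G -> L1 L (fun x => 2^-1 * grad_sq G x) /\ Int (fun x => 2^-1 * grad_sq G x) = 2^-1 * dirichlet G.
Proof.
move=> lG; have q i j := L2_sq (lG i j).
have l3 : L1 L (grad_sq G) by apply: L1D => //; apply: L1D => //; exact: L1D.
split; first exact: L1Z.
rewrite (IntZ _ l3) /grad_sq.
rewrite (IntD (L1D (L1D (q true true) (q true false)) (q false true)) (q false false)).
by rewrite (IntD (L1D (q true true) (q true false)) (q false true)) (IntD (q true true) (q true false)) /dirichlet addrA.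
Qed.

Lemma energyE u G : cL2 u -> gL2 G -> L1 L (fun x => sqnorm2 (u x) ^+ 2) ->
  energy eps a mu f u G = 2^-1 * dirichlet G + Int (pot_density u).
Proof.
move=> lu lG l4; have [l1 <-] := grad_L1 lG.
rewrite -(IntD l1 (pot_L1 lu l4)); apply: Int_ext => x; rewrite /pot_density; ring.
Qed.

Lemma energy_undefined u G : cL2 u -> gL2 G -> ~ L1 L (fun x => sqnorm2 (u x) ^+ 2) ->
  energy eps a mu f u G = 0.
Proof.
move=> lu lG l4; have [l1 _] := grad_L1 lG.
rewrite -(Int_undefined (L1D l1 (lower_L1 lu)) (k := fun x => (4 * eps ^+ 2)^-1 * sqnorm2 (u x) ^+ 2)).
- by apply: Int_ext => x; ring.
- by apply: measurable_funM => //; apply: measurable_funX; exact: L1_meas (L1_sqnorm lu).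
- by move=> x; rewrite mulr_ge0 ?sqr_ge0// invr_ge0 mulr_ge0// sqr_ge0.
- move=> h; apply: l4; have := L1Z (4 * eps ^+ 2) h; apply: L1_ext => x.
  by rewrite mulrA mulfV ?mul1r// mulf_neq0// expf_neq0// gt_eqF.
Qed.

Section Excess.
Variables (v : R * R -> R * R) (D : bool -> bool -> R * R -> R) (H : R).
Hypotheses (lv : cL2 v) (lD : gL2 D) (vH : forall i x, `|Defs.comp i (v x)| <= H).

(** The potential V of the Euler-Lagrange equation; [residual] below is the value that this equation
    prescribes for the Laplacian of v_i. *)
Definition well (x : R * R) : R := (sqnorm2 (v x) - mu x) / eps ^+ 2.
Definition residual (i : bool) (x : R * R) : R := well x * Defs.comp i (v x) - a / eps * Defs.comp i (f x).

Hypothesis sol : forall i, Int (fun x => D i true x ^+ 2) + Int (fun x => D i false x ^+ 2) +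
  Int (fun x => Defs.comp i (v x) * residual i x) = 0.

Lemma Mes_well : Mes well.
Proof.
apply: measurable_funM => //; apply: measurable_funB => //; exact: L1_meas (L1_sqnorm lv).
Qed.

Lemma well_bounded x : `|well x| <= (2 * H ^+ 2 + M) / eps ^+ 2.
Proof.
rewrite normrM (gtr0_norm (_ : 0 < (eps ^+ 2)^-1)) ?invr_gt0 ?exprn_gt0//.
rewrite ler_wpM2r ?invr_ge0 ?sqr_ge0//; apply: le_trans (ler_normB _ _) (lerD _ (muM x)).
have b i : Defs.comp i (v x) ^+ 2 <= H ^+ 2.
  by rewrite -[leLHS]real_normK ?num_real// lerXn2r ?nnegrE// (le_trans (normr_ge0 _) (vH i x)).
rewrite ger0_norm ?addr_ge0 ?sqr_ge0//; have := b true; have := b false; rewrite /sqnorm2 /=; lra.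
Qed.

Lemma residual_L2 i : L2 L (residual i).
Proof. by apply: L2B; [exact: (L2_bdd (lv i) Mes_well well_bounded)|exact: L2Z]. Qed.

Lemma quartic_L1 : L1 L (fun x => sqnorm2 (v x) ^+ 2).
Proof.
have -> : (fun x => sqnorm2 (v x) ^+ 2) = (fun x => sqnorm2 (v x) * sqnorm2 (v x)) by apply/funext.
apply: (L1_bdd (L1_sqnorm lv) (L1_meas (L1_sqnorm lv)) (C := 2 * H ^+ 2)) => x.
have b i : Defs.comp i (v x) ^+ 2 <= H ^+ 2.
  by rewrite -[leLHS]real_normK ?num_real// lerXn2r ?nnegrE// (le_trans (normr_ge0 _) (vH i x)).
rewrite ger0_norm ?addr_ge0 ?sqr_ge0//; have := b true; have := b false; rewrite /sqnorm2 /=; lra.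
Qed.

Definition diffsq u (x : R * R) : R :=
  (Defs.comp true (u x) - Defs.comp true (v x)) ^+ 2 + (Defs.comp false (u x) - Defs.comp false (v x)) ^+ 2.
Definition defect u (x : R * R) : R :=
  2^-1 * (well x * diffsq u x) + (4 * eps ^+ 2)^-1 * (sqnorm2 (u x) - sqnorm2 (v x)) ^+ 2.

Lemma diffsq_L1 u : cL2 u -> L1 L (diffsq u).
Proof. by move=> lu; apply: L1D; apply: L2_sq; exact: L2B. Qed.

Lemma cross_L1 u i : cL2 u -> L1 L (fun x => (2 * Defs.comp i (u x) - Defs.comp i (v x)) * residual i x).
Proof. by move=> lu; apply: L2_mul; [exact: L2B (L2Z 2 (lu i)) (lv i)|exact: residual_L2]. Qed.

Lemma sqdiff_L1 u : cL2 u -> L1 L (fun x => sqnorm2 (u x) ^+ 2) -> L1 L (fun x => (sqnorm2 (u x) - sqnorm2 (v x)) ^+ 2).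
Proof.
move=> lu l4; apply: (@L1_dom _ _ _ L _ (fun x => 2 * sqnorm2 (u x) ^+ 2 + 2 * sqnorm2 (v x) ^+ 2)).
- apply: measurable_funX; apply: measurable_funB; [exact: L1_meas (L1_sqnorm lu)|exact: L1_meas (L1_sqnorm lv)].
- by apply: L1D; apply: L1Z => //; exact: quartic_L1.
- by move=> x; rewrite ger0_norm ?sqr_ge0//; have := sqr_ge0 (sqnorm2 (u x) + sqnorm2 (v x)); lra.
Qed.

(** The potential energy is quadratic in |u|^2 apart from the linear forcing, so its expansion about
    v is exact and leaves the square of |u|^2 - |v|^2. The Dirichlet integral of v is eliminated by
    [sol], which produces the combination 2u - v of [comparison]. *)
Lemma excess u G : cL2 u -> gL2 G -> L1 L (fun x => sqnorm2 (u x) ^+ 2) ->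
  L1 L (defect u) /\
  energy eps a mu f u G - energy eps a mu f v D = 2^-1 * (dirichlet G +
   (Int (fun x => (2 * Defs.comp true (u x) - Defs.comp true (v x)) * residual true x) +
    Int (fun x => (2 * Defs.comp false (u x) - Defs.comp false (v x)) * residual false x))) + Int (defect u).
Proof.
move=> lu lG l4.
have ld : L1 L (defect u).
  apply: L1D; apply: L1Z; last exact: sqdiff_L1.
  by apply: (L1_bdd (diffsq_L1 lu) Mes_well well_bounded).
split=> //; rewrite (energyE lu lG l4) (energyE lv lD quartic_L1).
have q i : L1 L (fun x => Defs.comp i (v x) * residual i x) by apply: L2_mul => //; exact: residual_L2.
have -> : dirichlet D = - (Int (fun x => Defs.comp true (v x) * residual true x) + Int (fun x => Defs.comp false (v x) * residual false x)).
  by have := sol true; have := sol false; rewrite /dirichlet; lra.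
pose c i x := (2 * Defs.comp i (u x) - Defs.comp i (v x)) * residual i x.
have lc i : L1 L (c i) := cross_L1 i lu.
have E : (fun x => pot_density u x - pot_density v x) = (fun x => defect u x +
   2^-1 * ((c true x + c false x) - (Defs.comp true (v x) * residual true x + Defs.comp false (v x) * residual false x))).
  apply/funext => x; rewrite /pot_density /defect /c /residual /well /diffsq /sqnorm2 /dot2 /=.
  by field; rewrite gt_eqF.
have l5 := L1B (L1D (lc true) (lc false)) (L1D (q true) (q false)).
have := IntB (pot_L1 lu l4) (pot_L1 lv quartic_L1); rewrite E (IntD ld (L1Z 2^-1 l5)) (IntZ _ l5).
rewrite (IntB (L1D (lc true) (lc false)) (L1D (q true) (q false))) (IntD (lc true) (lc false)) (IntD (q true) (q false)).
rewrite -![Int (c _)]/(Int (fun x => (2 * Defs.comp _ (u x) - Defs.comp _ (v x)) * residual _ x)).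
by move=> h; lra.
Qed.

End Excess.
End Energy.

(** * Positive solutions as ground states *)

Section GroundState.
Variable R : realType.
Local Notation L := (@leb2 R).
Local Notation Int f := (Rintegral L setT f).

(** A long shift t is the n-fold iterate of t / n <= 1; negative shifts are inverted. *)
Lemma ae_translation_line (g : R * R -> R) (e : R * R) :
  (forall s : R, 0 < s <= 1 -> {ae L, forall x, g (x + s *: e) = g x}) ->
  forall t : R, {ae L, forall x, g (x + t *: e) = g x}.
Proof.
move=> h.
have pos n (s : R) : 0 < s <= 1 -> {ae L, forall x, g (x + (n%:R * s) *: e) = g x}.
  move=> s01; elim: n => [|n IH]; first by apply: aeT => x; rewrite mul0r scale0r addr0.
  have h1 := ae_shift (s *: e) IH.
  apply: aeS (aeI (h s s01) h1) => x [e1 e2].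
  have -> : x + (n.+1%:R * s) *: e = x + s *: e + (n%:R * s) *: e.
    by rewrite -addrA -scalerDl -natr1 mulrDl mul1r [s + _]addrC.
  by rewrite e2.
have pos' (t : R) : 0 < t -> {ae L, forall x, g (x + t *: e) = g x}.
  move=> t0; pose n := (Num.truncn t).+1; have hn : t < n%:R by exact: truncnS_gt.
  have n0 : 0 < n%:R :> R by exact: lt_trans hn.
  have := pos n (t / n%:R); rewrite divr_gt0// ler_pdivrMr// mul1r (ltW hn) mulrCA divff ?mulr1 ?gt_eqF//.
  exact.
move=> t; have [t0|t0|->] := ltgtP t 0; last by apply: aeT => x; rewrite scale0r addr0.
  have t0' : 0 < - t by rewrite oppr_gt0.
  apply: aeS (ae_shift (t *: e) (pos' _ t0')) => x.
  by rewrite scaleNr addrK.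
exact: pos'.
Qed.

Variables (Y V u : R * R -> R) (Y1 Z G : bool -> R * R -> R) (H C Vb : R).
Hypotheses (cY : continuous Y) (Y0 : forall x, 0 < Y x) (YH : forall x, Y x <= H)
  (mZ : forall j, Mes (Z j)) (ZC : forall j x, `|Z j x| <= C)
  (d1 : forall j x, off j x -> is_derive x (dir R j) Y (Y1 j x))
  (d2 : forall j x, off j x -> is_derive x (dir R j) (Y1 j) (Z j x))
  (mV : Mes V) (VVb : forall x, `|V x| <= Vb) (eqn : forall x, Z true x + Z false x = V x * Y x)
  (lu : L2 L u) (lG : forall j, L2 L (G j)) (wG : forall j, weak j u (G j)).

(** Picone's identity divides by z and needs a positive lower bound, while Y is only positive. It is
    used with z = Y + eta, and eta tends to 0 afterwards. *)
Let eta (k : nat) : R := k.+1%:R^-1.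
Let eta0 k : 0 < eta k. Proof. by rewrite invr_gt0 ltr0n. Qed.
Let z k x := Y x + eta k.
Let mY : Mes Y := continuous_Mes cY.
Let sz k j : SDiff j (z k) (Z j) (2 * C).
Proof.
apply: (@SDiff_derive _ j (z k) (Y1 j)) => //.
- exact: measurable_funD.
- move=> x ox; refine (is_derive_eq (is_deriveD (d1 ox) (is_derive_cst (eta k) x (dir R j))) _).
  by rewrite addr0.
Qed.
Let z1 k x : eta k <= z k x. Proof. by rewrite /z lerDr ltW. Qed.
Let zM k x : z k x <= H + eta k. Proof. by rewrite /z lerD2r. Qed.
Let hK j (s : R) : 0 < s <= 1 -> Int (fun x => (u (x + s *: dir R j) - u x) ^+ 2) <= s ^+ 2 * Int (fun x => G j x ^+ 2).
Proof. by move=> /andP[s0 _]; exact: weak_translation. Qed.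

Let Q k j := Int (fun x => - Z j x / z k x * u x ^+ 2).
Let K j := Int (fun x => G j x ^+ 2).
Let X := K true + K false + Int (fun x => V x * u x ^+ 2).

Let QK k j : Q k j <= K j.
Proof. exact: (picone (sz k j) (eta0 k) (z1 k) (zM k) lu (@hK j)). Qed.

Let S01 : 0 < (1 : R) <= 1. Proof. by rewrite ltr01 lexx. Qed.

Let lVu : L1 L (fun x => V x * u x ^+ 2) := L1_bdd (L2_sq lu) mV VVb.

Let eta_cvg : eta @ \oo --> (0 : R). Proof. exact: cvg_harmonic. Qed.

Let Qsum : (fun k => K true + K false - (Q k true + Q k false)) @ \oo --> X.
Proof.
have lQ k j : L1 L (fun x => - Z j x / z k x * u x ^+ 2).
  by have [] := picone_limit (sz k j) (eta0 k) (z1 k) (zM k) lu S01.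
have E k : Q k true + Q k false = Int (fun x => - (V x * Y x) / z k x * u x ^+ 2).
  by rewrite /Q -(IntD (lQ k true) (lQ k false)); apply: Int_ext => x; rewrite -eqn; ring.
have z0 k x : 0 < z k x by rewrite addr_gt0.
have c1 : (fun k => Int (fun x => - (V x * Y x) / z k x * u x ^+ 2)) @ \oo --> Int (fun x => - (V x * u x ^+ 2)).
  have m1 k : Mes (fun x => - (V x * Y x) / z k x * u x ^+ 2).
    apply: measurable_funM; last exact: L1_meas (L2_sq lu).
    apply: measurable_funM; first by apply: measurableT_comp => //; exact: measurable_funM.
    by apply: measurable_funV; exact: measurable_funD.
  have m2 : Mes (fun x => - (V x * u x ^+ 2)) := L1_meas (L1N lVu).
  have a1 x : (fun k => - (V x * Y x) / z k x * u x ^+ 2) @ \oo --> - (V x * u x ^+ 2).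
    have h : (fun k => z k x) @ \oo --> Y x.
      by rewrite -[X in _ --> X]addr0; apply: cvgD; [exact: cvg_cst|exact: eta_cvg].
    have h2 := cvgM (cvgM (cvg_cst (- (V x * Y x))) (cvgV (lt0r_neq0 (Y0 x)) h)) (cvg_cst (u x ^+ 2)).
    have e : - (V x * Y x) / Y x * u x ^+ 2 = - (V x * u x ^+ 2) by field; rewrite gt_eqF.
    by rewrite e in h2; exact: h2.
  have a2 x k : `|- (V x * Y x) / z k x * u x ^+ 2| <= Vb * u x ^+ 2.
    rewrite normrM (ger0_norm (sqr_ge0 _)) ler_wpM2r ?sqr_ge0//.
    rewrite normrM normrN normrM normfV (gtr0_norm (z0 k x)) (gtr0_norm (Y0 x)) ler_pdivrMr//.
    by apply: ler_pM => //; [exact: ltW|rewrite /z lerDl ltW].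
  have [_ c] := @DCT _ _ _ L _ _ _ m1 m2 (L1Z Vb (L2_sq lu)) (aeT a1) (aeT a2).
  exact: c.
rewrite (_ : X = K true + K false - Int (fun x => - (V x * u x ^+ 2))); last by rewrite (IntN lVu) opprK.
apply: cvgB; first exact: cvg_cst.
by rewrite (_ : (fun k => Q k true + Q k false) = (fun k => Int (fun x => - (V x * Y x) / z k x * u x ^+ 2))); [exact: c1|apply/funext].
Qed.

Lemma ground_state_ge0 : 0 <= X.
Proof.
apply: (cvgr_to_ge Qsum); apply: nearW => k; rewrite subr_ge0; apply: lerD; exact: QK.
Qed.

(** [picone_rigid] bounds the increments of u / (Y + eta) on each box by the Picone deficit, which
    tends to X = 0. By Fatou's lemma u / Y is invariant under short shifts along both axes, hence
    under all translations, hence constant. *)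
Lemma ground_state_rigid : X = 0 -> exists k, {ae L, forall x, u x = k * Y x}.
Proof.
move=> X0.
(* The deficit of each direction is nonnegative by [QK], and the two add up to a sequence with limit
   X = 0. *)
have Pj j : (fun k => K j - Q k j) @ \oo --> (0 : R).
  rewrite -X0; have h := Qsum; rewrite X0 in h *.
  apply: (squeeze_cvgr (f := fun=> 0) (h := fun k => K true + K false - (Q k true + Q k false))); last 2 first.
  - exact: cvg_cst.
  - exact: h.
  apply: nearW => k; rewrite subr_ge0 QK/=.
  by have := QK k true; have := QK k false; case: j; lra.
have mu' := L2_meas lu.
have zc x : (fun k => z k x) @ \oo --> Y x.
  by rewrite -[X in _ --> X]addr0; apply: cvgD; [exact: cvg_cst|exact: eta_cvg].
have cYi : continuous (fun x => (Y x)^-1).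
  by move=> x; apply: cvgV; [exact: lt0r_neq0|exact: cY].
have step j (s : R) (N : nat) : 0 < s <= 1 ->
    {ae L, forall x, \1_(box N%:R) x * (u (x + s *: dir R j) / Y (x + s *: dir R j) - u x / Y x) ^+ 2 = 0}.
  move=> s01; have /andP[s0 s1] := s01.
  (* The larger box contains all shifts by at most 1 of points of [box N], so m bounds Y, and every
     z k, from below along the segments. *)
  have [C0 hC0] := cont_box_bounded (N%:R + 1) cYi.
  pose m : R := (`|C0| + 1)^-1.
  have m0 : 0 < m by rewrite invr_gt0 ltr_wpDl.
  have Ym x : box (N%:R + 1) x -> m <= Y x.
    move=> /hC0; rewrite normfV (gtr0_norm (Y0 x)) => h.
    have C1 : 0 < `|C0| + 1 by rewrite ltr_wpDl.
    have h1 : (Y x)^-1 <= `|C0| + 1 by apply: le_trans h _; have := ler_norm C0; lra.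
    have Yi : 0 < (Y x)^-1 by rewrite invr_gt0.
    by rewrite /m -[Y x]invrK lef_pV2// posrE.
  have zm k (x : R * R) : box N%:R x -> forall t, 0 <= t <= s -> m <= z k (x + t *: dir R j).
    move=> bx t /andP[t0 ts]; apply: (@le_trans _ _ (Y (x + t *: dir R j))); last by rewrite /z lerDl ltW.
    apply: Ym; apply: (box_shift (j := j) (s := - t)); first by rewrite normrN ger0_norm// (le_trans ts).
    by rewrite -addrA -scalerDl subrr scale0r addr0.
  have rig k := picone_rigid (sz k j) (eta0 k) (z1 k) (zM k) lu (@hK j) s01 (measurable_box N%:R) m0 (zm k).
  pose F k (x : R * R) := \1_(box N%:R) x * (u (x + s *: dir R j) / z k (x + s *: dir R j) - u x / z k x) ^+ 2.
  pose F1 (x : R * R) := \1_(box N%:R) x * (u (x + s *: dir R j) / Y (x + s *: dir R j) - u x / Y x) ^+ 2.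
  have i0 (x : R * R) : 0 <= \1_(box N%:R) x :> R by rewrite indicE ler0n.
  have mF1 : Mes F1.
    apply: measurable_funM; first exact: Mes_indic (measurable_box _).
    have mg : Mes (fun x => u x / Y x) := measurable_fun_div mu' mY.
    apply: measurable_funX; apply: measurable_funB => //; exact: (meas_shift (s *: dir R j) mg).
  have cF x : (fun k => F k x) @ \oo --> F1 x.
    have hq w : (fun k => u w / z k w) @ \oo --> u w / Y w.
      exact: (cvgM (cvg_cst (u w)) (cvgV (lt0r_neq0 (Y0 w)) (zc w))).
    apply: cvgM; first exact: cvg_cst.
    by apply: cvg_sqr; apply: cvgB; exact: hq.
  have c0 : (fun k => s ^+ 2 / m ^+ 2 * (K j - Q k j)) @ \oo --> (0 : R).
    by rewrite -[X in _ --> X](mulr0 (s ^+ 2 / m ^+ 2)); apply: cvgM; [exact: cvg_cst|exact: Pj].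
  have F0 k x : 0 <= F k x by rewrite mulr_ge0 ?sqr_ge0.
  have F10 x : 0 <= F1 x by rewrite mulr_ge0 ?sqr_ge0.
  have [lF1 IF1] := @Fatou _ _ _ L F F1 _ _ (fun k => (rig k).1) F0 mF1 (aeT cF) (fun k => (rig k).2) c0 F10.
  by apply: Int_eq0 => //; apply/eqP; rewrite eq_le IF1 Int_ge0.
pose g x := u x / Y x.
have mg : Mes g := measurable_fun_div mu' mY.
have tr j (s : R) : 0 < s <= 1 -> {ae L, forall x, g (x + s *: dir R j) = g x}.
  move=> s01; have : {ae L, forall x, forall N : nat, \1_(box N%:R) x * (u (x + s *: dir R j) / Y (x + s *: dir R j) - u x / Y x) ^+ 2 = 0}.
    by apply/ae_foralln => N; exact: step.
  apply: aeS => x h; apply/eqP; rewrite -subr_eq0 -sqrf_eq0.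
  pose N := (Num.truncn (`|x.1| + `|x.2|)).+1.
  have bx : box N%:R x.
    have : `|x.1| + `|x.2| < N%:R by exact: truncnS_gt.
    by move=> hN; apply/boxP; have := normr_ge0 x.1; have := normr_ge0 x.2; split; lra.
  by have := h N; rewrite indicE mem_set// mul1r => ->.
have all (c : R * R) : {ae L, forall x, g (x + c) = g x}.
  have t1 := ae_translation_line (tr true) c.1; have t2 := ae_translation_line (tr false) c.2.
  apply: aeS (aeI t1 (ae_shift (c.1 *: dir R true) t2)) => x [e1 e2].
  have cE : c = c.1 *: dir R true + c.2 *: dir R false.
    by case: c {t1 t2 e1 e2} => p q; congr (_, _) => /=; rewrite /GRing.scale/=; ring.
  by rewrite -e1 -e2 {1}cE addrA.
have [k hk] := ae_translation_cst mg all; exists k.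
by apply: aeS hk => x <-; rewrite /g divfK// gt_eqF.
Qed.

End GroundState.

(** * Consequences of the hypotheses, and the sign of the minimal energy *)

Section Facts.
Variable R : realType.
Local Notation L := (@leb2 R).
Local Notation Int f := (Rintegral L setT f).

Lemma eucl_axis (t : R) : eucl ((t, 0) : R * R) = `|t|.
Proof. by rewrite /eucl/= expr0n addr0 sqrtr_sqr. Qed.

Lemma mu_facts (mu : R * R -> R) (mu_rad : R -> R) : mu_hyp mu mu_rad -> exists M rho : R,
  [/\ Cinf mu_rad, (forall t, `|mu_rad t| <= M), (forall s t : R, 0 <= s -> s < t -> mu_rad t < mu_rad s),
      0 < rho & mu_rad rho = 0].
Proof.
move=> [_ [/smooth_Cinf cm [ev [mE [[M hM] [dec [rho [rho0 [mr _]]]]]]]]].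
exists M, rho; split => //.
- move=> t; have := hM (t, 0); rewrite mE eucl_axis; case: (ger0P t) => // _; by rewrite ev.
- move=> s t s0 st; have [m' dm cm'] := Cinf_derive cm.
  have [c /andP[c1 c2] E] := mvt_open dm st.
  rewrite -subr_lt0 E pmulr_llt0 ?subr_gt0//.
  by have := dec c (le_lt_trans s0 c1); rewrite derive1E; have [_ ->] := dm c.
Qed.

Lemma f_facts (f : R * R -> R * R) (f_rad : R -> R) : f_hyp f f_rad -> exists (q : R -> R) (K Kf : R),
  [/\ [/\ continuous q, (forall t, q (- t) = q t), (forall t, `|q t| <= K),
      (forall t : R, 0 <= t -> 0 <= q t) & (forall t : R, 0 < t -> 0 < q t)],
      (forall r : R, r * q r = f_rad r), continuous f_rad /\ (forall r, `|f_rad r| <= Kf),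
      (forall i x, Defs.comp i (f x) = Defs.comp i x * q (eucl x)) &
      (forall i, L2 L (fun x => Defs.comp i (f x)) /\ L1 L (fun x => Defs.comp i (f x)))].
Proof.
move=> [_ [/smooth_Cinf cf [od [fE [fL1 [[Kf hK] fp]]]]]].
have f0 : f_rad 0 = 0 by have := od 0; rewrite oppr0 => h; lra.
have [f' df cf'] := Cinf_derive cf; have c' := Cinf_cont cf'.
(* This is f_rad(r) / r in the form int_0^1 f_rad'(r s) ds, which is continuous through 0. *)
pose q := avg 0 f'.
have rq (r : R) : r * q r = f_rad r.
  have := avgE 0 r c'; rewrite expr1 => ->.
  apply: (prim_uniq (@powM_cont _ 0 _ c')) => // x.
  by rewrite expr0 mul1r; exact: df.
have cq : continuous q := avg_cont c'.
have fb r : `|f_rad r| <= Kf.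
  have pos (t : R) : 0 < t -> `|f_rad t| <= Kf.
    move=> t0; have := hK (t, 0); rewrite fE /= eucl_axis (gtr0_norm t0) divff ?gt_eqF// mulr1 mul0r mulr0.
    by rewrite eucl_axis.
  have [r0|r0|->] := ltgtP r 0; [|exact: pos|].
    by rewrite -normrN -od; apply: pos; rewrite oppr_gt0.
  by rewrite f0 normr0 (le_trans (normr_ge0 _) (pos 1 ltr01)).
have qp (t : R) : 0 < t -> 0 < q t by move=> t0; rewrite -(pmulr_rgt0 _ t0) rq fp.
have q0 : 0 <= q 0.
  rewrite leNgt; apply/negP => h; have /cvgr_lt /(_ _ h) [d /= d0 hd] := cq 0.
  have := hd (d / 2); rewrite /= sub0r normrN gtr0_norm ?divr_gt0//.
  rewrite ltr_pdivrMr// ltr_pMr// ltr1n => /(_ isT).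
  by rewrite ltNge ltW// qp// divr_gt0.
have qe t : q (- t) = q t.
  have [->|t0] := eqVneq t 0; first by rewrite oppr0.
  by apply: (mulfI (_ : - t != 0)); rewrite ?oppr_eq0// rq od -rq mulNr.
have ca : {within `[-1, 1], continuous (fun t : R => `|q t|)}.
  by apply: continuous_subspaceT => t; apply: cvg_norm; exact: cq.
have [c _ hc] := EVT_max (ltac:(lra) : -1 <= 1 :> R) ca.
have qb t : `|q t| <= `|q c| + Kf.
  have K0 : 0 <= Kf := le_trans (normr_ge0 _) (fb 0).
  have [t1|t1] := leP `|t| 1.
    by apply: le_trans (_ : `|q c| <= _); [apply: hc; rewrite in_itv/= -ler_norml|rewrite lerDl].
  apply: le_trans (_ : Kf <= _); last by rewrite lerDr.
  apply: le_trans (fb t); rewrite -rq normrM ler_peMl// ltW//.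
have fq i x : Defs.comp i (f x) = Defs.comp i x * q (eucl x).
  have h : f_rad (eucl x) * (Defs.comp i x / eucl x) = Defs.comp i x * q (eucl x).
    have [e|e] := eqVneq (eucl x) 0; last by rewrite -rq; field.
    have : Defs.comp i x = 0.
      by apply/eqP; rewrite -normr_le0 -e; exact: eucl_comp.
    by rewrite e => ->; rewrite !mul0r mulr0.
  by rewrite -h fE; case: i {h}.
exists q, (`|q c| + Kf), Kf; split => //.
- by split => // t; rewrite le_eqVlt => /orP[/eqP <-//|/qp/ltW].
- by split => //; exact: Cinf_cont.
- move=> i; have l1 : L1 L (fun x => Defs.comp i (f x)) := fL1 i.
  split => //; split; first exact: L1_meas l1.
  have -> : (fun x => Defs.comp i (f x) ^+ 2) = (fun x => Defs.comp i (f x) * Defs.comp i (f x)) by apply/funext.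
  by apply: (L1_bdd l1 (L1_meas l1) (C := Kf)) => x; exact: le_trans (eucl_comp _ _) (hK x).
Qed.

Lemma out_box (rho : R) (x : R * R) : ~ box rho x -> rho <= eucl x.
Proof.
move=> nb; rewrite leNgt; apply/negP => h; apply: nb; apply/(boxP' _ true).
by split; apply: le_lt_trans h; exact: eucl_comp.
Qed.

Lemma H1_L2 (u : R * R -> R * R) G : H1_with_grad u G -> [/\ cL2 u, gL2 G & forall i j, weak j (fun x => Defs.comp i (u x)) (G i j)].
Proof. by move=> [lu [lG wG]]; split => //; move=> i j phi; exact: wG. Qed.

Lemma L2_H1 (u : R * R -> R * R) G : cL2 u -> gL2 G -> (forall i j, weak j (fun x => Defs.comp i (u x)) (G i j)) -> H1_with_grad u G.
Proof. by move=> lu lG wG; split => //; split => //; move=> i j phi; exact: wG. Qed.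

Section Min.
Variables (eps a M : R) (mu : R * R -> R) (f : R * R -> R * R).
Hypotheses (eps0 : 0 < eps) (mmu : Mes mu) (muM : forall x, `|mu x| <= M)
  (lf : forall i, L2 L (fun x => Defs.comp i (f x))).
Variables (v : R * R -> R * R) (D : bool -> bool -> R * R -> R) (H : R).
Hypotheses (lv : cL2 v) (lD : gL2 D) (vH : forall i x, `|Defs.comp i (v x)| <= H)
  (wv : forall i j, weak j (fun x => Defs.comp i (v x)) (D i j))
  (sol : forall i, Int (fun x => D i true x ^+ 2) + Int (fun x => D i false x ^+ 2) +
    Int (fun x => Defs.comp i (v x) * residual eps a mu f v i x) = 0)
  (fv : forall x, 0 <= a / eps * dot2 (f x) (v x)) (v0 : forall x, off true x -> v x <> (0, 0)).

(** [excess] with the competitor 0 gives - E(v) as the integral of (a / 2 eps) f . v + |v|^4 / (4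
    eps^2), which is nonnegative and vanishes only where v does. *)
Lemma energy_neg : energy eps a mu f v D < 0.
Proof.
have lz : L2 L (fun _ : R * R => 0 : R).
  by split => //; apply: (@L1_ext _ _ _ L (fun=> 0)) => [x|]; [rewrite expr0n|exact: L1_0].
have l0 : cL2 (fun _ : R * R => (0, 0) : R * R) by move=> i; apply: (L2_ext _ lz) => x; case: i.
have g0 : gL2 (fun _ _ (_ : R * R) => 0 : R) by move=> i j; exact: lz.
have q0 : L1 L (fun x : R * R => sqnorm2 ((fun _ : R * R => (0, 0) : R * R) x) ^+ 2).
  by apply: (@L1_ext _ _ _ L (fun=> 0)) => [x|]; [rewrite /sqnorm2/= !expr0n/= addr0 expr0n|exact: L1_0].
have [ld E] := excess eps0 mmu muM lf lv lD vH sol l0 g0 q0.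
have Int0 : Int (fun _ : R * R => 0 : R) = 0 by rewrite /Rintegral integral0.
have e0 : energy eps a mu f (fun=> (0, 0)) (fun _ _ _ => 0) = 0.
  rewrite /energy -[RHS]Int0; apply: Int_ext => x; rewrite /grad_sq /sqnorm2 /dot2 /=; ring.
have d0 : dirichlet (fun _ _ (_ : R * R) => 0 : R) = 0.
  by rewrite /dirichlet (_ : (fun _ : R * R => 0 ^+ 2) = fun=> 0 :> R) ?Int0 ?addr0//; apply/funext => x; rewrite expr0n.
pose T x := 2^-1 * (a / eps * dot2 (f x) (v x)) + (4 * eps ^+ 2)^-1 * sqnorm2 (v x) ^+ 2.
have lc i := cross_L1 a eps0 mmu muM lf lv vH i l0.
pose lt := L1D (L1Z 2^-1 (L1D (lc true) (lc false))) ld.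
have ET : (fun x => 2^-1 * ((2 * Defs.comp true ((0, 0) : R * R) - Defs.comp true (v x)) * residual eps a mu f v true x +
    (2 * Defs.comp false ((0, 0) : R * R) - Defs.comp false (v x)) * residual eps a mu f v false x) + defect eps mu v (fun=> (0, 0)) x) = T.
  apply/funext => x; rewrite /T /defect /residual /well /diffsq /sqnorm2 /dot2 /=.
  by field; rewrite gt_eqF.
have lT : L1 L T by rewrite -ET.
have IT : - energy eps a mu f v D = Int T.
  rewrite -ET (IntD (L1Z 2^-1 (L1D (lc true) (lc false))) ld) (IntZ _ (L1D (lc true) (lc false))) (IntD (lc true) (lc false)).
  by move: E; rewrite e0 d0 sub0r add0r.
have e40 : 0 < (4 * eps ^+ 2)^-1 by rewrite invr_gt0 mulr_gt0// exprn_gt0.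
have T0 x : 0 <= T x by rewrite addr_ge0// mulr_ge0 ?sqr_ge0// ltW.
rewrite -oppr_gt0 IT lt_neqAle Int_ge0// andbT; apply/eqP => /esym IT0.
have [x [Tx ox]] := no_ae_false (aeI (Int_eq0 lT T0 IT0) (ae_off R true)).
have := v0 ox; apply.
have h1 : 0 <= 2^-1 * (a / eps * dot2 (f x) (v x)) by rewrite mulr_ge0.
have h2 : sqnorm2 (v x) = 0.
  apply/eqP; rewrite -sqrf_eq0; apply/eqP; apply: (mulfI (lt0r_neq0 e40)); rewrite mulr0.
  have : 0 <= (4 * eps ^+ 2)^-1 * sqnorm2 (v x) ^+ 2 by rewrite mulr_ge0 ?sqr_ge0// ltW.
  by move: Tx; rewrite /T; lra.
move: h2; rewrite /sqnorm2 => /eqP; rewrite paddr_eq0 ?sqr_ge0// !sqrf_eq0 => /andP[/eqP a1 /eqP a2].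
by case: (v x) a1 a2 => p1 p2 /= -> ->.
Qed.

Hypothesis low : forall u G, H1_with_grad u G -> L1 L (fun x => sqnorm2 (u x) ^+ 2) ->
  energy eps a mu f v D <= energy eps a mu f u G.

Lemma minimal : global_minimizer eps a mu f v.
Proof.
exists D; split; first exact: L2_H1.
move=> u G hu; have [lu lG _] := H1_L2 hu.
have [l4|n4] := pselect (L1 L (fun x => sqnorm2 (u x) ^+ 2)); first exact: low.
by rewrite (energy_undefined a eps0 mmu muM lf lu lG n4) ltW// energy_neg.
Qed.

Lemma minimizer_energy w : global_minimizer eps a mu f w -> exists G, [/\ H1_with_grad w G,
  L1 L (fun x => sqnorm2 (w x) ^+ 2) & energy eps a mu f w G = energy eps a mu f v D].
Proof.
move=> [G [hw mw]]; exists G; have [lw lG _] := H1_L2 hw.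
have le := mw _ _ (L2_H1 lv lD wv).
have [l4|n4] := pselect (L1 L (fun x => sqnorm2 (w x) ^+ 2)).
  by split => //; apply/eqP; rewrite eq_le le low.
by move: le; rewrite (energy_undefined a eps0 mmu muM lf lw lG n4) leNgt energy_neg.
Qed.

End Min.
End Facts.

(** * The two regimes *)

Section CaseOne.
Variable R : realType.
Local Notation L := (@leb2 R).
Local Notation Int f := (Rintegral L setT f).

Lemma critical_facts (eps a M H c0 R0 : R) (mu : R * R -> R) (f v : R * R -> R * R) (D DD : bool -> bool -> R * R -> R) :
  0 < eps -> Mes mu -> (forall x, `|mu x| <= M) -> (forall i, L1 L (fun x => Defs.comp i (f x))) ->
  (forall i, Mes (fun x => Defs.comp i (v x))) -> (forall i x, `|Defs.comp i (v x)| <= H) ->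
  (forall i j, Lb (D i j)) -> (forall i j, Lb (DD i j)) ->
  (forall i j x, off j x -> is_derive x (dir R j) (fun x => Defs.comp i (v x)) (D i j x)) ->
  (forall i j x, off j x -> is_derive x (dir R j) (D i j) (DD i j x)) ->
  (forall i x, DD i true x + DD i false x = residual eps a mu f v i x) ->
  0 < c0 -> (forall x, ~ box R0 x -> c0 <= well eps mu v x) ->
  [/\ cL2 v, gL2 D, (forall i j, weak j (fun x => Defs.comp i (v x)) (D i j)) &
   forall i, Int (fun x => D i true x ^+ 2) + Int (fun x => D i false x ^+ 2) +
    Int (fun x => Defs.comp i (v x) * residual eps a mu f v i x) = 0].
Proof.
move=> eps0 mmu muM lf mv vH LbD LbDD dv dD eqn c00 Vc0.
have [chi [d [dd [K cut]]]] := cutoff_exists R.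
have mW : Mes (well eps mu v).
  apply: measurable_funM => //; apply: measurable_funB => //.
  by apply: measurable_funD; apply: measurable_funX; [exact: (mv true)|exact: (mv false)].
have Wb := well_bounded eps0 muM vH.
have lfa i : L1 L (fun x => a / eps * Defs.comp i (f x)) by exact: L1Z.
split.
- by move=> i; exact: (sol_L2 cut (mv i) (vH i) (LbD i) (LbDD i) Wb c00 Vc0 (lfa i) (dv i) (dD i) (eqn i)).
- by move=> i j; exact: (sol_grad_L2 cut (mv i) (vH i) (LbD i) (LbDD i) Wb c00 Vc0 (lfa i) (dv i) (dD i) (eqn i)).
- by move=> i j; exact: (sol_weak (mv i) (vH i) (LbD i) (dv i)).
- by move=> i; exact: (sol_energy cut (mv i) (vH i) (LbD i) (LbDD i) mW Wb c00 Vc0 (lfa i) (dv i) (dD i) (eqn i)).2.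
Qed.

Definition rotation (k1 k2 : R) : 'M[R]_2 :=
  \matrix_(i, j) if i == 0 then (if j == 0 then k1 else - k2) else (if j == 0 then k2 else k1).

Lemma rotation_SO2 (k1 k2 : R) : k1 ^+ 2 + k2 ^+ 2 = 1 -> SO2 (rotation k1 k2).
Proof.
move=> k12; split.
  apply/matrixP => i j; rewrite !mxE !big_ord_recl big_ord0 !mxE /=.
  by case: i => -[|[|//]] ? /=; case: j => -[|[|//]] ? /=; rewrite ?eqxx /= ?addr0; move: k12; lra.
rewrite (expand_det_row _ 0) !big_ord_recl big_ord0 /cofactor !det_mx11 !mxE /=.
move: k12; rewrite /bump /= !addn0 ?expr0 ?expr1; lra.
Qed.

Lemma circle_eq (k1 k2 Y : R) : Y != 0 -> (k1 * Y) ^+ 2 + (k2 * Y) ^+ 2 - Y ^+ 2 = 0 -> k1 ^+ 2 + k2 ^+ 2 = 1.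
Proof.
move=> Y0 h; have Y2 : Y ^+ 2 != 0 by rewrite expf_neq0.
by apply: (mulfI Y2); move: h; rewrite !exprMn => h; lra.
Qed.

Lemma sqnorm2_ge0 (p : R * R) : 0 <= sqnorm2 p.
Proof. by rewrite addr_ge0// sqr_ge0. Qed.

(** Lower bounds on the potential are reduced to lower bounds on |v|^2 in this form, on the annulus
    as well as far away. *)
Lemma well_ge (eps m : R) (mu : R * R -> R) (v : R * R -> R * R) x : 0 < eps ->
  mu x + m * eps ^+ 2 <= sqnorm2 (v x) -> m <= well eps mu v x.
Proof. by move=> e0 h; rewrite /well ler_pdivlMr ?exprn_gt0//; lra. Qed.

Lemma well_far (eps r0 : R) (mu : R * R -> R) (mu_rad : R -> R) (v : R * R -> R * R) x : 0 < eps -> 0 <= r0 ->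
  (forall x, mu x = mu_rad (eucl x)) -> (forall s t : R, 0 <= s -> s < t -> mu_rad t < mu_rad s) ->
  r0 <= eucl x -> - mu_rad r0 / eps ^+ 2 <= well eps mu v x.
Proof.
move=> e0 r00 mE dec h; apply: well_ge => //.
rewrite divfK ?mE; last by rewrite expf_neq0// gt_eqF.
apply: le_trans (sqnorm2_ge0 (v x)); rewrite subr_le0.
by move: h; rewrite le_eqVlt => /orP[/eqP ->//|h]; apply: ltW; exact: dec h.
Qed.

Lemma half_sum_eq0 (p q r : R) : 2^-1 * (p + q) + r = 0 -> 0 <= p -> 0 <= q -> 0 <= r -> [/\ p = 0, q = 0 & r = 0].
Proof. by move=> h p0 q0 r0; split; lra. Qed.

Lemma case_one (mu : R * R -> R) (mu_rad : R -> R) (f : R * R -> R * R) (f_rad : R -> R) :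
  mu_hyp mu mu_rad -> f_hyp f f_rad ->
  exists eps0 : R, 0 < eps0 /\ forall eps : R, 0 < eps -> eps < eps0 ->
      exists (v : R * R -> R * R) (v_rad : R -> R),
        global_minimizer eps 0 mu f v /\
        smooth v_rad /\ (forall r, 0 < v_rad r) /\
        {ae @leb2 R, forall x, v x = (v_rad (eucl x), 0)} /\
        (forall w, global_minimizer eps 0 mu f w ->
           exists g : 'M[R]_2, SO2 g /\ {ae @leb2 R, forall x, w x = mxact g (v x)}).
Proof.
move=> hmu hf; have [M [rho [cm muM dec rho0 mrho]]] := mu_facts hmu.
have [_ [_ [mev [mE _]]]] := hmu.
have [q [K [Kf [_ _ _ _ lfs]]]] := f_facts hf.
have lf i := (lfs i).1; have lf1 i := (lfs i).2.
pose T := mu_rad (rho / 2) * rho ^+ 2 / 128.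
have T0 : 0 < T.
  have m0 : 0 < mu_rad (rho / 2) by rewrite -mrho; apply: dec; lra.
  by rewrite /T divr_gt0// mulr_gt0// exprn_gt0.
(* With eps < 1 one has eps^2 <= eps < T, the smallness that [ode_i] asks for. *)
exists (Num.min 1 T); split; first by rewrite lt_min ltr01.
move=> eps eps0; rewrite lt_min => /andP[e1 eT].
have e2T : eps ^+ 2 < mu_rad (rho / 2) * rho ^+ 2 / 128.
  by apply: le_lt_trans eT; rewrite expr2 ler_piMl// ltW.
have e20 : 0 < eps ^+ 2 by rewrite exprn_gt0.
pose H := M + 1.
have [y [bb [F0 [cy [cb cF] [yH yev] [dy db] [FE [C hC]]]]]] := ode_i cm mev muM dec rho0 mrho (lexx H) e20 e2T.
pose Y (x : R * R) := y (eucl x).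
pose v (x : R * R) : R * R := (Y x, 0).
pose D (i j : bool) : R * R -> R := if i then sgrad bb j else fun=> 0.
pose DD (i j : bool) : R * R -> R := if i then shess bb F0 2 j else fun=> 0.
have mmu : Mes mu.
  by rewrite (_ : mu = fun x => mu_rad (eucl x)); [apply: continuous_Mes; apply: radial_cont; exact: Cinf_cont|apply/funext].
have muM2 x : `|mu x| <= M by rewrite mE.
have cY : continuous Y by apply: radial_cont; exact: Cinf_cont.
have Y0 x : 0 < Y x by have [] := yH (eucl x).
have YH x : Y x <= H by have [] := yH (eucl x).
have H0 : 0 <= H := le_trans (ltW (Y0 (0, 0))) (YH _).
have mz : Mes (fun _ : R * R => 0 : R) by exact: measurable_cst.
have mv i : Mes (fun x => Defs.comp i (v x)) by case: i => //=; exact: continuous_Mes.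
have vH i x : `|Defs.comp i (v x)| <= H by case: i => /=; [rewrite gtr0_norm|rewrite normr0].
have Lb0 : Lb (fun _ : R * R => 0 : R) by apply: (@Lb_bdd _ _ 0) => // x; rewrite normr0.
have LbD i j : Lb (D i j) by case: i => //; exact: Lb_sgrad.
have LbDD i j : Lb (DD i j) by case: i => //; exact: Lb_shess.
have wE x : well eps mu v x * Y x = F0 (eucl x).
  by rewrite /well /sqnorm2/= expr0n addr0 FE mE.
have eqn i x : DD i true x + DD i false x = residual eps 0 mu f v i x.
  rewrite /residual mul0r mul0r subr0; case: i => /=; last by rewrite mulr0 addr0.
  by rewrite shess_sum// -wE.
have dv i j x : off j x -> is_derive x (dir R j) (fun x => Defs.comp i (v x)) (D i j x).
  by case: i => /= ox; [exact: (sgrad_derive dy ox)|exact: is_derive_cst].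
have dD i j x : off j x -> is_derive x (dir R j) (D i j) (DD i j x).
  by case: i => /= ox; [exact: (shess_derive db ox)|exact: is_derive_cst].
pose c0 := - mu_rad (2 * rho) / eps ^+ 2.
have c00 : 0 < c0.
  have : mu_rad (2 * rho) < mu_rad rho by apply: dec; lra.
  by rewrite mrho => h; rewrite divr_gt0// oppr_gt0.
have Vc0 x : ~ box (2 * rho) x -> c0 <= well eps mu v x.
  by move=> /out_box; apply: (well_far v eps0 _ mE dec); rewrite mulr_ge0// ltW.
have [lv lD wv sol] := critical_facts eps0 mmu muM2 lf1 mv vH LbD LbDD dv dD eqn c00 Vc0.
have fv x : 0 <= 0 / eps * dot2 (f x) (v x) by rewrite !mul0r.
have v0 x : off true x -> v x <> (0, 0) by move=> _ [e]; have := Y0 x; rewrite e ltxx.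
have Wb := well_bounded eps0 muM2 vH; have mW := Mes_well eps mmu lv.
have mS j : Mes (shess bb F0 2 j) by have [] := LbDD true j.
have SC j x : `|shess bb F0 2 j x| <= C + (C + 2 * C).
  have [h1 h2] := hC (eucl x).
  apply: le_trans (ler_normD _ _) (lerD h1 _); rewrite normrM -[leRHS]mul1r; apply: ler_pM => //; first exact: ang_le1.
  by apply: le_trans (ler_normB _ _) (lerD h2 _); rewrite normrM ger0_norm// ler_wpM2l.
have eqY x : shess bb F0 2 true x + shess bb F0 2 false x = well eps mu v x * Y x by rewrite wE shess_sum.
have X0 (u : R * R -> R) (G : bool -> R * R -> R) lu lG wG := @ground_state_ge0 R Y (well eps mu v) u _ _ G _ _ _ cY Y0 YH mS SC
  (fun j x => @sgrad_derive R y bb dy j x) (fun j x => @shess_derive R bb F0 2 db j x) mW Wb eqY lu lG wG.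
have Xr (u : R * R -> R) (G : bool -> R * R -> R) lu lG wG := @ground_state_rigid R Y (well eps mu v) u _ _ G _ _ _ cY Y0 YH mS SC
  (fun j x => @sgrad_derive R y bb dy j x) (fun j x => @shess_derive R bb F0 2 db j x) mW Wb eqY lu lG wG.
have key u G : H1_with_grad u G -> L1 L (fun x => sqnorm2 (u x) ^+ 2) ->
   energy eps 0 mu f u G - energy eps 0 mu f v D =
     2^-1 * ((Int (fun x => G true true x ^+ 2) + Int (fun x => G true false x ^+ 2) + Int (fun x => well eps mu v x * Defs.comp true (u x) ^+ 2)) +
      (Int (fun x => G false true x ^+ 2) + Int (fun x => G false false x ^+ 2) + Int (fun x => well eps mu v x * Defs.comp false (u x) ^+ 2)))
     + (4 * eps ^+ 2)^-1 * Int (fun x => (sqnorm2 (u x) - sqnorm2 (v x)) ^+ 2).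
  move=> hu l4; have [lu lG wG] := H1_L2 hu.
  have [ld ->] := excess eps0 mmu muM2 lf lv lD vH sol lu lG l4.
  have lc i := cross_L1 0 eps0 mmu muM2 lf lv vH i lu.
  have lw i : L1 L (fun x => well eps mu v x * Defs.comp i (u x) ^+ 2) := L1_bdd (L2_sq (lu i)) mW Wb.
  have ls := sqdiff_L1 lv vH lu l4.
  (* Without forcing the residual is V v, and (2u - v) V v + V (u - v)^2 = V u^2 in each component:
     v drops out of the quadratic part. *)
  have E : (fun x => 2^-1 * ((2 * Defs.comp true (u x) - Defs.comp true (v x)) * residual eps 0 mu f v true x +
       (2 * Defs.comp false (u x) - Defs.comp false (v x)) * residual eps 0 mu f v false x) + defect eps mu v u x) =
     (fun x => 2^-1 * (well eps mu v x * Defs.comp true (u x) ^+ 2 + well eps mu v x * Defs.comp false (u x) ^+ 2) +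
       (4 * eps ^+ 2)^-1 * (sqnorm2 (u x) - sqnorm2 (v x)) ^+ 2).
    apply/funext => x; rewrite /defect /residual /diffsq mul0r !mul0r !subr0.
    move: (well eps mu v x) ((4 * eps ^+ 2)^-1) => W k; rewrite /sqnorm2 /=; by field.
  have := congr1 (fun h => Int h) E.
  rewrite (IntD (L1Z 2^-1 (L1D (lc true) (lc false))) ld) (IntZ _ (L1D (lc true) (lc false))) (IntD (lc true) (lc false)).
  rewrite (IntD (L1Z 2^-1 (L1D (lw true) (lw false))) (L1Z (4 * eps ^+ 2)^-1 ls)) (IntZ _ (L1D (lw true) (lw false))) (IntD (lw true) (lw false)) (IntZ _ ls).
  move=> h; rewrite mulrDr -addrA h /dirichlet addrA -mulrDr; congr (_ * _ + _).
  by rewrite addrACA.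
have e40 : 0 < (4 * eps ^+ 2)^-1 by rewrite invr_gt0 mulr_gt0.
have low u G : H1_with_grad u G -> L1 L (fun x => sqnorm2 (u x) ^+ 2) -> energy eps 0 mu f v D <= energy eps 0 mu f u G.
  move=> hu l4; rewrite -subr_ge0 (key _ _ hu l4); have [lu lG wG] := H1_L2 hu.
  have x1 := X0 _ _ (lu true) (lG true) (wG true); have x2 := X0 _ _ (lu false) (lG false) (wG false).
  by rewrite addr_ge0// mulr_ge0 ?(ltW e40)//; [exact: addr_ge0|apply: Int_ge0 => x; exact: sqr_ge0].
exists v, y; split; first exact: (minimal eps0 mmu muM2 lf lv lD vH wv sol fv v0 low).
split; first exact: Cinf_smooth.
split; first by move=> r; have [] := yH r.
split; first exact: aeT.
move=> w hw.
have [G [hG l4 eE]] := minimizer_energy eps0 mmu muM2 lf lv lD vH wv sol fv v0 low hw.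
have [lw lG wG] := H1_L2 hG.
have := key _ _ hG l4; rewrite eE subrr.
have x1 := X0 _ _ (lw true) (lG true) (wG true); have x2 := X0 _ _ (lw false) (lG false) (wG false).
have I0 : 0 <= (4 * eps ^+ 2)^-1 * Int (fun x => (sqnorm2 (w x) - sqnorm2 (v x)) ^+ 2).
  by rewrite mulr_ge0 ?(ltW e40)//; apply: Int_ge0 => x; exact: sqr_ge0.
move=> E0.
have [z1 z2 z3] := half_sum_eq0 (esym E0) x1 x2 I0.
have [k1 h1] := Xr _ _ (lw true) (lG true) (wG true) z1.
have [k2 h2] := Xr _ _ (lw false) (lG false) (wG false) z2.
have z4 : Int (fun x => (sqnorm2 (w x) - sqnorm2 (v x)) ^+ 2) = 0.
  by apply: (mulfI (lt0r_neq0 e40)); rewrite z3 mulr0.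
have h3 := Int_eq0 (sqdiff_L1 lv vH lw l4) (fun x => sqr_ge0 _) z4.
(* The quartic part of the excess vanishes too, so |w| = |v| almost everywhere, and one such point
   with Y > 0 decides. *)
have k12 : k1 ^+ 2 + k2 ^+ 2 = 1.
  have [x [[e1' e2'] e3]] := no_ae_false (aeI (aeI h1 h2) h3).
  move: e3 => /eqP; rewrite sqrf_eq0 /sqnorm2 /= in e1' e2' * => /eqP; rewrite e1' e2' expr0n addr0.
  by apply: circle_eq; rewrite gt_eqF.
exists (rotation k1 k2); split; first exact: rotation_SO2.
apply: aeS (aeI h1 h2) => x [e1' e2'].
rewrite /mxact /rotation !mxE /= !mulr0 !addr0; move: e1' e2'; by case: (w x) => p1 p2 /= -> ->.
Qed.

End CaseOne.

(** * Large forcing *)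

Section CaseTwo.
Variable R : realType.
Local Notation L := (@leb2 R).
Local Notation Int f := (Rintegral L setT f).

Section Barrier.
Variable tau : R.
Hypothesis tau0 : 0 < tau.

(* [barrier2] is the Laplacian of [x |-> barrier |x|]. *)
Definition gau (r : R) : R := expR (- (tau * (r * r))).
Definition barrier (r : R) : R := 1 + gau r.
Definition barrier1 (r : R) : R := - (2 * tau) * gau r.
Definition barrier2 (r : R) : R := 4 * tau * (tau * r ^+ 2 - 1) * gau r.

Lemma gau_derive (r : R) : is_derive r 1 gau (- (2 * tau * r) * gau r).
Proof.
have d0 : is_derive r 1 (fun r : R => - (tau * (r * r))) (- (2 * tau * r)).
  have d1 := is_deriveM (is_derive_id r (1 : R)) (is_derive_id r (1 : R)).
  refine (is_derive_eq (is_deriveN (is_deriveM (is_derive_cst tau r (1 : R)) d1)) _).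
  by rewrite /GRing.scale/=; ring.
refine (is_derive_eq (is_derive_comp (f := expR) (g := fun r : R => - (tau * (r * r))) (is_derive_expR _) d0) _).
by rewrite /gau mulrC.
Qed.

Lemma gau_cont : continuous gau. Proof. exact: is_derive_cont gau_derive. Qed.

Lemma gau_gt0 r : 0 < gau r. Proof. exact: expR_gt0. Qed.

Lemma gau_le1 r : gau r <= 1.
Proof.
have h : 0 <= tau * (r * r) by rewrite mulr_ge0 ?(ltW tau0)// -expr2 sqr_ge0.
by rewrite /gau -expR0 ler_expR oppr_le0.
Qed.

Lemma barrier_derive (r : R) : is_derive r 1 barrier (r * barrier1 r).
Proof.
refine (is_derive_eq (is_deriveD (is_derive_cst (1 : R) r (1 : R)) (gau_derive r)) _).
by rewrite /barrier1; ring.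
Qed.

Lemma barrier1_derive (r : R) : r != 0 -> is_derive r 1 barrier1 ((barrier2 r - 2 * barrier1 r) / r).
Proof.
move=> r0; refine (is_derive_eq (is_deriveM (is_derive_cst (- (2 * tau)) r (1 : R)) (gau_derive r)) _).
by rewrite /GRing.scale/= /barrier1 /barrier2; field.
Qed.

Lemma gau_exp r : tau * r ^+ 2 * gau r <= 1.
Proof.
have x0 : 0 <= tau * r ^+ 2 by rewrite mulr_ge0 ?sqr_ge0// ltW.
have := expR_pow_bound 1 x0; rewrite expr1 /gau -expr2; apply.
Qed.

Lemma gau_exp2 r : (tau * r ^+ 2) ^+ 2 * gau r <= 2.
Proof.
have x0 : 0 <= tau * r ^+ 2 by rewrite mulr_ge0 ?sqr_ge0// ltW.
have := expR_pow_bound 2 x0; rewrite /gau -expr2; apply.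
Qed.

Lemma barrier1_bound r : `|barrier1 r| <= 2 * tau.
Proof.
have g0 := gau_gt0 r; have g1 := gau_le1 r.
rewrite /barrier1 mulNr normrN ger0_norm ?mulr_ge0 ?(ltW tau0) ?(ltW g0)//.
by rewrite ler_piMr// mulr_ge0// ltW.
Qed.

Lemma barrier2_bound r : `|barrier2 r| <= 8 * tau.
Proof.
have g0 := gau_gt0 r; have g1 := gau_le1 r; have hx := gau_exp r; have t0 := tau0.
have x0 : 0 <= tau * r ^+ 2 * gau r by rewrite mulr_ge0 ?(ltW g0)// mulr_ge0 ?sqr_ge0// ltW.
have -> : barrier2 r = 4 * tau * (tau * r ^+ 2 * gau r - gau r) by rewrite /barrier2; ring.
rewrite normrM ger0_norm ?mulr_ge0 ?(ltW tau0)//.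
have h : `|tau * r ^+ 2 * gau r - gau r| <= 2 by rewrite ler_norml; lra.
have := ler_wpM2l (ltW tau0) h; lra.
Qed.

(** After multiplication by z, write x = tau r^2 and g = [gau]. For x <= 1/4, - Lap z >= 4 tau
    (3/4)^2 = (9/4) tau beats V z >= - 2 M >= - 2 tau. Up to R1, Lap z < 4 tau because x g <= 1.
    Beyond R1, x^2 g <= 2 gives Lap z <= 8 / r^2, which is below c0. *)
Lemma barrier_pos (V r M R1 c0 : R) : 0 <= r -> 0 <= M -> 2 * M <= 2 * tau ->
  - M <= V -> (1 / 4 <= tau * r ^+ 2 -> r <= R1 -> 4 * tau <= V) -> 0 < R1 -> 8 / R1 ^+ 2 < c0 -> (R1 <= r -> c0 <= V) ->
  0 < - barrier2 r / barrier r + V.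
Proof.
move=> r0 M0 Mt VM VB R10 Rc VC; have t0 := tau0.
have g0 := gau_gt0 r; have g1 := gau_le1 r.
have b0 : 0 < barrier r by rewrite addr_gt0.
have -> : - barrier2 r / barrier r + V = (- barrier2 r + V * barrier r) / barrier r by field; rewrite gt_eqF.
rewrite divr_gt0// /barrier2 /barrier.
have x0 : 0 <= tau * r ^+ 2 by rewrite mulr_ge0 ?sqr_ge0// ltW.
have hx := gau_exp r; have hx2 := gau_exp2 r.
have ge : 1 - tau * r ^+ 2 <= gau r by have := expR_ge1Dx (- (tau * (r * r))); rewrite /gau expr2.
set x := tau * r ^+ 2 in x0 hx hx2 ge VB *; set gr := gau r in g0 g1 hx hx2 ge *.
have [xs|xs] := leP x (1 / 4).
  have h1 : 3 / 4 * (3 / 4) <= (1 - x) * gr by apply: ler_pM; lra.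
  have h2 : - (M * 2) <= V * (1 + gr).
    have := ler_wpM2r (ltac:(lra) : 0 <= 1 + gr) VM; have := ler_wpM2l M0 g1; lra.
  have := ler_wpM2l (ltW t0) h1; lra.
have [rR|rR] := leP r R1.
  have V4 := VB (ltW xs) rR.
  have h1 : V <= V * (1 + gr) by rewrite ler_peMr; lra.
  have := ler_wpM2l (ltW t0) hx; have := mulr_gt0 t0 g0; lra.
have Vc := VC (ltW rR).
have c00 : 0 < c0 by apply: lt_trans Rc; rewrite divr_gt0// exprn_gt0.
have h1 : V <= V * (1 + gr) by rewrite ler_peMr; lra.
have rp : 0 < r by exact: lt_trans rR.
have h3 : tau * x * gr <= 2 / r ^+ 2.
  rewrite ler_pdivlMr ?exprn_gt0//.
  have -> : tau * x * gr * r ^+ 2 = x ^+ 2 * gr by rewrite /x; ring.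
  exact: hx2.
have h4 : 8 / r ^+ 2 <= 8 / R1 ^+ 2.
  by rewrite ler_wpM2l// lef_pV2 ?posrE ?exprn_gt0// lerXn2r ?nnegrE ?(ltW R10)// ltW.
have := mulr_gt0 t0 g0; lra.
Qed.
End Barrier.

Lemma half_add_eq0 (p q : R) : 2^-1 * p + q = 0 -> 0 <= q -> 0 <= p -> p = 0.
Proof. by move=> h q0 p0; lra. Qed.

Lemma case_two (mu : R * R -> R) (mu_rad : R -> R) (f : R * R -> R * R) (f_rad : R -> R) :
  mu_hyp mu mu_rad -> f_hyp f f_rad ->
  forall eps : R, 0 < eps -> exists A : R, 0 < A /\
      forall a : R, A < a ->
        exists v : R * R -> R * R,
          global_minimizer eps a mu f v /\
          (forall w, global_minimizer eps a mu f w -> {ae @leb2 R, forall x, w x = v x}) /\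
          exists v_rad : R -> R,
            {ae @leb2 R, forall x, v x = (v_rad (eucl x) * (x.1 / eucl x),
                                         v_rad (eucl x) * (x.2 / eucl x))}.
Proof.
move=> hmu hf eps eps0; have [M [rho [cm muM dec rho0 mrho]]] := mu_facts hmu.
have [_ [_ [mev [mE _]]]] := hmu.
have [q [K [Kf [[cq qe qK q0 qp] rq [cf fK] fq lfs]]]] := f_facts hf.
have lf i := (lfs i).1; have lf1 i := (lfs i).2.
have M0 : 0 <= M := le_trans (normr_ge0 _) (muM 0).
have e20 : 0 < eps ^+ 2 by rewrite exprn_gt0.
(* Large enough to compensate the least possible value - M / eps^2 of the potential near the
   origin. *)
pose tau := M / eps ^+ 2 + 1.
have tau0 : 0 < tau by rewrite ltr_wpDl// divr_ge0// ltW.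
pose c0 := - mu_rad (2 * rho) / eps ^+ 2.
have c00 : 0 < c0.
  have : mu_rad (2 * rho) < mu_rad rho by apply: dec; lra.
  by rewrite mrho => h; rewrite divr_gt0// oppr_gt0.
(* Beyond 2 rho the potential is at least c0, and R1 > 1 together with R1 > 8 / c0 gives 8 / R1^2 <
   c0. *)
pose R1 := 2 * rho + 8 / c0 + 1.
have c80 : 0 < 8 / c0 by rewrite divr_gt0.
have R11 : 1 < R1 by rewrite /R1; lra.
have R1c : 8 / R1 ^+ 2 < c0.
  rewrite ltr_pdivrMr ?exprn_gt0//; last by lra.
  rewrite mulrC -ltr_pdivrMr//; apply: (@lt_le_trans _ _ R1); first by rewrite /R1; lra.
  by rewrite expr2 ler_peMr//; lra.
(* As tau d^2 <= 1/4, the annulus from d to R1 begins inside the region that the barrier handles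
   near the origin. *)
pose d := (2 * (tau + 1))^-1.
have d0 : 0 < d by rewrite invr_gt0; lra.
have dt : tau * d ^+ 2 <= 1 / 4.
  rewrite /d exprVn ler_pdivrMr ?exprn_gt0//; [have := sqr_ge0 tau; lra|lra].
(* A height of at least k >= 1 gives |v|^2 >= k^2 >= k > mu + 4 tau eps^2, so the potential is at
   least 4 tau on the annulus. *)
pose k := M + 4 * tau * eps ^+ 2 + 1.
have te0 : 0 < tau * eps ^+ 2 by rewrite mulr_gt0.
have k1 : 1 <= k by rewrite /k; lra.
have k0 : 0 < k by lra.
have cw : {within `[d / 2, R1 + d], continuous f_rad} := continuous_subspaceT cf.
have [rm rmI hm] := EVT_min (ltac:(lra) : d / 2 <= R1 + d) cw.
have rm0 : 0 < rm by move: rmI; rewrite in_itv/= => /andP[h _]; lra.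
have fm0 : 0 < f_rad rm by rewrite -rq mulr_gt0// qp.
(* The threshold [fmE] of [height_lower]. As f_rad has a positive minimum on [d/2, R1 + d], the
   forcing (a / eps) f_rad exceeds it there as soon as a > A. *)
pose Bd := (4 * k ^+ 2 + M) / eps ^+ 2 * (2 * k) + 64 * k / d ^+ 2.
have Bd0 : 0 <= Bd.
  have h4 : 0 <= 4 * k ^+ 2 + M by rewrite addr_ge0// mulr_ge0// sqr_ge0.
  by rewrite addr_ge0// ?mulr_ge0 ?divr_ge0 ?(ltW e20)// ?mulr_ge0 ?invr_ge0 ?sqr_ge0// ltW.
exists (Bd * eps / f_rad rm + 1); split.
  by rewrite ltr_wpDl// divr_ge0 ?mulr_ge0// ltW.
move=> a aA.
have a0 : 0 < a.
  by apply: lt_trans aA; rewrite ltr_wpDl// divr_ge0 ?mulr_ge0// ltW.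
have ae0 : 0 < a / eps by rewrite divr_gt0.
have aB : Bd < a / eps * f_rad rm.
  have : Bd * eps / f_rad rm < a by apply: lt_trans aA; rewrite ltrDl.
  by rewrite ltr_pdivrMr// mulrAC ltr_pdivlMr// mulrC.
pose qq r := a / eps * q r.
have Kf0 : 0 <= Kf := le_trans (normr_ge0 _) (fK 0).
(* The part M + 1 gives H^2 - mu >= 1, and the rest makes H exceed eps^2 times the forcing: together
   these are [topH]. *)
pose H := M + 1 + eps ^+ 2 * (a / eps * Kf).
have eK0 : 0 <= eps ^+ 2 * (a / eps * Kf) by rewrite mulr_ge0 ?(ltW e20)// mulr_ge0// ltW.
have H0 : 0 < H by rewrite /H; lra.
have topH (t : R) : 0 <= t -> hgt true t (qq t) < (H ^+ 2 - mu_rad t) / eps ^+ 2 * H.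
  move=> t0; rewrite /hgt /qq mulrCA rq.
  have h1 : a / eps * f_rad t <= a / eps * Kf.
    by rewrite ler_wpM2l ?(ltW ae0)// (le_trans (ler_norm _))// fK.
  have h2 : 1 <= H ^+ 2 - mu_rad t.
    have := muM t; rewrite ler_norml => /andP[_ h].
    have : (M + 1) ^+ 2 <= H ^+ 2 by rewrite lerXn2r ?nnegrE ?(ltW H0)//; rewrite /H; lra.
    have := sqr_ge0 M; lra.
  apply: le_lt_trans h1 _; rewrite [ltRHS]mulrAC ltr_pdivlMr//.
  have := ler_wpM2r (ltW H0) h2; rewrite mul1r; apply: lt_le_trans.
  by rewrite /H [ltLHS]mulrC ltrDr ltr_wpDl.
have cqq : continuous qq by move=> t; apply: cvgM; [exact: cvg_cst|exact: cq].
have qqK t : `|qq t| <= a / eps * K by rewrite normrM (gtr0_norm ae0) ler_wpM2l// ltW.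
have qq0 (t : R) : 0 <= t -> 0 <= qq t by move=> t0; rewrite mulr_ge0 ?q0// ltW.
have qqp (t : R) : 0 < t -> 0 < qq t by move=> t0; rewrite mulr_gt0// qp.
have [y [bb [F0 [[cb cF] [yp yev] yH [dy db] FE]]]] :=
  ode_ii (Cinf_cont cm) cqq mev (fun t => congr1 ( *%R (a / eps)) (qe t)) muM qqK qq0 qqp e20 H0 topH.
have qm (r : R) : d / 2 <= r <= R1 + d -> a / eps * f_rad rm <= r * qq r.
  by move=> hr; rewrite /qq mulrCA rq ler_wpM2l ?(ltW ae0)//; apply: hm; rewrite in_itv.
have hlow := height_lower e20 muM yp k0 d0 dy db FE qm aB.
pose v (x : R * R) : R * R := (vsol y true x, vsol y false x).
have vE i x : Defs.comp i (v x) = vsol y i x by case: i.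
have vEf i : (fun x => Defs.comp i (v x)) = vsol y i by apply/funext.
pose D (i j : bool) := vgrad y bb i j.
pose DD (i j : bool) := vhess bb F0 4 i j.
have mmu : Mes mu.
  by rewrite (_ : mu = fun x => mu_rad (eucl x)); [apply: continuous_Mes; apply: radial_cont; exact: Cinf_cont|apply/funext].
have muM2 x : `|mu x| <= M by rewrite mE.
have Lbv i : Lb (fun x => Defs.comp i (v x)) by rewrite vEf; exact: (Lb_vsol dy).
have mv i : Mes (fun x => Defs.comp i (v x)) by have [] := Lbv i.
have vH i x : `|Defs.comp i (v x)| <= H.
  rewrite vE normrM (gtr0_norm (yp _)); apply: le_trans (yH _ (eucl_ge0 x)).
  by rewrite ler_wpM2r ?(ltW (yp _))//; exact: eucl_comp.
have LbD i j : Lb (D i j) := Lb_vgrad cb dy i j.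
have LbDD i j : Lb (DD i j) := Lb_vhess 4 cb cF i j.
have sqE x : sqnorm2 (v x) = (eucl x * y (eucl x)) ^+ 2.
  by rewrite exprMn eucl_sqr /sqnorm2 /= /vsol /=; ring.
have eqn i x : DD i true x + DD i false x = residual eps a mu f v i x.
  rewrite /DD vhess_sum// /residual /well sqE vE FE fq /vsol /qq mE; ring.
have dv i j x : off j x -> is_derive x (dir R j) (fun x => Defs.comp i (v x)) (D i j x).
  by move=> ox; rewrite vEf; exact: vgrad_derive.
have dD i j x : off j x -> is_derive x (dir R j) (D i j) (DD i j x) by move=> ox; exact: vhess_derive.
have far x : 2 * rho <= eucl x -> c0 <= well eps mu v x.
  by apply: (well_far v eps0 _ mE dec); rewrite mulr_ge0// ltW.
have Vc0 x : ~ box (2 * rho) x -> c0 <= well eps mu v x by move=> /out_box; exact: far.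
have [lv lD wv sol] := critical_facts eps0 mmu muM2 lf1 mv vH LbD LbDD dv dD eqn c00 Vc0.
have fv x : 0 <= a / eps * dot2 (f x) (v x).
  rewrite mulr_ge0 ?(ltW ae0)// /dot2 -[(f x).1]/(Defs.comp true (f x)) -[(f x).2]/(Defs.comp false (f x)) !fq /= /vsol /=.
  have qy : 0 <= q (eucl x) * y (eucl x) by rewrite mulr_ge0 ?q0 ?eucl_ge0// ltW.
  have := mulr_ge0 qy (addr_ge0 (sqr_ge0 x.1) (sqr_ge0 x.2)).
  by congr (0 <= _); ring.
have v0 x : off true x -> v x <> (0, 0).
  rewrite /off /= => x2 [_ e]; move: e; rewrite /vsol /= => /eqP; rewrite mulf_eq0 (negbTE x2)/= => /eqP e.
  by have := yp (eucl x); rewrite e ltxx.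
have [chi [dc [ddc [Kc cut]]]] := cutoff_exists R.
pose z (x : R * R) := barrier tau (eucl x).
pose Z j := shess (barrier1 tau) (barrier2 tau) 2 j : R * R -> R.
have cb1 : continuous (barrier1 tau).
  by move=> r; apply: cvgM; [exact: cvg_cst|exact: gau_cont].
have cb2 : continuous (barrier2 tau).
  move=> r; apply: cvgM; last exact: gau_cont.
  apply: cvgM; first exact: cvg_cst.
  by apply: cvgB; [apply: cvgM; [exact: cvg_cst|exact: exprn_continuous]|exact: cvg_cst].
have b1C r : `|barrier1 tau r| <= 2 * tau.
  exact: barrier1_bound.
have b2C r : `|barrier2 tau r| <= 8 * tau.
  exact: barrier2_bound.
have ZC j x : `|Z j x| <= 2 * tau + (8 * tau + 2 * (2 * tau)).
  apply: le_trans (ler_normD _ _) (lerD (b1C _) _); rewrite normrM -[leRHS]mul1r; apply: ler_pM => //; first exact: ang_le1.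
  by apply: le_trans (ler_normB _ _) (lerD (b2C _) _); rewrite normrM ger0_norm// ler_wpM2l.
have cz : continuous z.
  by apply: radial_cont; apply: is_derive_cont => r; exact: barrier_derive.
have mz := continuous_Mes cz.
have LbZ j : Lb (Z j) by exact: Lb_shess.
have sz j : SDiff j z (Z j) (2 * (2 * tau + (8 * tau + 2 * (2 * tau)))).
  apply: (@SDiff_derive _ j z (sgrad (barrier1 tau) j)) => //; first by have [] := LbZ j.
  - by move=> x ox; exact: (sgrad_derive (barrier_derive tau) ox).
  - by move=> x ox; exact: (shess_derive (@barrier1_derive tau) ox).
have z1 x : 1 <= z x by rewrite /z /barrier lerDl ltW// gau_gt0.
have z2 x : z x <= 2 by rewrite /z /barrier -[2]/(1 + 1) lerD2l; exact: gau_le1.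
have ZE x : Z true x + Z false x = barrier2 tau (eucl x) by rewrite shess_sum.
pose Pc x := - (Z true x + Z false x) / z x + well eps mu v x.
have P0 x : 0 < Pc x.
  rewrite /Pc ZE; have r0 := eucl_ge0 x.
  have Me : M / eps ^+ 2 <= tau by rewrite /tau lerDl.
  apply: (barrier_pos tau0 (M := M / eps ^+ 2) (R1 := R1) (c0 := c0)) => //.
  - by rewrite divr_ge0// ltW.
  - by rewrite ler_wpM2l.
  - apply: well_ge => //; apply: le_trans (sqnorm2_ge0 (v x)).
    by rewrite -mulNr divfK ?gt_eqF// subr_le0 (le_trans (ler_norm _)).
  - move=> xt rR; have dr : d <= eucl x.
      rewrite leNgt; apply/negP => h; move: xt; rewrite leNgt => /negP; apply.
      apply: lt_le_trans dt; rewrite ltr_pM2l// ltrXn2r//.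
    have hk := hlow (eucl x) (ltac:(by rewrite dr rR)).
    apply: well_ge => //; rewrite sqE; apply: (@le_trans _ _ k).
      by rewrite /k -[leRHS]addrA lerD ?lerDl// (le_trans (ler_norm _)).
    apply: (@le_trans _ _ (k ^+ 2)); first by rewrite expr2 ler_peMr// ltW.
    by rewrite lerXn2r ?nnegrE ?(ltW k0)// (le_trans (ltW k0)).
  - exact: lt_trans R11.
  - move=> rR; apply: far; apply: le_trans rR.
    by rewrite /R1 -addrA lerDl addr_ge0// ltW.
pose Phi (u : R * R -> R * R) x := 2^-1 * (Pc x * diffsq v u x) + (4 * eps ^+ 2)^-1 * (sqnorm2 (u x) - sqnorm2 (v x)) ^+ 2.
have e40 : 0 < (4 * eps ^+ 2)^-1 by rewrite invr_gt0 mulr_gt0.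
have Phi0 u x : 0 <= Phi u x.
  rewrite addr_ge0// mulr_ge0 ?sqr_ge0 ?(ltW e40)//; apply: mulr_ge0; first exact: ltW.
  by rewrite addr_ge0// sqr_ge0.
have key u G : H1_with_grad u G -> L1 L (fun x => sqnorm2 (u x) ^+ 2) ->
   L1 L (Phi u) /\ Int (Phi u) <= energy eps a mu f u G - energy eps a mu f v D.
  move=> hu l4; have [lu lG wG] := H1_L2 hu.
  have [ld ->] := excess eps0 mmu muM2 lf lv lD vH sol lu lG l4.
  have cmp i := comparison cut (lv i) (Lbv i) (LbD i) (LbDD i) (lD i)
     (residual_L2 a eps0 mmu muM2 lf lv vH i) (dv i) (dD i) (eqn i) sz ZC z1 z2 (lu i)
     (fun j s hs => weak_translation (lu i) (lG i j) (wG i j) (proj1 (andP hs))).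
  have [lA1 _ c1] := cmp true; have [lA2 _ c2] := cmp false.
  have E : Phi u = (fun x => 2^-1 * (- (Z true x + Z false x) / z x * (Defs.comp true (u x) - Defs.comp true (v x)) ^+ 2 +
     - (Z true x + Z false x) / z x * (Defs.comp false (u x) - Defs.comp false (v x)) ^+ 2) + defect eps mu v u x).
    apply/funext => x; rewrite /Phi /Pc /diffsq /defect /diffsq.
    by move: (- _ / z x) (well _ _ _ _) ((4 * _)^-1) => p1 p2 p3; ring.
  rewrite E; split; first exact: L1D (L1Z 2^-1 (L1D lA1 lA2)) ld.
  rewrite (IntD (L1Z 2^-1 (L1D lA1 lA2)) ld) (IntZ _ (L1D lA1 lA2)) (IntD lA1 lA2) lerD2r ler_wpM2l//.
  rewrite lerBlDr in c1; rewrite lerBlDr in c2; rewrite /dirichlet.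
  by apply: le_trans (lerD c1 c2) _; rewrite addrACA.
have low u G : H1_with_grad u G -> L1 L (fun x => sqnorm2 (u x) ^+ 2) -> energy eps a mu f v D <= energy eps a mu f u G.
  move=> hu l4; have [_ h] := key _ _ hu l4; rewrite -subr_ge0; apply: le_trans h.
  by apply: Int_ge0.
exists v; split; first exact: (minimal eps0 mmu muM2 lf lv lD vH wv sol fv v0 low).
split.
  move=> w hw.
  have [G [hG l4 eE]] := minimizer_energy eps0 mmu muM2 lf lv lD vH wv sol fv v0 low hw.
  have [lP iP] := key _ _ hG l4; rewrite eE subrr in iP.
  have iP0 : Int (Phi w) = 0 by apply/eqP; rewrite eq_le iP Int_ge0.
  apply: aeS (Int_eq0 lP (Phi0 w) iP0) => x Px.
  have ds0 : 0 <= diffsq v w x by rewrite addr_ge0// sqr_ge0.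
  have h2 : Pc x * diffsq v w x = 0.
    have := mulr_ge0 (ltW (P0 x)) ds0.
    have : 0 <= (4 * eps ^+ 2)^-1 * (sqnorm2 (w x) - sqnorm2 (v x)) ^+ 2 by rewrite mulr_ge0 ?sqr_ge0 ?(ltW e40).
    by move: Px; rewrite /Phi; exact: half_add_eq0.
  move/eqP: h2; rewrite mulf_eq0 gt_eqF//= /diffsq paddr_eq0 ?sqr_ge0// !sqrf_eq0 !subr_eq0 => /andP[/eqP h3 /eqP h4].
  by case: (w x) (v x) h3 h4 => p1 p2 [s1 s2] /= -> ->.
exists (fun r => r * y r); apply: aeT => x; rewrite /v /vsol /=.
(* At the origin both sides vanish, since division by 0 yields 0. *)
have [e|e] := eqVneq (eucl x) 0.
  have c i : Defs.comp i x = 0 by apply/eqP; rewrite -normr_le0 -e; exact: eucl_comp.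
  by have := c true; have := c false; rewrite /= => -> ->; rewrite !mul0r !mulr0.
by congr (_, _); field.
Qed.

End CaseTwo.

Theorem theorem3 (R : realType) (mu : R * R -> R) (mu_rad : R -> R)
  (f : R * R -> R * R) (f_rad : R -> R) :
  mu_hyp mu mu_rad -> f_hyp f f_rad ->
  (* (i) a = 0, eps small *)
  (exists eps0 : R, 0 < eps0 /\
    forall eps : R, 0 < eps -> eps < eps0 ->
      exists (v : R * R -> R * R) (v_rad : R -> R),
        global_minimizer eps 0 mu f v /\
        smooth v_rad /\ (forall r, 0 < v_rad r) /\
        {ae @leb2 R, forall x, v x = (v_rad (eucl x), 0)} /\
        (forall w, global_minimizer eps 0 mu f w ->
           exists g : 'M[R]_2, SO2 g /\ {ae @leb2 R, forall x, w x = mxact g (v x)})) /\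
  (* (ii) a large *)
  (forall eps : R, 0 < eps ->
    exists A : R, 0 < A /\
      forall a : R, A < a ->
        exists v : R * R -> R * R,
          global_minimizer eps a mu f v /\
          (forall w, global_minimizer eps a mu f w -> {ae @leb2 R, forall x, w x = v x}) /\
          exists v_rad : R -> R,
            {ae @leb2 R, forall x, v x = (v_rad (eucl x) * (x.1 / eucl x),
                                         v_rad (eucl x) * (x.2 / eucl x))}).
Proof.
move=> hmu hf; split; [exact: (case_one hmu hf)|exact: (case_two hmu hf)].
Qed.
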